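(* Let $n\ge2$, let $S\subseteq\{1,\dots,n-1\}$ be nonempty with $m:=|S|$, and let $\mathfrak p:=\sum_{i\in S}\mathfrak p_i'$ (a nonzero idempotent prime ideal of $\mathbb S_{n-1}$ of height $m$). For $i,j\in S$ with $i>j$ put $\theta_{ij}:=\theta_{ij}(\{i,j,n\})$. Then: (1) The group $\mathrm{GL}_\infty(\mathbb S_{n-1},\mathfrak p)$ is generated by the elements $\theta_{ij}$ ($i>j$, $i,j\in S$), the groups $U_{\{k,n\}}(K)$ ($k\in S$) and $E_\infty(\mathbb S_{n-1},\mathfrak p)$. (2) Every $a\in\mathrm{GL}_\infty(\mathbb S_{n-1},\mathfrak p)$ is a unique product (with a fixed, arbitrary order of the factors) $$a=\prod_{i>j,\ i,j\in S}\theta_{ij}^{n_{ij}}\cdot\prod_{k\in S}\mu_{\{k,n\}}(\lambda_k)\cdot e,\qquad n_{ij}\in\mathbb Z,\ \lambda_k\in K^*,\ e\in E_\infty(\mathbb S_{n-1},\mathfrak p).$$ (3) $\mathrm{K}_1(\mathbb S_{n-1},\mathfrak p)\simeq\prod_{i>j,\,i,j\in S}\langle\theta_{ij}\rangle\times\prod_{k\in S}U_{\{k,n\}}(K)\simeq\begin{cases}K^*,& m=1,\\ \mathbb Z^{\binom m2}\times (K^* )^m,& m>1.\end{cases}$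
   Context: $K$ is a field, $\mathbb N=\{0,1,\dots\}$. For $n\ge1$, $\mathbb S_n$ is the $K$-algebra generated by $x_1,\dots,x_n,y_1,\dots,y_n$ subject to $y_ix_i=1$ and $[x_i,y_j]=[x_i,x_j]=[y_i,y_j]=0$ for $i\ne j$; $\mathbb S_0:=K$. Put $E_{st}(i):=x_i^sy_i^t-x_i^{s+1}y_i^{t+1}$ ($s,t\in\mathbb N$), $e_i:=E_{00}(i)=1-x_iy_i$, $e_I:=\prod_{i\in I}e_i$. For $J$ with $|J|\ge2$ and distinct $i,j\in J$, $\theta_{ij}(J):=(1+(y_i-1)e_{J\setminus\{i\}})(1+(x_j-1)e_{J\setminus\{j\}})$. For $I\subseteq\{1,\dots,n\}$ and $\lambda\in K^*$, $\mu_I(\lambda):=\lambda e_I+1-e_I$ and $U_I(K):=\{\mu_I(\lambda):\lambda\in K^*\}$. $\mathbb S_{n-1}$ is the subalgebra of $\mathbb S_n$ generated by $x_1,\dots,x_{n-1},y_1,\dots,y_{n-1}$; $\mathfrak p_i'$ is the ideal of $\mathbb S_{n-1}$ generated by $e_i$ ($i\le n-1$), while $\mathfrak p_i$ is the ideal of $\mathbb S_n$ generated by $e_i$. (The nonzero idempotent prime ideals of $\mathbb S_{n-1}$ are exactly the ideals $\sum_{i\in S}\mathfrak p_i'$, $\emptyset\ne S\subseteq\{1,\dots,n-1\}$, of height $|S|$.) For a ring $A$ and ideal $\mathfrak a$: $\mathrm{GL}_\infty(A,\mathfrak a):=\ker(\mathrm{GL}_\infty(A)\to\mathrm{GL}_\infty(A/\mathfrak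 a))$; $E_\infty(A,\mathfrak a)$ is the relative elementary group, the normal subgroup of $E_\infty(A)$ generated by the $\mathfrak a$-elementary matrices $1+aE_{kl}$ ($a\in\mathfrak a$, $k\ne l$); $\mathrm{K}_1(A,\mathfrak a):=\mathrm{GL}_\infty(A,\mathfrak a)/E_\infty(A,\mathfrak a)$. The group $\mathrm{GL}_\infty(\mathbb S_{n-1})$ is identified with the group $(1+\mathfrak p_n)^*$ of units of $\mathbb S_n$ in $1+\mathfrak p_n$ via $(a_{kl})\mapsto1+\sum_{k,l}(a_{kl}-\delta_{kl})E_{kl}(n)$; under it $\mathrm{GL}_\infty(\mathbb S_{n-1},\mathfrak p)$ corresponds to $(1+\mathfrak p\mathfrak p_n)^*$, where $\mathfrak p\mathfrak p_n:=\sum_{i\in S}\mathfrak p_i\mathfrak p_n$, and the elements $\theta_{ij}$, $\mu_{\{k,n\}}(\lambda)$ lie in it. *)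

(* Defs.v *)
From HB Require Import structures.
From mathcomp Require Import all_boot all_order all_algebra.
Set Implicit Arguments. Unset Strict Implicit. Unset Printing Implicit Defensive.
Import Order.TTheory GRing.Theory Num.Theory.
Local Open Scope ring_scope.

Section Jacobian.
Variables (K : fieldType) (A : unitAlgType K) (n : nat) (x y : nat -> A).

Definition mono (al be : {ffun 'I_n -> nat}) : A :=
  \prod_(i < n) (x i.+1 ^+ al i * y i.+1 ^+ be i).

(* (A, x_1..x_n, y_1..y_n) is (a copy of) the algebra S_n: the defining
   relations hold and the monomials x^al y^be form a K-basis of A
   (these two facts characterise S_n up to isomorphism). *)
Definition is_Sn : Prop :=
  [/\ forall i, (0 < i <= n)%N -> y i * x i = 1,
      forall i j, (0 < i <= n)%N -> (0 < j <= n)%N -> i != j ->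
        [/\ x i * y j = y j * x i, x i * x j = x j * x i & y i * y j = y j * y i],
      forall a : A, exists s : seq ({ffun 'I_n -> nat} * {ffun 'I_n -> nat}),
        exists c : {ffun 'I_n -> nat} * {ffun 'I_n -> nat} -> K,
          a = \sum_(m <- s) c m *: mono m.1 m.2 &
      forall (s : seq ({ffun 'I_n -> nat} * {ffun 'I_n -> nat}))
             (c : {ffun 'I_n -> nat} * {ffun 'I_n -> nat} -> K),
        uniq s -> \sum_(m <- s) c m *: mono m.1 m.2 = 0 ->
        forall m, m \in s -> c m = 0].

Definition Est (i s t : nat) : A := x i ^+ s * y i ^+ t - x i ^+ s.+1 * y i ^+ t.+1.
Definition ee (i : nat) : A := 1 - x i * y i.
Definition eI (I : seq nat) : A := \prod_(i <- I) ee i.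
(* theta_{ij}(J) for J given as a duplicate-free list *)
Definition theta (J : seq nat) (i j : nat) : A :=
  (1 + (y i - 1) * eI (rem i J)) * (1 + (x j - 1) * eI (rem j J)).
Definition mu (I : seq nat) (lam : K) : A := lam *: eI I + 1 - eI I.

Inductive in_Snm1 : A -> Prop :=
| Snm1_scal (k : K) : in_Snm1 (k%:A)
| Snm1_x i : (0 < i < n)%N -> in_Snm1 (x i)
| Snm1_y i : (0 < i < n)%N -> in_Snm1 (y i)
| Snm1_add a b : in_Snm1 a -> in_Snm1 b -> in_Snm1 (a + b)
| Snm1_mul a b : in_Snm1 a -> in_Snm1 b -> in_Snm1 (a * b).

Inductive sums (G : A -> Prop) : A -> Prop :=
| sums0 : sums G 0
| sumsG a : G a -> sums G a
| sumsD a b : sums G a -> sums G b -> sums G (a + b).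

Inductive grp_gen (X : A -> Prop) : A -> Prop :=
| gg1 : grp_gen X 1
| ggX a : X a -> grp_gen X a
| ggM a b : grp_gen X a -> grp_gen X b -> grp_gen X (a * b)
| ggV a : grp_gen X a -> grp_gen X (a^-1).

Variable S : seq nat.

Definition pid (a : A) : Prop :=
  sums (fun z => exists u v i, [/\ in_Snm1 u, in_Snm1 v, i \in S & z = u * ee i * v]) a.

Definition pI (i : nat) (a : A) : Prop :=
  sums (fun z => exists u v, z = u * ee i * v) a.

(* p p_n = sum_{i in S} p_i p_n *)
Definition ppn (a : A) : Prop :=
  sums (fun z => exists u v i, [/\ i \in S, pI i u, pI n v & z = u * v]) a.

(* GL_oo(S_{n-1}, p), identified with (1 + p p_n)^* *)
Definition GLrel (u : A) : Prop := u \is a GRing.unit /\ ppn (u - 1).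

(* E_oo(S_{n-1}) under the identification: generated by 1 + a E_{kl}(n) *)
Definition Einf (u : A) : Prop :=
  grp_gen (fun g => exists a k l, [/\ in_Snm1 a, k != l & g = 1 + a * Est n k l]) u.

Definition Erel (u : A) : Prop :=
  grp_gen (fun g => exists h a k l,
     [/\ Einf h, pid a, k != l & g = h * (1 + a * Est n k l) * h^-1]) u.

Definition pairsS : seq (nat * nat) :=
  [seq p <- [seq (i, j) | i <- S, j <- S] | (p.2 < p.1)%N].

Definition thetaS (p : nat * nat) : A := theta [:: p.1; p.2; n] p.1 p.2.
Definition muS (k : nat) (lam : K) : A := mu [:: k; n] lam.

Definition prodform (ps : seq (nat * nat)) (ks : seq nat)
  (nn : nat * nat -> int) (lam : nat -> K) (e : A) : A :=
  (\prod_(p <- ps) thetaS p ^ (nn p)) * (\prod_(k <- ks) muS k (lam k)) * e.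

End Jacobian.

(* Main.v *)
(** Elements of [GL_oo(S_(n-1))] are units in [1 + p_n]. Inverting variables one by one turns the
    algebra into a Laurent polynomial ring over [K], whose [K_1] is computed by the Bass-Heller-Swan
    argument (regularity, linearisation, idempotents and nilpotents), so that there every matrix is a
    monomial times an elementary one. Descending along a variable [x_s]: the exponent of [x_s] in the
    monomial is a Fredholm index, hence zero for a unit that lifts; what remains lies over the ideal of
    [e_s], is compressed by Vaserstein's lemma to the corner [e_s A e_s], and is governed there by the
    case already known. The same induction over the set [S] gives generators of the relative group: the
    block [mu_k(x_s)], which exists once [x_s] is inverted, lifts to [theta_ks].
    Independence is seen by determinants: for [k] in [S] and a character of the other variables, a unit
    in [1 + p p_n] acts on the corner of [e_k e_n] as a finite matrix. With all variables sent to 1 the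
    determinant reads off [lambda_k]; with [x_j] sent to [t], its degree in [t] reads off [n_kj].
    Relative elementary matrices are killed because [p] is idempotent, so that they are products of
    commutators. *)

Require Import Defs.
From HB Require Import structures.
From mathcomp Require Import all_boot all_order all_algebra.
From mathcomp Require Import generic_quotient boolp zify.
Set Implicit Arguments. Unset Strict Implicit. Unset Printing Implicit Defensive.
Import GRing.Theory.
Local Open Scope ring_scope.

(** * Noncommutative ring identities by normalisation *)

(** All matrix groups live inside one ring. If [Y * X = 1], the elements
    [X ^+ k * (1 - X * Y) * Y ^+ l] are matrix units, and shifting by [X ^+ M] and [Y ^+ M] provides
    unoccupied diagonal blocks; the stable lemmas thus become identities between finitely many
    noncommuting letters, and the normaliser below serves to verify these. Most of the work takes
    place in quotients of [A] by ideals generated by some of the [ee q]. These rings carry no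
    inversion operation, so every unit travels with an explicit inverse. Regularity is stated with
    finite free resolutions rather than projective ones: this makes the classes of idempotents
    trivial as well, and K_0 needs no computation of its own. The vanishing of the index rests on
    one fact only: a one-sided inverse of a square matrix over a field is two-sided. Finally,
    generation cannot be proved for [A] alone, because taking [s] out of [S] means inverting [x s];
    the induction therefore runs over all sets [Q] of inverted variables at once. *)

Inductive nce := NV of nat | NZ | NU | NA of nce & nce | NO of nce | NM of nce & nce.

Section NC.
(** Coefficients are unary: a word is repeated as often as its coefficient says, and the boolean
    [true] marks a minus sign. Cancelling then means finding one copy of opposite sign. *)
Definition ncp := seq (bool * seq nat).
Fixpoint nnorm (e : nce) : ncp := match e with
 | NV i => [:: (false, [:: i])] | NZ => [::] | NU => [:: (false, [::])]
 | NA a b => nnorm a ++ nnorm b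
 | NO a => [seq (~~ t.1, t.2) | t <- nnorm a]
 | NM a b => [seq (t.1 (+) s.1, t.2 ++ s.2) | t <- nnorm a, s <- nnorm b] end.
Fixpoint nfind (hs : seq (seq nat * ncp)) (w : seq nat) : option ncp :=
  match hs with [::] => None | h :: hs' =>
    if (take (size h.1) w == h.1) then Some [seq (t.1, t.2 ++ drop (size h.1) w) | t <- h.2]
    else nfind hs' w end.
Fixpoint nstep hs (w : seq nat) : option ncp :=
  match nfind hs w with Some p => Some p | None =>
   match w with [::] => None | i :: w' => omap (map (fun t => (t.1, i :: t.2))) (nstep hs w') end end.
(** Fuel replaces a termination proof: a round rewrites every word at most once and preserves the
    value, so stopping early is sound. *)
Fixpoint nred fuel hs (p : ncp) : ncp := match fuel with 0%N => p | f.+1 =>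
  nred f hs (flatten [seq match nstep hs t.2 with Some q => [seq (t.1 (+) s.1, s.2) | s <- q]
     | None => [:: t] end | t <- p]) end.
Fixpoint nins (t : bool * seq nat) (p : ncp) : ncp := match p with [::] => [:: t]
 | s :: p' => if (s.2 == t.2) && (s.1 != t.1) then p' else s :: nins t p' end.
(** A left-hand side that is not a single positive word becomes the idle rule 1 = 1, so soundness
    holds for arbitrary hypotheses. *)
Definition nrule (h : nce * nce) : seq nat * ncp :=
  match nnorm h.1 with [:: (false, w)] => (w, nnorm h.2) | _ => ([::], [:: (false, [::])]) end.
Definition ncheck fuel (hs : seq (nce * nce)) e1 e2 : bool :=
  nilp (foldr nins [::] (nred fuel (map nrule hs) (nnorm (NA e1 (NO e2))))).

Variable R : pzRingType.
Variable env : seq R.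
Fixpoint nev (e : nce) : R := match e with
 | NV i => nth 0 env i | NZ => 0 | NU => 1 | NA a b => nev a + nev b | NO a => - nev a
 | NM a b => nev a * nev b end.
Definition wev (w : seq nat) : R := foldr (fun i a => nth 0 env i * a) 1 w.
Definition tev (t : bool * seq nat) : R := if t.1 then - wev t.2 else wev t.2.
Definition pev (p : ncp) : R := foldr (fun t a => tev t + a) 0 p.

Lemma wev_cat u v : wev (u ++ v) = wev u * wev v.
Proof. by elim: u => [|i u IH] /=; rewrite ?mul1r // IH mulrA. Qed.
Lemma pev_cat u v : pev (u ++ v) = pev u + pev v.
Proof. by elim: u => [|i u IH] /=; rewrite ?add0r // IH addrA. Qed.
Lemma pev_opp p : pev [seq (~~ t.1, t.2) | t <- p] = - pev p.
Proof.
elim: p => [|[b w] p IH] /=; rewrite ?oppr0 // opprD IH /tev /=.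
by case: b => //=; rewrite opprK.
Qed.
Lemma tev_mul (t s : bool * seq nat) : tev (t.1 (+) s.1, t.2 ++ s.2) = tev t * tev s.
Proof. by case: t s => [[] u] [[] v]; rewrite /tev /= wev_cat ?mulNr ?mulrN ?opprK. Qed.
Lemma pev_mul p q : pev [seq (t.1 (+) s.1, t.2 ++ s.2) | t <- p, s <- q] = pev p * pev q.
Proof.
elim: p => [|t p IH] /=; first by rewrite mul0r.
rewrite pev_cat IH mulrDl; congr (_ + _); elim: q {IH} => [|s q IH] /=; first by rewrite mulr0.
by rewrite IH mulrDr tev_mul.
Qed.
Lemma nnormE e : pev (nnorm e) = nev e.
Proof.
elim: e => //= [i||a IHa b IHb|a IHa|a IHa b IHb].
- by rewrite /tev /= mulr1 addr0.
- by rewrite /tev addr0.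
- by rewrite pev_cat IHa IHb.
- by rewrite pev_opp IHa.
- by rewrite pev_mul IHa IHb.
Qed.

Definition rok (h : seq nat * ncp) := wev h.1 = pev h.2.
Fixpoint roks (hs : seq (seq nat * ncp)) := if hs is h :: hs' then rok h /\ roks hs' else True.

Lemma pev_app q (v : seq nat) : pev [seq (t.1, t.2 ++ v) | t <- q] = pev q * wev v.
Proof.
elim: q => [|[[] w] q IH] /=; rewrite ?mul0r // mulrDl IH; congr (_ + _).
  by rewrite /tev /= wev_cat mulNr.
by rewrite /tev /= wev_cat.
Qed.
Lemma pev_pre i q : pev [seq (t.1, i :: t.2) | t <- q] = nth 0 env i * pev q.
Proof.
elim: q => [|[[] w] q IH] /=; rewrite ?mulr0 // mulrDr IH; congr (_ + _).
by rewrite /tev /= mulrN.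
Qed.
Lemma pev_sgn b q : pev [seq (b (+) s.1, s.2) | s <- q] = if b then - pev q else pev q.
Proof.
case: b => /=; first exact: pev_opp.
by elim: q => [|[b w] q IH] //=; rewrite IH.
Qed.
Lemma nfindP hs w p : roks hs -> nfind hs w = Some p -> wev w = pev p.
Proof.
elim: hs => // h hs IH /= [hh hhs]; case: eqP => [e [<-]|_]; last exact: IH.
by rewrite pev_app -hh -[in wev h.1]e -wev_cat cat_take_drop.
Qed.
Lemma nstepP hs w p : roks hs -> nstep hs w = Some p -> wev w = pev p.
Proof.
move=> ok; elim: w p => [|i w IH] p /=; case E: (nfind _ _) => [q|].
- by move=> [<-]; apply: nfindP E.
- by [].
- by move=> [<-]; apply: nfindP E.
- by case E': (nstep hs w) => [q|//] [<-]; rewrite pev_pre (IH q).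
Qed.
Lemma nredP fuel hs p : roks hs -> pev (nred fuel hs p) = pev p.
Proof.
move=> ok; elim: fuel p => //= f IH p; rewrite IH; elim: p => //= t p IHp.
rewrite pev_cat IHp; congr (_ + _); case E: (nstep hs t.2) => [q|] /=; last by rewrite addr0.
by rewrite pev_sgn -(nstepP ok E).
Qed.
Lemma ninsP t p : pev (nins t p) = tev t + pev p.
Proof.
elim: p => //= [[b w]] p IH; case: t IH => [c v] IH /=.
case: eqP => [->|_] /=; last by rewrite IH addrCA.
by case: b c IH => [] [] /= IH; rewrite ?IH 1?addrCA // /tev /= ?addrA ?subrr ?addNr ?add0r.
Qed.
Fixpoint nhyp (hs : seq (nce * nce)) : Prop :=
  if hs is h :: hs' then nev h.1 = nev h.2 /\ nhyp hs' else True.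
Theorem nc_correct fuel hs e1 e2 : nhyp hs -> ncheck fuel hs e1 e2 -> nev e1 = nev e2.
Proof.
move=> hh; rewrite /ncheck => /nilP H.
have ok : roks (map nrule hs).
  elim: hs hh {H} => //= h hs IH [e /IH ok]; split=> //; rewrite /rok /nrule.
  rewrite -!nnormE in e; move: e; case: (nnorm h.1) => [|[[] w] [|? ?]] /=; rewrite /tev /= ?addr0 //.
apply/eqP; rewrite -subr_eq0 -[_ - _]/(nev (NA e1 (NO e2))) -nnormE -(nredP fuel _ ok).
elim: (nred _ _ _) H => //= t p IH H; have := ninsP t (foldr nins [::] p); rewrite H /= => H'.
have fE q : pev (foldr nins [::] q) = pev q by elim: q => //= s q IHq; rewrite ninsP IHq.
by rewrite -fE -H'.
Qed.
End NC.

(** Atoms are compared by [unify]. The dummy matches on [Set] make it possible to run a tactic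
    inside an Ltac function that returns a term. *)
Ltac nc_insert t l := lazymatch l with
  | nil => constr:(cons t nil)
  | cons ?h ?r => match constr:(Set) with
    | _ => let u := match constr:(Set) with _ => unify h t end in l
    | _ => let r' := nc_insert t r in constr:(cons h r') end end.
Ltac nc_atoms t l := lazymatch t with
  | Algebra.add ?a ?b => let l1 := nc_atoms a l in nc_atoms b l1
  | Algebra.opp ?a => nc_atoms a l
  | GRing.mul ?a ?b => let l1 := nc_atoms a l in nc_atoms b l1
  | @Algebra.zero _ => l | GRing.one _ => l
  | _ => nc_insert t l end.
Ltac nc_index t l := lazymatch l with
  | cons ?h ?r => match constr:(Set) with
    | _ => let u := match constr:(Set) with _ => unify h t end in constr:(O)
    | _ => let k := nc_index t r in constr:(S k) end end.
Ltac nc_reify t l := lazymatch t with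
  | Algebra.add ?a ?b => let a' := nc_reify a l in let b' := nc_reify b l in constr:(NA a' b')
  | Algebra.opp ?a => let a' := nc_reify a l in constr:(NO a')
  | GRing.mul ?a ?b => let a' := nc_reify a l in let b' := nc_reify b l in constr:(NM a' b')
  | @Algebra.zero _ => constr:(NZ) | GRing.one _ => constr:(NU)
  | _ => let k := nc_index t l in constr:(NV k) end.
Ltac nc_hatoms hs l := lazymatch hs with
  | tt => l
  | pair ?hs' ?h => let l1 := nc_hatoms hs' l in
     lazymatch type of h with ?a = ?b => let l2 := nc_atoms a l1 in nc_atoms b l2 end end.
Ltac nc_hreify hs l := lazymatch hs with
  | tt => constr:(@nil (nce * nce))
  | pair ?hs' ?h => let r := nc_hreify hs' l in
     lazymatch type of h with ?a = ?b => let a' := nc_reify a l in let b' := nc_reify b l in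
       constr:(cons (a', b') r) end end.
Ltac nc_proof hs := lazymatch hs with
  | tt => constr:(Logic.I)
  | pair ?hs' ?h => let r := nc_proof hs' in constr:(conj h r) end.
(* [nc_ring (tt, h1, .., hk)] proves an equation of noncommutative polynomials, rewriting with the [hi] from
   left to right; the left-hand side of each [hi] must be a product of atoms. *)
Ltac nc_ring hs := lazymatch goal with |- @eq ?T ?a ?b =>
  let l0 := nc_atoms a (@nil T) in let l1 := nc_atoms b l0 in let l := nc_hatoms hs l1 in
  let ea := nc_reify a l in let eb := nc_reify b l in
  let hr := nc_hreify hs l in let pf := nc_proof hs in
  exact (@nc_correct _ l 60 hr ea eb pf (ltac:(vm_compute; reflexivity))) end.

(** * Quotient rings *)

Section Quotient.
Variables (R : nzRingType) (I : R -> Prop).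
Hypotheses (I0 : I 0) (ID : forall a b, I a -> I b -> I (a + b)).
Hypotheses (IMl : forall a b, I b -> I (a * b)) (IMr : forall a b, I a -> I (a * b)).
Hypothesis (I1 : ~ I 1).

Let IN a : I a -> I (- a).
Proof. by move=> Ia; rewrite -mulN1r; apply: IMl. Qed.

Let ex_rep a : exists b, `[< I (b - a) >].
Proof. by exists a; apply/asboolP; rewrite subrr. Qed.
(** The ideal is a mere predicate, so a class is represented by a choice that depends only on the
    predicate of being congruent to [a]. Congruent elements have equivalent predicates, hence the
    same representative, and the quotient is the set of fixed points of [rep]. *)
Let rep a : R := xchoose (ex_rep a).
Let rep_cong a : I (rep a - a).
Proof. exact/asboolP/(xchooseP (ex_rep a)). Qed.
Let rep_eq a b : I (a - b) -> rep a = rep b.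
Proof.
move=> Iab; apply: eq_xchoose => c; apply/asboolP/asboolP => H.
  by rewrite -(subrKA a); apply: ID.
by rewrite -(subrKA b); apply: ID => //; rewrite -opprB; apply: IN.
Qed.
Let rep_inj a b : rep a = rep b -> I (a - b).
Proof.
move=> e; rewrite -(subrKA (rep a)) -opprB; apply: ID; last by rewrite e.
exact: IN.
Qed.
Let repK a : rep (rep a) = rep a.
Proof. exact: rep_eq. Qed.

Let Q := {a : R | rep a == a}.
Let pi a : Q := exist _ (rep a) (introT eqP (repK a)).
Let pi_eq a b : I (a - b) -> pi a = pi b.
Proof. by move=> H; apply: val_inj; apply: rep_eq. Qed.
Let valQ (q : Q) : pi (val q) = q.
Proof. by apply: val_inj; apply/eqP; apply: (valP q). Qed.
Let pi_rep a : I (val (pi a) - a).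
Proof. exact: rep_cong. Qed.

Let zero := pi 0.
Let one := pi 1.
Let add (p q : Q) := pi (val p + val q).
Let opp (p : Q) := pi (- val p).
Let mul (p q : Q) := pi (val p * val q).

Let piD a b : add (pi a) (pi b) = pi (a + b).
Proof. by apply: pi_eq; rewrite opprD addrACA; apply: ID. Qed.
Let piN a : opp (pi a) = pi (- a).
Proof. by apply: pi_eq; rewrite -opprD; apply: IN. Qed.
Let piM a b : mul (pi a) (pi b) = pi (a * b).
Proof.
apply: pi_eq; rewrite -(subrKA (val (pi a) * b)) -mulrBr -mulrBl.
by apply: ID; [apply: IMl|apply: IMr].
Qed.
Let piP (q : Q) : exists a, q = pi a.
Proof. by exists (val q); rewrite valQ. Qed.

Let addA : associative add.
Proof. by move=> p q r; have [a ->] := piP p; have [b ->] := piP q; have [c ->] := piP r; rewrite !piD addrA. Qed.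
Let addC : commutative add.
Proof. by move=> p q; have [a ->] := piP p; have [b ->] := piP q; rewrite !piD addrC. Qed.
Let add0 : left_id zero add.
Proof. by move=> p; have [a ->] := piP p; rewrite /zero piD add0r. Qed.
Let addN : left_inverse zero opp add.
Proof. by move=> p; have [a ->] := piP p; rewrite piN piD addNr. Qed.
Let mulA : associative mul.
Proof. by move=> p q r; have [a ->] := piP p; have [b ->] := piP q; have [c ->] := piP r; rewrite !piM mulrA. Qed.
Let mul1 : left_id one mul.
Proof. by move=> p; have [a ->] := piP p; rewrite /one piM mul1r. Qed.
Let mulr1' : right_id one mul.
Proof. by move=> p; have [a ->] := piP p; rewrite /one piM mulr1. Qed.
Let mulDl : left_distributive mul add.
Proof. by move=> p q r; have [a ->] := piP p; have [b ->] := piP q; have [c ->] := piP r; rewrite !(piM, piD) mulrDl. Qed.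
Let mulDr : right_distributive mul add.
Proof. by move=> p q r; have [a ->] := piP p; have [b ->] := piP q; have [c ->] := piP r; rewrite !(piM, piD) mulrDr. Qed.
Let one0 : one != zero.
Proof. by apply/eqP => /(congr1 val) /rep_inj; rewrite subr0. Qed.

Lemma quotient_ring_exists : exists (T : nzRingType) (f : {rmorphism R -> T}),
  (forall t, exists a, t = f a) /\ (forall a, f a = 0 <-> I a).
Proof.
pose zM := GRing.isZmodule.Build Q addA addC add0 addN.
pose zT : zmodType := HB.pack {a : R | rep a == a} zM.
pose rM := @GRing.Zmodule_isNzRing.Build zT one mul mulA mul1 mulr1' mulDl mulDr one0.
pose rT : nzRingType := HB.pack {a : R | rep a == a} zM rM.
pose fA := @GRing.isZmodMorphism.Build R rT pi (fun a b => esym (etrans (congr1 (add (pi a)) (piN b)) (piD a (- b)))).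
pose fM := @GRing.isMonoidMorphism.Build R rT pi (conj erefl (fun a b => esym (piM a b))).
pose f : {rmorphism R -> rT} := HB.pack pi fA fM.
exists rT, f; split; first exact: piP.
move=> a; split => [/(congr1 val) /rep_inj|Ia]; first by rewrite subr0.
by apply: pi_eq; rewrite subr0.
Qed.
End Quotient.

Section Subring.
Variables (R : nzRingType) (P : R -> Prop).
Hypotheses (P1 : P 1) (PB : forall a b, P a -> P b -> P (a - b)) (PM : forall a b, P a -> P b -> P (a * b)).
Hypothesis (PC : forall a b, P a -> P b -> a * b = b * a).

Let S := {a : R | `[< P a >]}.
Let mk a (Pa : P a) : S := exist _ a (introT (asboolP _) Pa).
Let SP (s : S) : P (val s). Proof. exact/asboolP/(valP s). Qed.

(** The Laurent argument needs a packaged commutative ring, whereas its coefficients are given as a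
    predicate inside a noncommutative quotient. *)
Lemma commutative_subring_exists : exists (T : comNzRingType) (j : {rmorphism T -> R}),
  injective j /\ (forall a, P a <-> exists t, a = j t).
Proof.
have P0 : P 0 by rewrite -(subrr 1); apply: PB.
have PN a : P a -> P (- a) by move=> Pa; rewrite -sub0r; apply: PB.
have PD a b : P a -> P b -> P (a + b) by move=> Pa Pb; rewrite -(opprK b); apply/PB/PN.
pose add (p q : S) := mk (PD _ _ (SP p) (SP q)).
pose opp (p : S) := mk (PN _ (SP p)).
pose mul (p q : S) := mk (PM (SP p) (SP q)).
have addA : associative add by move=> *; apply: val_inj; apply: addrA.
have addC : commutative add by move=> *; apply: val_inj; apply: addrC.
have add0 : left_id (mk P0) add by move=> *; apply: val_inj; apply: add0r.
have addN : left_inverse (mk P0) opp add by move=> *; apply: val_inj; apply: addNr.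
have mulA : associative mul by move=> *; apply: val_inj; apply: mulrA.
have mulC : commutative mul by move=> *; apply: val_inj; apply: PC; apply: SP.
have mul1 : left_id (mk P1) mul by move=> *; apply: val_inj; apply: mul1r.
have mulDl : left_distributive mul add by move=> *; apply: val_inj; apply: mulrDl.
have one0 : mk P1 != mk P0 by apply/eqP => /(congr1 val) /eqP; rewrite oner_eq0.
pose zM := GRing.isZmodule.Build S addA addC add0 addN.
pose zT : zmodType := HB.pack {a : R | `[< P a >]} zM.
pose rM := @GRing.Zmodule_isComNzRing.Build zT _ mul mulA mulC mul1 mulDl one0.
pose rT : comNzRingType := HB.pack {a : R | `[< P a >]} zM rM.
pose v (s : rT) : R := val s.
have vB : {morph v : a b / a - b} by [].
have vM : monoid_morphism v by [].
pose fA := @GRing.isZmodMorphism.Build rT R v vB.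
pose fM := @GRing.isMonoidMorphism.Build rT R v vM.
pose f : {rmorphism rT -> R} := HB.pack v fA fM.
exists rT, f; split; first exact: val_inj.
move=> a; split => [Pa|[t ->]]; last exact: SP.
by exists (mk Pa).
Qed.
End Subring.

(** * Stable K-theory over a Toeplitz extension *)

Section Toeplitz.
Variables (R : nzRingType) (X Y : R).
Hypothesis YX : Y * X = 1.

(** Matrix unit in row [k] and column [l], for the basis on which [X] acts as the one-sided shift;
    [1 - X * Y] projects onto the first basis vector. *)
Definition Ekl k l : R := X ^+ k * (1 - X * Y) * Y ^+ l.

Lemma mulY_e : Y * (1 - X * Y) = 0.
Proof. by rewrite mulrBr mulr1 mulrA YX mul1r subrr. Qed.
Lemma mule_X : (1 - X * Y) * X = 0.
Proof. by rewrite mulrBl mul1r -mulrA YX mulr1 subrr. Qed.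
Lemma mulYX_exp k : Y ^+ k * X ^+ k = 1.
Proof. by elim: k => [|k IH]; rewrite ?mulr1 // exprSr exprS mulrA -(mulrA _ Y) YX mulr1 IH. Qed.
Lemma mulYX_exp_le k l : (k <= l)%N -> Y ^+ k * X ^+ l = X ^+ (l - k).
Proof. by move=> kl; rewrite -{1}(subnKC kl) exprD mulrA mulYX_exp mul1r. Qed.
Lemma mulYX_exp_ge k l : (l <= k)%N -> Y ^+ k * X ^+ l = Y ^+ (k - l).
Proof. by move=> kl; rewrite -{1}(subnK kl) exprD -mulrA mulYX_exp mulr1. Qed.

Lemma mulY_Ekl M k l : Y ^+ M * Ekl k l = if (M <= k)%N then Ekl (k - M) l else 0.
Proof.
rewrite /Ekl !mulrA; case: leqP => [Mk|kM]; first by rewrite mulYX_exp_le.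
rewrite mulYX_exp_ge; last exact: ltnW.
by rewrite -(subnSK kM) exprSr -!mulrA (mulrA Y) mulY_e mul0r mulr0.
Qed.
Lemma mulEkl_X M k l : Ekl k l * X ^+ M = if (M <= l)%N then Ekl k (l - M) else 0.
Proof.
rewrite /Ekl -!mulrA; case: leqP => [Ml|lM]; first by rewrite mulYX_exp_ge.
rewrite mulYX_exp_le; last exact: ltnW.
by rewrite -(subnSK lM) exprS !mulrA -(mulrA (X ^+ k)) mule_X mulr0 mul0r.
Qed.
Lemma mulX_Ekl M k l : X ^+ M * Ekl k l = Ekl (M + k) l.
Proof. by rewrite /Ekl !mulrA -exprD. Qed.
Lemma mulEkl_Y M k l : Ekl k l * Y ^+ M = Ekl k (l + M).
Proof. by rewrite /Ekl -!mulrA -exprD. Qed.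

Lemma mulEkl k l r s : Ekl k l * Ekl r s = if l == r then Ekl k s else 0.
Proof.
have -> : Ekl r s = X ^+ r * Ekl 0 s by rewrite mulX_Ekl addn0.
rewrite mulrA mulEkl_X; case: leqP => [rl|lr]; last by rewrite mul0r (ltn_eqF lr).
have -> : Ekl k (l - r) = Ekl k 0 * Y ^+ (l - r) by rewrite mulEkl_Y.
rewrite -mulrA mulY_Ekl leqn0 subn_eq0; case: eqP => [->|/eqP lr]; last first.
  by rewrite leqNgt ltn_neqAle eq_sym lr rl /= mulr0.
rewrite leqnn subnn /Ekl expr0 mul1r mulr1 -!mulrA; congr (_ * _).
by rewrite mulrA mulrBr mulr1 mulrA mule_X mul0r subr0.
Qed.

(** Projection onto the first [N] basis vectors, by [PnE]. *)
Definition Pn N : R := 1 - X ^+ N * Y ^+ N.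

Lemma PnE N : Pn N = \sum_(k < N) Ekl k k.
Proof.
elim: N => [|N IH]; first by rewrite big_ord0 /Pn mulr1 subrr.
rewrite big_ord_recr /= -IH /Pn /Ekl mulrBr mulr1 mulrBl !mulrA -exprSr -!mulrA -exprS.
by rewrite addrA subrK.
Qed.

End Toeplitz.

Lemma comm_exp (R : nzRingType) (b z : R) k : b * z = z * b -> b * z ^+ k = z ^+ k * b.
Proof. by move=> bz; apply: commrX. Qed.

(* [X, Y] generate a Toeplitz algebra over the ring of coefficients [B]; "matrices over [B]" are the
   combinations of the [Ekl] with coefficients in [B]. *)
Record tctx (R : nzRingType) (X Y : R) (B : R -> Prop) : Prop := Tctx {
  tc_YX : Y * X = 1; tc_B1 : B 1;
  tc_BB : forall a b, B a -> B b -> B (a - b);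
  tc_BM : forall a b, B a -> B b -> B (a * b);
  tc_BX : forall b, B b -> b * X = X * b;
  tc_BY : forall b, B b -> b * Y = Y * b }.

(** * The lemmas of Whitehead and Vaserstein, relative to an ideal *)

Section StableK1.
Variables (R : nzRingType) (X Y : R) (B : R -> Prop).
Hypothesis HT : tctx X Y B.
Local Notation Ekl := (Ekl X Y).
Local Notation Pn := (Pn X Y).
Let YX : Y * X = 1 := tc_YX HT.
Let B1 : B 1 := tc_B1 HT.
Let BB := tc_BB HT.
Let BM := tc_BM HT.
Let BX := tc_BX HT.
Let BY := tc_BY HT.
Let mulYX_exp := mulYX_exp YX.
Let mulYX_exp_le := @mulYX_exp_le _ _ _ YX.
Let mulYX_exp_ge := @mulYX_exp_ge _ _ _ YX.
Let mulY_Ekl := mulY_Ekl YX.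
Let mulEkl_X := mulEkl_X YX.
Let mulX_Ekl := mulX_Ekl X Y.
Let mulEkl_Y := mulEkl_Y X Y.
Let mulEkl := mulEkl YX.

Let B0 : B 0. Proof. by rewrite -(subrr 1); apply: BB. Qed.
Let BN a : B a -> B (- a). Proof. by move=> Ba; rewrite -sub0r; apply: BB. Qed.


Lemma B_Ekl b k l : B b -> b * Ekl k l = Ekl k l * b.
Proof.
move=> Bb; have bX := BX Bb; have bY := BY Bb.
have be : b * (1 - X * Y) = (1 - X * Y) * b.
  by rewrite mulrBr mulrBl mulr1 mul1r mulrA bX -mulrA bY mulrA.
by rewrite /Ekl mulrA (mulrA b) (comm_exp _ bX) -!mulrA (mulrA b) be -!mulrA (comm_exp _ bY).
Qed.

Record idl (p : R -> Prop) : Prop := Idl {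
  idl_sub : forall a, p a -> B a;
  idl0 : p 0;
  idlB : forall a b, p a -> p b -> p (a - b);
  idlMl : forall a b, B b -> p a -> p (b * a);
  idlMr : forall a b, B b -> p a -> p (a * b) }.

Lemma idlN p a : idl p -> p a -> p (- a).
Proof. by move=> ip pa; rewrite -sub0r; apply: idlB => //; apply: idl0. Qed.
Lemma idl_B : idl B. Proof. by split => // a b Bb Ba; apply: BM. Qed.

(** Finite matrices with entries in [p] at positions allowed by [c]. The shape [c] is there for the
    block-triangular matrices of [El_block]; [F] allows all positions. *)
Inductive Fs (c : nat -> nat -> bool) (p : R -> Prop) : R -> Prop :=
| Fs0 : Fs c p 0
| FsE a k l : c k l -> p a -> Fs c p (a * Ekl k l)
| FsD a b : Fs c p a -> Fs c p b -> Fs c p (a + b).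

Notation F := (Fs (fun _ _ => true)).

Lemma FsN c p a : idl p -> Fs c p a -> Fs c p (- a).
Proof.
move=> ip; elim=> [|{}a k l ckl pa|b d _ IHb _ IHd]; rewrite ?oppr0 ?opprD.
- exact: Fs0.
- by rewrite -mulNr; apply: FsE => //; apply: idlN.
- exact: FsD.
Qed.
Lemma FsW (c c' : nat -> nat -> bool) (p p' : R -> Prop) a : (forall k l, c k l -> c' k l) -> (forall b, p b -> p' b) ->
  Fs c p a -> Fs c' p' a.
Proof.
move=> cc pp; elim=> [|{}a k l ckl pa|b d _ IHb _ IHd]; first exact: Fs0.
- by apply: FsE; auto.
- exact: FsD.
Qed.
Lemma Fs_sum c p I (r : seq I) (P : pred I) (G : I -> R) :
  (forall i, P i -> Fs c p (G i)) -> Fs c p (\sum_(i <- r | P i) G i).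
Proof. by move=> H; apply: big_ind => //; [apply: Fs0|apply: FsD]. Qed.

Lemma FM (p q s : R -> Prop) : (forall a b, p a -> q b -> s (a * b)) -> (forall b, q b -> B b) ->
  forall a b, F p a -> F q b -> F s (a * b).
Proof.
move=> pqs qB a b Fa; elim: Fa b => [b _|{}a k l _ pa b|{}a a' _ IHa _ IHa' b Fb].
- by rewrite mul0r; apply: Fs0.
- elim=> [|{}b r t _ qb|b' d _ IHb _ IHd]; rewrite ?mulr0 ?mulrDr.
  + exact: Fs0.
  + rewrite mulrA -(mulrA a) -B_Ekl; last exact: qB.
    rewrite mulrA -mulrA mulEkl; case: eqP => _; last by rewrite mulr0; apply: Fs0.
    by apply: FsE => //; apply: pqs.
  + exact: FsD.
- by rewrite mulrDl; apply: FsD; [apply: IHa|apply: IHa'].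
Qed.
Lemma FMl p a b : idl p -> F p a -> F B b -> F p (a * b).
Proof. by move=> ip; apply: FM => // u v pu Bv; apply: idlMr. Qed.
Lemma FMr p a b : idl p -> F B a -> F p b -> F p (a * b).
Proof. by move=> ip; apply: FM => [u v Bu pv|u]; [apply: idlMl|apply: idl_sub]. Qed.
Lemma F_B p a : idl p -> F p a -> F B a.
Proof. by move=> ip; apply: FsW => // b; apply: idl_sub. Qed.

Lemma F_Y p a k : F p a -> F p (a * Y ^+ k).
Proof.
elim=> [|{}a r l _ pa|b d _ IHb _ IHd]; rewrite ?mul0r ?mulrDl; first exact: Fs0.
- by rewrite -mulrA mulEkl_Y; apply: FsE.
- exact: FsD.
Qed.
Lemma F_X p a k : idl p -> F p a -> F p (X ^+ k * a).
Proof.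
move=> ip; elim=> [|{}a r l _ pa|b d _ IHb _ IHd]; rewrite ?mulr0 ?mulrDr; first exact: Fs0.
- rewrite mulrA -comm_exp; last exact/BX/(idl_sub ip).
  by rewrite -mulrA mulX_Ekl; apply: FsE.
- exact: FsD.
Qed.

(** The support lies in the first [N] rows and columns. Asking for all [M] from [N] on makes
    enlarging the bound immediate. *)
Definition bnd N (a : R) := forall M, (N <= M)%N -> Y ^+ M * a = 0 /\ a * X ^+ M = 0.

Lemma bndW N M a : (N <= M)%N -> bnd N a -> bnd M a.
Proof. by move=> NM ba K MK; apply: ba; apply: leq_trans MK. Qed.
Lemma F_bnd p a : idl p -> F p a -> exists N, bnd N a.
Proof.
move=> ip; elim=> [|{}a k l _ pa|b d _ [N1 H1] _ [N2 H2]].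
- by exists 0%N => M _; rewrite mulr0 mul0r.
- exists (k + l).+1 => M klM; split.
    rewrite mulrA -comm_exp; last exact/BY/(idl_sub ip).
    by rewrite -mulrA mulY_Ekl leqNgt (leq_ltn_trans _ klM) ?leq_addr //= mulr0.
  by rewrite -mulrA mulEkl_X leqNgt (leq_ltn_trans _ klM) ?leq_addl //= mulr0.
- exists (maxn N1 N2) => M; rewrite geq_max => /andP[M1 M2].
  have [-> ->] : Y ^+ M * (b + d) = Y ^+ M * b + Y ^+ M * d /\ (b + d) * X ^+ M = b * X ^+ M + d * X ^+ M.
    by rewrite mulrDr mulrDl.
  by have [-> ->] := H1 _ M1; have [-> ->] := H2 _ M2; rewrite addr0.
Qed.

Lemma F_Pn N : F B (Pn N).
Proof. by rewrite (PnE X Y); apply: Fs_sum => i _; rewrite -[Ekl _ _]mul1r; apply: FsE. Qed.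
Lemma Pn_bnd N a : bnd N a -> Pn N * a = a /\ a * Pn N = a.
Proof.
move=> /(_ _ (leqnn N)) [Ya aX].
by rewrite /Pn mulrBl mulrBr -mulrA Ya mulrA aX mulr0 mul0r !subr0 mul1r mulr1.
Qed.
Lemma bnd_Pn N : bnd N (Pn N).
Proof.
move=> M NM; rewrite /Pn mulrBr mulrBl mulr1 mul1r !mulrA mulYX_exp_ge // -mulrA mulYX_exp_le //.
by rewrite -!exprD subnK // subnKC // !subrr.
Qed.

Inductive El (p : R -> Prop) : R -> Prop :=
| El1 : El p 1
| ElE a k l : k != l -> p a -> El p (1 + a * Ekl k l)
| ElM g h : El p g -> El p h -> El p (g * h).

(** The conjugating matrix and its inverse are both data, since the ring has no inversion. *)
Inductive Er (p : R -> Prop) : R -> Prop :=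
| Er1 : Er p 1
| ErE h h' a k l : El B h -> El B h' -> h * h' = 1 -> h' * h = 1 -> k != l -> p a ->
    Er p (h * (1 + a * Ekl k l) * h')
| ErM g h : Er p g -> Er p h -> Er p (g * h).

Lemma elemV a k l : B a -> k != l ->
  (1 + a * Ekl k l) * (1 + - a * Ekl k l) = 1.
Proof.
move=> Ba kl; rewrite mulrDr mulr1 mulrDl mul1r mulNr mulrN -mulrA (mulrA (Ekl k l)) -B_Ekl //.
by rewrite -(mulrA a (Ekl k l)) mulEkl eq_sym (negPf kl) !mulr0 subr0 addrK.
Qed.

Lemma El_inv p g : idl p -> El p g -> exists g', [/\ El p g', g * g' = 1 & g' * g = 1].
Proof.
move=> ip; elim=> [|a k l kl pa|u v _ [u' [Eu uu' u'u]] _ [v' [Ev vv' v'v]]].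
- by exists 1; rewrite mulr1; split => //; apply: El1.
- have Ba := idl_sub ip pa.
  exists (1 + - a * Ekl k l); split; first by apply: ElE => //; apply: idlN.
    exact: elemV.
  by rewrite -{2}(opprK a); apply: elemV => //; apply: BN.
- exists (v' * u'); split; first exact: ElM.
    by rewrite mulrA -(mulrA u) vv' mulr1.
  by rewrite mulrA -(mulrA v') u'u mulr1.
Qed.

Lemma Er_W (p q : R -> Prop) g : (forall a, p a -> q a) -> Er p g -> Er q g.
Proof.
move=> pq; elim=> [|h h' a k l Eh Eh' hh' h'h kl pa|u v _ Eu _ Ev]; first exact: Er1.
  by apply: ErE => //; apply: pq.
exact: ErM.
Qed.

Lemma El_Er p g : El p g -> Er p g.
Proof.
elim=> [|a k l kl pa|u v _ Eu _ Ev]; first exact: Er1; last exact: ErM.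
have := ErE (El1 B) (El1 B) (mulr1 1) (mulr1 1) kl pa.
by rewrite mul1r mulr1.
Qed.
Lemma Er_El g : Er B g -> El B g.
Proof.
elim=> [|h h' a k l Eh Eh' hh' h'h kl pa|u v _ Eu _ Ev]; first exact: El1; last exact: ElM.
by apply: ElM => //; apply: ElM => //; apply: ElE.
Qed.

Lemma Er_conjE p h h' g : El B h -> El B h' -> h * h' = 1 -> h' * h = 1 -> Er p g -> Er p (h * g * h').
Proof.
move=> Eh Eh' hh' h'h; elim=> [|k k' a r l Ek Ek' kk' k'k rl pa|u v _ IHu _ IHv].
- by rewrite mulr1 hh'; apply: Er1.
- have -> : h * (k * (1 + a * Ekl r l) * k') * h' = (h * k) * (1 + a * Ekl r l) * (k' * h').
    by rewrite !mulrA.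
  by apply: ErE; rewrite //; [apply: ElM|apply: ElM|
    rewrite mulrA -(mulrA h) kk' mulr1|rewrite mulrA -(mulrA k') h'h mulr1].
- have -> : h * (u * v) * h' = (h * u * h') * (h * v * h').
    by rewrite !mulrA -(mulrA _ h' h) h'h mulr1.
  exact: ErM.
Qed.

Lemma Er_inv p g : idl p -> Er p g -> exists g', [/\ Er p g', g * g' = 1 & g' * g = 1].
Proof.
move=> ip; elim=> [|h h' a k l Eh Eh' hh' h'h kl pa|u v _ [u' [Eu uu' u'u]] _ [v' [Ev vv' v'v]]].
- by exists 1; rewrite mulr1; split => //; apply: Er1.
- have [f [Eg gg' g'g]] := El_inv ip (ElE kl pa).
  exists (h * f * h'); split; first by apply: Er_conjE => //; apply: El_Er.
    by set e := 1 + _ in gg' *; nc_ring (tt, h'h, gg', hh').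
  by set e := 1 + _ in g'g *; nc_ring (tt, h'h, g'g, hh').
- exists (v' * u'); split; first exact: ErM.
    by rewrite mulrA -(mulrA u) vv' mulr1.
  by rewrite mulrA -(mulrA v') u'u mulr1.
Qed.

Lemma F1M p u v : idl p -> F p (u - 1) -> F p (v - 1) -> F p (u * v - 1).
Proof.
move=> ip Fu Fv; have -> : u * v - 1 = (u - 1) * (v - 1) + (u - 1) + (v - 1).
  by rewrite mulrBr mulr1 subrK mulrBl mul1r addrA subrK.
by apply: FsD => //; apply: FsD => //; apply: FMl => //; apply: F_B Fv.
Qed.
Lemma El_F p g : idl p -> El p g -> F p (g - 1).
Proof.
move=> ip; elim=> [|a k l kl pa|u v _ Eu _ Ev]; last exact: F1M.
  by rewrite subrr; apply: Fs0.
by rewrite addrC addKr; apply: FsE.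
Qed.
Lemma F_conj p u h h' : idl p -> F B (h - 1) -> F B (h' - 1) -> F p u -> F p (h * u * h').
Proof.
move=> ip Fh Fh' Fu; rewrite -(subrK 1 h) -(subrK 1 h') mulrDl mul1r mulrDr mulr1.
have Fhu : F p ((h - 1) * u + u) by apply: FsD => //; apply: FMr.
by apply: FsD => //; apply: FMl.
Qed.
Lemma Er_F p g : idl p -> Er p g -> F p (g - 1).
Proof.
move=> ip; elim=> [|h h' a k l Eh Eh' hh' h'h kl pa|u v _ Eu _ Ev]; last exact: F1M.
  by rewrite subrr; apply: Fs0.
rewrite mulrDr mulrDl mulr1 hh' addrC addKr; apply: F_conj => //; try exact: El_F idl_B _.
exact: FsE.
Qed.

Record gl (p : R -> Prop) (u u' : R) : Prop := Gl {
  gl_r : u * u' = 1; gl_l : u' * u = 1; gl_F : F p (u - 1); gl_F' : F p (u' - 1) }.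

Lemma gl_sym p u u' : gl p u u' -> gl p u' u.
Proof. by case. Qed.
Lemma gl_mul p u u' v v' : idl p -> gl p u u' -> gl p v v' -> gl p (u * v) (v' * u').
Proof.
move=> ip [a b c d] [e f g h]; split; try exact: F1M.
  by rewrite mulrA -(mulrA u) e mulr1.
by rewrite mulrA -(mulrA v') b mulr1.
Qed.
Lemma gl_B p u u' : idl p -> gl p u u' -> gl B u u'.
Proof. by move=> ip [a b c d]; split => //; apply: F_B ip _. Qed.
Lemma Er_gl p g : idl p -> Er p g -> exists2 g', gl p g g' & Er p g'.
Proof.
by move=> ip Eg; have [g' [Eg' a b]] := Er_inv ip Eg; exists g' => //; split => //; apply: Er_F.
Qed.
Lemma inv_unique (u v w : R) : v * u = 1 -> u * w = 1 -> v = w.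
Proof. by move=> vu uw; rewrite -[v]mulr1 -uw mulrA vu mul1r. Qed.
Lemma Er_inv_gl p u u' : idl p -> Er p u -> u * u' = 1 -> Er p u'.
Proof.
move=> ip /(Er_inv ip) [g' [Eg' a b]] uu'.
by rewrite -(inv_unique b uu').
Qed.

(** No column index of the shape is a row index of it, so products of two such matrices vanish and
    [1 + z] is the plain product of its elementary factors. *)
Lemma El_block p (c : nat -> nat -> bool) z : idl p -> (forall k l, c k l -> k != l) ->
  (forall k l r s, c k l -> c r s -> l != r) -> Fs c p z -> El p (1 + z).
Proof.
move=> ip c1 c2; elim=> [|a k l ckl pa|a b Fa Ea Fb Eb].
- by rewrite addr0; apply: El1.
- by apply: ElE => //; apply: c1.
have ab : a * b = 0.
  elim: Fa {Ea} => [|{}a k l ckl pa|a1 a2 _ IH1 _ IH2]; rewrite ?mul0r ?mulrDl ?IH1 ?IH2 ?addr0 //.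
  elim: Fb {Eb} => [|{}b r s crs pb|b1 b2 _ IH1 _ IH2]; rewrite ?mulr0 ?mulrDr ?IH1 ?IH2 ?addr0 //.
  have e1 := esym (B_Ekl k l (idl_sub ip pb)).
  have e2 : Ekl k l * Ekl r s = 0 by rewrite mulEkl (negPf (c2 _ _ _ _ ckl crs)).
  by nc_ring (tt, e1, e2).
have -> : 1 + (a + b) = (1 + a) * (1 + b) by nc_ring (tt, ab).
exact: ElM.
Qed.

(** Right multiplication by [Y ^+ M] moves the columns of [a] past its support: this is the block
    matrix [[1, a], [0, 1]] with blocks of size [M]. *)
Lemma El_upper p M a : idl p -> F p a -> bnd M a -> El p (1 + a * Y ^+ M).
Proof.
move=> ip Fa ba.
pose c k l := (k < M <= l)%N.
apply: (@El_block p c) => //.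
- by move=> k l /andP[kM Ml]; rewrite neq_ltn (leq_trans kM Ml).
- by move=> k l r s /andP[_ Ml] /andP[rM _]; rewrite neq_ltn (leq_trans rM Ml) orbT.
have [<- _] := Pn_bnd ba.
elim: Fa {ba} => [|{}a k l _ pa|b d _ IHb _ IHd]; first by rewrite mulr0 mul0r; apply: Fs0.
- have Ba := idl_sub ip pa.
  rewrite /Pn mulrBl mul1r -mulrA [Y ^+ M * _]mulrA -(comm_exp _ (BY Ba)) -mulrA mulY_Ekl.
  case: leqP => [Mk|kM]; last first.
    by rewrite !mulr0 subr0 -mulrA mulEkl_Y; apply: FsE => //; rewrite /c kM leq_addl.
  have e1 := esym (comm_exp M (BX Ba)).
  have e2 : X ^+ M * Ekl (k - M) l = Ekl k l by rewrite mulX_Ekl subnKC.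
  set z := (X in Fs c p X); have -> : z = 0 by rewrite /z; nc_ring (tt, e1, e2).
  exact: Fs0.
- by rewrite mulrDr mulrDl; apply: FsD.
Qed.
Lemma El_lower p M a : idl p -> F p a -> bnd M a -> El p (1 + X ^+ M * a).
Proof.
move=> ip Fa ba.
pose c k l := (l < M <= k)%N.
apply: (@El_block p c) => //.
- by move=> k l /andP[kM Ml]; rewrite neq_ltn (leq_trans kM Ml) orbT.
- by move=> k l r s /andP[rM _] /andP[_ Ml]; rewrite neq_ltn (leq_trans rM Ml).
have [_ <-] := Pn_bnd ba.
elim: Fa {ba} => [|{}a k l _ pa|b d _ IHb _ IHd]; first by rewrite mul0r mulr0; apply: Fs0.
- have Ba := idl_sub ip pa.
  rewrite /Pn mulrBr mulr1 [a * _ * (_ * _)]mulrA -(mulrA a) mulEkl_X.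
  case: leqP => [Ml|lM]; last first.
    by rewrite mulr0 mul0r subr0 mulrA -(comm_exp _ (BX Ba)) -mulrA mulX_Ekl; apply: FsE => //;
      rewrite /c lM leq_addr.
  by rewrite -mulrA mulEkl_Y subnK // subrr mulr0; apply: Fs0.
- by rewrite mulrDl mulrDr; apply: FsD.
Qed.

(** The block matrix diag(1, v) with a first block of size [M]. *)
Definition sh M (v : R) := 1 + X ^+ M * (v - 1) * Y ^+ M.

Lemma sh_mul M u v : sh M u * sh M v = sh M (u * v).
Proof.
by rewrite /sh; have H := mulYX_exp M; nc_ring (tt, H).
Qed.
Lemma sh1 M : sh M 1 = 1.
Proof. by rewrite /sh subrr mulr0 mul0r addr0. Qed.
Lemma sh_gl p M u u' : idl p -> gl p u u' -> gl p (sh M u) (sh M u').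
Proof.
move=> ip [a b c d]; split; rewrite ?sh_mul ?a ?b ?sh1 //.
  by rewrite /sh addrC addKr; apply: F_Y; apply: F_X.
by rewrite /sh addrC addKr; apply: F_Y; apply: F_X.
Qed.
Lemma sh_comm M w u : bnd M (w - 1) -> sh M u * w = w * sh M u.
Proof.
move=> /(_ _ (leqnn M)) [a b]; rewrite -(subrK 1 w) /sh.
by set z := w - 1 in a b *; nc_ring (tt, a, b).
Qed.

(** Whitehead's factorisation of diag(u, u^-1), arranged so that it stays in the relative group. *)
Lemma diagE p u u' : idl p -> gl p u u' ->
  exists N, forall M, (N <= M)%N -> Er p (u * sh M u').
Proof.
move=> ip [uu' u'u Fu Fu'].
have [N1 H1] := F_bnd ip Fu; have [N2 H2] := F_bnd ip Fu'.
exists (maxn N1 N2) => M; rewrite geq_max => /andP[/bndW /(_ H1) {}H1 /bndW /(_ H2) {}H2].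
set a := u - 1 in Fu H1; set c := u' - 1 in Fu' H2.
have Eu : u = 1 + a by rewrite addrC subrK.
have Eu' : u' = 1 + c by rewrite addrC subrK.
have ac : a * c = - a - c.
  by apply: (addrI (1 + a + c)); transitivity (u * u'); [rewrite Eu Eu'; nc_ring tt|rewrite uu'; nc_ring tt].
have ca : c * a = - a - c.
  by apply: (addrI (1 + a + c)); transitivity (u' * u); [rewrite Eu Eu'; nc_ring tt|rewrite u'u; nc_ring tt].
pose J := X ^+ M; pose J' := Y ^+ M; pose P := Pn M.
have JJ : J' * J = 1 by apply: mulYX_exp.
have [PJ' JP'] : P * J = 0 /\ J' * P = 0 by have [] := bnd_Pn (leqnn M).
have [J'a aJ] := H1 _ (leqnn M); have [J'c cJ] := H2 _ (leqnn M).
have [Pa aP] := Pn_bnd H1; have [Pc cP] := Pn_bnd H2.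
rewrite -/J -/J' -/P in J'a aJ J'c cJ Pa aP Pc cP.
(* [J * P] is the lower left identity block. It has no entries in [p], so the classical product is
   regrouped in such a way that [1 + J * P] occurs only as a conjugator of the [p]-elementary factor
   [1 - a * J']. *)
have -> : u * sh M u' = (1 + J * c) * ((1 + J * P) * (1 - a * J') * (1 - J * P)) * (1 - c * J').
  rewrite /sh -/c -/J -/J' Eu.
  by nc_ring (tt, JJ, PJ', JP', J'a, aJ, J'c, cJ, Pa, aP, Pc, cP, ac, ca).
have FP : F B P by apply: F_Pn.
have eP : forall z, F B z -> bnd M z -> El B (1 + J * z).
  by move=> z Fz bz; apply: El_lower => //; apply: idl_B.
have bP : bnd M P by apply: bnd_Pn.
have bN : forall z, bnd M z -> bnd M (- z).
  by move=> z bz K MK; have [h1 h2] := bz _ MK; rewrite mulrN mulNr h1 h2 oppr0.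
apply: ErM; first apply: ErM.
- by apply: El_Er; apply: El_lower.
- have PP : (J * P) * (J * P) = 0 by rewrite mulrA -(mulrA J) PJ' mulr0 mul0r.
  apply: Er_conjE.
  + exact: eP.
  + by rewrite -mulrN; apply: eP; [apply: FsN => //; apply: idl_B|apply: bN].
  + by rewrite mulrBr mulr1 mulrDl mul1r PP addr0 addrK.
  + by rewrite mulrDr mulr1 mulrBl mul1r PP subr0 subrK.
  + by apply: El_Er; rewrite -mulNr; apply: El_upper => //; [apply: FsN|apply: bN].
- by apply: El_Er; rewrite -mulNr; apply: El_upper => //; [apply: FsN|apply: bN].
Qed.

(** Multiplied by a far copy of its inverse, [w] becomes elementary, and the far copy commutes with
    [d]. So conjugation by [w] agrees with conjugation by an elementary matrix. *)
Lemma Er_conj p w w' d : idl p -> gl B w w' -> Er p d -> Er p (w * d * w').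
Proof.
move=> ip gw Ed; have [N1 H1] := diagE idl_B gw.
have [N2 H2] := F_bnd ip (Er_F ip Ed).
pose M := maxn N1 N2.
have EH : El B (w * sh M w') by apply/Er_El/H1/leq_maxl.
have bd : bnd M (d - 1) by apply: bndW H2; apply: leq_maxr.
have [H' [EH' HH' H'H]] := El_inv idl_B EH.
have [a b _ _] := sh_gl M idl_B gw.
have e : H' = sh M w * w'.
  apply: inv_unique H'H _; rewrite -mulrA (mulrA (sh M w')) b mul1r; exact: gl_r gw.
have -> : w * d * w' = (w * sh M w') * d * H'.
  by rewrite e; have c := sh_comm w' bd; nc_ring (tt, c, b).
exact: Er_conjE.
Qed.

(** The same device applied to [u]: it differs from a far copy of itself by a relative elementary
    matrix, and the far copy commutes with [w]. *)
Lemma whitehead p w w' u u' : idl p -> gl B w w' -> gl p u u' -> Er p (w * u * w' * u').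
Proof.
move=> ip gw gu; have [N1 H1] := diagE ip gu.
have [N2 H2] := F_bnd idl_B (gl_F' gw).
pose M := maxn N1 N2.
have Ed : Er p (u * sh M u') by apply/H1/leq_maxl.
have b2 : bnd M (w' - 1) by apply: bndW H2; apply: leq_maxr.
have [a b _ _] := sh_gl M ip gu.
have Ed' : Er p (sh M u * u').
  apply: (Er_inv_gl ip Ed); rewrite -mulrA (mulrA (sh M u')) b mul1r; exact: gl_r gu.
have -> : w * u * w' * u' = (w * (u * sh M u') * w') * (sh M u * u').
  rewrite !mulrA -(mulrA _ (sh M u') w') (sh_comm _ b2) !mulrA -(mulrA _ (sh M u')) b mulr1 //.
by apply: ErM => //; apply: Er_conj.
Qed.

(** Only [a] has its entries in the ideal. Conjugating [(1 + a * J') * (1 + a * b)] by [1 + J * b]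
    produces a far copy of [1 + b * a], up to the factor [1 + a * J']; the conjugations are absorbed
    by [whitehead], and [diagE] brings the far copy back. *)
Lemma vaserstein p a b c : idl p -> F p a -> F B b -> gl p (1 + a * b) c ->
  gl p (1 + b * a) (1 - b * c * a) /\ Er p ((1 + b * a) * c).
Proof.
move=> ip Fa Fb gu; set v := 1 + b * a; set v' := 1 - b * c * a; set u := 1 + a * b in gu.
have [uc cu Fu Fc] := gu.
have Fba : F p (b * a) by apply: FMr.
have abc : a * b * c = 1 - c by rewrite -uc /u; nc_ring tt.
have cab : c * a * b = 1 - c by rewrite -cu /u; nc_ring tt.
have gv : gl p v v'.
  split; rewrite /v /v'.
  - by nc_ring (tt, abc).
  - by nc_ring (tt, cab).
  - by rewrite addrC addKr.
  - rewrite addrC addKr -mulrN -mulrA; apply: FMr => //.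
    rewrite -(subrK 1 c) mulrDl mul1r; apply: FsD; last exact: FsN.
    by apply: FMr => //; [apply: F_B Fc|apply: FsN].
split=> //; have [N0 H0] := diagE ip gv.
have [N1 H1] := F_bnd ip Fa; have [N2 H2] := F_bnd idl_B Fb.
pose M := maxn N0 (maxn N1 N2).
have HM : Er p (v * sh M v') by apply/H0/leq_maxl.
have {}H1 : bnd M a by apply: bndW H1; rewrite !leq_max leqnn !orbT.
have {}H2 : bnd M b by apply: bndW H2; rewrite !leq_max leqnn !orbT.
pose J := X ^+ M; pose J' := Y ^+ M.
have JJ : J' * J = 1 by apply: mulYX_exp.
have [J'a aJ] := H1 _ (leqnn M); have [J'b bJ] := H2 _ (leqnn M).
rewrite -/J -/J' in J'a aJ J'b bJ.
have bN z : bnd M z -> bnd M (- z).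
  by move=> bz K MK; have [h1 h2] := bz _ MK; rewrite mulrN mulNr h1 h2 oppr0.
have Eg : El p (1 + a * J') by apply: El_upper.
have Eg' : El p (1 - a * J') by rewrite -mulNr; apply: El_upper => //; [apply: FsN|apply: bN].
have Eh : El B (1 + J * b) by apply: El_lower => //; apply: idl_B.
have Eh' : El B (1 - J * b).
  by rewrite -mulrN; apply: El_lower; [apply: idl_B|apply: FsN => //; apply: idl_B|apply: bN].
have gh : gl B (1 + J * b) (1 - J * b).
  by split; [nc_ring (tt, bJ)|nc_ring (tt, bJ)|apply: El_F => //; apply: idl_B|apply: El_F => //; apply: idl_B].
have gg : gl p (1 + a * J') (1 - a * J').
  by split; [nc_ring (tt, J'a)|nc_ring (tt, J'a)|apply: El_F|apply: El_F].
have es : sh M v = (1 + J * b) * ((1 + a * J') * u) * (1 - J * b) * (1 - a * J').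
  rewrite /sh /v /u -/J -/J'.
  by nc_ring (tt, JJ, J'a, aJ, J'b, bJ).
have W1 := whitehead ip gh (gl_mul ip gg gu).
have W2 := whitehead ip (gl_B ip gg) gu.
have gJ : (1 - a * J') * (1 + a * J') = 1 by apply: gl_l gg.
have E1 : Er p (sh M v * c).
  have -> : sh M v * c = ((1 + J * b) * ((1 + a * J') * u) * (1 - J * b) * (c * (1 - a * J'))) *
     ((1 + a * J') * u * (1 - a * J') * c).
    rewrite es; set g := 1 + a * J' in gJ *; set g' := 1 - a * J' in gJ *.
    set h := 1 + _; set h' := 1 - _.
    by nc_ring (tt, gJ, cu).
  exact: ErM.
have [_ s's _ _] := sh_gl M ip gv.
have -> : v * c = (v * sh M v') * (sh M v * c) by rewrite mulrA -(mulrA v) s's mulr1.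
exact: ErM.
Qed.
End StableK1.

(** * Finite free resolutions *)

Section Resolutions.
Variable B : comNzRingType.

Definition submod n (Z : 'rV[B]_n -> Prop) :=
  Z 0 /\ forall a u v, Z u -> Z v -> Z (a *: u + v).

Lemma submodD n (Z : 'rV[B]_n -> Prop) u v : submod Z -> Z u -> Z v -> Z (u + v).
Proof. by move=> [_ Zs] Zu Zv; rewrite -[u]scale1r; apply: Zs. Qed.
Lemma submodZ n (Z : 'rV[B]_n -> Prop) a u : submod Z -> Z u -> Z (a *: u).
Proof. by move=> [Z0 Zs] Zu; rewrite -[_ *: _]addr0; apply: Zs. Qed.
Lemma submodB n (Z : 'rV[B]_n -> Prop) u v : submod Z -> Z u -> Z v -> Z (u - v).
Proof. by move=> Zs Zu Zv; apply: submodD => //; rewrite -scaleN1r; apply: submodZ. Qed.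
Lemma submod_sum n (Z : 'rV[B]_n -> Prop) I (r : seq I) (P : pred I) F : submod Z ->
  (forall i, P i -> Z (F i)) -> Z (\sum_(i <- r | P i) F i).
Proof. by move=> Zs H; apply: big_ind => //; [case: Zs|move=> *; apply: submodD]. Qed.
Lemma submod_mul n (Z : 'rV[B]_n -> Prop) m (w : 'rV_m) (D : 'M_(m, n)) : submod Z ->
  (forall i, Z (row i D)) -> Z (w *m D).
Proof.
by move=> Zs H; rewrite mulmx_sum_row; apply: submod_sum => // i _; apply: submodZ.
Qed.
Lemma submod_preim m n (Z : 'rV[B]_n -> Prop) (D : 'M_(m, n)) : submod Z ->
  submod (fun w => Z (w *m D)).
Proof.
move=> [Z0 Zs]; split=> [|a u v Zu Zv]; first by rewrite mul0mx.
by rewrite mulmxDl -scalemxAl; apply: Zs.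
Qed.
Lemma submod_ker m n (D : 'M[B]_(m, n)) : submod (fun w => w *m D = 0).
Proof.
split=> [|a u v Zu Zv]; first by rewrite mul0mx.
by rewrite mulmxDl -scalemxAl Zu Zv scaler0 addr0.
Qed.
Lemma submod_im m n (Z : 'rV[B]_m -> Prop) (D : 'M_(m, n)) : submod Z ->
  submod (fun u => exists2 v, Z v & u = v *m D).
Proof.
move=> [Z0 Zs]; split=> [|a _ _ [u Zu ->] [v Zv ->]]; first by exists 0; rewrite ?mul0mx.
by exists (a *: u + v); rewrite ?mulmxDl ?scalemxAl //; apply: Zs.
Qed.
Lemma submodI m (Z Z' : 'rV[B]_m -> Prop) : submod Z -> submod Z' -> submod (fun v => Z v /\ Z' v).
Proof.
move=> [Z0 Zs] [Z0' Zs']; split=> // a u v [Zu Zu'] [Zv Zv'].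
by split; [apply: Zs|apply: Zs'].
Qed.

(* [ffr d Z]: the submodule [Z] has a free resolution of finite rank with at most [d] terms. *)
Fixpoint ffr (d : nat) n (Z : 'rV[B]_n -> Prop) : Prop :=
  if d is d'.+1 then exists m (D : 'M[B]_(m, n)),
      (forall v, Z v <-> exists w, v = w *m D) /\ ffr d' (fun w : 'rV_m => w *m D = 0)
  else forall v, Z v <-> v = 0.

Lemma ffr_iff d n (Z Z' : 'rV[B]_n -> Prop) : (forall v, Z v <-> Z' v) -> ffr d Z -> ffr d Z'.
Proof.
case: d => [|d] ZZ /= H; first by move=> v; rewrite -ZZ.
by have [m [D [HD K]]] := H; exists m, D; split=> // v; rewrite -ZZ.
Qed.

Lemma ffrS d n (Z : 'rV[B]_n -> Prop) : ffr d Z -> ffr d.+1 Z.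
Proof.
elim: d n Z => [|d IH] n Z H; last by have [m [D [HD K]]] := H; exists m, D; split=> //; apply: IH.
exists 0%N, 0; split=> [v|w]; last by rewrite [w]thinmx0 mul0mx.
by rewrite H; split=> [->|[w ->]]; rewrite ?mulmx0 //; exists 0; rewrite mul0mx.
Qed.
Lemma ffr_le d d' n (Z : 'rV[B]_n -> Prop) : (d <= d')%N -> ffr d Z -> ffr d' Z.
Proof. by move=> /subnK <-; elim: (d' - d)%N => // k IH /IH; apply: ffrS. Qed.

Lemma ffr_inj d m n (Z : 'rV[B]_m -> Prop) (phi : 'M_(m, n)) :
  (forall v : 'rV_m, v *m phi = 0 -> v = 0) -> ffr d Z ->
  ffr d (fun u => exists2 v, Z v & u = v *m phi).
Proof.
move=> inj; case: d => [|d] /= H.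
  move=> v; split=> [[u /H -> ->]|->]; first by rewrite mul0mx.
  by exists 0; rewrite ?mul0mx //; apply/H.
have [r [D [HD K]]] := H; exists r, (D *m phi); split=> [v|].
  split=> [[u /HD [w ->] ->]|[w ->]]; first by exists w; rewrite mulmxA.
  by exists (w *m D); rewrite ?mulmxA //; apply/HD; exists w.
by apply: ffr_iff K => w; rewrite mulmxA; split=> [->|/inj //]; rewrite mul0mx.
Qed.

(** Horseshoe lemma for the extension of the image of [Z] under [p] by the kernel of [p] on [Z].
    Generators of the image are lifted to [Z], and the kernel of the joint cover is again such an
    extension, with resolutions one step shorter. *)
Lemma ffr_ext d g h (Z : 'rV[B]_g -> Prop) (p : 'M_(g, h)) : submod Z ->
  ffr d (fun v => Z v /\ v *m p = 0) -> ffr d (fun u => exists2 v, Z v & u = v *m p) -> ffr d Z.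
Proof.
elim: d g h Z p => [|d IH] g h Z p Zs /= H1 H2.
  move=> v; split=> [Zv|->]; last by case: Zs.
  by apply/H1; split=> //; apply/H2; exists v.
have [m1 [D1 [HD1 K1]]] := H1; have [m2 [D2 [HD2 K2]]] := H2.
have HL i : exists v, Z v /\ row i D2 = v *m p.
  have [|v Zv e] := (HD2 (row i D2)).2; first by exists (delta_mx 0 i); rewrite rowE.
  by exists v.
have [f Hf] := choice HL; pose D2' := \matrix_i f i.
have ZD2 w : Z (w *m D2') by apply: submod_mul => // i; rewrite rowK; case: (Hf i).
have D2p : D2' *m p = D2 by apply/row_matrixP => i; rewrite row_mul rowK; case: (Hf i).
have ZD1 w : Z (w *m D1) by have [] := (HD1 (w *m D1)).2 (ex_intro _ w erefl).
have D1p : D1 *m p = 0.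
  apply/row_matrixP => i; rewrite row_mul row0 rowE.
  by have [] := (HD1 (delta_mx 0 i *m D1)).2 (ex_intro _ _ erefl).
exists (m1 + m2)%N, (col_mx D1 D2'); split=> [v|].
  split=> [Zv|[w ->]]; last first.
    by rewrite -[w]hsubmxK mul_row_col; apply: submodD.
  have [w2 e2] : exists w2, v *m p = w2 *m D2 by apply/HD2; exists v.
  have [w1 e1] : exists w1, v - w2 *m D2' = w1 *m D1.
    apply/HD1; split; first exact: submodB.
    by rewrite mulmxBl -mulmxA D2p e2 subrr.
  by exists (row_mx w1 w2); rewrite mul_row_col -e1 subrK.
pose p1 : 'M[B]_(m1 + m2, m2) := col_mx 0 1%:M.
apply: (IH _ m2 _ p1); first exact: submod_ker.
  pose f1 : 'M[B]_(m1, m1 + m2) := row_mx 1%:M 0.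
  have inj : forall v : 'rV_m1, v *m f1 = 0 -> v = 0.
    by move=> v; rewrite mul_mx_row mulmx1 mulmx0 -row_mx0 => /eq_row_mx [].
  apply: ffr_iff (ffr_inj inj K1) => w; split=> [[v v0 ->]|].
    by rewrite mul_mx_row mulmx1 mulmx0 !mul_row_col v0 !mul0mx !mulmx0 !addr0; split.
  rewrite -[w]hsubmxK !mul_row_col mulmx0 mulmx1 add0r => -[e e2].
  by exists (lsubmx w); rewrite ?mul_mx_row ?mulmx1 ?mulmx0 ?e2 //; move: e; rewrite e2 mul0mx addr0.
apply: ffr_iff K2 => w; split=> [w0|[v]].
  have [w1 e1] : exists w1, - (w *m D2') = w1 *m D1.
    apply/HD1; split; first by rewrite -scaleN1r; apply: submodZ.
    by rewrite mulNmx -mulmxA D2p w0 oppr0.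
  exists (row_mx w1 w); first by rewrite mul_row_col -e1 addNr.
  by rewrite mul_row_col mulmx0 mulmx1 add0r.
rewrite -[v]hsubmxK !mul_row_col mulmx0 mulmx1 add0r => e ->.
have := congr1 (mulmx^~ p) e.
by rewrite mulmxDl mul0mx -!mulmxA D1p D2p mulmx0 add0r.
Qed.

(** A cover [D] of [Z] also covers the image under [q]; its new relations form an extension of the
    kernel of [q] on [Z] by the old relations. *)
Lemma ffr_coker d g l (Z : 'rV[B]_g -> Prop) (q : 'M_(g, l)) : submod Z ->
  ffr d Z -> ffr d (fun v => Z v /\ v *m q = 0) -> ffr d.+1 (fun u => exists2 v, Z v & u = v *m q).
Proof.
case: d => [|d] Zs H1 H2.
  apply: ffrS => v; split=> [[u /H1 -> ->]|->]; first by rewrite mul0mx.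
  by exists 0; rewrite ?mul0mx //; apply/H1.
have [m [D [HD K]]] := H1; exists m, (D *m q); split=> [v|].
  split=> [[u /HD [w ->] ->]|[w ->]]; first by exists w; rewrite mulmxA.
  by exists (w *m D); rewrite ?mulmxA //; apply/HD; exists w.
apply: (ffr_ext (p := D)); first exact: submod_ker.
  apply: ffrS; apply: ffr_iff K => w; split=> [w0|[]//].
  by rewrite mulmxA w0 mul0mx.
apply: ffr_iff H2 => v; split=> [[/HD [w ->] e]|[w e ->]]; first by exists w; rewrite ?mulmxA.
by split; [apply/HD; exists w|rewrite -mulmxA].
Qed.

(** This contains the noetherian property. That the resolutions are free, not just projective, is
    what trivialises idempotent matrices later on. *)
Definition regular := forall n (Z : 'rV[B]_n -> Prop), submod Z -> exists d, ffr d Z.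

(** Induction on the rank: the first coordinate of a submodule ranges over an ideal, and the kernel
    of this projection has one rank less. *)
Lemma regular_ideals : (forall Z : 'rV[B]_1 -> Prop, submod Z -> exists d, ffr d Z) -> regular.
Proof.
move=> H; elim=> [|n IH] Z Zs.
  by exists 0%N => v; rewrite [v]thinmx0; split=> // _; case: Zs.
rewrite -[n.+1]/(1 + n)%N in Z Zs *.
pose p : 'M[B]_(1 + n, 1) := col_mx 1%:M 0.
have [d1 H1] := H _ (submod_im p Zs).
pose f : 'M[B]_(n, 1 + n) := row_mx 0 1%:M.
have [d2 H2] := IH _ (submod_preim f Zs).
have inj : forall v : 'rV_n, v *m f = 0 -> v = 0.
  by move=> v; rewrite mul_mx_row mulmx1 mulmx0 -row_mx0 => /eq_row_mx [].
exists (maxn d1 d2); apply: (ffr_ext (p := p)) => //.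
  apply: ffr_le (leq_maxr d1 d2) _; apply: ffr_iff (ffr_inj inj H2) => w; split.
    by move=> [v Zv ->]; split=> //; rewrite mul_mx_row mulmx1 mulmx0 mul_row_col mul0mx mulmx0 addr0.
  rewrite -{2}[w]hsubmxK mul_row_col mulmx1 mulmx0 addr0 => -[Zw w0].
  have e : w = rsubmx w *m f by rewrite mul_mx_row mulmx1 mulmx0 -w0 hsubmxK.
  by exists (rsubmx w); rewrite -?e.
exact: ffr_le (leq_maxl d1 d2) _.
Qed.

Lemma regular_field : (forall a : B, a != 0 -> exists b, a * b = 1) -> regular.
Proof.
move=> fB; apply: regular_ideals => Z Zs.
have [[v [Zv v0]]|nZ] := EM (exists v, Z v /\ v != 0); last first.
  exists 0%N => v; split=> [Zv|->]; last by case: Zs.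
  by apply/eqP/negPn/negP => v0; apply: nZ; exists v.
have v00 : v 0 0 != 0 by apply: contraNneq v0 => e; apply/eqP/matrixP => i j; rewrite !ord1 mxE.
have [b vb] := fB _ v00.
have Z1 : Z 1%:M.
  have -> : 1%:M = b *: v by apply/matrixP => i j; rewrite !ord1 !mxE mulrC vb.
  exact: submodZ.
exists 1%N, 1%N, 1%:M; split=> [u|w]; last by rewrite mulmx1.
split=> [_|[w ->]]; first by exists u; rewrite mulmx1.
have -> : w *m 1%:M = w 0 0 *: 1%:M by apply/matrixP => i j; rewrite !ord1 mulmx1 !mxE mulr1.
exact: submodZ.
Qed.
End Resolutions.

(** * Regularity passes to Laurent extensions *)

Section Laurent.
Variables (B L : comNzRingType) (io : {rmorphism B -> L}) (t t' : L).
Hypothesis (tt' : t * t' = 1).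
Hypothesis decL : forall a : L, exists k (p : {poly B}), a = t' ^+ k * (map_poly io p).[t].
Hypothesis indL : forall p : {poly B}, (map_poly io p).[t] = 0 -> p = 0.

Local Notation ev p := ((map_poly io p).[t]).
Local Notation mx A := (map_mx io A).

Let tk k : t ^+ k * t' ^+ k = 1. Proof. by rewrite -exprMn tt' expr1n. Qed.
Let t'k k : t' ^+ k * t ^+ k = 1. Proof. by rewrite mulrC. Qed.

Definition sumt m n r (y : nat -> 'M[B]_(m, n)) : 'M[L]_(m, n) := \sum_(i < r) t ^+ i *: mx (y i).

Lemma sumt_entry m n r (y : nat -> 'M[B]_(m, n)) i j :
  sumt r y i j = ev (\poly_(k < r) y k i j).
Proof.
rewrite /sumt summxE.
have -> : map_poly io (\poly_(k < r) y k i j) = \poly_(k < r) io (y k i j).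
  by apply/polyP => k; rewrite coef_map !coef_poly; case: ifP => // _; rewrite raddf0.
by rewrite horner_poly; apply: eq_bigr => k _; rewrite !mxE mulrC.
Qed.

Lemma sumt_inj m n r (y : nat -> 'M[B]_(m, n)) : sumt r y = 0 -> forall i, (i < r)%N -> y i = 0.
Proof.
move=> H k kr; apply/matrixP => i j; rewrite mxE.
have /indL e : ev (\poly_(k < r) y k i j) = 0 by rewrite -sumt_entry H mxE.
by have := congr1 (fun p : {poly B} => p`_k) e; rewrite coef_poly kr coef0.
Qed.

Lemma ev_sum (p : {poly B}) r : (size p <= r)%N -> ev p = \sum_(i < r) t ^+ i * io p`_i.
Proof.
move=> pr; rewrite (@horner_coef_wide _ r); last exact: leq_trans (size_poly _ _) pr.
by apply: eq_bigr => i _; rewrite coef_map mulrC.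
Qed.

Lemma dec_unif (a : L) : exists k r, forall k', (k <= k')%N -> exists p : {poly B},
  (size p <= r + k')%N /\ a = t' ^+ k' * ev p.
Proof.
have [k [p ->]] := decL a; exists k, (size p) => k' kk'.
exists (p * 'X^(k' - k)); split.
  by apply: leq_trans (size_polyMleq _ _) _; rewrite size_polyXn addnS /= leq_add2l leq_subr.
rewrite rmorphM /= map_polyXn hornerM hornerXn -{1}(subnKC kk') exprD.
by rewrite -mulrA; congr (_ * _); rewrite mulrCA t'k mulr1.
Qed.

Lemma mx_dec m n (M : 'M[L]_(m, n)) : exists k r (y : nat -> 'M[B]_(m, n)), M = t' ^+ k *: sumt r y.
Proof.
have H (ij : 'I_m * 'I_n) : exists kr, forall k', (kr.1 <= k')%N -> exists p : {poly B},
    (size p <= kr.2 + k')%N /\ M ij.1 ij.2 = t' ^+ k' * ev p.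
  by have [k [r H]] := dec_unif (M ij.1 ij.2); exists (k, r).
have [f Hf] := choice H.
pose k := (\max_ij (f ij).1)%N; pose r := (\max_ij (f ij).2)%N.
have H' ij : exists p : {poly B}, (size p <= r + k)%N /\ M ij.1 ij.2 = t' ^+ k * ev p.
  have [|p [p1 p2]] := Hf ij k; first by rewrite /k (leq_bigmax (F := fun ij => (f ij).1)).
  exists p; split=> //; apply: leq_trans p1 _; rewrite leq_add2r /r.
  by rewrite (leq_bigmax (F := fun ij => (f ij).2)).
have [g Hg] := choice H'.
exists k, (r + k)%N, (fun l => \matrix_(i, j) (g (i, j))`_l).
apply/matrixP => i j; rewrite mxE summxE.
have [/= e ->] := Hg (i, j); congr (_ * _); rewrite (ev_sum e).
by apply: eq_bigr => l _; rewrite !mxE.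
Qed.

Definition Lspan n (Z : 'rV[B]_n -> Prop) (w : 'rV[L]_n) : Prop :=
  exists k r (y : nat -> 'rV[B]_n), (forall i, Z (y i)) /\ w = t' ^+ k *: sumt r y.

Lemma sumt_mul m n l r (y : nat -> 'M[B]_(m, n)) (D : 'M[B]_(n, l)) :
  sumt r y *m mx D = sumt r (fun i => y i *m D).
Proof.
by rewrite /sumt mulmx_suml; apply: eq_bigr => i _; rewrite -scalemxAl map_mxM.
Qed.

Lemma scale_t'_inj m n k (M : 'M[L]_(m, n)) : t' ^+ k *: M = 0 -> M = 0.
Proof. by move=> /(congr1 (fun N => t ^+ k *: N)); rewrite scalerA tk scale1r scaler0. Qed.

Lemma Lspan_cover m n (Z : 'rV[B]_n -> Prop) (D : 'M[B]_(m, n)) :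
  (forall v, Z v <-> exists w, v = w *m D) -> forall w, Lspan Z w <-> exists c, w = c *m mx D.
Proof.
move=> HD w; split=> [[k [r [y [Zy ->]]]]|[c ->]].
  have [f Hf] := choice (fun i => (HD (y i)).1 (Zy i)).
  exists (t' ^+ k *: sumt r f); rewrite -scalemxAl sumt_mul; congr (_ *: _).
  by apply: eq_bigr => i _; rewrite (Hf i).
have [k [r [y ->]]] := mx_dec c; exists k, r, (fun i => y i *m D); split=> [i|].
  by apply/HD; exists (y i).
by rewrite -scalemxAl sumt_mul.
Qed.

(** Flatness of [L] over [B], obtained by comparing the coefficients of the powers of [t]. *)
Lemma Lspan_ker m n (D : 'M[B]_(m, n)) (w : 'rV[L]_m) :
  w *m mx D = 0 <-> Lspan (fun v => v *m D = 0) w.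
Proof.
split=> [|[k [r [y [Zy ->]]]]]; last first.
  by rewrite -scalemxAl sumt_mul /sumt big1 ?scaler0 // => i _; rewrite Zy raddf0 scaler0.
have [k [r [y ->]]] := mx_dec w; rewrite -scalemxAl sumt_mul => /scale_t'_inj /sumt_inj H.
exists k, r, (fun i => if (i < r)%N then y i else 0); split=> [i|].
  by case: ifP => [/H //|_]; rewrite mul0mx.
by congr (_ *: _); apply: eq_bigr => i _; rewrite ltn_ord.
Qed.

Lemma ffr_base d n (Z : 'rV[B]_n -> Prop) : ffr d Z -> ffr d (Lspan Z).
Proof.
elim: d n Z => [|d IH] n Z H.
  move=> v; split=> [[k [r [y [Zy ->]]]]|->].
    by rewrite /sumt big1 ?scaler0 // => i _; rewrite ((H _).1 (Zy i)) raddf0 scaler0.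
  exists 0%N, 0%N, (fun _ => 0); split=> [i|]; first exact/H.
  by rewrite /sumt big_ord0 scaler0.
have [m [D [HD K]]] := H; exists m, (mx D); split; first exact: Lspan_cover.
by apply: ffr_iff (IH _ _ K) => w; rewrite Lspan_ker.
Qed.

Lemma evB p q : ev (p - q) = ev p - ev q.
Proof. by rewrite rmorphB hornerD hornerN. Qed.
Lemma evM p q : ev (p * q) = ev p * ev q.
Proof. by rewrite rmorphM hornerM. Qed.
Lemma evXn k : ev 'X^k = t ^+ k.
Proof. by rewrite map_polyXn hornerXn. Qed.

Section RegularStep.
Variable I : L -> Prop.
Hypotheses (I0 : I 0) (IL : forall c a b, I a -> I b -> I (c * a + b)).

Let ID a b : I a -> I b -> I (a + b). Proof. by rewrite -{2}[a]mul1r; apply: IL. Qed.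
Let IM c a : I a -> I (c * a). Proof. by move=> Ia; rewrite -[_ * _]addr0; apply: IL. Qed.

Definition polyI r (v : 'rV[B]_r) := I (ev (rVpoly v)).

Lemma polyI_submod r : submod (@polyI r).
Proof.
split=> [|a u v Iu Iv]; first by rewrite /polyI linear0 rmorph0 horner0.
by rewrite /polyI linearP /= rmorphD hornerD -mul_polyC evM; apply: IL.
Qed.

Hypothesis regB : regular B.

(** Hilbert's basis argument. The leading coefficients of polynomials in the ideal form a finitely
    generated ideal of [B], and [d] bounds the degrees of polynomials that realise its generators.
    Dividing by these expresses every element through members of degree at most [d], multiplied by
    powers of [t]. *)
Lemma lead_reduction : exists d, forall p, I (ev p) ->
  exists (y : nat -> 'rV[B]_d.+1) r, (forall i, polyI (y i)) /\
    ev p = \sum_(i < r) t ^+ i * ev (rVpoly (y i)).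
Proof.
(* [e] is a formal degree: the coefficient at [e] may vanish, so that 0 belongs to the set and sums
   need no case distinction. *)
pose LC (b : 'rV[B]_1) := exists e p, [/\ I (ev p), (size p <= e.+1)%N & p`_e = b 0 0].
have LCs : submod LC.
  split; first by exists 0%N, 0; rewrite rmorph0 horner0 size_poly0 coef0 mxE.
  move=> a u v [e [p [Ip sp pe]]] [f [q [Iq sq qf]]].
  exists (e + f)%N, (a%:P * (p * 'X^f) + q * 'X^e); split.
  - rewrite rmorphD hornerD !evM !evXn; apply: ID; first by apply: IM; rewrite mulrC; apply: IM.
    by rewrite mulrC; apply: IM.
  - rewrite (leq_trans (size_polyD _ _)) // geq_max; apply/andP; split.
      rewrite mul_polyC (leq_trans (size_scale_leq _ _)) // (leq_trans (size_polyMleq _ _)) //.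
      by rewrite size_polyXn addnS /= -addSn leq_add2r.
    rewrite (leq_trans (size_polyMleq _ _)) //.
    by rewrite size_polyXn addnS /= addnC -addnS leq_add2l.
  - rewrite coefD coefCM !coefMXn addnK addKn !ltnNge leq_addl leq_addr /= pe qf.
    by rewrite !mxE.
(* [ffrS] ensures at least one term in the resolution, hence a matrix [D] of generators. *)
have [c0 /ffrS [m [D [HD _]]]] := regB LCs.
have H i : exists ep : nat * {poly B}, [/\ I (ev ep.2), (size ep.2 <= ep.1.+1)%N & ep.2`_ep.1 = D i 0].
  have [e [p [h1 h2 h3]]] : LC (row i D) by apply/HD; exists (delta_mx 0 i); rewrite rowE.
  by exists (e, p); split=> //=; rewrite h3 mxE.
have [f Hf] := choice H.
pose d := (\max_i (f i).1)%N; exists d.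
pose q i := (f i).2 * 'X^(d - (f i).1).
have dl i : ((f i).1 <= d)%N by rewrite /d (leq_bigmax (F := fun i => (f i).1)).
have Iq i : I (ev (q i)) by rewrite evM mulrC; apply: IM; case: (Hf i).
have sq i : (size (q i) <= d.+1)%N.
  rewrite (leq_trans (size_polyMleq _ _)) // size_polyXn addnS /=.
  by rewrite -{2}(subnKC (dl i)) -addSn leq_add2r; case: (Hf i).
have cq i : (q i)`_d = D i 0.
  by rewrite coefMXn ltnNge leq_subr /= subKn //; case: (Hf i).
move=> p Ip.
have [r] := ubnP (size p); elim: r p Ip => // r IH p Ip sp.
have [sd|ds] := leqP (size p) d.+1.
  exists (fun i => if i is 0%N then poly_rV p else 0 : 'rV[B]_d.+1), 1%N; split.
    case=> [|i]; rewrite /polyI ?poly_rV_K //.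
    by case: (polyI_submod d.+1).
  by rewrite big_ord1 expr0 mul1r poly_rV_K.
pose e := (size p).-1.
have se : size p = e.+1 by rewrite /e prednK // (leq_trans _ ds).
have de : (d < e)%N by rewrite -ltnS -se.
have [w Hw] : exists w, (p`_e)%:M = w *m D.
  by apply/HD; exists e, p; rewrite se leqnn mxE eqxx mulr1n; split.
pose g := \sum_i (w 0 i)%:P * q i.
have sg : (size g <= d.+1)%N.
  apply: (leq_trans (size_sum _ _ _)); apply/bigmax_leqP => i _.
  by rewrite mul_polyC (leq_trans (size_scale_leq _ _)).
have Ig : I (ev g).
  rewrite /g rmorph_sum horner_sum; apply: big_ind => // i _.
  by rewrite evM; apply: IM.
have cg : g`_d = p`_e.
  have := congr1 (fun M : 'M_1 => M 0 0) Hw; rewrite !mxE eqxx mulr1n => ->.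
  by rewrite /g coef_sum; apply: eq_bigr => i _; rewrite coefCM cq.
pose p1 := p - g * 'X^(e - d).
have Ip1 : I (ev p1).
  rewrite evB addrC -mulN1r; apply: IL => //; rewrite evM mulrC; exact: IM.
have sp1 : (size p1 < r)%N.
  apply: (@leq_ltn_trans e); last by move: sp; rewrite se ltnS.
  apply/leq_sizeP => j; rewrite leq_eqVlt coefB coefMXn => /orP[/eqP <-|ej].
    by rewrite ltnNge leq_subr /= subKn ?(ltnW de) // cg subrr.
  rewrite nth_default ?se // ltnNge (leq_trans (leq_subr d e) (ltnW ej)) /= sub0r.
  rewrite nth_default ?oppr0 //; apply: leq_trans sg _.
  have aux (d1 e1 j1 : nat) : (d1 < e1)%N -> (e1 < j1)%N -> (d1 < j1 - (e1 - d1))%N by lia.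
  exact: aux.
have [y [r1 [Hy e1]]] := IH _ Ip1 sp1.
pose k := (e - d)%N.
exists (fun i => (if (i < r1)%N then y i else 0) + (if i == k then poly_rV g else 0 : 'rV[B]_d.+1)), (r1 + k).+1; split=> [i|].
  apply: submodD; first exact: polyI_submod.
    by case: ifP => // _; case: (polyI_submod d.+1).
  by case: ifP => [_|_]; [rewrite /polyI poly_rV_K|case: (polyI_submod d.+1)].
have -> : p = p1 + g * 'X^k by rewrite subrK.
rewrite rmorphD hornerD evM evXn e1.
under [RHS]eq_bigr => i _ do rewrite linearD rmorphD hornerD mulrDr.
rewrite big_split /=; congr (_ + _).
  rewrite -addnS big_split_ord /= [X in _ = _ + X]big1 ?addr0 => [|i _]; last first.
    by rewrite ltnNge leq_addr /= linear0 rmorph0 horner0 mulr0.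
  by apply: eq_bigr => i _; rewrite ltn_ord.
have kr : (k < (r1 + k).+1)%N by rewrite ltnS leq_addl.
rewrite (bigD1 (Ordinal kr)) //= eqxx big1 ?addr0 => [|i ik]; last first.
  by rewrite -[k]/(nat_of_ord (Ordinal kr)) (inj_eq val_inj) (negPf ik) linear0 rmorph0 horner0 mulr0.
by rewrite poly_rV_K // mulrC.
Qed.

(** Let [Y] and [X] be the [B]-modules of polynomials in the ideal of degree at most [d] and below
    [d]. After extension of scalars they fit into an exact sequence 0 -> X -> Y -> I -> 0, whose
    first map [phi] sends f to t (x) f - 1 (x) tf and whose second map is evaluation. Both modules
    inherit resolutions from [B], and [ffr_coker] gives one for [I]. *)
Lemma ideal_ffr : exists d, ffr d (fun v : 'rV[L]_1 => I (v 0 0)).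
Proof.
have [d Hd] := lead_reduction.
pose Y : 'rV[B]_d.+1 -> Prop := @polyI d.+1; pose X : 'rV[B]_d -> Prop := @polyI d.
have [d1 H1] := regB (polyI_submod d.+1); have [d2 H2] := regB (polyI_submod d).
pose q : 'M[L]_(d.+1, 1) := \matrix_(i, j) t ^+ i.
have mxq (v : 'rV[B]_d.+1) : (mx v *m q) 0 0 = ev (rVpoly v).
  rewrite mxE (@ev_sum _ d.+1) ?size_poly //; apply: eq_bigr => i _.
  by rewrite !mxE coef_rVpoly_ord mulrC.
pose pad0 : 'M[B]_(d, d.+1) := \matrix_(i, j) ((i : nat) == j)%:R.
pose pad1 : 'M[B]_(d, d.+1) := \matrix_(i, j) (i.+1 == j)%:R.
have pad0E (v : 'rV[B]_d) : rVpoly (v *m pad0) = rVpoly v.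
  apply/polyP => j; rewrite [RHS]coef_rVpoly; case: (ltnP j d.+1) => jd; last first.
    rewrite nth_default; last by apply: leq_trans (size_poly _ _) jd.
    by case: insubP => // i; rewrite ltnNge (ltnW jd).
  rewrite -[j]/(nat_of_ord (Ordinal jd)) coef_rVpoly_ord mxE /=.
  case: insubP => [i jd' ij|]; last first.
    rewrite -leqNgt => dj; rewrite big1 // => i _; rewrite mxE /=.
    by rewrite (ltn_eqF (leq_trans (ltn_ord i) dj)) mulr0.
  rewrite (bigD1 i) //= mxE ij eqxx mulr1 big1 ?addr0 // => k ki; rewrite mxE /= -ij.
  by rewrite (inj_eq val_inj) (negPf ki) mulr0.
have pad1E (v : 'rV[B]_d) : rVpoly (v *m pad1) = 'X * rVpoly v.
  apply/polyP => j; rewrite mulrC coefMX; case: (ltnP j d.+1) => jd; last first.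
    rewrite nth_default; last by apply: leq_trans (size_poly _ _) jd.
    rewrite nth_default ?if_same //; apply: leq_trans (size_poly _ _) _.
    by rewrite -ltnS (leq_trans jd) // leqSpred.
  rewrite -[j in LHS]/(nat_of_ord (Ordinal jd)) coef_rVpoly_ord mxE /=.
  case: j jd => [|j] jd /=.
    by rewrite big1 // => i _; rewrite mxE mulr0.
  have jd' : (j < d)%N by [].
  rewrite -[j in RHS]/(nat_of_ord (Ordinal jd')) coef_rVpoly_ord (bigD1 (Ordinal jd')) //= mxE eqxx mulr1.
  rewrite big1 ?addr0 // => k ki; rewrite mxE eqSS.
  by rewrite -[j]/(nat_of_ord (Ordinal jd')) (inj_eq val_inj) (negPf ki) mulr0.
pose phi : 'M[L]_(d, d.+1) := t *: mx pad0 - mx pad1.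
have inj : forall v : 'rV_d, v *m phi = 0 -> v = 0.
  move=> v v0.
  suff H k (kd : (k < d)%N) : v 0 (Ordinal kd) = 0.
    by apply/rowP => -[k kd]; rewrite H mxE.
  have E (j : 'I_d.+1) : t * (\sum_i v 0 i * (nat_of_ord i == j)%:R) = \sum_i v 0 i * (i.+1 == j)%:R.
    have := congr1 (fun M : 'rV_d.+1 => M 0 j) v0; rewrite !mxE => /eqP.
    under eq_bigr => i _ do rewrite !mxE !rmorph_nat mulrBr.
    rewrite sumrB subr_eq0 => /eqP <-; rewrite mulr_sumr; apply: eq_bigr => i _.
    by rewrite mulrCA.
  elim: k kd => [|k IH] kd.
    have := E (inord 0); rewrite inordK // [X in _ = X]big1 => [|i _]; last by rewrite mulr0.
    rewrite (bigD1 (Ordinal kd)) //= mulr1 big1 => [|i i0]; last first.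
      by rewrite -[0%N]/(nat_of_ord (Ordinal kd)) (inj_eq val_inj) (negPf i0) mulr0.
    by rewrite addr0 => /(congr1 (fun z => t' * z)); rewrite mulrA (mulrC t') tt' mul1r mulr0.
  have kd' : (k < d)%N by apply: ltnW.
  have := E (inord k.+1); rewrite inordK ?ltnS ?(ltnW kd) //.
  rewrite (bigD1 (Ordinal kd)) //= eqxx mulr1 big1 => [|i i0]; last first.
    by rewrite -[k.+1]/(nat_of_ord (Ordinal kd)) (inj_eq val_inj) (negPf i0) mulr0.
  rewrite (bigD1 (Ordinal kd')) //= eqxx mulr1 big1 => [|i i0]; last first.
    by rewrite eqSS -[k]/(nat_of_ord (Ordinal kd')) (inj_eq val_inj) (negPf i0) mulr0.
  rewrite IH !addr0 => /(congr1 (fun z => t' * z)); by rewrite mulrA (mulrC t') tt' mul1r mulr0.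
have Xpad0 v : X v -> Y (v *m pad0) by rewrite /X /Y /polyI pad0E.
have Xpad1 v : X v -> Y (v *m pad1).
  by rewrite /X /Y /polyI pad1E evM => ?; apply: IM.
have Ylast (v : 'rV[B]_d.+1) : Y v -> v 0 ord_max = 0 -> exists2 u, X u & v = u *m pad0.
  move=> Yv v0; have sv : (size (rVpoly v) <= d)%N.
    apply/leq_sizeP => j; rewrite leq_eqVlt => /orP[/eqP <-|dj].
      by rewrite -[d]/(nat_of_ord (@ord_max d)) coef_rVpoly_ord.
    by rewrite nth_default //; apply: leq_trans (size_poly _ _) dj.
  have e : rVpoly (poly_rV (rVpoly v) *m pad0) = rVpoly v by rewrite pad0E poly_rV_K.
  exists (poly_rV (rVpoly v)); first by rewrite /X /polyI poly_rV_K.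
  by apply: (can_inj rVpolyK); rewrite e.
have qphi (u : 'rV[B]_d) : mx u *m phi *m q = 0.
  apply/matrixP => i j; rewrite !ord1 mulmxBr -scalemxAr -!map_mxM mulmxBl -scalemxAl !mxE.
  have e1 := mxq (u *m pad0); have e2 := mxq (u *m pad1); rewrite !mxE in e1 e2; rewrite e1 e2.
  by rewrite pad0E pad1E evM -['X]expr1 evXn expr1 subrr.
have Lphi w : Lspan X w -> Lspan Y (w *m phi) /\ w *m phi *m q = 0.
  move=> [k [r [y [Xy ->]]]]; split; last first.
    rewrite -!scalemxAl /sumt !mulmx_suml big1 ?scaler0 // => i _.
    by rewrite -!scalemxAl qphi scaler0.
  exists k, r.+1, (fun i => (if (0 < i)%N then y i.-1 *m pad0 else 0) - (if (i < r)%N then y i *m pad1 else 0)).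
  have Y0 : Y 0 by case: (polyI_submod d.+1).
  split=> [i|]; first by apply: submodB; [exact: polyI_submod|case: ifP => // _; exact: Xpad0|case: ifP => // _; exact: Xpad1].
  rewrite -scalemxAl; congr (_ *: _); rewrite /sumt mulmx_suml.
  under [RHS]eq_bigr => i _ do rewrite raddfB scalerBr.
  rewrite sumrB big_ord_recl /= raddf0 scaler0 add0r.
  rewrite [X in _ = _ - X]big_ord_recr /= ltnn raddf0 scaler0 addr0 -sumrB.
  apply: eq_bigr => i _; rewrite ltn_ord /bump /= add1n -scalemxAl mulmxBr -scalemxAr -!map_mxM scalerBr.
  by rewrite scalerA exprSr.
have kerP w : Lspan Y w /\ w *m q = 0 <-> exists2 v, Lspan X v & w = v *m phi.
  split=> [[[k [r [y [Yy ->]]]]]|[v Xv ->]]; last exact: Lphi.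
  rewrite -scalemxAl => /scale_t'_inj e.
  suff [v Xv ->] : exists2 v, Lspan X v & sumt r y = v *m phi.
    have [k' [r' [y' [Xy' ->]]]] := Xv; exists (t' ^+ k *: (t' ^+ k' *: sumt r' y')); last by rewrite !scalemxAl.
    by exists (k + k')%N, r', y'; rewrite scalerA -exprD.
  have LX0 : Lspan X 0.
    exists 0%N, 0%N, (fun _ => 0); split; first by move=> _; case: (polyI_submod d).
    by rewrite /sumt big_ord0 scaler0.
  elim: r y Yy e => [|r IH] y Yy e; first by exists 0; rewrite // mul0mx /sumt big_ord0.
  case: r IH e => [|r] IH e.
    rewrite /sumt big_ord1 scale1r in e *; exists 0 => //.
    have := congr1 (fun M : 'M_1 => M 0 0) e; rewrite mxq mxE => /indL.
    by move/(congr1 (@poly_rV _ d.+1)); rewrite rVpolyK linear0 => ->; rewrite raddf0 mul0mx.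
  (* The coefficient in degree [d + r.+1] comes from the top summand alone, so its last coordinate
     vanishes. The top summand then comes from [X], and subtracting an image of [phi] pushes it into
     the summand below. *)
  have ytop : y r.+1 0 ord_max = 0.
    pose p := \sum_(i < r.+2) 'X^i * rVpoly (y i).
    have /indL p0 : ev p = 0.
      have := congr1 (fun M : 'M_1 => M 0 0) e; rewrite [RHS]mxE => <-.
      rewrite /sumt mulmx_suml summxE rmorph_sum horner_sum; apply: eq_bigr => i _.
      by rewrite evM evXn -scalemxAl mxE mxq.
    have := congr1 (fun p : {poly B} => p`_(d + r.+1)) p0; rewrite /p coef_sum coef0 big_ord_recr /= big1 ?add0r.
      by rewrite mulrC coefMXn ltnNge leq_addl /= addnK -[d]/(nat_of_ord (@ord_max d)) coef_rVpoly_ord.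
    move=> i _; rewrite mulrC coefMXn; case: ifP => // _.
    rewrite nth_default //; apply: leq_trans (size_poly _ _) _.
    by rewrite -ltnS -subSn ?leq_subRL; have := ltn_ord i; lia.
  have [u Xu yu] := Ylast _ (Yy r.+1) ytop.
  pose y' i := if i == r then y r + u *m pad1 else y i.
  have Yy' i : Y (y' i).
    rewrite /y'; case: eqP => // _; apply: submodD; [exact: polyI_submod|exact: Yy|exact: Xpad1].
  have es : sumt r.+2 y = sumt r.+1 y' + t ^+ r *: (mx u *m phi).
    rewrite /sumt big_ord_recr /= yu [in RHS]big_ord_recr /= [in LHS]big_ord_recr /= -!addrA; congr (_ + _).
      by apply: eq_bigr => i _; rewrite /y' (ltn_eqF (ltn_ord i)).
    rewrite /y' eqxx raddfD scalerDr -addrA; congr (_ + _).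
    by rewrite mulmxBr -scalemxAr -!map_mxM scalerBr scalerA -exprSr addrC subrK.
  have [|v Xv ev'] := IH y' Yy'.
    by move: e; rewrite es mulmxDl -scalemxAl qphi scaler0 addr0.
  have [k' [r' [y2 [Xy2 e2]]]] := Xv.
  exists (v + t ^+ r *: mx u); last by rewrite es ev' mulmxDl scalemxAl.
  pose y3 i := (if (i < r')%N then y2 i else 0) + (if i == (k' + r)%N then u else 0).
  have X0 : X 0 by case: (polyI_submod d).
  exists k', (r' + (k' + r).+1)%N, y3; split=> [i|].
    by apply: submodD; [exact: polyI_submod|case: ifP|case: ifP].
  rewrite /sumt; under [in RHS]eq_bigr => i _ do rewrite raddfD scalerDr.
  rewrite big_split /= scalerDr e2; congr (_ + _).
    congr (_ *: _); rewrite /sumt big_split_ord /= [X in _ + X]big1 ?addr0 => [|i _]; last first.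
      by rewrite ltnNge leq_addr /= raddf0 scaler0.
    by apply: eq_bigr => i _; rewrite ltn_ord.
  have kr : (k' + r < r' + (k' + r).+1)%N by rewrite addnS ltnS leq_addl.
  rewrite (bigD1 (Ordinal kr)) //= eqxx big1 ?addr0 => [|i ik]; last first.
    by rewrite -[(k' + r)%N]/(nat_of_ord (Ordinal kr)) (inj_eq val_inj) (negPf ik) raddf0 scaler0.
  by rewrite scalerA exprD mulrA t'k mul1r.
have LYs : submod (Lspan Y).
  have [m [D [HD _]]] := ffrS H1; have HL := Lspan_cover HD.
  split=> [|a u v /HL [cu ->] /HL [cv ->]]; first by apply/HL; exists 0; rewrite mul0mx.
  by apply/HL; exists (a *: cu + cv); rewrite mulmxDl scalemxAl.
exists (maxn d1 d2).+1.
have F1 := ffr_le (leq_maxl d1 d2) (ffr_base H1).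
have F2 : ffr (maxn d1 d2) (fun v => Lspan Y v /\ v *m q = 0).
  apply: ffr_iff (ffr_inj inj (ffr_le (leq_maxr d1 d2) (ffr_base H2))) => w.
  by rewrite kerP.
apply: ffr_iff (ffr_coker LYs F1 F2) => v; split=> [[u [k [r [y [Yy ->]]]] ->]|Iv].
  rewrite -scalemxAl /sumt mulmx_suml mxE summxE; apply: IM; apply: big_ind => // i _.
  by rewrite -scalemxAl mxE mxq; apply: IM; apply: Yy.
have [k [p ep]] := decL (v 0 0).
have [|y [r [Yy e]]] := Hd p.
  have -> : ev p = t ^+ k * v 0 0 by rewrite ep mulrA tk mul1r.
  exact: IM.
exists (t' ^+ k *: sumt r y); first by exists k, r, y.
apply/matrixP => i j; rewrite !ord1 ep -scalemxAl mxE; congr (_ * _).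
rewrite e /sumt mulmx_suml summxE; apply: eq_bigr => l _.
by rewrite -scalemxAl [RHS]mxE mxq.
Qed.
End RegularStep.

Lemma regular_Laurent : regular B -> regular L.
Proof.
move=> regB; apply: regular_ideals => Z [Z0 Zs].
pose I (a : L) := Z (a%:M).
have I0 : I 0 by rewrite /I raddf0.
have IL c a b : I a -> I b -> I (c * a + b).
  by move=> Ia Ib; rewrite /I raddfD /= -scale_scalar_mx; apply: Zs.
have [d H] := ideal_ffr I0 IL regB; exists d; apply: ffr_iff H => v.
by rewrite /I; have <- : v = (v 0 0)%:M by apply/matrixP => i j; rewrite !ord1 !mxE mulr1n.
Qed.
End Laurent.

(** * Matrices over Laurent extensions *)

(* Matrices trivial in [K_1] modulo the units in [U]; by Vaserstein's lemma the swap
   [1 + XY -> 1 + YX] subsumes transvections, stabilisation and conjugation. *)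
Inductive triv (L : comNzRingType) (U : L -> Prop) : forall n, 'M[L]_n -> Prop :=
| triv1 n : triv U (1%:M : 'M[L]_n)
| triv_unit u : U u -> triv U (u%:M : 'M[L]_1)
| triv_mul n (A D : 'M[L]_n) : triv U A -> triv U D -> triv U (A *m D)
| triv_swap m n (X : 'M[L]_(m, n)) (Y : 'M[L]_(n, m)) :
    triv U (1%:M + X *m Y) -> triv U (1%:M + Y *m X).

Section Triv.
Variables (L : comNzRingType) (U : L -> Prop).
Local Notation triv := (triv U).

Lemma triv_upper m n (X : 'M[L]_(m, n)) : triv (block_mx 1%:M X 0 1%:M).
Proof.
have -> : block_mx 1%:M X 0 1%:M = 1%:M + col_mx X 0 *m (row_mx 0 1%:M : 'M_(n, m + n)).
  by rewrite mul_col_row scalar_mx_block add_block_mx !mulmx0 !mul0mx mulmx1 !addr0 add0r.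
apply: triv_swap; rewrite mul_row_col mul0mx mulmx0 !addr0; exact: triv1.
Qed.
Lemma triv_lower m n (X : 'M[L]_(n, m)) : triv (block_mx 1%:M 0 X 1%:M).
Proof.
have -> : block_mx 1%:M 0 X 1%:M = 1%:M + col_mx 0 X *m (row_mx 1%:M 0 : 'M_(m, m + n)).
  by rewrite mul_col_row scalar_mx_block add_block_mx !mulmx0 !mul0mx mulmx1 !addr0 add0r.
apply: triv_swap; rewrite mul_row_col mulmx0 mul0mx !addr0; exact: triv1.
Qed.
Lemma triv_diagl m n (A : 'M[L]_m) : triv (block_mx A 0 0 (1%:M : 'M_n)) <-> triv A.
Proof.
have e1 : block_mx A 0 0 (1%:M : 'M_n) = 1%:M + col_mx (A - 1%:M) 0 *m (row_mx 1%:M 0 : 'M_(m, m + n)).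
  by rewrite mul_col_row scalar_mx_block add_block_mx !mulmx0 !mul0mx mulmx1 !addr0 addrC subrK.
have e2 : A = 1%:M + (row_mx 1%:M 0 : 'M_(m, m + n)) *m col_mx (A - 1%:M) 0.
  by rewrite mul_row_col mulmx0 mul1mx addr0 addrC subrK.
by split=> H; [rewrite e2; apply: triv_swap; rewrite -e1|rewrite e1; apply: triv_swap; rewrite -e2].
Qed.
Lemma triv_diagr m n (A : 'M[L]_n) : triv A -> triv (block_mx (1%:M : 'M_m) 0 0 A).
Proof.
have -> : block_mx 1%:M 0 0 A = 1%:M + col_mx 0 (A - 1%:M) *m (row_mx 0 1%:M : 'M_(n, m + n)).
  by rewrite mul_col_row scalar_mx_block add_block_mx !mulmx0 !mul0mx mulmx1 !addr0 addrC subrK.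
by move=> H; apply: triv_swap; rewrite mul_row_col mulmx0 mul1mx add0r addrC subrK.
Qed.
Lemma triv_scalar u n : U u -> triv (u%:M : 'M_n).
Proof.
move=> Uu; elim: n => [|n IH].
  by rewrite (_ : u%:M = 1%:M); [apply: triv1|apply/matrixP => -[]].
rewrite -[n.+1]/(1 + n)%N scalar_mx_block.
have -> : block_mx (u%:M : 'M_1) 0 0 (u%:M : 'M_n) = block_mx u%:M 0 0 1%:M *m block_mx 1%:M 0 0 u%:M.
  by rewrite mulmx_block !mulmx0 !mul0mx !mulmx1 !mul1mx !addr0 add0r.
by apply: triv_mul; [apply/triv_diagl/triv_unit|apply: triv_diagr].
Qed.
Lemma triv_scalarX u n k : U u -> triv ((u ^+ k)%:M : 'M_n).
Proof.
move=> Uu; elim: k => [|k IH]; first exact: triv1.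
by rewrite exprS scalar_mxM; apply: triv_mul => //; apply: triv_scalar.
Qed.
End Triv.

Lemma triv_map (B L : comNzRingType) (io : {rmorphism B -> L}) (UB : B -> Prop) (UL : L -> Prop) :
  (forall b, UB b -> UL (io b)) -> forall n (A : 'M_n), triv UB A -> triv UL (map_mx io A).
Proof.
move=> UU n A; elim=> {n A} [n|u Uu|n A D _ IHA _ IHD|m n X Y _ IH].
- by rewrite map_scalar_mx rmorph1; apply: triv1.
- by rewrite map_scalar_mx; apply: triv_unit; apply: UU.
- by rewrite map_mxM; apply: triv_mul.
- move: IH; rewrite !map_mxD !map_mxM !map_scalar_mx rmorph1; exact: triv_swap.
Qed.

Definition invm (L : comNzRingType) n (A : 'M[L]_n) := exists2 A', A *m A' = 1%:M & A' *m A = 1%:M.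
Definition K1triv (L : comNzRingType) (U : L -> Prop) := forall n (A : 'M[L]_n), invm A -> triv U A.

Lemma invm_mul (L : comNzRingType) n (A D : 'M[L]_n) : invm A -> invm D -> invm (A *m D).
Proof.
move=> [A' a b] [D' c d]; exists (D' *m A').
  by rewrite mulmxA -(mulmxA A) c mulmx1.
by rewrite mulmxA -(mulmxA D') b mulmx1.
Qed.

(** * Gaussian elimination over a field *)

Section FieldK1.
Variables (B : comNzRingType) (U : B -> Prop).
Hypothesis fB : forall a : B, a != 0 -> U a /\ exists b, a * b = 1.

Lemma K1triv_field : K1triv U.
Proof.
elim=> [|n IH] A iA.
  by rewrite (_ : A = 1%:M); [apply: triv1|apply/matrixP => -[]].
rewrite -[n.+1]/(1 + n)%N in A iA *.
(* The first column of an invertible matrix is nonzero; adding a suitable row to the first one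
   creates the pivot. *)
wlog a0 : A iA / ulsubmx A 0 0 != 0.
  move=> H; have [a0|a0] := eqVneq (ulsubmx A 0 0) 0; last exact: H.
  have [i ci] : exists i, dlsubmx A i 0 != 0.
    apply: contrapT => nex; have [A' AA' A'A] := iA.
    have z : lsubmx A = 0.
      rewrite -[lsubmx A]vsubmxK; apply/matrixP => i j; rewrite !ord1 -col_mx0.
      case: (split_ordP i) => k ->; rewrite ?col_mxEu ?col_mxEd [RHS]mxE.
        by rewrite !ord1; move: a0; rewrite ulsubmxEsub !mxE => ->.
      by apply/eqP/negPn/negP => ck; apply: nex; exists k; move: ck; rewrite !mxE.
    have := congr1 (fun M : 'M_(1 + n) => M 0 0) A'A.
    rewrite [RHS]mxE eqxx mxE big1 => [/esym/eqP|k _]; first by rewrite oner_eq0.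
    have -> : A k 0 = lsubmx A k 0 by rewrite mxE; congr (A _ _); apply: val_inj.
    by rewrite z mxE mulr0.
  pose X : 'M[B]_(1, n) := delta_mx 0 i.
  pose E := block_mx 1%:M X 0 1%:M; pose E' := block_mx 1%:M (- X) 0 1%:M.
  have EE' : E *m E' = 1%:M.
    by rewrite mulmx_block !mulmx0 !mul0mx !mulmx1 !mul1mx !addr0 add0r addNr -scalar_mx_block.
  have E'E : E' *m E = 1%:M.
    by rewrite mulmx_block !mulmx0 !mul0mx !mulmx1 !mul1mx !addr0 add0r subrr -scalar_mx_block.
  have -> : A = E' *m (E *m A) by rewrite mulmxA E'E mul1mx.
  apply: triv_mul; first exact: triv_upper.
  apply: H; first by apply: invm_mul => //; exists E'.
  rewrite -[A]submxK mulmx_block block_mxKul mul1mx mxE a0 add0r.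
  rewrite mxE (bigD1 i) //= mxE !eqxx mul1r big1 ?addr0 // => k ki.
  by rewrite mxE eqxx /= (negPf ki) mul0r.
set a := ulsubmx A 0 0 in a0; have [Ua [b ab]] := fB a0.
have ula : ulsubmx A = a%:M by apply/matrixP => i j; rewrite !ord1 [RHS]mxE eqxx mulr1n.
set c := dlsubmx A; set r := ursubmx A; set D := drsubmx A.
pose E := block_mx 1%:M 0 (b *: c) 1%:M; pose E' := block_mx 1%:M 0 (- (b *: c)) 1%:M.
pose F := block_mx 1%:M (b *: r) 0 1%:M; pose F' := block_mx 1%:M (- (b *: r)) 0 1%:M.
have EE' : E *m E' = 1%:M.
  by rewrite mulmx_block !mulmx0 !mul0mx !mulmx1 !mul1mx !addr0 ?add0r subrr -scalar_mx_block.
have E'E : E' *m E = 1%:M.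
  by rewrite mulmx_block !mulmx0 !mul0mx !mulmx1 !mul1mx !addr0 ?add0r addNr -scalar_mx_block.
have FF' : F *m F' = 1%:M.
  by rewrite mulmx_block !mulmx0 !mul0mx !mulmx1 !mul1mx !addr0 ?add0r addNr -scalar_mx_block.
have F'F : F' *m F = 1%:M.
  by rewrite mulmx_block !mulmx0 !mul0mx !mulmx1 !mul1mx !addr0 ?add0r subrr -scalar_mx_block.
pose D1 := D - b *: (c *m r).
have eA : A = E *m block_mx a%:M 0 0 D1 *m F.
  rewrite -[LHS]submxK ula -/c -/r -/D !mulmx_block !mulmx0 !mul0mx !mulmx1 !mul1mx !addr0 ?add0r.
  rewrite mul_scalar_mx mul_mx_scalar !scalerA ab scale1r scale1r; congr block_mx.
  by rewrite -scalemxAr addrC subrK.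
have iD : invm (block_mx (a%:M : 'M_1) 0 0 D1).
  have -> : block_mx (a%:M : 'M_1) 0 0 D1 = E' *m A *m F'.
    by rewrite eA -!mulmxA FF' mulmx1 !mulmxA E'E mul1mx.
  by apply: invm_mul; [apply: invm_mul => //; exists E|exists F].
have {}iD : invm D1.
  have [W h1 h2] := iD; exists (drsubmx W).
    move: h1; rewrite -[W]submxK mulmx_block !mul0mx !add0r scalar_mx_block => /eq_block_mx [_ _ _ <-].
    by rewrite block_mxKdr.
  move: h2; rewrite -[W]submxK mulmx_block !mulmx0 !add0r scalar_mx_block => /eq_block_mx [_ _ _ <-].
  by rewrite block_mxKdr.
rewrite eA; apply: triv_mul; last exact: triv_upper.
apply: triv_mul; first exact: triv_lower.
have -> : block_mx a%:M 0 0 D1 = block_mx (a%:M : 'M_1) 0 0 1%:M *m block_mx 1%:M 0 0 D1.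
  by rewrite mulmx_block !mulmx0 !mul0mx !mulmx1 !mul1mx !addr0 add0r.
by apply: triv_mul; [apply/triv_diagl/triv_unit|apply: triv_diagr; apply: IH].
Qed.
End FieldK1.

(** * Nilpotent and idempotent matrices over a regular ring *)

Section Filtration.
Variable B : comNzRingType.

(* [Fil N ds Z]: a filtration of [Z], given from the top by the kernels of successive matrices [p],
   which [N] shifts by one step and whose graded pieces are [ffr] of the lengths [ds]. *)
Fixpoint Fil n (N : 'M[B]_n) (ds : seq nat) (Z : 'rV[B]_n -> Prop) : Prop :=
  if ds is d :: ds' then exists r (p : 'M[B]_(n, r)),
    [/\ ffr d (fun u => exists2 v, Z v & u = v *m p),
        forall v, Z v -> Z (v *m N) /\ v *m N *m p = 0 &
        Fil N ds' (fun v => Z v /\ v *m p = 0)]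
  else forall v, Z v -> v = 0.

Lemma Fil_iff n (N : 'M[B]_n) ds Z Z' : (forall v, Z v <-> Z' v) -> Fil N ds Z -> Fil N ds Z'.
Proof.
elim: ds Z Z' => [|d ds IH] Z Z' ZZ /= H; first by move=> v /ZZ; apply: H.
have [r [p [h1 h2 h3]]] := H; exists r, p; split.
- by apply: ffr_iff h1 => u; split=> -[v Zv ->]; exists v => //; apply/ZZ.
- by move=> v /ZZ /h2 [? ?]; split=> //; apply/ZZ.
- by apply: IH h3 => v; rewrite ZZ.
Qed.

Lemma Fil_ffr n (N : 'M[B]_n) ds Z d : submod Z -> all (leq^~ d) ds -> Fil N ds Z -> ffr d Z.
Proof.
elim: ds Z => [|d0 ds IH] Z Zs /=.
  move=> _ H; apply: (@ffr_le _ 0) => // v; split=> [/H //|->]; by case: Zs.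
move=> /andP[dd ad] [r [p [h1 h2 h3]]]; apply: (ffr_ext (p := p)) => //; last exact: ffr_le h1.
by apply: IH => //; apply: submodI => //; apply: submod_ker.
Qed.

(** After the swap from [X *m D] to [D *m X], the module [Y] is replaced by its preimage under the
    cover [D]. The old filtration pulls back, and the kernel of [D], which [D *m X] annihilates,
    becomes the new last piece. *)
Lemma Fil_step m n (N : 'M[B]_n) (D : 'M_(m, n)) (X : 'M_(n, m)) ds Y d' : X *m D = N -> submod Y ->
  (forall v, Y v -> exists w, v = w *m D) -> ffr d' (fun w : 'rV_m => w *m D = 0) -> Fil N ds Y ->
  Fil (D *m X) (rcons ds d') (fun w => Y (w *m D)).
Proof.
move=> XD; elim: ds Y => [|d ds IH] Y Ys YD kD.
  move=> /= Y0; exists m, 1%:M; split.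
  - apply: ffr_iff kD => u; split=> [u0|[v /Y0 v0 ->]]; last by rewrite mulmx1.
    by exists u; rewrite ?mulmx1 // u0; case: Ys.
  - by move=> v /Y0 v0; rewrite mulmx1 mulmxA v0 !mul0mx; split=> //; case: Ys.
  - by move=> v [_]; rewrite mulmx1.
move=> /= [r [p [h1 h2 h3]]]; exists r, (D *m p); split.
- apply: ffr_iff h1 => u; split=> [[v Yv ->]|[w Yw ->]]; last by exists (w *m D); rewrite // mulmxA.
  by have [w e] := YD _ Yv; exists w; rewrite -?e // e mulmxA.
- move=> w /h2; rewrite !mulmxA -!(mulmxA _ X D) XD => -[? ?]; by split.
- apply: (@Fil_iff _ _ _ (fun w => (fun v => Y v /\ v *m p = 0) (w *m D))).
    by move=> w; rewrite mulmxA.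
  apply: (IH (fun v => Y v /\ v *m p = 0)) => //; last by move=> v [/YD].
  by apply: submodI => //; apply: submod_ker.
Qed.

Lemma rows_factor m n k (M : 'M[B]_(k, n)) (D : 'M[B]_(m, n)) :
  (forall v : 'rV_k, exists w : 'rV_m, v *m M = w *m D) -> exists X, X *m D = M.
Proof.
move=> H; have [f Hf] := choice (fun i : 'I_k => H (delta_mx 0 i)).
by exists (\matrix_i f i); apply/row_matrixP => i; rewrite row_mul rowK -Hf -rowE.
Qed.

Lemma mulmx_inj0 m n (M : 'M[B]_(m, n)) : (forall v : 'rV_m, v *m M = 0) -> M = 0.
Proof. by move=> H; apply/row_matrixP => i; rewrite rowE H row0. Qed.

Variables (L : comNzRingType) (io : {rmorphism B -> L}) (U : L -> Prop).
Local Notation mx A := (map_mx io A).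

(** Write [N] as [X *m D] with [D] a free cover of [Z], and swap. The filtration loses its top
    piece, because [N] maps into the next one, and gains at the bottom the kernel of [D], whose
    resolution is one step shorter than the common bound. This gives a double induction: on the
    bound, and on the number of pieces that may still attain it. *)
Lemma Fil_triv (s : L) ds n (N : 'M[B]_n) Z : submod Z -> (forall v, Z (v *m N)) -> Fil N ds Z ->
  triv U (1%:M + s *: mx N).
Proof.
pose P ds := forall n (N : 'M[B]_n) Z, submod Z -> (forall v, Z (v *m N)) -> Fil N ds Z ->
  triv U (1%:M + s *: mx N).
suff H d : forall ds, all (leq^~ d) ds -> P ds.
  apply: (H (foldr maxn 0%N ds)); elim: ds => //= d ds IH; rewrite leq_maxl /=.
  by apply: sub_all IH => x xd; apply: leq_trans xd (leq_maxr _ _).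
elim: d => [|d IHd] {}ds ad.
  move=> {}n {}N {}Z Zs ZN /(Fil_ffr Zs ad) Z0.
  have -> : N = 0 by apply: mulmx_inj0 => v; apply/Z0.
  by rewrite raddf0 scaler0 addr0; apply: triv1.
(* [ds1] holds the pieces not yet removed, [ds2] the kernels already appended. *)
suff H ds1 ds2 : all (leq^~ d.+1) ds1 -> all (leq^~ d) ds2 -> P (ds1 ++ ds2).
  by rewrite -[ds]cats0; apply: H.
elim: ds1 ds2 => [|d0 ds1 IH] ds2 a1 a2; first exact: IHd.
move=> {}n {}N {}Z Zs ZN FN.
have aa : all (leq^~ d.+1) ((d0 :: ds1) ++ ds2).
  by rewrite all_cat a1; apply: sub_all a2 => x xd; apply: leqW.
have [m [D [HD kD]]] := Fil_ffr Zs aa FN.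
have [X XD] : exists X, X *m D = N by apply: rows_factor => v; apply/HD.
have [r [p [h1 h2 h3]]] := FN.
have -> : 1%:M + s *: mx N = 1%:M + mx X *m (s *: mx D) by rewrite -scalemxAr -map_mxM XD.
apply: triv_swap; rewrite -scalemxAl -map_mxM.
have Ys : submod (fun v => Z v /\ v *m p = 0) by apply: submodI => //; apply: submod_ker.
have YD v : Z v /\ v *m p = 0 -> exists w, v = w *m D by move=> [/HD].
have FF := Fil_step XD Ys YD kD h3.
rewrite rcons_cat in FF.
apply: (IH (rcons ds2 d) _ _ _ _ _ _ _ FF).
- by case/andP: a1.
- by rewrite all_rcons leqnn.
- exact: submod_preim Ys.
- move=> w; rewrite mulmxA -mulmxA XD; apply: h2; apply/HD; by exists w.
Qed.

Hypothesis regB : regular B.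

(** The filtration is by the kernels of the powers of [N]; regularity resolves its graded pieces. *)
Lemma nilpotent_triv (s : L) n (N : 'M[B]_n) k : N ^+ k = 0 -> triv U (1%:M + s *: mx N).
Proof.
case: k => [|k] Nk.
  have -> : N = 0 by rewrite -[N]mulr1 -[1](expr0 N) Nk mulr0.
  by rewrite raddf0 scaler0 addr0; apply: triv1.
have [ds F] : exists ds, Fil N ds (fun v => v *m (N ^+ k) = 0).
  elim: k {Nk} => [|k [ds IH]]; first by exists [::] => v; rewrite mulmx1.
  have sk : submod (fun v => v *m (N ^+ k.+1) = 0) by apply: submod_ker.
  have [d Hd] := regB (submod_im (N ^+ k) sk).
  exists (d :: ds), n, (N ^+ k); split=> //.
    move=> v v0; rewrite -!mulmxA -[N *m (N ^+ k)]exprS v0; split=> //.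
    by rewrite -[N *m _]exprS exprSr mulmxA v0 mul0mx.
  apply: Fil_iff IH => v; split=> [e|[]//]; split=> //.
  by rewrite exprSr mulmxA e mul0mx.
apply: (Fil_triv s (submod_ker _) _ F) => v.
by rewrite -mulmxA -[N *m _]exprS Nk mulmx0.
Qed.

(** Induction along a resolution of the image of [P]. The swap leads to the idempotent [P1] on the
    free cover, and [1 - P1] projects onto the kernel of [D], which has a shorter resolution.
    Extracting the scalar [u] passes from [P1] to [1 - P1] and exchanges [u] with [u']. *)
Lemma idempotent_triv n (P : 'M[B]_n) u u' : P *m P = P -> U u -> U u' -> u * u' = 1 ->
  triv U (1%:M + (u - 1) *: mx P).
Proof.
move=> PP Uu Uu' uu'.
have sP : submod (fun v : 'rV[B]_n => v *m (P - 1%:M) = 0) by apply: submod_ker.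
have [d Hd] := regB sP.
have {}Hd : ffr d (fun v => v *m P = v).
  apply: ffr_iff Hd => v; rewrite mulmxBr mulmx1; split=> [/eqP|->]; last by rewrite subrr.
  by rewrite subr_eq0 => /eqP.
elim: d n P u u' PP {sP} Uu Uu' uu' Hd => [|d IH] n P u u' PP Uu Uu' uu' Hd.
  have -> : P = 0 by apply: mulmx_inj0 => v; apply/Hd; rewrite -mulmxA PP.
  by rewrite raddf0 scaler0 addr0; apply: triv1.
have [m [D [HD kD]]] := Hd.
have [X' X'D] : exists X, X *m D = P by apply: rows_factor => v; apply/HD; rewrite -mulmxA PP.
pose X := P *m X'.
have XD : X *m D = P by rewrite -mulmxA X'D PP.
have DP : D *m P = D.
  by apply/row_matrixP => i; rewrite row_mul; apply/HD; exists (delta_mx 0 i); rewrite rowE.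
have PX : P *m X = X by rewrite mulmxA PP.
pose P1 := D *m X.
have P1P1 : P1 *m P1 = P1 by rewrite /P1 mulmxA -(mulmxA D X D) XD -mulmxA PX.
have -> : 1%:M + (u - 1) *: mx P = 1%:M + mx X *m ((u - 1) *: mx D) by rewrite -scalemxAr -map_mxM XD.
apply: triv_swap; rewrite -scalemxAl -map_mxM -/P1.
have -> : 1%:M + (u - 1) *: mx P1 = u%:M *m (1%:M + (u' - 1) *: mx (1%:M - P1)).
  rewrite mul_scalar_mx scalerDr scalerA mulrBr uu' mulr1 map_mxB map_scalar_mx rmorph1 scalerBr.
  rewrite addrA -scalerDl; have -> : u + (1 - u) = 1 by rewrite addrC subrK.
  by rewrite scale1r -scaleNr opprB.
apply: triv_mul; first exact: triv_scalar.
apply: (IH _ _ u' u) => //; last 1 first.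
- apply: ffr_iff kD => w; rewrite mulmxBr mulmx1; split=> [w0|].
    by rewrite /P1 mulmxA w0 mul0mx subr0.
  move=> e; have e0 : w *m P1 = 0 by apply/eqP; rewrite -oppr_eq0 -(inj_eq (addrI w)) addr0 e.
  have -> : w *m D = w *m P1 *m D by rewrite /P1 -(mulmxA w) -(mulmxA D) XD DP.
  by rewrite e0 mul0mx.
- by rewrite mulmxBl !mulmxBr !mul1mx !mulmx1 P1P1 subrr subr0.
- by rewrite mulrC.
Qed.
End Filtration.

Section CoMax.
Variable R : pzRingType.

Lemma comaximal_powers (N : R) p q : exists F G : R,
  [/\ F * N ^+ p + G * (1 - N) ^+ q = 1, GRing.comm F N & GRing.comm G N].
Proof.
have [F0 [G0 [e0 cF cG]]] : exists F G : R, [/\ F * N ^+ p + G * (1 - N) = 1, GRing.comm F N & GRing.comm G N].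
  elim: p => [|p [F [G [e cF cG]]]].
    by exists 1, 0; rewrite mul0r addr0 mulr1; split=> //; [apply: commr_sym; apply: commr1|apply: commr_sym; apply: commr0].
  exists F, (F * N ^+ p + G); split=> //; last first.
    by apply: commr_sym; apply: commrD; [apply: commrM; [apply: commr_sym|apply: commrX]|apply: commr_sym].
  rewrite -[RHS]e exprSr; set M := N ^+ p; nc_ring tt.
have cN (H : R) j : GRing.comm H N -> H * (1 - N) ^+ j = (1 - N) ^+ j * H.
  by move=> cH; apply: commrX; apply: commrB => //; apply: commr1.
elim: q => [|q [F [G [e c1 c2]]]].
  by exists 0, 1; rewrite mul0r add0r mulr1; split=> //; [apply: commr_sym; apply: commr0|apply: commr_sym; apply: commr1].
exists (F + G * (1 - N) ^+ q * F0), (G * G0); split.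
- rewrite -[RHS]e exprSr.
  have h := cN G0 q cG; set K := (1 - N) ^+ q in h *; set M := N ^+ p in e0 *; set Q := 1 - N in e0 *.
  transitivity (F * M + G * K * (F0 * M + G0 * Q)); last by rewrite e0 mulr1.
  by nc_ring (tt, h).
- apply: commr_sym; apply: commrD; first exact: commr_sym.
  apply: commrM; last exact: commr_sym.
  by apply: commrM; [exact: commr_sym|apply: commrX; apply: commrB => //; apply: commr1].
- by apply: commr_sym; apply: commrM; apply: commr_sym.
Qed.

(** The [c i] are the coefficients of the inverse of [1 + (t - 1) N], shifted by [t ^+ k]. Upwards
    from the lowest one, powers of [1 - N] kill those with [i < k]; downwards from the highest one,
    powers of [N] kill those with [i >= k]; the relation at [k] combines the two. *)
Lemma nilpotent_product (N : R) (c : nat -> R) k r :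
  (forall i, (1 - N) * c i + (if i is j.+1 then N * c j else 0) = (i == k)%:R) ->
  (forall i, (r <= i)%N -> c i = 0) -> exists p q, N ^+ p * (1 - N) ^+ q = 0.
Proof.
move=> rel c0.
have [rk|kr] := leqP r k.
  (* Here [c k = 0], so [N] has a right inverse [c k.-1] (or 1 = 0 when [k] is 0), and
     [(1 - N) ^+ k] already vanishes: the exponent of [N] is immaterial. *)
  exists (if k is j.+1 then (r - j).+1 else 0%N), k.
  have H i : (i < k)%N -> (1 - N) ^+ i.+1 * c i = 0.
    elim: i => [|i IH] ik.
      by have := rel 0%N; rewrite addr0 expr1 (ltn_eqF ik).
    have := rel i.+1; rewrite (ltn_eqF ik) exprSr -mulrA => /eqP; rewrite addr_eq0 => /eqP ->.
    rewrite mulrN mulrA; have -> : (1 - N) ^+ i.+1 * N = N * (1 - N) ^+ i.+1.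
      by apply: commr_sym; apply: commrX; apply: commrB => //; apply: commr1.
    by rewrite -mulrA IH ?mulr0 ?oppr0 // ltnW.
  have := rel k; rewrite eqxx (c0 k rk) mulr0 add0r; case: k rel rk H => [|k] rel rk H e.
    by rewrite mulr1; symmetry; exact: e.
  have {}e : N * c k = 1 := e.
  rewrite -[LHS]mulr1 -[X in _ * X]e -mulrA.
  have -> : (1 - N) ^+ k.+1 * (N * c k) = N * ((1 - N) ^+ k.+1 * c k).
    rewrite !mulrA; congr (_ * _); apply: commr_sym; apply: commrX; apply: commrB => //; exact: commr1.
  by rewrite H // !mulr0.
exists (r - k)%N, k.
have H1 j : (j <= r - k)%N -> N ^+ j * c (r - j)%N = 0.
  elim: j => [|j IH] jr; first by rewrite subn0 c0 // mulr0.
  have e := rel (r - j)%N.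
  have e1 : (r - j = (r - j.+1).+1)%N by lia.
  have e2 : ((r - j)%N == k) = false by lia.
  rewrite e2 e1 in e; rewrite exprSr -mulrA; move: e => /eqP; rewrite addrC addr_eq0 => /eqP ->.
  rewrite mulrN mulrA.
  have -> : N ^+ j * (1 - N) = (1 - N) * N ^+ j by apply: commr_sym; apply: commrX; apply: commr_sym; apply: commrB => //; apply: commr1.
  by rewrite -mulrA -e1 IH ?mulr0 ?oppr0 //; lia.
have cN j l : N ^+ j * (1 - N) ^+ l = (1 - N) ^+ l * N ^+ j.
  by apply: commrX; apply: commr_sym; apply: commrX; apply: commr_sym; apply: commrB => //; apply: commr1.
have H2 i : (i < k)%N -> (1 - N) ^+ i.+1 * c i = 0.
  elim: i => [|i IH] ik.
    by have := rel 0%N; rewrite addr0 expr1 (ltn_eqF ik).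
  have := rel i.+1; rewrite (ltn_eqF ik) exprSr -mulrA => /eqP; rewrite addr_eq0 => /eqP ->.
  by rewrite mulrN mulrA -(expr1 N) -cN expr1 -mulrA IH ?mulr0 ?oppr0 // ltnW.
have := rel k; rewrite eqxx => e; rewrite -[LHS]mulr1 -[X in _ * X]e mulrDr.
have -> : N ^+ (r - k) * (1 - N) ^+ k * ((1 - N) * c k) = 0.
  have h1 : N ^+ (r - k) * c k = 0 by have := H1 _ (leqnn (r - k)); rewrite subKn // ltnW.
  by rewrite mulrA -(mulrA (N ^+ (r - k))) -exprSr cN -mulrA h1 mulr0.
rewrite add0r; case: k H2 {rel e H1 kr} => [|k] H2; first by rewrite mulr0.
by rewrite mulrA -(mulrA (N ^+ _)) -{3}(expr1 N) -cN expr1 mulrA -mulrA H2 // mulr0.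
Qed.
End CoMax.

(** * The group K_1 of a Laurent extension *)

Section LaurentK1.
Variables (B L : comNzRingType) (io : {rmorphism B -> L}) (t t' : L).
Hypothesis (tt' : t * t' = 1).
Hypothesis decL : forall a : L, exists k (p : {poly B}), a = t' ^+ k * (map_poly io p).[t].
Hypothesis indL : forall p : {poly B}, (map_poly io p).[t] = 0 -> p = 0.
Variables (UB : B -> Prop) (U : L -> Prop).
Hypotheses (UBU : forall b, UB b -> U (io b)) (Ut : U t) (Ut' : U t').
Hypotheses (regB : regular B) (K1B : K1triv UB).
Local Notation mx A := (map_mx io A).
Local Notation sumtL := (sumt io t).

(** The Bezout relation yields an idempotent [P] commuting with [N] such that [N] is nilpotent on
    the part of [1 - P] and [1 - N] is nilpotent on the part of [P]. On the latter
    [1 + (t - 1) N = t (1 + (t' - 1) (1 - N))], which explains the three factors. *)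
Lemma linear_triv n (N : 'M[B]_n) p q : N ^+ p * (1 - N) ^+ q = 0 ->
  triv U (1%:M + (t - 1) *: mx N).
Proof.
move=> Npq; have [F [G [e cF cG]]] := comaximal_powers N p q.
pose P := F * N ^+ p.
have P1 : 1 - P = G * (1 - N) ^+ q by apply/eqP; rewrite subr_eq addrC e.
have cP : GRing.comm P N.
  by apply: commr_sym; apply: commrM; [apply: commr_sym|apply: commrX].
have c1N : GRing.comm (1 - N) N by apply: commr_sym; apply: commrB => //; apply: commr1.
have PQ : N ^+ p * (1 - P) = 0.
  have cGp : N ^+ p * G = G * N ^+ p by apply: commr_sym; apply: commrX.
  by rewrite P1 mulrA cGp -mulrA Npq mulr0.
have PP : P * P = P.
  by apply/eqP; rewrite -subr_eq0 -oppr_eq0 opprB -{1}[P]mulr1 -mulrBr -mulrA PQ mulr0.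
have QP : (1 - N) ^+ q * P = 0.
  have cFq : (1 - N) ^+ q * F = F * (1 - N) ^+ q.
    by apply: commr_sym; apply: commrX; apply: commrB => //; apply: commr1.
  rewrite /P mulrA cFq -mulrA.
  have -> : (1 - N) ^+ q * N ^+ p = N ^+ p * (1 - N) ^+ q.
    by apply: commrX; apply: commr_sym; apply: commrX; apply: commr_sym.
  by rewrite Npq mulr0.
pose N0 := N * (1 - P); pose N1 := (1 - N) * P.
have n0 : N0 ^+ p.+1 = 0.
  rewrite /N0 exprMn_comm; last by apply: commrB; [apply: commr1|apply: commr_sym].
  by rewrite exprS exprS -mulrA (mulrA (N ^+ p)) PQ mul0r mulr0.
have n1 : N1 ^+ q.+1 = 0.
  rewrite /N1 exprMn_comm; last by apply: commr_sym; apply: commrB; [apply: commr1|].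
  by rewrite exprS exprS -mulrA (mulrA ((1 - N) ^+ q)) QP mul0r mulr0.
clearbody P.
have -> : 1%:M + (t - 1) *: mx N =
   (1%:M + (t - 1) *: mx N0) *m (1%:M + (t - 1) *: mx P) *m (1%:M + (t' - 1) *: mx N1).
  rewrite -!mul_scalar_mx !raddfB /= /N0 /N1 !map_mxM !map_mxB !map_mx1.
  have e1 : t%:M *m t'%:M = 1%:M :> 'M_n by rewrite -scalar_mxM tt'.
  have e2 := scalar_mxC t (mx N); have e3 := scalar_mxC t (mx P).
  have e4 := scalar_mxC t' (mx N); have e5 := scalar_mxC t' (mx P).
  have e6 : t'%:M *m t%:M = 1%:M :> 'M_n by rewrite -scalar_mxM mulrC tt'.
  have e7 : mx N *m mx P = mx P *m mx N by rewrite -!map_mxM; congr (mx _); exact: (esym cP).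
  have e8 : mx P *m mx P = mx P by rewrite -map_mxM; congr (mx _).
  move: e1 e2 e3 e4 e5 e6 e7 e8.
  move: (mx N) (mx P) (t%:M : 'M_n) (t'%:M : 'M_n) => A Q T T'.
  change (T * T' = 1 -> A * T = T * A -> Q * T = T * Q -> A * T' = T' * A -> Q * T' = T' * Q ->
    T' * T = 1 -> A * Q = Q * A -> Q * Q = Q -> 1 + (T - 1) * A =
    (1 + (T - 1) * (A * (1 - Q))) * (1 + (T - 1) * Q) * (1 + (T' - 1) * ((1 - A) * Q))).
  move=> e1 e2 e3 e4 e5 e6 e7 e8.
  by nc_ring (tt, e1, e6, e2, e3, e4, e5, e7, e8).
apply: triv_mul; first apply: triv_mul.
- exact: nilpotent_triv n0.
- exact: (idempotent_triv io regB PP Ut Ut').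
- exact: nilpotent_triv n1.
Qed.

Lemma sumt_pad m n r s (y : nat -> 'M[B]_(m, n)) : (r <= s)%N ->
  sumtL s (fun i => if (i < r)%N then y i else 0) = sumtL r y.
Proof.
move=> rs; rewrite /sumt -(subnKC rs) big_split_ord /= [X in _ + X]big1 ?addr0 => [|i _]; last first.
  by rewrite ltnNge leq_addr /= raddf0 scaler0.
by apply: eq_bigr => i _; rewrite ltn_ord.
Qed.

(** Comparing coefficients in the inverse shows that the value [G] at [t = 1] is invertible over
    [B], and that [N = G' *m A1] satisfies the recursion of [nilpotent_product]. *)
Lemma degree1_triv n (A0 A1 : 'M[B]_n) : invm (mx A0 + t *: mx A1) -> triv U (mx A0 + t *: mx A1).
Proof.
move=> [W MW WM].
have [k [r0 [c0 eW]]] := mx_dec tt' decL W.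
pose r := (r0 + k).+1.
pose c i := if (i < r0)%N then c0 i else 0.
have {}eW : W = t' ^+ k *: sumtL r c by rewrite eW sumt_pad // /r -addnS leq_addr.
have cr i : (r <= i)%N -> c i = 0.
  by move=> ri; rewrite /c ltnNge (leq_trans (leq_addr _ _) (ltnW ri)).
have tkk : t ^+ k *: W = sumtL r c by rewrite eW scalerA -exprMn tt' expr1n scale1r.
pose cp i := if i is j.+1 then c j else 0.
have kr : (k < r.+1)%N by rewrite /r ltnS leqW // leq_addl.
have sumdelta : sumtL r.+1 (fun i => if i == k then 1%:M else 0 : 'M[B]_n) = t ^+ k *: 1%:M.
  rewrite /sumt (bigD1 (Ordinal kr)) //= eqxx map_mx1 big1 ?addr0 // => i ik.
  by rewrite -[k]/(nat_of_ord (Ordinal kr)) (inj_eq val_inj) (negPf ik) raddf0 scaler0.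
have sumc : sumtL r.+1 c = sumtL r c.
  by rewrite /sumt big_ord_recr /= cr // raddf0 scaler0 addr0.
have sumcp : sumtL r.+1 cp = t *: sumtL r c.
  rewrite /sumt big_ord_recl /= raddf0 scaler0 add0r scaler_sumr.
  by apply: eq_bigr => i _; rewrite scalerA /bump add1n exprS.
have sD (y z : nat -> 'M[B]_n) s : sumtL s y + sumtL s z = sumtL s (fun i => y i + z i).
  by rewrite /sumt -big_split /=; apply: eq_bigr => i _; rewrite map_mxD scalerDr.
have sB (y z : nat -> 'M[B]_n) s : sumtL s y - sumtL s z = sumtL s (fun i => y i - z i).
  by rewrite /sumt -sumrB; apply: eq_bigr => i _; rewrite map_mxB scalerBr.
have mul_sumt (D : 'M[B]_n) y s : mx D *m sumtL s y = sumtL s (fun i => D *m y i).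
  by rewrite /sumt mulmx_sumr; apply: eq_bigr => i _; rewrite -scalemxAr map_mxM.
have relL i : A0 *m c i + A1 *m cp i = if i == k then 1%:M else 0.
  have [ir|ri] := ltnP i r.+1; last first.
    have -> : (i == k) = false by apply/eqP => ik; rewrite ik in ri; move: kr; rewrite ltnNge ri.
    case: i ri => // i ri; rewrite /cp !cr ?mulmx0 ?addr0 //; exact: ltnW.
  apply/eqP; rewrite -subr_eq0; apply/eqP.
  apply: (sumt_inj indL (r := r.+1) (y := fun i => A0 *m c i + A1 *m cp i - (if i == k then 1%:M else 0))) ir.
  rewrite -sB -sD -!mul_sumt sumdelta sumc sumcp -MW -tkk.
  have -> : mx A0 *m (t ^+ k *: W) + mx A1 *m (t *: (t ^+ k *: W)) = t ^+ k *: ((mx A0 + t *: mx A1) *m W).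
    rewrite mulmxDl -!scalemxAr -scalemxAl scalerDr; congr (_ + _).
    by rewrite scalerA mulrC -scalerA.
  by rewrite subrr.
have relR i : c i *m A0 + cp i *m A1 = if i == k then 1%:M else 0.
  have [ir|ri] := ltnP i r.+1; last first.
    have -> : (i == k) = false by apply/eqP => ik; rewrite ik in ri; move: kr; rewrite ltnNge ri.
    case: i ri => // i ri; rewrite /cp !cr ?mul0mx ?addr0 //; exact: ltnW.
  apply/eqP; rewrite -subr_eq0; apply/eqP.
  apply: (sumt_inj indL (r := r.+1) (y := fun i => c i *m A0 + cp i *m A1 - (if i == k then 1%:M else 0))) ir.
  rewrite -sB -sD -!sumt_mul sumdelta sumc sumcp -WM -tkk.
  have -> : t ^+ k *: W *m mx A0 + t *: (t ^+ k *: W) *m mx A1 = t ^+ k *: (W *m (mx A0 + t *: mx A1)).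
    rewrite mulmxDr -!scalemxAl -scalemxAr scalerDr; congr (_ + _).
    by rewrite scalerA mulrC -scalerA.
  by rewrite subrr.
pose G := A0 + A1; pose G' := \sum_(i < r) c i.
have csum : \sum_(i < r.+1) c i = G' by rewrite big_ord_recr /= cr // addr0.
have cpsum : \sum_(i < r.+1) cp i = G' by rewrite big_ord_recl /= add0r.
have dsum : \sum_(i < r.+1) (if nat_of_ord i == k then 1%:M else 0 : 'M[B]_n) = 1%:M.
  rewrite (bigD1 (Ordinal kr)) //= eqxx big1 ?addr0 // => i ik.
  by rewrite -[k]/(nat_of_ord (Ordinal kr)) (inj_eq val_inj) (negPf ik).
have GG' : G *m G' = 1%:M.
  by rewrite -dsum -(eq_bigr _ (fun (i : 'I_r.+1) _ => relL i)) big_split /= -!mulmx_sumr csum cpsum -mulmxDl.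
have G'G : G' *m G = 1%:M.
  by rewrite -dsum -(eq_bigr _ (fun (i : 'I_r.+1) _ => relR i)) big_split /= -!mulmx_suml csum cpsum -mulmxDr.
pose N := G' *m A1.
have N1 : 1%:M - N = G' *m A0 by rewrite -G'G /G mulmxDr addrK.
have -> : mx A0 + t *: mx A1 = mx G *m (1%:M + (t - 1) *: mx N).
  rewrite mulmxDr mulmx1 -scalemxAr -map_mxM mulmxA GG' mul1mx scalerBl scale1r map_mxD.
  by rewrite addrA addrAC -!addrA addNKr // addrC.
apply: triv_mul; first by apply: (triv_map UBU); apply: K1B; exists G'.
pose c' i := c i *m G.
have [p [q Npq]] : exists p q, N ^+ p * (1 - N) ^+ q = 0.
  apply: (@nilpotent_product _ N c' k r) => [i|i ri]; last by rewrite /c' cr // mul0mx.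
  have := congr1 (fun M => G' *m M *m G) (relL i); rewrite -[1 - N]/(1%:M - N) N1.
  have -> : G' *m (if i == k then 1%:M else 0) *m G = (i == k)%:R.
    by case: ifP; rewrite ?mulmx1 ?mulmx0 ?mul0mx ?G'G.
  move=> <-; rewrite mulmxDr mulmxDl !mulmxA; congr (_ + _).
    by rewrite /c' -[LHS]/(G' *m A0 *m (c i *m G)) !mulmxA.
  case: i => [|i]; rewrite /cp ?mulmx0 ?mul0mx //.
  by rewrite /c' -[LHS]/(N *m (c i *m G)) /N !mulmxA.
exact: linear_triv Npq.
Qed.

(** Higman's trick: at the price of doubling the size, the top coefficient moves to an off-diagonal
    block, where it occurs with one power of [t] less. *)
Lemma higman_triv d n (y : nat -> 'M[B]_n) : invm (sumtL d.+2 y) -> triv U (sumtL d.+2 y).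
Proof.
elim: d n y => [|d IH] n y iM.
  have e : sumtL 2 y = mx (y 0%N) + t *: mx (y 1%N).
    by rewrite /sumt !big_ord_recl big_ord0 addr0 expr0 scale1r expr1.
  by rewrite e; apply: degree1_triv; rewrite -e.
pose y' i := block_mx (y i) (if i == 1%N then 1%:M else 0) (if i == d.+1 then - y d.+2 else 0)
   (if i == 0%N then 1%:M else 0) : 'M[B]_(n + n).
pose S := t ^+ d.+1 *: mx (y d.+2).
have ey' : sumtL d.+2 y' = block_mx (sumtL d.+2 y) t%:M (- S) 1%:M.
  have -> : sumtL d.+2 y' = \sum_(i < d.+2) block_mx (t ^+ i *: mx (y i))
     (t ^+ i *: mx (if nat_of_ord i == 1%N then 1%:M else 0)) (t ^+ i *: mx (if nat_of_ord i == d.+1 then - y d.+2 else 0))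
     (t ^+ i *: mx (if nat_of_ord i == 0%N then 1%:M else 0)).
    by apply: eq_bigr => i _; rewrite map_block_mx scale_block_mx.
  have bs (a b c e : 'I_d.+2 -> 'M[L]_n) : \sum_i block_mx (a i) (b i) (c i) (e i) =
     block_mx (\sum_i a i) (\sum_i b i) (\sum_i c i) (\sum_i e i).
    by elim: (index_enum _) => [|i l IHl]; rewrite ?big_nil ?block_mx0 // !big_cons IHl add_block_mx.
  rewrite bs; congr block_mx.
  - rewrite (bigD1 (inord 1)) //= inordK // eqxx map_mx1 scalemx1 expr1 big1 ?addr0 // => i i1.
    have -> : (nat_of_ord i == 1%N) = false.
      by apply: contraNF i1 => /eqP i1; apply/eqP/val_inj; rewrite /= inordK.
    by rewrite raddf0 scaler0.
  - rewrite big_ord_recr /= eqxx map_mxN scalerN big1 ?add0r // => i _.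
    by rewrite (ltn_eqF (ltn_ord i)) raddf0 scaler0.
  - rewrite big_ord_recl /= map_mx1 scale1r big1 ?addr0 // => i _.
    by rewrite raddf0 scaler0.
have eM : sumtL d.+3 y = sumtL d.+2 y + t *: S by rewrite /sumt big_ord_recr /= scalerA -exprS.
pose E := block_mx 1%:M (t%:M : 'M[L]_n) 0 1%:M; pose E' := block_mx 1%:M (- t%:M : 'M[L]_n) 0 1%:M.
pose F := block_mx 1%:M (0 : 'M[L]_n) S 1%:M; pose F' := block_mx 1%:M (0 : 'M[L]_n) (- S) 1%:M.
have EE' : E *m E' = 1%:M.
  by rewrite mulmx_block !mulmx0 !mul0mx !mulmx1 !mul1mx !addr0 ?add0r addNr -scalar_mx_block.
have E'E : E' *m E = 1%:M.
  by rewrite mulmx_block !mulmx0 !mul0mx !mulmx1 !mul1mx !addr0 ?add0r subrr -scalar_mx_block.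
have FF' : F *m F' = 1%:M.
  by rewrite mulmx_block !mulmx0 !mul0mx !mulmx1 !mul1mx !addr0 ?add0r subrr -scalar_mx_block.
have F'F : F' *m F = 1%:M.
  by rewrite mulmx_block !mulmx0 !mul0mx !mulmx1 !mul1mx !addr0 ?add0r addNr -scalar_mx_block.
have fact : sumtL d.+2 y' = E *m block_mx (sumtL d.+3 y) 0 0 1%:M *m F'.
  rewrite ey' eM !mulmx_block !mulmx0 !mul0mx !mulmx1 !mul1mx !addr0 ?add0r.
  by rewrite !mulmxN mul1mx mul_scalar_mx addrK.
have iD : invm (block_mx (sumtL d.+3 y) 0 0 (1%:M : 'M_n)).
  have [W h1 h2] := iM; exists (block_mx W 0 0 1%:M);
    by rewrite mulmx_block !mulmx0 !mul0mx !mulmx1 !addr0 ?add0r ?h1 ?h2 -scalar_mx_block.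
apply/(triv_diagl U n).
have -> : block_mx (sumtL d.+3 y) 0 0 (1%:M : 'M_n) = E' *m sumtL d.+2 y' *m F.
  by rewrite fact !mulmxA E'E mul1mx -mulmxA F'F mulmx1.
apply: triv_mul; last exact: triv_lower.
apply: triv_mul; first exact: triv_upper.
apply: IH; rewrite fact; apply: invm_mul; first by apply: invm_mul => //; exists E'.
by exists F.
Qed.

Theorem K1triv_Laurent : K1triv U.
Proof.
move=> n M [M' MM' M'M]; have [k [r [y eM]]] := mx_dec tt' decL M.
have eS : sumtL r y = t ^+ k *: M by rewrite eM scalerA -exprMn tt' expr1n scale1r.
rewrite eM -mul_scalar_mx; apply: triv_mul; first exact: triv_scalarX.
have e2 : sumtL r y = sumtL r.+2 (fun i => if (i < r)%N then y i else 0).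
  by rewrite sumt_pad // -addn2 leq_addr.
rewrite e2; apply: higman_triv; rewrite -e2 eS.
exists (t' ^+ k *: M'); rewrite -scalemxAl -scalemxAr scalerA -exprMn ?(mulrC t') tt' expr1n scale1r //.
Qed.
End LaurentK1.

(** * The algebra S_n *)

Section Relations.
Variables (R : nzRingType) (n : nat) (X Y : nat -> R).
Local Notation idx := ({ffun 'I_n -> nat} * {ffun 'I_n -> nat})%type.

Definition Srel := (forall i, (0 < i <= n)%N -> Y i * X i = 1) /\
  (forall i j, (0 < i <= n)%N -> (0 < j <= n)%N -> i != j ->
        [/\ X i * Y j = Y j * X i, X i * X j = X j * X i & Y i * Y j = Y j * Y i]).

Definition mon (m : idx) : R := \prod_(i < n) (X i.+1 ^+ m.1 i * Y i.+1 ^+ m.2 i).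

(** Product rule of the bicyclic monoid in each coordinate; truncated subtraction covers both cases,
    as [y ^+ b * x ^+ c] is a power of [x] or of [y]. *)
Definition mulm (m m' : idx) : idx :=
  ([ffun i => m.1 i + (m'.1 i - m.2 i)], [ffun i => m'.2 i + (m.2 i - m'.1 i)])%N.

Hypothesis HR : Srel.

Lemma bic_mul i a b c d : (0 < i <= n)%N ->
  X i ^+ a * Y i ^+ b * (X i ^+ c * Y i ^+ d) = X i ^+ (a + (c - b)) * Y i ^+ (d + (b - c)).
Proof.
move=> hi; have YX := HR.1 i hi.
rewrite mulrA -(mulrA (X i ^+ a)); case: (leqP b c) => bc.
  by rewrite (mulYX_exp_le YX bc) (eqP bc) addn0 -exprD.
rewrite (mulYX_exp_ge YX (ltnW bc)); have -> : (c - b = 0)%N by apply/eqP; rewrite subn_eq0 ltnW.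
by rewrite addn0 -mulrA -exprD addnC.
Qed.

Lemma bic_comm i j a b c d : (0 < i <= n)%N -> (0 < j <= n)%N -> i != j ->
  GRing.comm (X i ^+ a * Y i ^+ b) (X j ^+ c * Y j ^+ d).
Proof.
move=> hi hj ij; have [h1 h2 h3] := HR.2 i j hi hj ij.
have ji : j != i by rewrite eq_sym.
have [h4 _ _] := HR.2 j i hj hi ji.
apply: commrM; apply: commr_sym; apply: commrM; apply: commrX; apply: commr_sym; apply: commrX => //.
Qed.

Lemma mon_mul m m' : mon m * mon m' = mon (mulm m m').
Proof.
rewrite /mon; elim: (index_enum _) (index_enum_uniq 'I_n) => [|i s IH] /=; first by rewrite !big_nil mulr1.
move=> /andP[si us]; rewrite !big_cons -(IH us).
have c : GRing.comm (\prod_(j <- s) (X j.+1 ^+ m.1 j * Y j.+1 ^+ m.2 j)) (X i.+1 ^+ m'.1 i * Y i.+1 ^+ m'.2 i).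
  apply: commr_sym; rewrite big_seq; apply: commr_prod => j js.
  have ij : i.+1 != j.+1 by rewrite eqSS; apply: contraNneq si => e; rewrite (val_inj e).
  by apply: bic_comm; rewrite ?ltn_ord.
rewrite !ffunE -bic_mul ?ltn_ord //.
set P := \prod_(j <- s) (X j.+1 ^+ m.1 j * Y j.+1 ^+ m.2 j) in c *.
have {}c : P * (X i.+1 ^+ m'.1 i * Y i.+1 ^+ m'.2 i) = X i.+1 ^+ m'.1 i * Y i.+1 ^+ m'.2 i * P := c.
by rewrite -mulrA (mulrA P) c !mulrA.
Qed.

Lemma mon0 (m : idx) : (forall i, m.1 i = 0%N) -> (forall i, m.2 i = 0%N) -> mon m = 1.
Proof. by move=> h1 h2; rewrite /mon big1 // => i _; rewrite h1 h2 mulr1. Qed.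

Definition idx0 : idx := ([ffun=> 0%N], [ffun=> 0%N]).
Lemma mon_idx0 : mon idx0 = 1.
Proof. by apply: mon0 => i; rewrite ffunE. Qed.

Lemma mon_one (m : idx) (o : 'I_n) : (forall i, i != o -> m.1 i = 0%N /\ m.2 i = 0%N) ->
  mon m = X o.+1 ^+ m.1 o * Y o.+1 ^+ m.2 o.
Proof.
move=> h; rewrite /mon; elim: (index_enum _) (index_enum_uniq 'I_n) (mem_index_enum o) => // i s IH /=.
move=> /andP[si us]; rewrite inE big_cons => /orP[/eqP e|os].
  rewrite -e in si *; rewrite big_seq big1 ?mulr1 // => j js.
  have [|-> ->] := h j; last by rewrite mulr1.
  by apply: contraNneq si => <-.
rewrite (IH us os); have [|-> ->] := h i; last by rewrite !mul1r.
by apply: contraNneq si => ->.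
Qed.
End Relations.

(** * The monomial basis, retractions and compressions *)

Section Structure.
Variables (K : fieldType) (A : unitAlgType K) (n : nat) (x y : nat -> A).
Hypothesis HS : is_Sn n x y.
Local Notation idx := ({ffun 'I_n -> nat} * {ffun 'I_n -> nat})%type.
Local Notation M' := (@mon A n x y).

Let HR : Srel n x y. Proof. by case: HS. Qed.


Lemma A_ind (P : A -> Prop) : P 0 -> (forall a b, P a -> P b -> P (a + b)) ->
  (forall c (m : idx), P (c *: M' m)) -> forall a, P a.
Proof.
move=> P0 PD PM a; case: HS => _ _ /(_ a) [s [c ->]] _.
by apply: big_ind => // m _; apply: PM.
Qed.

(** Linear extension from the monomial basis. Elements are treated as lists of terms grouped by
    monomial, since independence is available for duplicate-free lists. *)
Lemma ext_exists (V : zmodType) (sc : K -> V -> V) (g : idx -> V) :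
  (forall c v w, sc c (v + w) = sc c v + sc c w) ->
  (forall c d v, sc (c + d) v = sc c v + sc d v) ->
  exists f : A -> V, (forall a b, f (a + b) = f a + f b) /\ (forall c m, f (c *: M' m) = sc c (g m)).
Proof.
move=> scDr scDl; have [_ _ span ind] := HS.
have sc0 v : sc 0 v = 0 by apply: (addrI (sc 0 v)); rewrite -scDl !addr0.
pose S (l : seq (K * idx)) := \sum_(p <- l) p.1 *: M' p.2.
pose T (l : seq (K * idx)) := \sum_(p <- l) sc p.1 (g p.2).
have scN c v : sc (- c) v = - sc c v by apply: (addrI (sc c v)); rewrite -scDl !subrr.
have group (W : zmodType) (l : seq (K * idx)) (F : K * idx -> W) :
    \sum_(p <- l) F p = \sum_(m <- undup [seq p.2 | p <- l]) \sum_(p <- l | p.2 == m) F p.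
  rewrite (exchange_big_dep xpredT) //= [LHS]big_seq [RHS]big_seq; apply: eq_bigr => p pl.
  under eq_bigl => m do rewrite eq_sym.
  by rewrite -big_filter filter_pred1_uniq ?undup_uniq ?mem_undup ?map_f // big_seq1.
have HT l : S l = 0 -> T l = 0.
  pose c m := \sum_(p <- l | p.2 == m) p.1; pose s := undup [seq p.2 | p <- l].
  have eS : S l = \sum_(m <- s) c m *: M' m.
    rewrite /S group; apply: eq_bigr => m _; rewrite scaler_suml.
    by apply: eq_bigr => p /eqP ->.
  have eT : T l = \sum_(m <- s) sc (c m) (g m).
    rewrite /T group; apply: eq_bigr => m _; rewrite /c (big_morph (sc^~ (g m)) (fun c d => scDl c d (g m)) (sc0 _)).
    by apply: eq_bigr => p /eqP ->.
  rewrite eS eT => /(ind s c (undup_uniq _)) c0.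
  by rewrite big_seq big1 // => m ms; rewrite c0 // sc0.
have Srep a : exists l, S l = a.
  have [s [c ->]] := span a; exists [seq (c m, m) | m <- s].
  by rewrite /S big_map.
have [l Hl] := choice Srep.
pose neg (l : seq (K * idx)) := [seq (- p.1, p.2) | p <- l].
have Tneg l' : T (neg l') = - T l'.
  by rewrite /T big_map -sumrN; apply: eq_bigr => p _; rewrite scN.
have Sneg l' : S (neg l') = - S l'.
  by rewrite /S big_map -sumrN; apply: eq_bigr => p _; rewrite scaleNr.
have fT l' a : S l' = a -> T (l a) = T l'.
  move=> e; apply/eqP; rewrite -subr_eq0; apply/eqP; rewrite -Tneg.
  have -> : T (l a) + T (neg l') = T (l a ++ neg l') by rewrite /T big_cat.
  by apply: HT; rewrite /S big_cat /= -/(S _) -/(S _) Sneg Hl e subrr.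
exists (fun a => T (l a)); split=> [a b|c m].
  rewrite (fT (l a ++ l b)); first by rewrite /T big_cat.
  by rewrite /S big_cat /= -/(S _) -/(S _) !Hl.
by rewrite (fT [:: (c, m)]) /T /S big_seq1.
Qed.

Lemma universal (R : nzRingType) (ka : {rmorphism K -> R}) (X Y : nat -> R) : Srel n X Y ->
  (forall c z, ka c * z = z * ka c) ->
  exists f : {rmorphism A -> R}, forall c m, f (c *: M' m) = ka c * mon X Y m.
Proof.
move=> HX kaC.
have [f [fD fM]] := @ext_exists R (fun c z => ka c * z) (mon X Y)
   (fun c v w => mulrDr _ _ _) (fun c d v => etrans (congr1 (fun z => z * v) (rmorphD ka c d)) (mulrDl _ _ _)).
have f0 : f 0 = 0 by apply: (addrI (f 0)); rewrite -fD !addr0.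
have fN a : f (- a) = - f a by apply: (addrI (f a)); rewrite -fD !subrr.
have fB : {morph f : a b / a - b} by move=> a b; rewrite fD fN.
have f1 : f 1 = 1.
  by have := fM 1 (idx0 n); rewrite !mon_idx0 scale1r rmorph1 mulr1.
have fMM a b : f (a * b) = f a * f b.
  move: a b; apply: A_ind => [b|a a' IH IH' b|c m]; first by rewrite mul0r f0 mul0r.
    by rewrite mulrDl !fD IH IH' mulrDl.
  apply: A_ind => [|b b' IH IH'|d m']; first by rewrite mulr0 f0 mulr0.
    by rewrite mulrDr !fD IH IH' mulrDr.
  rewrite -scalerAl -scalerAr scalerA (mon_mul HR) !fM rmorphM /= -(mon_mul HX).
  by rewrite -!mulrA; congr (_ * _); rewrite !mulrA kaC.
pose fAm := @GRing.isZmodMorphism.Build A R f fB.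
pose fMm := @GRing.isMonoidMorphism.Build A R f (conj f1 fMM).
pose F : {rmorphism A -> R} := HB.pack f fAm fMm.
by exists F.
Qed.

Definition xidx (o : 'I_n) (a b : nat) : idx := ([ffun i => if i == o then a else 0%N], [ffun i => if i == o then b else 0%N]).

Lemma mon_xidx (R : nzRingType) (X Y : nat -> R) o a b : mon X Y (xidx o a b) = X o.+1 ^+ a * Y o.+1 ^+ b.
Proof.
rewrite (mon_one X Y (o := o)); first by rewrite !ffunE eqxx.
by move=> i io; rewrite !ffunE (negPf io).
Qed.

Lemma universal_gen (R : nzRingType) (ka : {rmorphism K -> R}) (X Y : nat -> R) : Srel n X Y ->
  (forall c z, ka c * z = z * ka c) ->
  exists f : {rmorphism A -> R}, [/\ forall c m, f (c *: M' m) = ka c * mon X Y m, forall c, f c%:A = ka c &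
    forall i, (0 < i <= n)%N -> f (x i) = X i /\ f (y i) = Y i].
Proof.
move=> HX kaC; have [f Hf] := universal HX kaC; exists f; split=> // [c|i /andP[i0 i_n]].
  by have := Hf c (idx0 n); rewrite !mon_idx0 mulr1.
case: i i0 i_n => // i _ i_n; pose o := Ordinal i_n.
have := Hf 1 (xidx o 1 0); have := Hf 1 (xidx o 0 1).
by rewrite !mon_xidx !scale1r rmorph1 !mul1r !mulr1 !expr1 => -> ->.
Qed.

Definition erase (s : nat) (m : idx) : idx :=
  ([ffun i : 'I_n => if i.+1 == s then 0%N else m.1 i], [ffun i : 'I_n => if i.+1 == s then 0%N else m.2 i]).

(** Setting [x s] and [y s] to 1 is a retraction onto the subalgebra of the other variables, and it
    kills [ee s]. So a congruence that involves [ee s], between elements free of [s], can be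
    replaced by one without [ee s]. *)
Lemma eps_exists s : exists f : {rmorphism A -> A},
  [/\ forall c m, f (c *: M' m) = c *: M' (erase s m), forall c, f c%:A = c%:A, (0 < s <= n)%N -> f (x s) = 1 /\ f (y s) = 1 &
    forall i, (0 < i <= n)%N -> i != s -> f (x i) = x i /\ f (y i) = y i].
Proof.
pose X i := if i == s then 1 else x i; pose Y i := if i == s then 1 else y i.
have HX : Srel n X Y.
  split=> [i hi|i j hi hj ij]; rewrite /X /Y; first by case: eqP => _; [rewrite mulr1|apply: HR.1].
  have [h1 h2 h3] := HR.2 i j hi hj ij.
  by case: eqP => _; case: eqP => _; rewrite ?mulr1 ?mul1r.
have kaC (c : K) (z : A) : c%:A * z = z * c%:A by rewrite mulr_algl mulr_algr.
have [f [h1 h2 h3]] := @universal_gen A (in_alg A) X Y HX kaC.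
exists f; split=> // [c m|hs|i hi si].
- rewrite h1 /= mulr_algl; congr (_ *: _); apply: eq_bigr => i _; rewrite !ffunE /X /Y.
  by case: eqP => _; rewrite ?expr1n ?expr0.
- by have [-> ->] := h3 s hs; rewrite /X /Y eqxx.
- by have [-> ->] := h3 i hi; rewrite /X /Y (negPf si).
Qed.

Definition eps s : {rmorphism A -> A} := projT1 (cid (eps_exists s)).

Lemma eps_mon s c m : eps s (c *: M' m) = c *: M' (erase s m).
Proof. by have [] := projT2 (cid (eps_exists s)). Qed.
Lemma eps_scal s c : eps s c%:A = c%:A.
Proof. by have [] := projT2 (cid (eps_exists s)). Qed.
Lemma eps_xs s : (0 < s <= n)%N -> eps s (x s) = 1.
Proof. by have [_ _ h _] := projT2 (cid (eps_exists s)) => /h []. Qed.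
Lemma eps_ys s : (0 < s <= n)%N -> eps s (y s) = 1.
Proof. by have [_ _ h _] := projT2 (cid (eps_exists s)) => /h []. Qed.
Lemma eps_x s i : (0 < i <= n)%N -> i != s -> eps s (x i) = x i.
Proof. by have [_ _ _ h] := projT2 (cid (eps_exists s)) => hi /(h i hi) []. Qed.
Lemma eps_y s i : (0 < i <= n)%N -> i != s -> eps s (y i) = y i.
Proof. by have [_ _ _ h] := projT2 (cid (eps_exists s)) => hi /(h i hi) []. Qed.

Lemma mproj_exists (chi : pred idx) : exists f : A -> A,
  (forall a b, f (a + b) = f a + f b) /\ (forall c m, f (c *: M' m) = if chi m then c *: M' m else 0).
Proof.
have [f [h1 h2]] := @ext_exists A (fun c v => c *: v) (fun m => if chi m then M' m else 0)
  (fun c v w => scalerDr c v w) (fun c d v => scalerDl v c d).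
by exists f; split=> // c m; rewrite h2; case: ifP => // _; rewrite scaler0.
Qed.
Definition mproj chi : A -> A := projT1 (cid (mproj_exists chi)).
Lemma mprojD chi a b : mproj chi (a + b) = mproj chi a + mproj chi b.
Proof. by have [h1 h2] := projT2 (cid (mproj_exists chi)); apply: h1. Qed.
Lemma mproj_mon chi c m : mproj chi (c *: M' m) = if chi m then c *: M' m else 0.
Proof. by have [h1 h2] := projT2 (cid (mproj_exists chi)); apply: h2. Qed.
Lemma mproj0 chi : mproj chi 0 = 0.
Proof. by apply: (addrI (mproj chi 0)); rewrite -mprojD !addr0. Qed.
Lemma mprojN chi a : mproj chi (- a) = - mproj chi a.
Proof. by apply: (addrI (mproj chi a)); rewrite -mprojD !subrr mproj0. Qed.
Lemma mprojB chi a b : mproj chi (a - b) = mproj chi a - mproj chi b.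
Proof. by rewrite mprojD mprojN. Qed.

(** The ideal is spanned by the differences between a product of two monomials and the same product
    with [x q * y q] inserted; by hypothesis [chi] keeps both or drops both. *)
Lemma mproj_pI (chi : pred idx) q : (0 < q <= n)%N ->
  (forall (o : 'I_n) m1 m2, o.+1 = q -> chi (mulm (mulm m1 (xidx o 1 1)) m2) = chi (mulm m1 m2)) ->
  forall a, pI x y q a -> pI x y q (mproj chi a).
Proof.
move=> /andP[q0 qn] hchi a; elim=> [|{}a [u [v ->]]|b d _ IHb _ IHd]; last first.
- by rewrite mprojD; apply: sumsD.
- have [o oq] : exists o : 'I_n, o.+1 = q by case: q q0 qn {hchi} => // q _ qn; exists (Ordinal qn).
  move: u v; apply: A_ind => [v|u u' IH IH' v|c m].
  + by rewrite !mul0r mproj0; apply: sums0.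
  + by rewrite !mulrDl mprojD; apply: sumsD; [apply: IH|apply: IH'].
  apply: A_ind => [|v v' IH IH'|d m'].
  + by rewrite !mulr0 mproj0; apply: sums0.
  + by rewrite mulrDr mprojD; apply: sumsD; [exact IH|exact IH'].
  have -> : c *: M' m * ee x y q * (d *: M' m') =
     (c * d) *: M' (mulm m m') - (c * d) *: M' (mulm (mulm m (xidx o 1 1)) m').
    rewrite -!(mon_mul HR) mon_xidx !expr1 oq /ee -!scalerAl -!scalerAr scalerA -scalerBr; congr (_ *: _).
    by rewrite mulrBr mulrBl mulr1.
  rewrite mprojB !mproj_mon hchi //; case: ifP => _; last by rewrite subr0; apply: sums0.
  apply: sumsG; exists ((c * d) *: M' m), (M' m').
  rewrite -!(mon_mul HR) mon_xidx !expr1 oq /ee -!scalerAl -scalerBr; congr (_ *: _).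
  by rewrite mulrBr mulrBl mulr1.
- by rewrite mproj0; apply: sums0.
Qed.

Definition chi0 s (m : idx) := [forall o : 'I_n, (o.+1 == s) ==> ((m.1 o == 0%N) && (m.2 o == 0%N))].
(** A conditional expectation onto the elements free of [s]: by [corner] it computes the compression
    to the corner of [ee s]. *)
Definition tau s := mproj (chi0 s).
Lemma tauE s a : tau s a = mproj (chi0 s) a. Proof. by []. Qed.

Lemma ordP s : (0 < s <= n)%N -> exists o : 'I_n, o.+1 = s.
Proof. by case: s => // s /= sn; exists (Ordinal sn). Qed.

Lemma chi0E s (o : 'I_n) m : o.+1 = s -> chi0 s m = (m.1 o == 0%N) && (m.2 o == 0%N).
Proof.
move=> os; apply/forallP/idP => [/(_ o)|h i]; first by rewrite os eqxx.
by apply/implyP; rewrite -os eqSS => /eqP/val_inj ->.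
Qed.

(* The elements in which the variables of index [s] do not occur; [Cs n] is the subalgebra S_(n-1). *)
Definition Cs s (a : A) := eps s a = a.
Lemma CsE s a : Cs s a = (eps s a = a). Proof. by []. Qed.

Lemma eraseK s m : erase s (erase s m) = erase s m.
Proof. by congr (_, _); apply/ffunP => i; rewrite !ffunE; case: (i.+1 == s). Qed.
Lemma epsK s a : Cs s (eps s a).
Proof.
move: a; apply: A_ind => [|a b Ha Hb|c m]; rewrite /Cs ?rmorph0 // ?rmorphD ?Ha ?Hb //.
by rewrite !eps_mon eraseK.
Qed.
Lemma Cs1 s : Cs s 1. Proof. exact: rmorph1. Qed.
Lemma Cs0 s : Cs s 0. Proof. exact: rmorph0. Qed.
Lemma CsB s a b : Cs s a -> Cs s b -> Cs s (a - b).
Proof. by rewrite /Cs rmorphB => -> ->. Qed.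
Lemma CsD s a b : Cs s a -> Cs s b -> Cs s (a + b).
Proof. by rewrite /Cs rmorphD => -> ->. Qed.
Lemma CsM s a b : Cs s a -> Cs s b -> Cs s (a * b).
Proof. by rewrite /Cs rmorphM => -> ->. Qed.
Lemma CsX s a k : Cs s a -> Cs s (a ^+ k).
Proof. by rewrite /Cs rmorphXn => ->. Qed.

Lemma Cs_ind s (P : A -> Prop) : P 0 -> (forall a b, P a -> P b -> P (a + b)) ->
  (forall c (m : idx), (forall o : 'I_n, o.+1 = s -> m.1 o = 0%N /\ m.2 o = 0%N) -> P (c *: M' m)) -> forall a, Cs s a -> P a.
Proof.
move=> P0 PD PM a <-; move: a; apply: A_ind => [|a b Ha Hb|c m]; rewrite ?rmorph0 ?rmorphD //; first exact: PD.
by rewrite eps_mon; apply: PM => o os; rewrite !ffunE os eqxx.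
Qed.

Lemma Cs_comm s a : (0 < s <= n)%N -> Cs s a -> a * x s = x s * a /\ a * y s = y s * a.
Proof.
move=> hs; move: a; apply: Cs_ind => [|a b [h1 h2] [h3 h4]|c m hm].
- by rewrite !mul0r !mulr0.
- by rewrite !mulrDl !mulrDr h1 h2 h3 h4.
rewrite -!scalerAl -!scalerAr; suff : GRing.comm (x s) (M' m) /\ GRing.comm (y s) (M' m) by case=> -> ->.
split; apply: commr_prod => i _.
  have [ise|ise] := eqVneq i.+1 s; first by have [-> ->] := hm i ise; rewrite mulr1; apply: commr1.
  have := @bic_comm _ _ _ _ HR s i.+1 1 0 (m.1 i) (m.2 i); rewrite expr1 mulr1; by apply; rewrite ?ltn_ord // eq_sym.
have [ise|ise] := eqVneq i.+1 s; first by have [-> ->] := hm i ise; rewrite mulr1; apply: commr1.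
have := @bic_comm _ _ _ _ HR s i.+1 0 1 (m.1 i) (m.2 i); rewrite expr1 mul1r; by apply; rewrite ?ltn_ord // eq_sym.
Qed.

Lemma mon_split s (o : 'I_n) m : o.+1 = s -> M' m = M' (erase s m) * (x s ^+ m.1 o * y s ^+ m.2 o).
Proof.
move=> os; rewrite -os -(mon_xidx x y) (mon_mul HR); congr (M' (_, _)); apply/ffunP => i; rewrite !ffunE eqSS.
  by have [/val_inj ->|ne] := eqVneq (i : nat) o; rewrite ?eqxx ?subn0 //=;
     have -> : (i == o) = false by [apply: contraNF ne => /eqP ->]; rewrite ?addn0.
by have [/val_inj ->|ne] := eqVneq (i : nat) o; rewrite ?eqxx ?subn0 ?addn0 //=;
     have -> : (i == o) = false by [apply: contraNF ne => /eqP ->]; rewrite ?add0n ?subn0.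
Qed.

Lemma A_span s (P : A -> Prop) : (0 < s <= n)%N -> P 0 -> (forall a b, P a -> P b -> P (a + b)) ->
  (forall b k l, Cs s b -> P (b * x s ^+ k * y s ^+ l)) -> forall a, P a.
Proof.
move=> hs P0 PD PM; have [o os] := ordP hs; apply: A_ind => // c m.
rewrite (mon_split _ os) scalerAl mulrA; apply: PM.
by rewrite /Cs -[_ *: _]/(c *: M' (erase s m)) eps_mon eraseK.
Qed.

Lemma mprojM_Cs (chi : pred idx) s a c : (0 < s <= n)%N ->
  (forall (o : 'I_n) (m m' : idx), o.+1 = s -> m'.1 o = 0%N -> m'.2 o = 0%N ->
     chi (mulm m m') = chi m /\ chi (mulm m' m) = chi m) -> Cs s c ->
  mproj chi (a * c) = mproj chi a * c /\ mproj chi (c * a) = c * mproj chi a.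
Proof.
move=> hs hchi Cc; have [o os] := ordP hs; move: c Cc; apply: Cs_ind => [|c c' [h1 h2] [h3 h4]|c m hm].
- by rewrite !mul0r !mulr0 mproj0.
- by rewrite !mulrDl !mulrDr !mprojD h1 h2 h3 h4.
have [m1 m2] := hm o os; move: a; apply: A_ind => [|a a' [h1 h2] [h3 h4]|d m'].
- by rewrite !mul0r !mulr0 mproj0 mul0r mulr0.
- by rewrite !mulrDl !mulrDr !mprojD mulrDl mulrDr h1 h2 h3 h4.
have [c1 c2] := hchi o m' m os m1 m2.
rewrite -!scalerAl -!scalerAr !scalerA !(mon_mul HR) !mproj_mon c1 c2; case: ifP => _.
  by rewrite -!scalerAl -!scalerAr !scalerA !(mon_mul HR) (mulrC d).
by rewrite mul0r mulr0 scaler0.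
Qed.

Lemma tau_Cs s a c : (0 < s <= n)%N -> Cs s c -> tau s (a * c) = tau s a * c /\ tau s (c * a) = c * tau s a.
Proof.
move=> hs; apply: mprojM_Cs => // o m m' os m1 m2; rewrite !(chi0E _ os) !ffunE m1 m2 !sub0n !subn0 !addn0 add0n.
by split=> //; rewrite add0n.
Qed.
Lemma tauMr s a c : (0 < s <= n)%N -> Cs s c -> tau s (a * c) = tau s a * c.
Proof. by move=> hs /(tau_Cs a hs) []. Qed.
Lemma tauMl s a c : (0 < s <= n)%N -> Cs s c -> tau s (c * a) = c * tau s a.
Proof. by move=> hs /(tau_Cs a hs) []. Qed.

Lemma tau_xy s k l : (0 < s <= n)%N -> tau s (x s ^+ k * y s ^+ l) = if (k == 0%N) && (l == 0%N) then 1 else 0.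
Proof.
move=> hs; have [o os] := ordP hs.
have := mproj_mon (chi0 s) 1 (xidx o k l); rewrite mon_xidx os scale1r => h; rewrite /tau h.
rewrite (chi0E _ os) !ffunE eqxx; case: eqP => // ->; case: eqP => // ->; by rewrite mulr1.
Qed.
Lemma tau1 s : (0 < s <= n)%N -> tau s 1 = 1.
Proof. by move=> hs; have := tau_xy 0 0 hs; rewrite mulr1. Qed.


Lemma tau_in_Cs s a : (0 < s <= n)%N -> Cs s (tau s a).
Proof.
move=> hs; move: a; apply: (A_span hs) => [|a b Ha Hb|b k l Cb].
- by rewrite /tau mproj0; apply: Cs0.
- by rewrite /tau mprojD; apply: CsD.
rewrite -mulrA tauMl // tau_xy //; apply: CsM => //; case: ifP => _; [exact: Cs1|exact: Cs0].
Qed.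

Lemma YX s : (0 < s <= n)%N -> y s * x s = 1. Proof. exact: HR.1. Qed.
Lemma y_ee s : (0 < s <= n)%N -> y s * ee x y s = 0. Proof. by move=> hs; apply: mulY_e (YX hs). Qed.
Lemma ee_x s : (0 < s <= n)%N -> ee x y s * x s = 0. Proof. by move=> hs; apply: mule_X (YX hs). Qed.
Lemma ee_idem s : (0 < s <= n)%N -> ee x y s * ee x y s = ee x y s.
Proof. by move=> hs; rewrite {2}/ee mulrBr mulr1 mulrA ee_x // mul0r subr0. Qed.
Lemma ee_comm s c : (0 < s <= n)%N -> Cs s c -> ee x y s * c = c * ee x y s.
Proof.
move=> hs Cc; have [h1 h2] := Cs_comm hs Cc; rewrite /ee mulrBl mulrBr mul1r mulr1; congr (_ - _).
by rewrite mulrA h1 -!mulrA h2.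
Qed.

Lemma corner s a : (0 < s <= n)%N -> ee x y s * a * ee x y s = ee x y s * tau s a.
Proof.
move=> hs; move: a; apply: (A_span hs) => [|a b Ha Hb|b k l Cb].
- by rewrite /tau mproj0 mulr0 mul0r.
- by rewrite /tau mprojD (mulrDr _ a) (mulrDl _ _ (ee x y s)) Ha Hb mulrDr.
rewrite -(mulrA b) tauMl // tau_xy // !mulrA (ee_comm hs Cb); case: k => [|k].
  case: l => [|l] /=; first by rewrite !expr0 !mulr1 -mulrA ee_idem.
  by rewrite exprSr mulrA -(mulrA _ (y s)) y_ee // !mulr0.
by rewrite exprS mulrA -(mulrA b) ee_x // mulr0 !mul0r mulr0.
Qed.

Lemma tau_ee s c : (0 < s <= n)%N -> Cs s c -> tau s (ee x y s * c) = c.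
Proof.
move=> hs Cc; rewrite tauMr // /ee /tau mprojB -/(tau s _) -/(tau s _) tau1 //.
by have := tau_xy 1 1 hs; rewrite !expr1 => ->; rewrite subr0 mul1r.
Qed.

Lemma tau_mul_ee s a b : (0 < s <= n)%N -> tau s (a * ee x y s * b) = tau s a * tau s b.
Proof.
move=> hs; have Ca := tau_in_Cs a hs; have Cb := tau_in_Cs b hs.
have e c : Cs s (tau s c) -> tau s (ee x y s * c * ee x y s) = tau s c by rewrite corner //; apply: tau_ee.
rewrite -(tau_ee hs (tau_in_Cs (a * ee x y s * b) hs)) -corner //.
have -> : ee x y s * (a * ee x y s * b) * ee x y s = (ee x y s * a * ee x y s) * (ee x y s * b * ee x y s).
  by rewrite !mulrA -(mulrA _ (ee x y s) (ee x y s)) ee_idem.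
rewrite !corner // mulrA -(mulrA _ _ (ee x y s)) -ee_comm // mulrA ee_idem // -mulrA tau_ee //.
exact: CsM.
Qed.

Definition IQ (Q : seq nat) (a : A) := sums (fun z => exists q u v, q \in Q /\ z = u * ee x y q * v) a.

Lemma IQ_D Q a b : IQ Q a -> IQ Q b -> IQ Q (a + b). Proof. exact: sumsD. Qed.
Lemma IQ_0 Q : IQ Q 0. Proof. exact: sums0. Qed.
Lemma IQ_Ml Q a b : IQ Q b -> IQ Q (a * b).
Proof.
elim=> [|{}b [q [u [v [qQ ->]]]]|c d _ IHc _ IHd].
- by rewrite mulr0; apply: sums0.
- by apply: sumsG; exists q, (a * u), v; rewrite !mulrA.
- by rewrite mulrDr; apply: sumsD.
Qed.
Lemma IQ_Mr Q a b : IQ Q a -> IQ Q (a * b).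
Proof.
elim=> [|{}a [q [u [v [qQ ->]]]]|c d _ IHc _ IHd].
- by rewrite mul0r; apply: sums0.
- by apply: sumsG; exists q, u, (v * b); rewrite !mulrA.
- by rewrite mulrDl; apply: sumsD.
Qed.
Lemma IQ_N Q a : IQ Q a -> IQ Q (- a).
Proof. by rewrite -mulN1r; apply: IQ_Ml. Qed.
Lemma IQ_B Q a b : IQ Q a -> IQ Q b -> IQ Q (a - b).
Proof. by move=> Ia Ib; apply: IQ_D => //; apply: IQ_N. Qed.
Lemma IQ_ee Q q : q \in Q -> IQ Q (ee x y q).
Proof. by move=> qQ; apply: sumsG; exists q, 1, 1; rewrite mul1r mulr1. Qed.
Lemma IQ_W Q Q' a : {subset Q <= Q'} -> IQ Q a -> IQ Q' a.
Proof.
move=> QQ; elim=> [|{}a [q [u [v [qQ ->]]]]|c d _ IHc _ IHd]; first exact: sums0; last exact: sumsD.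
by apply: sumsG; exists q, u, v; split=> //; apply: QQ.
Qed.
Lemma IQ_nil a : IQ [::] a -> a = 0.
Proof. by elim=> [|{}a [q [u [v []]]]|c d _ -> _ ->]; rewrite ?addr0. Qed.
Lemma IQ_pI q a : IQ [:: q] a <-> pI x y q a.
Proof.
split; elim.
- exact: sums0.
- by move=> ? [q' [u [v []]]]; rewrite inE => /eqP -> ->; apply: sumsG; exists u, v.
- by move=> c d _ IHc _ IHd; apply: sumsD.
- exact: sums0.
- by move=> ? [u [v ->]]; apply: sumsG; exists q, u, v; rewrite inE eqxx.
- by move=> c d _ IHc _ IHd; apply: sumsD.
Qed.
Lemma IQ_cons q Q a : IQ (q :: Q) a -> exists b c, [/\ IQ [:: q] b, IQ Q c & a = b + c].
Proof.
elim=> [|{}a [q' [u [v [qQ ->]]]]|a1 a2 _ [b1 [c1 [h1 h2 ->]]] _ [b2 [c2 [h3 h4 ->]]]].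
- by exists 0, 0; rewrite addr0; split=> //; apply: sums0.
- case/predU1P: qQ => [->|qQ].
    by exists (u * ee x y q * v), 0; rewrite addr0; split; [apply: IQ_Mr; apply: IQ_Ml; apply: IQ_ee; rewrite inE|apply: sums0|].
  by exists 0, (u * ee x y q' * v); rewrite add0r; split; [apply: sums0|apply: IQ_Mr; apply: IQ_Ml; apply: IQ_ee|].
- by exists (b1 + b2), (c1 + c2); rewrite addrACA; split=> //; apply: IQ_D.
Qed.

Lemma mproj_IQ (chi : pred idx) Q : (forall q, q \in Q -> (0 < q <= n)%N) ->
  (forall q, q \in Q -> forall (o : 'I_n) m1 m2, o.+1 = q -> chi (mulm (mulm m1 (xidx o 1 1)) m2) = chi (mulm m1 m2)) ->
  forall a, IQ Q a -> IQ Q (mproj chi a).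
Proof.
move=> hQ hchi a; elim=> [|{}a [q [u [v [qQ ->]]]]|b d _ IHb _ IHd].
- by rewrite mproj0; apply: sums0.
- apply: (@IQ_W [:: q]); first by move=> z; rewrite inE => /eqP ->.
  by apply/IQ_pI/mproj_pI; [exact: hQ|exact: hchi|apply: sumsG; exists u, v].
- by rewrite mprojD; apply: sumsD.
Qed.

Lemma tau_IQ s Q : (0 < s <= n)%N -> s \notin Q -> (forall q, q \in Q -> (0 < q <= n)%N) ->
  forall a, IQ Q a -> IQ Q (tau s a).
Proof.
move=> hs sQ hQ; apply: mproj_IQ => // q qQ o m1 m2 oq.
have [o' os] := ordP hs; rewrite !(chi0E _ os) !ffunE.
have -> : (o' == o) = false.
  by apply: contraNF sQ => /eqP e; rewrite -os e oq.
by rewrite !sub0n !addn0 subn0 add0n.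
Qed.

Lemma eps_IQ s Q : (0 < s <= n)%N -> (forall q, q \in Q -> (0 < q <= n)%N) ->
  forall a, IQ Q a -> IQ [seq q <- Q | q != s] (eps s a).
Proof.
move=> hs hQ a; elim=> [|{}a [q [u [v [qQ ->]]]]|b d _ IHb _ IHd]; rewrite ?rmorph0 ?rmorphD ?rmorphM /=.
- exact: sums0.
- rewrite /ee rmorphB rmorph1 rmorphM /=; have [->|qs] := eqVneq q s.
    by rewrite eps_xs // eps_ys // mulr1 subrr mulr0 mul0r; apply: sums0.
  rewrite eps_x ?eps_y ?hQ //; apply: sumsG; exists q, (eps s u), (eps s v); rewrite mem_filter qs qQ //.
- exact: sumsD.
Qed.

Lemma aug_exists : exists f : {rmorphism A -> K}, (forall c, f c%:A = c) /\
  forall i, (0 < i <= n)%N -> f (x i) = 1 /\ f (y i) = 1.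
Proof.
have HX : Srel n (fun _ => 1 : K) (fun _ => 1 : K) by split=> [i _|i j _ _ _]; rewrite ?mulr1.
have [f [_ h2 h3]] := @universal_gen K (idfun : {rmorphism K -> K}) _ _ HX (fun c z => mulrC _ _).
by exists f.
Qed.

Lemma IQ_proper Q : (forall q, q \in Q -> (0 < q <= n)%N) -> ~ IQ Q 1.
Proof.
move=> hQ I1; have [f [_ hf]] := aug_exists.
suff : f 1 = 0 by rewrite rmorph1 => /eqP; rewrite oner_eq0.
elim: I1 => [|a [q [u [v [qQ ->]]]]|b d _ IHb _ IHd]; rewrite ?rmorph0 ?rmorphD ?rmorphM ?IHb ?IHd ?addr0 //=.
have [h1 h2] := hf q (hQ q qQ).
by rewrite /ee rmorphB rmorph1 rmorphM /= h1 h2 mulr1 subrr mulr0 mul0r.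
Qed.
End Structure.

(** * Quotients by the ideals generated by idempotents *)

Section Models.
Variables (K : fieldType) (A : unitAlgType K) (n : nat) (x y : nat -> A).
Hypothesis HS : is_Sn n x y.
Hypothesis n0 : (0 < n)%N.
Local Notation idx := ({ffun 'I_n -> nat} * {ffun 'I_n -> nat})%type.
Local Notation M' := (@mon A n x y).
Local Notation Cs := (Cs HS).
Local Notation IQ := (IQ x y).
Local Notation tau := (tau HS).
Local Notation eps := (eps HS).
Local Notation ee := (ee x y).
Local Notation xn := (x n).
Local Notation yn := (y n).
Local Notation tt_ := (fun _ _ : nat => true).

Let hn : (0 < n <= n)%N. Proof. by rewrite n0 leqnn. Qed.

(** An element fixed by all these retractions equals its image under their composite, which produces
    only monomials free of the listed variables. *)
Lemma Cs_seq_ind (L : seq nat) (P : A -> Prop) : P 0 -> (forall a b, P a -> P b -> P (a + b)) ->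
  (forall c (m : idx), (forall o : 'I_n, o.+1 \in L -> m.1 o = 0%N /\ m.2 o = 0%N) -> P (c *: M' m)) ->
  forall a, (forall i, i \in L -> Cs i a) -> P a.
Proof.
move=> P0 PD PM a Ha.
have -> : a = foldr (fun i z => eps i z) a L.
  elim: L Ha {PM} => //= i L IH Ha; rewrite -IH; first by rewrite Ha // inE eqxx.
  by move=> j jL; apply: Ha; rewrite inE jL orbT.
move: a {Ha}; apply: (A_ind HS) => [|a b Ha Hb|c m].
- by suff -> : foldr (fun i z => eps i z) 0 L = 0 by []; elim: L {PM} => //= i L ->; rewrite rmorph0.
- have -> : foldr (fun i z => eps i z) (a + b) L = foldr (fun i z => eps i z) a L + foldr (fun i z => eps i z) b L.
    by elim: L {PM Ha Hb} => //= i L ->; rewrite rmorphD.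
  exact: PD.
have -> : foldr (fun i z => eps i z) (c *: M' m) L = c *: M' (foldr (@erase n) m L).
  by elim: L {PM} => //= i L ->; rewrite eps_mon.
apply: PM => o; elim: L => //= i L IH; rewrite inE !ffunE; case: eqP => //= _ oL; exact: IH.
Qed.

Lemma Cs_all_scalar a : (forall i, (0 < i <= n)%N -> Cs i a) -> exists c, a = c%:A.
Proof.
move=> Ha; move: a {Ha} (fun i => Ha i) => a Ha.
apply: (@Cs_seq_ind (iota 1 n) (fun a => exists c, a = c%:A)) => [|b d [c ->] [c' ->]|c m hm|i].
- by exists 0; rewrite scale0r.
- by exists (c + c'); rewrite scalerDl.
- exists c; congr (_ *: _); apply: mon0 => i; have [] := hm i; rewrite ?mem_iota ?add1n //=; exact: ltn_ord.
- by rewrite mem_iota add1n ltnS; apply: Ha.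
Qed.

(** The entry at ([k], [l]) is moved to position (0, 0) by the shifts and read off by [tau n]; the
    bound allows cutting with [Pn] on both sides. *)
Lemma bnd_expand (z : A) N : bnd xn yn N z ->
  z = \sum_(k < N) \sum_(l < N) tau n (yn ^+ k * z * xn ^+ l) * Ekl xn yn k l.
Proof.
move=> bz; have [h1 h2] := Pn_bnd bz.
rewrite -{1}h2 -{1}h1 (PnE xn yn) mulr_suml mulr_suml; apply: eq_bigr => k _.
rewrite mulr_sumr; apply: eq_bigr => l _.
have Ct := tau_in_Cs HS (yn ^+ k * z * xn ^+ l) hn.
rewrite {1 2}/Ekl !mulrA.
have -> : xn ^+ k * (1 - xn * yn) * yn ^+ k * z * xn ^+ l * (1 - xn * yn) * yn ^+ l =
   xn ^+ k * (ee n * (yn ^+ k * z * xn ^+ l) * ee n) * yn ^+ l by rewrite /Defs.ee !mulrA.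
rewrite (corner HS) // (ee_comm hn Ct); have [h3 h4] := Cs_comm hn Ct.
by rewrite mulrA -(comm_exp k h3) /Ekl -!mulrA.
Qed.

Lemma tau_entry c i j k l : Cs n c -> tau n (yn ^+ k * (c * Ekl xn yn i j) * xn ^+ l) = if (i == k) && (j == l) then c else 0.
Proof.
move=> Cc; have [h1 h2] := Cs_comm hn Cc; have e1 := esym (comm_exp k h2).
have -> : yn ^+ k * (c * Ekl xn yn i j) * xn ^+ l = c * (yn ^+ k * Ekl xn yn i j * xn ^+ l) by nc_ring (tt, e1).
rewrite tauMl // (mulY_Ekl (YX HS hn)).
have tau0 : tau n 0 = 0 by apply: mproj0.
have tE a b : tau n (Ekl xn yn a b) = if (a == 0%N) && (b == 0%N) then 1 else 0.
  have -> : Ekl xn yn a b = xn ^+ a * yn ^+ b - xn ^+ a.+1 * yn ^+ b.+1.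
    by rewrite /Ekl exprSr exprS; nc_ring tt.
  by rewrite !tauE mprojB -!tauE !tau_xy //= subr0.
case: leqP => [ki|ik]; last by rewrite mul0r tau0 mulr0 (ltn_eqF ik).
rewrite (mulEkl_X (YX HS hn)); case: leqP => [lj|jl]; last by rewrite tau0 mulr0 (ltn_eqF jl) andbF.
rewrite tE !subn_eq0 !eqn_leq ki lj !andbT; by case: ifP; rewrite ?mulr1 ?mulr0.
Qed.

(** In [u * ee s * v], trailing powers of [y s] in [u] and leading powers of [x s] in [v] vanish
    against [ee s]; what remains is a matrix unit with a coefficient free of [s]. *)
Lemma IQs_F s z : (0 < s <= n)%N -> IQ [:: s] z -> Fs (x s) (y s) tt_ (Cs s) z.
Proof.
move=> hs; elim=> [|_ [q [u [v [qs ->]]]]|a b _ IHa _ IHb]; [exact: Fs0| |exact: FsD].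
move: qs; rewrite inE => /eqP ->.
move: u v; apply: (A_span (HS := HS) (s := s) (P := fun u => forall v, Fs (x s) (y s) tt_ (Cs s) (u * ee s * v))) => // [v|u u' IH IH' v|b k l Cb v].
- by rewrite !mul0r; apply: Fs0.
- by rewrite (mulrDl u) (mulrDl _ _ v); apply: FsD; [apply: IH|apply: IH'].
case: l => [|l]; last by rewrite exprSr !mulrA -(mulrA _ (y s)) (y_ee HS hs) mulr0 mul0r; apply: Fs0.
rewrite mulr1; move: v; apply: (A_span (HS := HS) (s := s) (P := fun v => Fs (x s) (y s) tt_ (Cs s) (b * (x s) ^+ k * ee s * v))) => // [|v v' IH IH'|b' k' l' Cb'].
- by rewrite mulr0; apply: Fs0.
- by rewrite mulrDr; apply: FsD.
have [h1 h2] := Cs_comm hs Cb'.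
have e : b * (x s) ^+ k * ee s * (b' * (x s) ^+ k' * (y s) ^+ l') = b * b' * ((x s) ^+ k * (ee s * (x s) ^+ k') * (y s) ^+ l').
  have e1 := esym (comm_exp k h1); have e2 := ee_comm hs Cb'.
  by nc_ring (tt, e1, e2).
rewrite e; case: k' e => [|k'] e; first by rewrite mulr1 -[_ * _ * _ ^+ l']/(Ekl (x s) (y s) k l'); apply: FsE => //; apply: CsM.
have -> : ee s * (x s) ^+ k'.+1 = 0 by rewrite exprS mulrA (ee_x HS hs) mul0r.
by rewrite mulr0 mul0r mulr0; apply: Fs0.
Qed.

Lemma IQn_F z : IQ [:: n] z -> Fs xn yn tt_ (Cs n) z.
Proof. exact: IQs_F. Qed.

Definition pA S (a : A) := Cs n a /\ IQ S a.

Lemma F_IQ (p : A -> Prop) S z : (forall a, p a -> IQ S a) -> Fs xn yn tt_ p z -> IQ S z.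
Proof.
move=> pS; elim=> [|a k l _ pa|a b _ IHa _ IHb]; [exact: IQ_0|by apply: IQ_Mr; apply: pS|exact: IQ_D].
Qed.
Lemma F_IQn (p : A -> Prop) z : Fs xn yn tt_ p z -> IQ [:: n] z.
Proof.
elim=> [|a k l _ pa|a b _ IHa _ IHb]; [exact: IQ_0| |exact: IQ_D].
by apply: IQ_Ml; apply: IQ_Mr; apply: IQ_Ml; apply: IQ_ee; rewrite inE.
Qed.

Definition okS (S : seq nat) := forall s, s \in S -> (0 < s < n)%N.
Lemma okS_le S : okS S -> forall s, s \in S -> (0 < s <= n)%N.
Proof. by move=> h s /h /andP[-> /ltnW]. Qed.
Lemma okS_n S : okS S -> n \notin S.
Proof. by move=> h; apply/negP => /h; rewrite ltnn andbF. Qed.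

Lemma tctxAs s : (0 < s <= n)%N -> tctx (x s) (y s) (Cs s).
Proof.
move=> hs; split.
- exact: (YX HS hs).
- exact: Cs1.
- exact: CsB.
- exact: CsM.
- by move=> b /(Cs_comm hs) [].
- by move=> b /(Cs_comm hs) [].
Qed.
Lemma tctxA : tctx xn yn (Cs n). Proof. exact: tctxAs. Qed.

(** The entries are taken by [tau n], which preserves the ideal of [S] because [n] is not in [S]. *)
Lemma IQ_F S z : okS S -> IQ [:: n] z -> IQ S z -> Fs xn yn tt_ (pA S) z.
Proof.
move=> oS zn zS; have [N bz] := F_bnd tctxA (idl_B tctxA) (IQn_F zn).
rewrite (bnd_expand bz); apply: Fs_sum => k _; apply: Fs_sum => l _; apply: FsE => //; split.
  exact: tau_in_Cs.
apply: tau_IQ => //; [exact: okS_n|exact: okS_le|].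
by apply: IQ_Mr; apply: IQ_Ml.
Qed.

Section OneModel.
Variables (R : nzRingType) (f : {rmorphism A -> R}).

Definition Bf (b : R) := exists2 a, Cs n a & b = f a.
Definition pf S (b : R) := exists2 a, pA S a & b = f a.

Local Notation X := (f xn).
Local Notation Y := (f yn).
Local Notation Fp p := (Fs X Y tt_ p).

Lemma tctx_model : tctx X Y Bf.
Proof.
split.
- by rewrite -rmorphM (YX HS hn) rmorph1.
- by exists 1; rewrite ?rmorph1 //; apply: Cs1.
- by move=> _ _ [a Ca ->] [b Cb ->]; exists (a - b); rewrite ?rmorphB //; apply: CsB.
- by move=> _ _ [a Ca ->] [b Cb ->]; exists (a * b); rewrite ?rmorphM //; apply: CsM.
- by move=> _ [a /(Cs_comm hn) [h _] ->]; rewrite -!rmorphM h.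
- by move=> _ [a /(Cs_comm hn) [_ h] ->]; rewrite -!rmorphM h.
Qed.

Lemma pf_idl S : idl Bf (pf S).
Proof.
split.
- by move=> _ [a [Ca _] ->]; exists a.
- by exists 0; rewrite ?rmorph0 //; split; [apply: Cs0|apply: IQ_0].
- move=> _ _ [a [Ca Ia] ->] [b [Cb Ib] ->]; exists (a - b); rewrite ?rmorphB //.
  by split; [apply: CsB|apply: IQ_B].
- move=> _ _ [b Cb ->] [a [Ca Ia] ->]; exists (b * a); rewrite ?rmorphM //.
  by split; [apply: CsM|apply: IQ_Ml].
- move=> _ _ [b Cb ->] [a [Ca Ia] ->]; exists (a * b); rewrite ?rmorphM //.
  by split; [apply: CsM|apply: IQ_Mr].
Qed.
Lemma pf_W S S' b : {subset S <= S'} -> pf S b -> pf S' b.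
Proof. by move=> SS [a [Ca Ia] ->]; exists a => //; split=> //; apply: IQ_W SS _. Qed.

Lemma f_Ekl k l : f (Ekl xn yn k l) = Ekl X Y k l.
Proof. by rewrite /Ekl !rmorphM rmorphB rmorph1 !rmorphXn rmorphM. Qed.

Lemma F_image (p : A -> Prop) (q : R -> Prop) z : (forall a, p a -> q (f a)) ->
  Fs xn yn tt_ p z -> Fp q (f z).
Proof.
move=> pq; elim=> [|a k l _ pa|a b _ IHa _ IHb]; rewrite ?rmorph0 ?rmorphD; [exact: Fs0| |exact: FsD].
by rewrite rmorphM f_Ekl; apply: FsE => //; apply: pq.
Qed.
Lemma F_lift (p : A -> Prop) (q : R -> Prop) r : (forall b, q b -> exists2 a, p a & b = f a) ->
  Fp q r -> exists2 z, Fs xn yn tt_ p z & r = f z.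
Proof.
move=> qp; elim=> [|b k l _ /qp [a pa ->]|b c _ [z1 F1 ->] _ [z2 F2 ->]].
- by exists 0; rewrite ?rmorph0 //; apply: Fs0.
- by exists (a * Ekl xn yn k l); [apply: FsE|rewrite rmorphM f_Ekl].
- by exists (z1 + z2); [apply: FsD|rewrite rmorphD].
Qed.

Definition beta (b : R) := 1 + (b - 1) * Ekl X Y 0 0.

Lemma beta_mul b c : Bf b -> Bf c -> beta b * beta c = beta (b * c).
Proof.
move=> Bb Bc; have e1 := esym (B_Ekl tctx_model 0 0 Bc); have e2 := mulEkl (tc_YX tctx_model) 0 0 0 0.
rewrite eqxx in e2; rewrite /beta; set e := Ekl _ _ _ _ in e1 e2 *.
by nc_ring (tt, e1, e2).
Qed.
Lemma beta1 : beta 1 = 1. Proof. by rewrite /beta subrr mul0r addr0. Qed.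
Lemma beta_gl b b' : Bf b -> Bf b' -> b * b' = 1 -> b' * b = 1 -> gl X Y Bf (beta b) (beta b').
Proof.
move=> Bb Bb' bb' b'b; have B1 := tc_B1 tctx_model.
split; rewrite ?beta_mul ?bb' ?b'b ?beta1 //; rewrite /beta addrC addKr; apply: FsE => //; exact: (tc_BB tctx_model).
Qed.
End OneModel.

(** Up to isomorphism, [f] is the quotient of [A] by the ideal of the [ee q] with [q] in [Q]; in it
    [x q] and [y q] become inverse to each other. *)
Definition model Q (R : nzRingType) (f : {rmorphism A -> R}) :=
  (forall r, exists a, r = f a) /\ (forall a, f a = 0 <-> IQ Q a).

Lemma model_exists Q : okS Q -> exists (R : nzRingType) (f : {rmorphism A -> R}), model Q f.
Proof.
move=> oQ; have [] := @quotient_ring_exists A (IQ Q).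
- exact: IQ_0.
- exact: IQ_D.
- exact: IQ_Ml.
- exact: IQ_Mr.
- exact: (IQ_proper HS (okS_le oQ)).
- by move=> T [f [h1 h2]]; exists T, f.
Qed.

(* The monomials that become units once the [x_q], [q] in [Q], are inverted. *)
Inductive UQ (Q : seq nat) : A -> Prop :=
| UQ_scal c : c != 0 -> UQ Q c%:A
| UQ_x q : q \in Q -> UQ Q (x q)
| UQ_y q : q \in Q -> UQ Q (y q)
| UQ_mul a b : UQ Q a -> UQ Q b -> UQ Q (a * b).

Lemma Cs_scal s c : Cs s c%:A. Proof. exact: eps_scal. Qed.
Lemma Cs_x s i : (0 < i <= n)%N -> i != s -> Cs s (x i). Proof. exact: eps_x. Qed.
Lemma Cs_y s i : (0 < i <= n)%N -> i != s -> Cs s (y i). Proof. exact: eps_y. Qed.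

Lemma UQ_Cs Q s b : okS Q -> s \notin Q -> UQ Q b -> Cs s b.
Proof.
move=> oQ sQ; elim=> [c _|q qQ|q qQ|a c _ Ca _ Cc].
- exact: Cs_scal.
- by apply: Cs_x; [apply: (okS_le oQ)|apply: contraNneq sQ => <-].
- by apply: Cs_y; [apply: (okS_le oQ)|apply: contraNneq sQ => <-].
- exact: CsM.
Qed.

Lemma model_xy Q (R : nzRingType) (f : {rmorphism A -> R}) q : model Q f -> q \in Q -> f (x q) * f (y q) = 1.
Proof.
move=> [_ ker] qQ; apply/eqP; rewrite eq_sym -subr_eq0 -rmorphM -(rmorph1 f) -rmorphB.
by apply/eqP/ker; apply: IQ_ee.
Qed.

Lemma UQ_inv Q (R : nzRingType) (f : {rmorphism A -> R}) b : okS Q -> model Q f -> UQ Q b ->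
  exists b', [/\ UQ Q b', f b * f b' = 1 & f b' * f b = 1].
Proof.
move=> oQ mf; elim=> [c c0|q qQ|q qQ|a c _ [a' [h1 h2 h3]] _ [c' [h4 h5 h6]]].
- exists (c^-1)%:A; split; first by apply: UQ_scal; rewrite invr_eq0.
    by rewrite -rmorphM mulr_algl scalerA divff // scale1r rmorph1.
  by rewrite -rmorphM mulr_algl scalerA mulVf // scale1r rmorph1.
- exists (y q); split; [exact: UQ_y|exact: (model_xy mf qQ)|].
  by rewrite -rmorphM (YX HS (okS_le oQ qQ)) rmorph1.
- exists (x q); split; [exact: UQ_x| |exact: (model_xy mf qQ)].
  by rewrite -rmorphM (YX HS (okS_le oQ qQ)) rmorph1.
- exists (c' * a'); split; first exact: UQ_mul.
    by rewrite !rmorphM mulrA -(mulrA (f a)) h5 mulr1.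
  by rewrite !rmorphM mulrA -(mulrA (f c')) h3 mulr1.
Qed.

(** Quantifying over all models lets the induction pass between quotients without comparing their
    constructions. *)
Definition K1_monomial Q := forall (R : nzRingType) (f : {rmorphism A -> R}), model Q f ->
  forall u u', gl (f xn) (f yn) (Bf f) u u' ->
  exists b g, [/\ UQ Q b, El (f xn) (f yn) (Bf f) g & u = beta f (f b) * g].

Lemma UQ_Bf Q (R : nzRingType) (f : {rmorphism A -> R}) b : okS Q -> UQ Q b -> Bf f (f b).
Proof. by move=> oQ Ub; exists b => //; apply: UQ_Cs Ub => //; apply: okS_n. Qed.
End Models.

(** * All variables but one inverted *)

Section Base.
Variables (K : fieldType) (A : unitAlgType K) (n : nat) (x y : nat -> A).
Hypothesis HS : is_Sn n x y.
Hypothesis n0 : (0 < n)%N.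
Local Notation idx := ({ffun 'I_n -> nat} * {ffun 'I_n -> nat})%type.
Local Notation M' := (@mon A n x y).
Local Notation Cs := (Cs HS).
Local Notation IQ := (IQ x y).
Local Notation tau := (tau HS).
Local Notation xn := (x n).
Local Notation yn := (y n).
Local Notation tt_ := (fun _ _ : nat => true).

Let hn : (0 < n <= n)%N. Proof. by rewrite n0 leqnn. Qed.
Let Q := iota 1 n.-1.
Let QE q : (q \in Q) = (0 < q < n)%N.
Proof. by rewrite mem_iota; case: (q) n n0 => [|k] [|l] // _; rewrite add1n. Qed.
Let oQ : okS n Q. Proof. by move=> q; rewrite QE. Qed.
Variables (R : nzRingType) (f : {rmorphism A -> R}).
Hypothesis mf : model x y Q f.
Local Notation X := (f xn).
Local Notation Y := (f yn).
Local Notation Bf := (Bf HS f).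
Let HT := tctx_model HS n0 f.

Lemma gen_comm i (m : idx) : (0 < i < n)%N -> (forall o : 'I_n, o.+1 = n -> m.1 o = 0%N /\ m.2 o = 0%N) ->
  GRing.comm (f (x i)) (f (M' m)) /\ GRing.comm (f (y i)) (f (M' m)).
Proof.
move=> hi hm; rewrite /mon rmorph_prod.
have hi' : (0 < i <= n)%N by case/andP: hi => -> /ltnW.
have xy : f (x i) * f (y i) = f (y i) * f (x i).
  by rewrite (model_xy mf) ?QE // -rmorphM (YX HS hi') rmorph1.
split; apply: commr_prod => o _; rewrite rmorphM !rmorphXn; have [e|e] := eqVneq o.+1 i.
- by rewrite e; apply: commrM; apply: commrX => //; apply: xy.
- have [h1 h2 h3] : [/\ x i * y o.+1 = y o.+1 * x i, x i * x o.+1 = x o.+1 * x i & y i * y o.+1 = y o.+1 * y i].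
    by case: HS => _ h _ _; apply: h; rewrite ?ltn_ord // eq_sym.
  by apply: commrM; apply: commrX; rewrite /GRing.comm -!rmorphM ?h1 ?h2.
- by rewrite e; apply: commrM; apply: commrX => //; apply: esym xy.
- have [h1 h2 h3] : [/\ x i * y o.+1 = y o.+1 * x i, x i * x o.+1 = x o.+1 * x i & y i * y o.+1 = y o.+1 * y i].
    by case: HS => _ h _ _; apply: h; rewrite ?ltn_ord // eq_sym.
  have [h4 _ _] : [/\ x o.+1 * y i = y i * x o.+1, x o.+1 * x i = x i * x o.+1 & y o.+1 * y i = y i * y o.+1].
    by case: HS => _ h _ _; apply: h; rewrite ?ltn_ord.
  by apply: commrM; apply: commrX; rewrite /GRing.comm -!rmorphM ?h3 ?h4.
Qed.

Lemma Bf_comm a b : Bf a -> Bf b -> a * b = b * a.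
Proof.
move=> [a' Ca ->] [b' Cb ->]; rewrite -!rmorphM.
move: a' Ca b' Cb; apply: (@Cs_ind _ _ _ _ _ HS n (fun a' => forall b', Cs n b' -> f (a' * b') = f (b' * a'))).
- by move=> b'; rewrite mul0r mulr0.
- by move=> a1 a2 h1 h2 b' Cb; rewrite mulrDl mulrDr !rmorphD h1 ?h2.
move=> c m hm; apply: (@Cs_ind _ _ _ _ _ HS n) => [|a1 a2 h1 h2|d m' hm'].
- by rewrite mul0r mulr0.
- by rewrite mulrDl mulrDr !rmorphD h1 h2.
rewrite -!scalerAl -!scalerAr !scalerA (mulrC d c) -[_ *: (M' m * _)]mulr_algl -[_ *: (M' m' * _)]mulr_algl !rmorphM.
congr (_ * _).
  have -> : f (M' m) = \prod_(i < n) f (x i.+1 ^+ m.1 i * y i.+1 ^+ m.2 i) by rewrite /mon rmorph_prod.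
  apply: commr_sym; apply: commr_prod => o _.
  have [e|e] := eqVneq o.+1 n; first by have [-> ->] := hm o e; rewrite mulr1 rmorph1; apply: commr1.
  have ho : (0 < o.+1 < n)%N by apply/andP; split=> //; rewrite ltn_neqAle e ltn_ord.
  have [h1 h2] := gen_comm ho hm'.
  by rewrite rmorphM !rmorphXn; apply: commrM; apply: commrX; apply: commr_sym.
Qed.

(** Image of the subalgebra in the first [j] variables: the tower climbs from the scalars at [j = 0]
    to the whole coefficient ring at [n.-1]. *)
Definition Pj j (r : R) := exists2 a, (forall i, (j < i <= n)%N -> Cs i a) & r = f a.

Lemma Pj_Bf j r : (j < n)%N -> Pj j r -> Bf r.
Proof. by move=> jn [a Ha ->]; exists a => //; apply: Ha; rewrite jn leqnn. Qed.
Lemma PjW j r : Pj j r -> Pj j.+1 r.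
Proof. by move=> [a Ha ->]; exists a => // i /andP[ji i_n]; apply: Ha; rewrite (ltnW ji). Qed.
Lemma Bf_Pj r : Bf r -> Pj n.-1 r.
Proof.
move=> [a Ca ->]; exists a => // i /andP[i1 i2]; have -> // : i = n.
by apply/eqP; rewrite eqn_leq i2; move: i1; rewrite prednK.
Qed.

Lemma Cs_mon i c (m : idx) : (forall o : 'I_n, o.+1 = i -> m.1 o = 0%N /\ m.2 o = 0%N) -> Cs i (c *: M' m).
Proof.
move=> hm; rewrite CsE eps_mon; congr (_ *: M' _); case: m hm => m1 m2 hm.
by congr (_, _); apply/ffunP => o; rewrite !ffunE /=; case: eqP => // e; have [] := hm o e.
Qed.

Definition tower j := exists (T : comNzRingType) (jj : {rmorphism T -> R}),
  [/\ injective jj, forall r, Pj j r <-> (exists t, r = jj t), regular T &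
      K1triv (fun t => exists2 b, UQ x y Q b & jj t = f b)].

Lemma Pj_subring j : (j < n)%N -> exists (T : comNzRingType) (jj : {rmorphism T -> R}),
  injective jj /\ (forall r, Pj j r <-> exists t, r = jj t).
Proof.
move=> jn; apply: (commutative_subring_exists (P := Pj j)).
- by exists 1; rewrite ?rmorph1 // => i _; apply: Cs1.
- by move=> _ _ [a Ha ->] [b Hb ->]; exists (a - b); rewrite ?rmorphB // => i hi; apply: CsB; [apply: Ha|apply: Hb].
- by move=> _ _ [a Ha ->] [b Hb ->]; exists (a * b); rewrite ?rmorphM // => i hi; apply: CsM; [apply: Ha|apply: Hb].
- by move=> a b Ha Hb; apply: Bf_comm; apply: Pj_Bf jn _.
Qed.

Lemma tower0 : tower 0.
Proof.
have [T [jj [inj im]]] := Pj_subring n0; exists T, jj; split=> //.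
  apply: regular_field => a a0.
  have [z Hz e] := (im (jj a)).2 (ex_intro _ a erefl).
  have [c ec] := Cs_all_scalar Hz.
  have c0 : c != 0.
    by apply: contraNneq a0 => c0; apply/eqP/inj; rewrite e ec c0 scale0r !rmorph0.
  have [b eb] : exists b, f (c^-1)%:A = jj b.
    by apply/im; exists (c^-1)%:A => // i _; apply: Cs_scal.
  exists b; apply: inj; rewrite rmorphM -eb e ec -rmorphM mulr_algl scalerA divff // scale1r !rmorph1 //.
apply: K1triv_field => a a0.
have [z Hz e] := (im (jj a)).2 (ex_intro _ a erefl).
have [c ec] := Cs_all_scalar Hz.
have c0 : c != 0.
  by apply: contraNneq a0 => c0; apply/eqP/inj; rewrite e ec c0 scale0r !rmorph0.
split; first by exists c%:A; [apply: UQ_scal|rewrite e ec].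
have [b eb] : exists b, f (c^-1)%:A = jj b.
  by apply/im; exists (c^-1)%:A => // i _; apply: Cs_scal.
by exists b; apply: inj; rewrite rmorphM -eb e ec -rmorphM mulr_algl scalerA divff // scale1r !rmorph1.
Qed.

Lemma towerS j : (j.+1 < n)%N -> tower j -> tower j.+1.
Proof.
move=> jn [T [jj [inj im regT K1T]]].
have [T' [jj' [inj' im']]] := Pj_subring jn; exists T', jj'.
have Hio t : exists t', jj' t' = jj t.
  have /PjW /im' [t' ->] : Pj j (jj t) by apply/im; exists t.
  by exists t'.
have [io ioE] : exists io : {rmorphism T -> T'}, forall t, jj' (io t) = jj t.
  have [io0 Hio0] := choice Hio.
  have ioB : {morph io0 : a b / a - b} by move=> a b; apply: inj'; rewrite rmorphB !Hio0 rmorphB.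
  have ioM : monoid_morphism io0.
    by split; [apply: inj'; rewrite Hio0 !rmorph1|move=> a b; apply: inj'; rewrite rmorphM !Hio0 rmorphM].
  pose m1 := @GRing.isZmodMorphism.Build T T' io0 ioB.
  pose m2 := @GRing.isMonoidMorphism.Build T T' io0 ioM.
  pose io : {rmorphism T -> T'} := HB.pack io0 m1 m2.
  by exists io.
have hj : (0 < j.+1 <= n)%N by apply/andP; split=> //; apply: ltnW.
have hjQ : j.+1 \in Q by rewrite QE.
have [t et] : exists t, f (x j.+1) = jj' t.
  by apply/im'; exists (x j.+1) => // i /andP[ji _]; apply: Cs_x => //; rewrite neq_ltn ji.
have [t' et'] : exists t, f (y j.+1) = jj' t.
  by apply/im'; exists (y j.+1) => // i /andP[ji _]; apply: Cs_y => //; rewrite neq_ltn ji.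
have tt' : t * t' = 1 by apply: inj'; rewrite rmorphM -et -et' (model_xy mf) // rmorph1.
pose Dec s := exists k (p : {poly T}), s = t' ^+ k * (map_poly io p).[t].
have DecD s1 s2 : Dec s1 -> Dec s2 -> Dec (s1 + s2).
  move=> [k1 [p1 ->]] [k2 [p2 ->]]; exists (k1 + k2)%N, (p1 * 'X^k2 + p2 * 'X^k1).
  rewrite rmorphD !rmorphM /= !map_polyXn hornerD !hornerM !hornerXn mulrDr exprD.
  have tk k : t' ^+ k * t ^+ k = 1 by rewrite -exprMn mulrC tt' expr1n.
  congr (_ + _); first by rewrite -mulrA; congr (_ * _); rewrite mulrCA tk mulr1.
  by rewrite (mulrC (t' ^+ k1)) -mulrA; congr (_ * _); rewrite mulrCA tk mulr1.
have decL a : Dec a.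
  have [z Hz e] := (im' (jj' a)).2 (ex_intro _ a erefl).
  suff [s es Ds] : exists2 s, jj' s = f z & Dec s by have <- : s = a by [apply: inj'; rewrite es e].
  move: z Hz {e}; have H := @Cs_seq_ind _ _ _ _ _ HS (iota j.+2 (n - j.+1)) (fun z => exists2 s, jj' s = f z & Dec s).
  move=> z Hz; apply: H => [|a1 a2 [s1 e1 D1] [s2 e2 D2]|c m hm|i].
  - by exists 0; rewrite ?rmorph0 //; exists 0%N, 0; rewrite rmorph0 horner0 mulr0.
  - by exists (s1 + s2); rewrite ?rmorphD ?e1 ?e2 //; apply: DecD.
  - have [o oj] := ordP hj.
    pose b := c *: M' (erase j.+1 m).
    have [b0 eb] : exists b0, f b = jj b0.
      apply/im; exists b => // i /andP[ji i_n]; apply: Cs_mon => o' o'i; rewrite !ffunE o'i; case: eqP => // ij.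
      by apply: hm; rewrite o'i mem_iota; lia.
    exists (t' ^+ (m.2 o) * (map_poly io (b0%:P * 'X^(m.1 o))).[t]); last by exists (m.2 o), (b0%:P * 'X^(m.1 o)).
    have -> : (map_poly io (b0%:P * 'X^(m.1 o))).[t] = io b0 * t ^+ (m.1 o).
      by rewrite rmorphM /= map_polyC map_polyXn hornerM hornerC hornerXn.
    rewrite mulrC !rmorphM !rmorphXn -et -et' ioE -eb.
    by rewrite (mon_split HS m oj) scalerAl rmorphM -/b rmorphM !rmorphXn mulrA.
  - by rewrite mem_iota => hi; apply: Hz; lia.
have indL (p : {poly T}) : (map_poly io p).[t] = 0 -> p = 0.
  move=> p0; have [o oj] := ordP hj.
  have Hb k : exists b, (forall i, (j < i <= n)%N -> Cs i b) /\ jj p`_k = f b.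
    by have [b Hb e] := (im (jj p`_k)).2 (ex_intro _ p`_k erefl); exists b.
  have [b Hb1 Hb2] : exists2 b : nat -> A, (forall k i, (j < i <= n)%N -> Cs i (b k)) & forall k, jj p`_k = f (b k).
    have [b HB] := choice Hb; exists b; first by move=> k; case: (HB k).
    by move=> k; case: (HB k).
  pose z := \sum_(i < size p) b i * x j.+1 ^+ i.
  have Iz : IQ Q z.
    apply/(proj2 mf); rewrite /z rmorph_sum -[RHS](rmorph0 jj') -p0.
    rewrite (horner_coef_wide _ (size_poly _ _ : (size (map_poly io p) <= size p)%N)) rmorph_sum.
    apply: eq_bigr => i _; rewrite coef_map rmorphM rmorphXn -Hb2 et !rmorphM !rmorphXn /= ioE //.
  apply/polyP => k; rewrite coef0; have [kp|kp] := ltnP k (size p); last by rewrite nth_default.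
  (* Selects the part of degree [k] in the variable [j.+1], the exponent of [x] minus that of [y].
     Inserting [x q * y q] does not change this degree, so the selected part of a relation is a
     relation. *)
  pose chi (m : idx) := m.1 o == (m.2 o + k)%N.
  have Iz' : IQ Q (mproj HS chi z).
    apply: mproj_IQ => // [q|q qQ o' m1' m2' _]; first exact: (okS_le oQ).
    rewrite /chi !ffunE; case: (o == o'); lia.
  have ez : mproj HS chi z = b k * x j.+1 ^+ k.
    have sumE (I : Type) (r : seq I) (F : I -> A) : mproj HS chi (\sum_(i <- r) F i) = \sum_(i <- r) mproj HS chi (F i).
      by apply: (big_morph _ (mprojD HS chi) (mproj0 HS chi)).
    have tE i : mproj HS chi (b i * x j.+1 ^+ i) = if i == k then b i * x j.+1 ^+ i else 0.
      have Cb : Cs j.+1 (b i) by apply: Hb1; rewrite ltnSn ltnW.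
      have [|_ ->] := @mprojM_Cs _ _ _ _ _ HS chi j.+1 (x j.+1 ^+ i) _ hj _ Cb.
        move=> o' m m' o'j m1' m2'; have oo : o = o' by apply: val_inj; move: oj; rewrite -o'j => -[].
        by rewrite /chi !ffunE oo m1' m2'; split; apply/eqP/eqP; lia.
      have := mproj_mon HS chi 1 (xidx o i 0); rewrite mon_xidx oj expr0 mulr1 scale1r => ->.
      by rewrite /chi !ffunE eqxx add0n; case: ifP; rewrite // mulr0.
    rewrite /z sumE (bigD1 (Ordinal kp)) //= tE eqxx big1 ?addr0 // => i ik.
    by rewrite tE -[k]/(nat_of_ord (Ordinal kp)) (inj_eq val_inj) (negPf ik).
  apply: inj; rewrite rmorph0 Hb2.
  have : f (mproj HS chi z) = 0 by apply/(proj2 mf).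
  rewrite ez rmorphM rmorphXn => /(congr1 (fun r => r * f (y j.+1) ^+ k)).
  rewrite mul0r -mulrA -exprMn_comm; last by rewrite /GRing.comm (model_xy mf) // -rmorphM (YX HS hj) rmorph1.
  by rewrite (model_xy mf) // expr1n mulr1.
split=> //; first exact: (regular_Laurent tt' decL indL regT).
apply: (K1triv_Laurent tt' decL indL (UB := fun t => exists2 b, UQ x y Q b & jj t = f b)) => //.
- by move=> b [b' Ub e]; exists b' => //; rewrite ioE.
- by exists (x j.+1); [apply: UQ_x|rewrite et].
- by exists (y j.+1); [apply: UQ_y|rewrite et'].
Qed.

Lemma towerB : tower n.-1.
Proof.
have H j : (j < n)%N -> tower j.
  by elim: j => [|j IH] jn; [exact: tower0|apply: towerS => //; apply: IH; apply: ltnW].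
by apply: H; rewrite prednK.
Qed.

(** * From matrices over a commutative ring to units of the quotient *)

Section Sound.
Variables (T : comNzRingType) (jj : {rmorphism T -> R}).
Hypothesis jjB : forall t, Bf (jj t).
Let U t := exists2 b, UQ x y Q b & jj t = f b.
Local Notation E k l := (Ekl X Y k l).

(** Rectangular matrices are allowed, so that both sides of a swap in [triv] become products in
    [R]. *)
Definition psi m l (C : 'M[T]_(m, l)) : R := \sum_(i < m) \sum_(j < l) jj (C i j) * E i j.

Lemma psi_F m l (C : 'M[T]_(m, l)) : Fs X Y tt_ Bf (psi C).
Proof. by apply: Fs_sum => i _; apply: Fs_sum => j _; apply: FsE. Qed.
Lemma psiD m l (C D : 'M[T]_(m, l)) : psi (C + D) = psi C + psi D.
Proof.
rewrite /psi -big_split; apply: eq_bigr => i _; rewrite -big_split; apply: eq_bigr => j _.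
by rewrite mxE rmorphD mulrDl.
Qed.
Lemma psiN m l (C : 'M[T]_(m, l)) : psi (- C) = - psi C.
Proof.
rewrite /psi -sumrN; apply: eq_bigr => i _; rewrite -sumrN; apply: eq_bigr => j _.
by rewrite mxE rmorphN mulNr.
Qed.
Lemma psiM m l r (C : 'M[T]_(m, l)) (D : 'M[T]_(l, r)) : psi (C *m D) = psi C * psi D.
Proof.
rewrite /psi mulr_suml; apply: eq_bigr => i _; rewrite mulr_suml.
under [RHS]eq_bigr => j _ do rewrite mulr_sumr.
have e (j k : 'I_l) (s : 'I_r) : jj (C i j) * E i j * (jj (D k s) * E k s) = if j == k then jj (C i j) * jj (D k s) * E i s else 0.
  have e1 := esym (B_Ekl HT i j (jjB (D k s))); have e2 := mulEkl (tc_YX HT) i j k s.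
  transitivity (jj (C i j) * jj (D k s) * (E i j * E k s)); first by nc_ring (tt, e1).
  by rewrite e2 (inj_eq val_inj); case: eqP; rewrite ?mulr0.
transitivity (\sum_(j < l) \sum_(s < r) jj (C i j) * jj (D j s) * E i s).
  rewrite exchange_big /=; apply: eq_bigr => s _; rewrite mxE rmorph_sum mulr_suml.
  by apply: eq_bigr => j _; rewrite rmorphM.
apply: eq_bigr => j _; rewrite (bigD1 j) //= [X in _ = _ + X]big1 ?addr0.
  by rewrite mulr_sumr; apply: eq_bigr => s _; rewrite e eqxx.
by move=> k kj; rewrite mulr_sumr big1 // => s _; rewrite e eq_sym (negPf kj).
Qed.

Definition Good z := exists b g, [/\ UQ x y Q b, El X Y Bf g & z = beta n x y f (f b) * g].

Lemma Good_El e z : El X Y Bf e -> Good z -> Good (e * z).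
Proof.
move=> Ee [b [g [Ub Eg ->]]]; have [b' [Ub' bb' b'b]] := UQ_inv HS oQ mf Ub.
have gb := beta_gl n0 (UQ_Bf HS f oQ Ub) (UQ_Bf HS f oQ Ub') bb' b'b.
exists b, (beta n x y f (f b') * e * beta n x y f (f b) * g); split=> //.
  by apply: ElM => //; apply: Er_El; apply: (Er_conj HT (idl_B HT) (gl_sym gb)); apply: El_Er.
by rewrite !mulrA (gl_r gb) mul1r.
Qed.
Lemma Good_mul z w : Good z -> Good w -> Good (z * w).
Proof.
move=> [b [g [Ub Eg ->]]] Gw; rewrite -mulrA; have [c [h [Uc Eh ->]]] := Good_El Eg Gw.
exists (b * c), h; split=> //; first exact: UQ_mul.
by rewrite mulrA (beta_mul n0 (UQ_Bf HS f oQ Ub) (UQ_Bf HS f oQ Uc)) rmorphM.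
Qed.

(** Each rule of [triv] is matched in the stable group: units give a block [beta], products are
    collected by moving elementary factors past [beta], and the swap is [vaserstein]. The inverse is
    part of the induction because [vaserstein] takes one as input. *)
Lemma triv_Good m (C : 'M[T]_m) : triv U C ->
  (exists z', gl X Y Bf (1 + psi (C - 1%:M)) z') /\ Good (1 + psi (C - 1%:M)).
Proof.
have psi0 m' : psi (0 : 'M[T]_m') = 0 by rewrite -(subrr 0) psiD psiN subrr.
elim=> {m C} [m|u [b Ub e]|m C D _ [[zC gC] GC] _ [[zD gD] GD]|m l C D _ [[z gz] G]].
- rewrite subrr psi0 addr0; split; first by exists 1; split; rewrite ?mulr1 ?subrr //; apply: Fs0.
  exists 1%:A, 1; split; [by apply: UQ_scal; rewrite oner_eq0|exact: El1|].
  by rewrite scale1r rmorph1 beta1 mulr1.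
- have -> : 1 + psi ((u%:M : 'M_1) - 1%:M) = beta n x y f (f b).
    by rewrite /psi !big_ord1 !mxE !mulr1n rmorphB rmorph1 e.
  have [b' [Ub' bb' b'b]] := UQ_inv HS oQ mf Ub.
  split; first by exists (beta n x y f (f b')); exact: (beta_gl n0 (UQ_Bf HS f oQ Ub) (UQ_Bf HS f oQ Ub') bb' b'b).
  by exists b, 1; rewrite mulr1; split=> //; apply: El1.
- have -> : 1 + psi (C *m D - 1%:M) = (1 + psi (C - 1%:M)) * (1 + psi (D - 1%:M)).
    have -> : C *m D - 1%:M = (C - 1%:M) *m (D - 1%:M) + (C - 1%:M) + (D - 1%:M).
      by rewrite mulmxBr mulmx1 subrK mulmxBl mul1mx addrA subrK.
    rewrite !psiD psiM -!psiD; set a := psi _; set b := psi _; by nc_ring tt.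
  split; last exact: Good_mul.
  by exists (zD * zC); apply: (gl_mul HT (idl_B HT)).
- rewrite !(addrC 1%:M) !addrK !psiM in gz G *.
  have [g1 g2] := vaserstein HT (idl_B HT) (psi_F C) (psi_F D) gz.
  split; first by exists (1 - psi D * z * psi C).
  have -> : 1 + psi D * psi C = (1 + psi D * psi C) * z * (1 + psi C * psi D) by rewrite -mulrA (gl_l gz) mulr1.
  by apply: Good_El => //; apply: Er_El.
Qed.
End Sound.

Lemma psi_inj (T : comNzRingType) (jj : {rmorphism T -> R}) m (C : 'M[T]_m) : injective jj ->
  (forall t, Bf (jj t)) -> psi jj C = 0 -> C = 0.
Proof.
move=> inj jjB C0; apply/matrixP => k l; rewrite mxE; apply: inj; rewrite rmorph0.
have H (ij : 'I_m * 'I_m) : exists c, Cs n c /\ jj (C ij.1 ij.2) = f c.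
  by have [c h1 h2] := jjB (C ij.1 ij.2); exists c.
have [c Hc] := choice H.
pose z := \sum_(i < m) \sum_(j < m) c (i, j) * Ekl xn yn i j.
have Iz : IQ Q z.
  apply/(proj2 mf); rewrite -[RHS]C0 /z /psi rmorph_sum; apply: eq_bigr => i _; rewrite rmorph_sum.
  by apply: eq_bigr => j _; rewrite rmorphM f_Ekl; have [_ ->] := Hc (i, j).
have It : IQ Q (tau n (yn ^+ k * z * xn ^+ l)).
  apply: tau_IQ => //; [exact: okS_n|exact: okS_le|]; by apply: IQ_Mr; apply: IQ_Ml.
have [Ckl ->] := Hc (k, l); apply/(proj2 mf); suff -> : c (k, l) = tau n (yn ^+ k * z * xn ^+ l) by [].
have sumE (I : Type) (r : seq I) (F : I -> A) : tau n (\sum_(i <- r) F i) = \sum_(i <- r) tau n (F i).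
  by apply: (big_morph _ (mprojD HS _) (mproj0 HS _)).
rewrite /z mulr_sumr mulr_suml sumE (bigD1 k) //= [X in _ = _ + X]big1 ?addr0.
  rewrite mulr_sumr mulr_suml sumE (bigD1 l) //= [X in _ = _ + X]big1 ?addr0.
    by rewrite (tau_entry n0) // !eqxx.
  move=> j jl; have [Ckj _] := Hc (k, j); rewrite (tau_entry n0) // eqxx /=.
  by rewrite (inj_eq val_inj) (negPf jl).
move=> i ik; rewrite mulr_sumr mulr_suml sumE big1 // => j _.
by have [Cij _] := Hc (i, j); rewrite (tau_entry n0) // (inj_eq val_inj) (negPf ik).
Qed.

(** The unit and its inverse are written as square matrices of one common size; injectivity of [psi]
    then shows that the matrix is invertible over the commutative ring. *)
Theorem K1_monomial_base u u' : gl X Y Bf u u' -> Good u.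
Proof.
move=> gu; have [T [jj [inj im _ K1]]] := towerB.
have jjB t : Bf (jj t) by apply: (@Pj_Bf n.-1); [rewrite prednK|apply/im; exists t].
have lift w : Fs X Y tt_ Bf w -> exists N, forall m, (N <= m)%N -> exists C : 'M[T]_m, w = psi jj C.
  move=> Fw; have [z Fz ->] := F_lift (p := Cs n) (fun b Bb => Bb) Fw.
  have [N bz] := F_bnd (tctxA HS n0) (idl_B (tctxA HS n0)) Fz.
  exists N => m Nm; have e := bnd_expand HS n0 (bndW Nm bz).
  have H (ij : 'I_m * 'I_m) : exists t, f (tau n (yn ^+ ij.1 * z * xn ^+ ij.2)) = jj t.
    apply/im; apply: Bf_Pj; exists (tau n (yn ^+ ij.1 * z * xn ^+ ij.2)) => //; exact: tau_in_Cs.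
  have [c Hc] := choice H; exists (\matrix_(i, j) c (i, j)).
  rewrite {1}e rmorph_sum; apply: eq_bigr => i _; rewrite rmorph_sum; apply: eq_bigr => j _.
  by rewrite rmorphM f_Ekl mxE -Hc.
have [N1 H1] := lift _ (gl_F gu); have [N2 H2] := lift _ (gl_F' gu).
pose m := maxn N1 N2.
have [C eC] := H1 m (leq_maxl _ _); have [D eD] := H2 m (leq_maxr _ _).
have psiB (k : nat) (E F : 'M[T]_k) : psi jj (E - F) = psi jj E - psi jj F by rewrite psiD psiN.
have prod0 (E F : 'M[T]_m) v w : v - 1 = psi jj E -> w - 1 = psi jj F -> v * w = 1 -> (1%:M + E) *m (1%:M + F) = 1%:M.
  move=> ev ew vw; apply/eqP; rewrite -subr_eq0; apply/eqP; apply: (psi_inj inj jjB).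
  have -> : (1%:M + E) *m (1%:M + F) - 1%:M = E *m F + E + F.
    by change ((1 + E) * (1 + F) - 1 = E * F + E + F); nc_ring tt.
  rewrite !psiD (psiM jjB) -ev -ew.
  have -> : (v - 1) * (w - 1) + (v - 1) + (w - 1) = v * w - 1 by nc_ring tt.
  by rewrite vw subrr.
have iC : invm (1%:M + C).
  by exists (1%:M + D); [apply: prod0 eC eD (gl_r gu)|apply: prod0 eD eC (gl_l gu)].
have [_ G] := triv_Good jjB (K1 _ _ iC).
by move: G; rewrite (addrC 1%:M) addrK -eC addrC subrK.
Qed.
End Base.

(** * Corners and the index *)

Section Corner.
Variables (K : fieldType) (A : unitAlgType K) (n : nat) (x y : nat -> A).
Hypothesis HS : is_Sn n x y.
Hypothesis n0 : (0 < n)%N.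
Local Notation Cs := (Cs HS).
Local Notation IQ := (IQ x y).
Local Notation tau := (tau HS).
Local Notation eps := (eps HS).
Local Notation ee := (ee x y).
Local Notation xn := (x n).
Local Notation yn := (y n).
Let hn : (0 < n <= n)%N. Proof. by rewrite n0 leqnn. Qed.

Variable s : nat.
Hypothesis hs0 : (0 < s < n)%N.
Let hs : (0 < s <= n)%N. Proof. by case/andP: hs0 => -> /ltnW. Qed.
Let sn : s != n. Proof. by rewrite neq_ltn; case/andP: hs0 => _ ->. Qed.
Let ns : n != s. Proof. by rewrite eq_sym. Qed.
Local Notation xs := (x s).
Local Notation ys := (y s).
Local Notation Es k l := (Ekl xs ys k l).
Local Notation En k l := (Ekl xn yn k l).

Lemma Cs_ee t i : (0 < i <= n)%N -> i != t -> Cs t (ee i).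
Proof. by move=> hi it; apply: CsB; [apply: Cs1|apply: CsM; [apply: Cs_x|apply: Cs_y]]. Qed.
Lemma Cs_Ekl t i k l : (0 < i <= n)%N -> i != t -> Cs t (Ekl (x i) (y i) k l).
Proof. by move=> hi it; apply: CsM; [apply: CsM; [apply: CsX; apply: Cs_x|apply: Cs_ee]|apply: CsX; apply: Cs_y]. Qed.
Lemma Cs_sum t I (r : seq I) (P : pred I) F : (forall i, P i -> Cs t (F i)) -> Cs t (\sum_(i <- r | P i) F i).
Proof. by move=> H; apply: big_ind => //; [apply: Cs0|apply: CsD]. Qed.
Lemma Cs_Pn t i N : (0 < i <= n)%N -> i != t -> Cs t (Pn (x i) (y i) N).
Proof. by move=> hi it; rewrite PnE; apply: Cs_sum => k _; apply: Cs_Ekl. Qed.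

Lemma Es_comm k l c : Cs s c -> Es k l * c = c * Es k l.
Proof. by move=> Cc; rewrite (B_Ekl (tctxAs HS hs)). Qed.

Definition T2 a := tau n (tau s a).

Lemma T2_mul a b : T2 (a * ee s * ee n * b) = T2 a * T2 b.
Proof.
rewrite /T2 -(mulrA (a * ee s)) (tau_mul_ee HS _ _ hs) (tauMl _ hs); last exact: Cs_ee.
by rewrite mulrA (tau_mul_ee HS _ _ hn).
Qed.
Lemma T2D a b : T2 (a + b) = T2 a + T2 b. Proof. by rewrite /T2 !tauE !mprojD. Qed.
Lemma T2_0 : T2 0 = 0. Proof. by rewrite /T2 !tauE !mproj0. Qed.
Lemma T2_ee c : Cs n c -> Cs s c -> T2 (ee s * ee n * c) = c.
Proof.
move=> Cn Cc; rewrite /T2 -mulrA tau_ee //; first by rewrite tau_ee.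
by apply: CsM => //; apply: Cs_ee.
Qed.

(* [cB N * cA N] is the projection [PP N] onto the first [N] cells in the directions [s] and [n], and
   [cA N * cB N] is the projection onto the first [N * N] cells in the direction [n] inside the corner of
   [e_s]. *)
Definition PP N := Pn xs ys N * Pn xn yn N.
Definition cA N := \sum_(k < N) Es 0 k * xn ^+ (N * k) * Pn xn yn N.
Definition cB N := \sum_(k < N) Es k 0 * Pn xn yn N * yn ^+ (N * k).

Lemma Pn_idem i N : (0 < i <= n)%N -> Pn (x i) (y i) N * Pn (x i) (y i) N = Pn (x i) (y i) N.
Proof. by move=> hi; have [] := Pn_bnd (@bnd_Pn _ _ _ _ (tctxAs HS hi) N). Qed.

Lemma cBA N : cB N * cA N = PP N.
Proof.
rewrite /cB /cA mulr_suml /PP (PnE xs ys) mulr_suml; apply: eq_bigr => k _.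
rewrite mulr_sumr (bigD1 k) //= [X in _ + X]big1 ?addr0.
  have e1 : yn ^+ (N * k) * xn ^+ (N * k) = 1 by apply: mulYX_exp; apply: (YX HS hn).
  have e2 : Es 0 k * (Pn xn yn N * yn ^+ (N * k)) = Pn xn yn N * yn ^+ (N * k) * Es 0 k.
    by apply: Es_comm; apply: CsM; [apply: Cs_Pn|apply: CsX; apply: Cs_y].
  have e3 : Es 0 k * xn ^+ (N * k) = xn ^+ (N * k) * Es 0 k by apply: Es_comm; apply: CsX; apply: Cs_x.
  have e4 : Es 0 k * Pn xn yn N = Pn xn yn N * Es 0 k by apply: Es_comm; apply: Cs_Pn.
  have e4' : Es k 0 * Pn xn yn N = Pn xn yn N * Es k 0 by apply: Es_comm; apply: Cs_Pn.
  have e3' : Es k 0 * yn ^+ (N * k) = yn ^+ (N * k) * Es k 0 by apply: Es_comm; apply: CsX; apply: Cs_y.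
  have e3'' : Es k 0 * xn ^+ (N * k) = xn ^+ (N * k) * Es k 0 by apply: Es_comm; apply: CsX; apply: Cs_x.
  have e5 : Es k 0 * Es 0 k = Es k k by rewrite (mulEkl (YX HS hs)) eqxx.
  have e6 : Es k k * Pn xn yn N = Pn xn yn N * Es k k by apply: Es_comm; apply: Cs_Pn.
  have e7 := Pn_idem N hn.
  have e8 : Es k k * xn ^+ (N * k) = xn ^+ (N * k) * Es k k by apply: Es_comm; apply: CsX; apply: Cs_x.
  by nc_ring (tt, e1, e3, e4, e4', e3', e3'', e5, e6, e7, e8).
move=> j jk.
(* The windows of width [N] starting at [N * k] and [N * j] are disjoint. *)
have e0 : Pn xn yn N * yn ^+ (N * k) * xn ^+ (N * j) * Pn xn yn N = 0.
  have [jlt|klt] : (j < k)%N \/ (k < j)%N by case: (ltngtP j k) jk => // [||/val_inj ->]; rewrite ?eqxx; auto.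
    rewrite -(mulrA (Pn _ _ _)) (mulYX_exp_ge (YX HS hn)) ?leq_mul2l ?(ltnW jlt) ?orbT // -mulrA.
    have hle : (N <= N * k - N * j)%N by rewrite -mulnBr leq_pmulr // subn_gt0.
    by have [-> _] := @bnd_Pn _ _ _ _ (tctxAs HS hn) N _ hle; rewrite mulr0.
  rewrite -(mulrA (Pn _ _ _)) (mulYX_exp_le (YX HS hn)) ?leq_mul2l ?(ltnW klt) ?orbT //.
  have hle : (N <= N * j - N * k)%N by rewrite -mulnBr leq_pmulr // subn_gt0.
  by have [_ ->] := @bnd_Pn _ _ _ _ (tctxAs HS hn) N _ hle; rewrite mul0r.
have e2 : (Pn xn yn N * yn ^+ (N * k)) * Es 0 j = Es 0 j * (Pn xn yn N * yn ^+ (N * k)).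
  by rewrite Es_comm //; apply: CsM; [apply: Cs_Pn|apply: CsX; apply: Cs_y].
have -> : Es k 0 * Pn xn yn N * yn ^+ (N * k) * (Es 0 j * xn ^+ (N * j) * Pn xn yn N) =
   Es k 0 * Es 0 j * (Pn xn yn N * yn ^+ (N * k) * xn ^+ (N * j) * Pn xn yn N) by nc_ring (tt, e2).
by rewrite e0 mulr0.
Qed.

Lemma ee00 : ee s = Es 0 0. Proof. by rewrite /Ekl mul1r mulr1. Qed.
Lemma cA_ee N : ee s * cA N = cA N.
Proof.
rewrite /cA mulr_sumr; apply: eq_bigr => k _.
have e : ee s * Es 0 k = Es 0 k by rewrite ee00 (mulEkl (YX HS hs)) eqxx.
by nc_ring (tt, e).
Qed.
Lemma cB_ee N : cB N * ee s = cB N.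
Proof.
rewrite /cB mulr_suml; apply: eq_bigr => k _.
have C1 : Cs s (Pn xn yn N) by apply: Cs_Pn.
have C2 : Cs s (yn ^+ (N * k)) by apply: CsX; apply: Cs_y.
have e1 := esym (ee_comm hs C1); have e2 := esym (ee_comm hs C2).
have e : Es k 0 * ee s = Es k 0 by rewrite ee00 (mulEkl (YX HS hs)) eqxx.
by nc_ring (tt, e, e1, e2).
Qed.
Lemma cA_PP N : cA N * PP N = cA N.
Proof.
rewrite /cA mulr_suml; apply: eq_bigr => k _; rewrite /PP.
have e1 : Pn xn yn N * Pn xs ys N = Pn xs ys N * Pn xn yn N.
  by rewrite (PnE xs ys) mulr_suml mulr_sumr; apply: eq_bigr => j _; rewrite Es_comm //; apply: Cs_Pn.
have e2 : xn ^+ (N * k) * Pn xs ys N = Pn xs ys N * xn ^+ (N * k).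
  by rewrite (PnE xs ys) mulr_suml mulr_sumr; apply: eq_bigr => j _; rewrite Es_comm //; apply: CsX; apply: Cs_x.
have e3 : Es 0 k * Pn xs ys N = Es 0 k.
  rewrite (PnE xs ys) mulr_sumr (bigD1 k) //= (mulEkl (YX HS hs)) eqxx big1 ?addr0 // => j jk.
  by rewrite (mulEkl (YX HS hs)) (inj_eq val_inj) eq_sym (negPf jk).
have e4 := Pn_idem N hn.
by nc_ring (tt, e1, e2, e3, e4).
Qed.
Lemma PP_cB N : PP N * cB N = cB N.
Proof.
rewrite /cB mulr_sumr; apply: eq_bigr => k _; rewrite /PP.
have e1 : Pn xn yn N * Es k 0 = Es k 0 * Pn xn yn N by rewrite Es_comm //; apply: Cs_Pn.
have e3 : Pn xs ys N * Es k 0 = Es k 0.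
  rewrite (PnE xs ys) mulr_suml (bigD1 k) //= (mulEkl (YX HS hs)) eqxx big1 ?addr0 // => j jk.
  by rewrite (mulEkl (YX HS hs)) (inj_eq val_inj) (negPf jk).
have e4 := Pn_idem N hn.
by nc_ring (tt, e1, e3, e4).
Qed.
Lemma cAB N : cA N * cB N = ee s * Pn xn yn (N * N).
Proof.
have -> : Pn xn yn (N * N) = \sum_(k < N) xn ^+ (N * k) * Pn xn yn N * yn ^+ (N * k).
  suff H m : Pn xn yn (N * m) = \sum_(k < m) xn ^+ (N * k) * Pn xn yn N * yn ^+ (N * k) by apply: H.
  elim: m => [|m IH]; first by rewrite muln0 big_ord0 /Pn mulr1 subrr.
  rewrite big_ord_recr /= -IH mulnS addnC /Pn !exprD.
  have e : xn ^+ N * xn ^+ (N * m) = xn ^+ (N * m) * xn ^+ N by rewrite -!exprD addnC.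
  have e' : yn ^+ N * yn ^+ (N * m) = yn ^+ (N * m) * yn ^+ N by rewrite -!exprD addnC.
  by nc_ring (tt, e, e').
rewrite /cA mulr_suml mulr_sumr; apply: eq_bigr => k _; rewrite /cB mulr_sumr (bigD1 k) //= [X in _ + X]big1 ?addr0.
  have C : Cs s (xn ^+ (N * k) * Pn xn yn N) by apply: CsM; [apply: CsX; apply: Cs_x|apply: Cs_Pn].
  have e1 : xn ^+ (N * k) * Pn xn yn N * Es k 0 = Es k 0 * (xn ^+ (N * k) * Pn xn yn N) by rewrite Es_comm.
  have e2 : Es 0 k * Es k 0 = ee s by rewrite (mulEkl (YX HS hs)) eqxx /Ekl mul1r mulr1.
  have e3 := Pn_idem N hn.
  by nc_ring (tt, e1, e2, e3).
move=> j jk.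
have C : Cs s (xn ^+ (N * k) * Pn xn yn N) by apply: CsM; [apply: CsX; apply: Cs_x|apply: Cs_Pn].
have e1 : xn ^+ (N * k) * Pn xn yn N * Es j 0 = Es j 0 * (xn ^+ (N * k) * Pn xn yn N) by rewrite Es_comm.
have e2 : Es 0 k * Es j 0 = 0 by rewrite (mulEkl (YX HS hs)) (inj_eq val_inj) eq_sym (negPf jk).
by nc_ring (tt, e1, e2).
Qed.

Lemma IQn_Pn N : IQ [:: n] (Pn xn yn N). Proof. exact: (F_IQn (F_Pn (tctxA HS n0) N)). Qed.
Lemma IQn_cA N : IQ [:: n] (cA N).
Proof. by apply: big_ind => [||k _]; [apply: IQ_0|apply: IQ_D|apply: IQ_Ml; apply: IQn_Pn]. Qed.
Lemma Cs_cA t N : t != s -> t != n -> Cs t (cA N).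
Proof.
move=> ts tn; apply: Cs_sum => k _; apply: CsM; last by apply: Cs_Pn; rewrite // eq_sym.
by apply: CsM; [apply: Cs_Ekl; rewrite // eq_sym|apply: CsX; apply: Cs_x; rewrite // eq_sym].
Qed.
Lemma Cs_cB t N : t != s -> t != n -> Cs t (cB N).
Proof.
move=> ts tn; apply: Cs_sum => k _; apply: CsM; last by apply: CsX; apply: Cs_y; rewrite // eq_sym.
by apply: CsM; [apply: Cs_Ekl; rewrite // eq_sym|apply: Cs_Pn; rewrite // eq_sym].
Qed.

Lemma PP_supp z : IQ [:: s] z -> IQ [:: n] z -> exists N0, forall N, (N0 <= N)%N -> PP N * z = z /\ z * PP N = z.
Proof.
move=> zs zn.
have [N1 b1] := F_bnd (tctxAs HS hs) (idl_B (tctxAs HS hs)) (IQs_F HS hs zs).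
have [N2 b2] := F_bnd (tctxA HS n0) (idl_B (tctxA HS n0)) (IQn_F HS n0 zn).
exists (maxn N1 N2) => N; rewrite geq_max => /andP[h1 h2].
have [e1 e2] := Pn_bnd (bndW h1 b1); have [e3 e4] := Pn_bnd (bndW h2 b2).
by rewrite /PP -mulrA e3 e1 mulrA e2 e4.
Qed.

(** * Finite matrices of corner elements *)

Section Theta.
Variables (L : comNzRingType) (rho : {rmorphism A -> L}).

(** The entries are taken in the first cell of the direction [s] and in the cells ([i], [j]) of the
    direction [n]; [rho] moves them to a commutative ring, where determinants exist. *)
Definition Th m l (w : A) : 'M[L]_(m, l) := \matrix_(i, j) rho (T2 (yn ^+ i * w * xn ^+ j)).

Lemma ThD m l a b : Th m l (a + b) = Th m l a + Th m l b.
Proof. by apply/matrixP => i j; rewrite !mxE mulrDr mulrDl T2D rmorphD. Qed.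

(** The hypothesis confines [a], on its right, to the first [l] cells of the corner, so that no
    summand is lost when the matrices are cut to size [l]. *)
Lemma Th_mul m l r a b : a * (ee s * Pn xn yn l) = a -> Th m r (a * b) = Th m l a *m Th l r b.
Proof.
move=> ea; apply/matrixP => i j; rewrite !mxE -{1}ea (PnE xn yn).
have -> : yn ^+ i * (a * (ee s * \sum_(k < l) En k k) * b) * xn ^+ j =
   \sum_(k < l) (yn ^+ i * a * xn ^+ k) * ee s * ee n * (yn ^+ k * b * xn ^+ j).
  rewrite !mulr_sumr !mulr_suml !mulr_sumr !mulr_suml; apply: eq_bigr => k _; rewrite /Ekl.
  have Ck : Cs s (xn ^+ k) by apply: CsX; apply: Cs_x.
  have e := ee_comm hs Ck.
  rewrite -/(ee n); set e1 := ee s in e *; set e2 := ee n; clearbody e1 e2; by nc_ring (tt, e).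
have sumE (I : Type) (q : seq I) (F : I -> A) : T2 (\sum_(i <- q) F i) = \sum_(i <- q) T2 (F i).
  by apply: (big_morph _ T2D T2_0).
by rewrite sumE rmorph_sum; apply: eq_bigr => k _; rewrite T2_mul rmorphM !mxE.
Qed.


Definition Dm N h := Th (N * N) (N * N) (cA N * h * cB N).

Lemma cA_cB_Pn N : ee s * Pn xn yn (N * N) * cA N = cA N /\ cB N * (ee s * Pn xn yn (N * N)) = cB N.
Proof. by rewrite -cAB -mulrA cBA cA_PP mulrA cBA PP_cB. Qed.

Lemma DmD N h k : Dm N (h + k) = Dm N h + Dm N k.
Proof. by rewrite /Dm -ThD; congr (Th _ _ _); nc_ring tt. Qed.
Lemma Dm_mul N h k : h * PP N = h -> Dm N (h * k) = Dm N h *m Dm N k.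
Proof.
move=> hP; rewrite /Dm -{1}hP -cBA.
have -> : cA N * (h * (cB N * cA N) * k) * cB N = cA N * h * cB N * (cA N * k * cB N) by nc_ring tt.
by apply: Th_mul; rewrite -(mulrA _ (cB N)) (cA_cB_Pn N).2.
Qed.
End Theta.

(** [cA] and [cB] turn an element supported on [N] by [N] cells into a finite matrix in the single
    direction [n], which is determined by its entries. *)
Lemma T2_inj N v : PP N * v = v -> v * PP N = v ->
  (forall i j : 'I_(N * N), T2 (yn ^+ i * (cA N * v * cB N) * xn ^+ j) = 0) -> v = 0.
Proof.
move=> v1 v2 H; have [e1 e2] := cA_cB_Pn N.
have Cx k : Cs s (xn ^+ k) by apply: CsX; apply: Cs_x.
have Cy k : Cs s (yn ^+ k) by apply: CsX; apply: Cs_y.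
pose t := tau s (cA N * v * cB N).
have E : cA N * v * cB N = ee s * t.
  rewrite -corner //.
  have e3 := cA_ee N; have e4 := cB_ee N.
  by set e := ee s in e3 e4 *; clearbody e; nc_ring (tt, e3, e4).
have t0 : t = 0.
  have bt : bnd xn yn (N * N) t.
    move=> M NM; rewrite /t -tauMl // -tauMr //.
    have [b1 b2] := @bnd_Pn _ _ _ _ (tctxA HS n0) (N * N)%N M NM.
    have z0 : tau s 0 = 0 by apply: mproj0.
    split.
      rewrite -e1; have e := esym (ee_comm hs (Cy M)).
      suff -> : yn ^+ M * (ee s * Pn xn yn (N * N) * cA N * v * cB N) = 0 by [].
      by set q := ee s in e *; clearbody q; nc_ring (tt, e, b1).
    rewrite -e2; have e := ee_comm hs (Cx M).
    have e' := ee_comm hs (Cs_Pn (N * N) hn ns).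
    suff -> : cA N * v * (cB N * (ee s * Pn xn yn (N * N))) * xn ^+ M = 0 by [].
    by set q := ee s in e e' *; clearbody q; nc_ring (tt, b2).
  rewrite (bnd_expand HS n0 bt) big1 // => i _; rewrite big1 // => j _.
  by have := H i j; rewrite /T2 (tauMr _ hs (Cx j)) (tauMl _ hs (Cy i)) -/t => ->; rewrite mul0r.
rewrite -v1 -v2 -cBA.
have -> : cB N * cA N * (v * (cB N * cA N)) = cB N * (cA N * v * cB N) * cA N by nc_ring tt.
by rewrite E t0 mulr0 mulr0 mul0r.
Qed.

Lemma eps_tau t r a : (0 < r <= n)%N -> t != r -> eps t (tau r a) = tau r (eps t a).
Proof.
move=> hr tr; have [o os] := ordP hr; move: a; apply: (A_ind HS) => [|a b Ha Hb|c m].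
- by rewrite !tauE mproj0 !rmorph0 mproj0.
- by rewrite !tauE mprojD !rmorphD mprojD -!tauE Ha Hb.
rewrite eps_mon !tauE !mproj_mon !(chi0E _ os) /= !ffunE os [r == t]eq_sym (negPf tr).
by case: ifP => _; rewrite ?eps_mon ?rmorph0.
Qed.

(** No index is defined. With [g] the shift block, [g'] its left inverse and [z] the finite
    difference, [1 + k = g' * U] is a left inverse of [1 + h = U' * g]. Since [h] and [k] amount to
    square matrices over [K], it is a right inverse too. Hence [g * g' = 1], so
    [xs ^+ d * ys ^+ d = 1], which is absurd for positive [d]. *)
Lemma index_lemma_pos U U' d : (forall j, (0 < j < n)%N -> j != s -> Cs j U /\ Cs j U') ->
  U * U' = 1 -> U' * U = 1 -> IQ [:: s] (U - 1 - (xs ^+ d - 1) * ee n) -> IQ [:: n] (U - 1 - (xs ^+ d - 1) * ee n) ->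
  d = 0%N.
Proof.
move=> CU r l Is In; have [->//|dp] := posnP d; exfalso.
set z := U - 1 - _ in Is In.
pose g := 1 + (xs ^+ d - 1) * ee n; pose g' := 1 + (ys ^+ d - 1) * ee n.
have Cx : Cs n (xs ^+ d) by apply: CsX; apply: Cs_x.
have Cy : Cs n (ys ^+ d) by apply: CsX; apply: Cs_y.
have ex := ee_comm hn Cx; have ey := ee_comm hn Cy; have ei := ee_idem HS hn.
have yx := mulYX_exp (YX HS hs) d.
have Uz : U = g + z by rewrite /z /g; nc_ring tt.
have gg : g' * g = 1 by rewrite /g /g'; set q := ee n in ex ey ei *; clearbody q; nc_ring (tt, ex, ey, ei, yx).
pose h := - (U' * z); pose k := g' * z.
have kh : k + h + k * h = 0.
  have e1 : U' * z = 1 - U' * g by rewrite -l Uz; nc_ring tt.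
  have e2 : g' * z = g' * U - 1 by rewrite -gg Uz; nc_ring tt.
  rewrite /k /h e1 e2.
  have -> : g' * U - 1 - (1 - U' * g) + (g' * U - 1) * - (1 - U' * g) = g' * (U * U') * g - 1 by nc_ring tt.
  by rewrite r mulr1 gg subrr.
have Ish : IQ [:: s] h by apply/IQ_N/IQ_Ml.
have Inh : IQ [:: n] h by apply/IQ_N/IQ_Ml.
have Isk : IQ [:: s] k by apply/IQ_Ml.
have Ink : IQ [:: n] k by apply/IQ_Ml.
have [N1 H1] := PP_supp Ish Inh; have [N2 H2] := PP_supp Isk Ink.
pose N := maxn N1 N2; have [Ph hP] := H1 N (leq_maxl _ _); have [Pk kP] := H2 N (leq_maxr _ _).
have hk : h + k + h * k = 0.
  have [rho [rhoc _]] := aug_exists HS.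
  apply: (@T2_inj N).
  - by have := Ph; have := Pk; set P := PP N => a b; nc_ring (tt, a, b).
  - by have := hP; have := kP; set P := PP N => a b; nc_ring (tt, a, b).
  have DE : Dm rho N (h + k + h * k) = 0.
    have e0 : Dm rho N k + Dm rho N h + Dm rho N k *m Dm rho N h = 0.
      rewrite -Dm_mul // -!DmD kh.
      by apply/eqP; rewrite -(inj_eq (addrI (Dm rho N 0))) -DmD !addr0.
    have e1 : (1%:M + Dm rho N k) *m (1%:M + Dm rho N h) = 1%:M.
      rewrite mulmxDl !mulmxDr !mulmx1 mul1mx -[RHS]addr0 -[in RHS]e0 -!addrA; congr (_ + _).
      by rewrite addrCA.
    have := mulmx1C e1; rewrite mulmxDl !mulmxDr !mulmx1 mul1mx => e2.
    rewrite !DmD (Dm_mul rho k hP); apply: (@addrI _ (1%:M : 'M[K]_(N * N))); rewrite addr0 -[RHS]e2.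
    by rewrite -!addrA; congr (_ + _); rewrite addrCA.
  move=> i j; set w := T2 _.
  have wD : rho w = 0 by have /matrixP /(_ i j) := DE; rewrite !mxE.
  (* The compressions remove the variables [s] and [n], the hypothesis on [U] and [U'] excludes all
     others; the entry is a scalar, and the augmentation [rho] detects it. *)
  have [c wc] : exists c, w = c%:A.
    apply: (Cs_all_scalar (HS := HS)) => t ht; have [->|tn] := eqVneq t n; first exact: tau_in_Cs.
    have tn' : (0 < t < n)%N by case/andP: ht => -> /=; rewrite leq_eqVlt (negPf tn).
    rewrite /w /T2; have [->|ts] := eqVneq t s.
      by rewrite CsE eps_tau // [eps s _](tau_in_Cs HS _ hs).
    have [C1 C2] := CU t tn' ts.
    have Ce : Cs t (ee n) by apply: Cs_ee; rewrite // eq_sym.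
    have Cz : Cs t z.
      by apply: CsB; [apply: CsB => //; apply: Cs1|apply: CsM => //; apply: CsB; [apply: CsX; apply: Cs_x; rewrite // eq_sym|apply: Cs1]].
    have Ch : Cs t h by rewrite /h -sub0r; apply: CsB; [apply: Cs0|apply: CsM].
    have Ck : Cs t k.
      by apply: CsM => //; apply: CsD; [apply: Cs1|apply: CsM => //; apply: CsB; [apply: CsX; apply: Cs_y; rewrite // eq_sym|apply: Cs1]].
    rewrite CsE !eps_tau //; congr (tau n (tau s _)).
    apply: CsM; last by apply: CsX; apply: Cs_x; rewrite // eq_sym.
    apply: CsM; first by apply: CsX; apply: Cs_y; rewrite // eq_sym.
    apply: CsM; last exact: Cs_cB.
    apply: CsM; first exact: Cs_cA.
    by apply: CsD; [apply: CsD|apply: CsM].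
  by move: wD; rewrite wc rhoc => ->; rewrite scale0r.
have gg' : g * g' = 1.
  have e1 : U' * z = 1 - U' * g by rewrite -l Uz; nc_ring tt.
  have e2 : g' * z = g' * U - 1 by rewrite -gg Uz; nc_ring tt.
  have e3 : (U' * g) * (g' * U) = 1.
    by rewrite -[RHS]addr0 -[in RHS]hk /h /k e1 e2; nc_ring tt.
  rewrite -[g]mul1r -[g']mulr1 -r; 
  have -> : U * U' * g * (g' * (U * U')) = U * (U' * g * (g' * U)) * U' by nc_ring tt.
  by rewrite e3 mulr1.
have e0 : ee n * (1 - xs ^+ d * ys ^+ d) = 0.
  have -> : ee n * (1 - xs ^+ d * ys ^+ d) = 1 - g * g'.
    by rewrite /g /g'; set q := ee n in ex ey ei *; clearbody q; nc_ring (tt, ex, ey, ei).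
  by rewrite gg' subrr.
have e1 : 1 - xs ^+ d * ys ^+ d = 0.
  rewrite -(tau_ee (HS := HS) (s := n) hn (c := 1 - xs ^+ d * ys ^+ d)); last by apply: CsB; [apply: Cs1|apply: CsM].
  by rewrite e0; apply: mproj0.
have := congr1 (tau s) e1; rewrite !tauE mprojB mproj0 -!tauE tau1 // tau_xy //.
by rewrite (gtn_eqF dp) /= subr0 => /eqP; rewrite oner_eq0.
Qed.

(** A power of [ys] is reduced to a power of [xs] by passing to the inverse of [U]. *)
Lemma index_lemma U U' d : (forall j, (0 < j < n)%N -> j != s -> Cs j U /\ Cs j U') ->
  U * U' = 1 -> U' * U = 1 -> forall w, w = xs ^+ d \/ w = ys ^+ d ->
  IQ [:: s] (U - 1 - (w - 1) * ee n) -> IQ [:: n] (U - 1 - (w - 1) * ee n) -> d = 0%N.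
Proof.
move=> CU r l w [->|->]; first exact: index_lemma_pos CU r l.
move=> Is In; apply: (@index_lemma_pos U' U d) => // [j hj js||]; try by have [] := CU j hj js.
all: pose z := U - 1 - (ys ^+ d - 1) * ee n; pose g := 1 + (xs ^+ d - 1) * ee n.
all: have Cx : Cs n (xs ^+ d) by [apply: CsX; apply: Cs_x].
all: have Cy : Cs n (ys ^+ d) by [apply: CsX; apply: Cs_y].
all: have ex := ee_comm hn Cx; have ey := ee_comm hn Cy; have ei := ee_idem HS hn.
all: have yx := mulYX_exp (YX HS hs) d.
all: suff -> : U' - 1 - (xs ^+ d - 1) * ee n = - (U' * z * g) by [apply: IQ_N; apply: IQ_Mr; apply: IQ_Ml].
all: rewrite /z /g; set q := ee n in ex ey ei *; clearbody q; nc_ring (tt, ex, ey, ei, yx, l).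
Qed.
End Corner.

(** * Descent *)

Section Descent.
Variables (K : fieldType) (A : unitAlgType K) (n : nat) (x y : nat -> A).
Hypothesis HS : is_Sn n x y.
Hypothesis n0 : (0 < n)%N.
Local Notation Cs := (Cs HS).
Local Notation IQ := (IQ x y).
Local Notation tau := (tau HS).
Local Notation eps := (eps HS).
Local Notation ee := (ee x y).
Local Notation xn := (x n).
Local Notation yn := (y n).
Local Notation tt_ := (fun _ _ : nat => true).
Local Notation En k l := (Ekl xn yn k l).
Let hn : (0 < n <= n)%N. Proof. by rewrite n0 leqnn. Qed.
Let le_of s : (0 < s < n)%N -> (0 < s <= n)%N. Proof. by case/andP => -> /ltnW. Qed.
Let ns_of s : (0 < s < n)%N -> n != s. Proof. by move=> h; rewrite eq_sym neq_ltn; case/andP: h => _ ->. Qed.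

(* The block [b] placed in the corner of [e_s e_n]; [gam k lam%:A] is [mu_{k,n}(lam)]. *)
Definition gam s b : A := 1 + (b - 1) * (ee s * ee n).

Lemma gam_mul s b c : (0 < s < n)%N -> Cs s b -> Cs n b -> Cs s c -> Cs n c -> gam s b * gam s c = gam s (b * c).
Proof.
move=> hs b1 b2 c1 c2; rewrite /gam.
have e1 := ee_comm (le_of hs) c1; have e2 := ee_comm hn c2.
have e3 : ee n * ee s = ee s * ee n by apply: (ee_comm (HS := HS)) => //; apply: Cs_ee; rewrite ?(le_of hs) // eq_sym ns_of.
have e4 := ee_idem HS (le_of hs); have e5 := ee_idem HS hn.
by nc_ring (tt, e1, e2, e3, e4, e5).
Qed.
Lemma gam1 s : gam s 1 = 1. Proof. by rewrite /gam subrr mul0r addr0. Qed.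
Lemma gam_IQn s b : IQ [:: n] (gam s b - 1).
Proof. by rewrite /gam addrC addKr; apply: IQ_Ml; apply: IQ_Ml; apply: IQ_ee; rewrite inE. Qed.
Lemma gam_IQs s b S : s \in S -> IQ S (gam s b - 1).
Proof. by move=> sS; rewrite /gam addrC addKr; apply: IQ_Ml; apply: IQ_Mr; apply: IQ_ee. Qed.

Lemma ker_eq Q (R : nzRingType) (f : {rmorphism A -> R}) a b : model x y Q f -> f a = f b <-> IQ Q (a - b).
Proof.
move=> [_ ker]; rewrite -ker rmorphB; split; first by move=> ->; rewrite subrr.
by move/eqP; rewrite subr_eq0 => /eqP.
Qed.
Lemma model_W Q Q' (R R' : nzRingType) (f : {rmorphism A -> R}) (f' : {rmorphism A -> R'}) a b :
  {subset Q <= Q'} -> model x y Q f -> model x y Q' f' -> f a = f b -> f' a = f' b.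
Proof. by move=> QQ m m' /(ker_eq _ _ m) h; apply/(ker_eq _ _ m'); apply: IQ_W h. Qed.

Lemma Cs_eps r t a : Cs r a -> Cs r (eps t a).
Proof.
move: a; apply: Cs_ind => [|a b Ha Hb|c m hm]; rewrite ?rmorph0 ?rmorphD; [exact: Cs0|exact: CsD|].
rewrite eps_mon CsE eps_mon; congr (c *: mon x y (_, _)); apply/ffunP => o; rewrite !ffunE.
  by case: eqP => // /hm [-> _]; case: ifP.
by case: eqP => // /hm [_ ->]; case: ifP.
Qed.

Local Notation Bof := (Bf HS).

Section M.
Variables (R : nzRingType) (f : {rmorphism A -> R}).
Local Notation X := (f xn).
Local Notation Y := (f yn).
Local Notation Bf := (Bf HS f).
Local Notation pf S := (pf HS f S).
Let HT := tctx_model HS n0 f.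

Lemma F_pf S z : okS n S -> IQ [:: n] z -> IQ S z -> Fs X Y tt_ (pf S) (f z).
Proof. by move=> oS zn zS; apply: F_image (IQ_F HS n0 oS zn zS) => a pa; exists a. Qed.
Lemma F_Bf z : IQ [:: n] z -> Fs X Y tt_ Bf (f z).
Proof. by move=> zn; apply: F_image (IQn_F HS n0 zn) => a Ca; exists a. Qed.
Lemma gl_lift S u u' : gl X Y (pf S) u u' ->
  exists z z', [/\ IQ [:: n] z /\ IQ S z, IQ [:: n] z' /\ IQ S z', u = f (1 + z) & u' = f (1 + z')].
Proof.
move=> gu.
have L w : Fs X Y tt_ (pf S) (w - 1) -> exists z, [/\ IQ [:: n] z, IQ S z & w = f (1 + z)].
  move=> Fw; have [z Fz e] := F_lift (p := pA HS S) (fun b h => h) Fw; exists z; split.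
  - exact: F_IQn Fz.
  - by apply: F_IQ Fz => a [].
  - by rewrite rmorphD rmorph1 -e addrC subrK.
have [z [h1 h2 h3]] := L _ (gl_F gu); have [z' [h4 h5 h6]] := L _ (gl_F' gu).
by exists z, z'.
Qed.
Lemma gl_lift_B u u' : gl X Y Bf u u' ->
  exists z z', [/\ IQ [:: n] z, IQ [:: n] z', u = f (1 + z) & u' = f (1 + z')].
Proof.
move=> gu.
have L w : Fs X Y tt_ Bf (w - 1) -> exists z, [/\ IQ [:: n] z & w = f (1 + z)].
  move=> Fw; have [z Fz e] := F_lift (p := Cs n) (fun b h => h) Fw; exists z; split.
  - exact: F_IQn Fz.
  - by rewrite rmorphD rmorph1 -e addrC subrK.
have [z [h1 h2]] := L _ (gl_F gu); have [z' [h3 h4]] := L _ (gl_F' gu).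
by exists z, z'.
Qed.
Lemma gl_of_B S u u' : gl X Y Bf u u' -> Fs X Y tt_ (pf S) (u - 1) -> gl X Y (pf S) u u'.
Proof.
move=> [r l Fu Fu'] Fp; split=> //.
have -> : u' - 1 = - ((u' - 1) * (u - 1) + (u - 1)) by nc_ring (tt, l).
apply: FsN; first exact: pf_idl.
by apply: FsD => //; apply: (FMr HT) => //; apply: pf_idl.
Qed.
Lemma El_image (p : A -> Prop) (q : R -> Prop) g : (forall a, p a -> q (f a)) -> El xn yn p g -> El X Y q (f g).
Proof.
move=> pq; elim=> [|a k l kl pa|g1 g2 _ E1 _ E2].
- by rewrite rmorph1; apply: El1.
- by rewrite rmorphD rmorph1 rmorphM f_Ekl; apply: ElE => //; apply: pq.
- by rewrite rmorphM; apply: ElM.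
Qed.
Lemma El_lift g : El X Y Bf g -> exists2 G, El xn yn (Cs n) G & g = f G.
Proof.
elim=> [|_ k l kl [a Ca ->]|g1 g2 _ [G1 E1 ->] _ [G2 E2 ->]].
- by exists 1; rewrite ?rmorph1 //; apply: El1.
- by exists (1 + a * En k l); [apply: ElE|rewrite rmorphD rmorph1 rmorphM f_Ekl].
- by exists (G1 * G2); [apply: ElM|rewrite rmorphM].
Qed.
Lemma El_IQn (p : A -> Prop) g : El xn yn p g -> IQ [:: n] (g - 1).
Proof.
elim=> [|a k l kl pa|g1 g2 _ E1 _ E2].
- by rewrite subrr; apply: IQ_0.
- rewrite addrC addKr; apply: (F_IQn (p := fun=> True)); exact: FsE.
- have -> : g1 * g2 - 1 = (g1 - 1) * g2 + (g2 - 1) by nc_ring tt.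
  by apply: IQ_D => //; apply: IQ_Mr.
Qed.

Lemma IQ1_mul S a b : IQ S (a - 1) -> IQ S (b - 1) -> IQ S (a * b - 1).
Proof.
move=> ha hb; have -> : a * b - 1 = (a - 1) * b + (b - 1) by nc_ring tt.
by apply: IQ_D => //; apply: IQ_Mr.
Qed.
End M.

(** * Passing from [s :: Q] back to [Q] *)

Section Step.
Variables (Q : seq nat) (s : nat).
Hypothesis oQ : okS n Q.
Hypothesis hs0 : (0 < s < n)%N.
Hypothesis sQ : s \notin Q.
Let hs := le_of hs0.
Let ns := ns_of hs0.
Let osQ : okS n (s :: Q).
Proof. by move=> q; rewrite inE => /predU1P[->//|]; apply: oQ. Qed.
Let os : okS n [:: s]. Proof. by move=> q; rewrite inE => /eqP ->. Qed.
Variables (R : nzRingType) (f : {rmorphism A -> R}).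
Hypothesis mf : model x y Q f.
Local Notation X := (f xn).
Local Notation Y := (f yn).
Local Notation Bf := (Bf HS f).
Local Notation pf S := (pf HS f S).
Let HT := tctx_model HS n0 f.

(** Since [z = z * b * a], Vaserstein's swap turns [1 + z] into [1 + a * z * b], which lies in the
    corner and has the form [1 + ee s * z2] with [z2] free of [s]. By this freeness [tau s] removes
    the factor [ee s] from the inverse relations, so [1 + z2] itself is invertible modulo [Q]. *)
Lemma compress u u' : gl X Y (pf [:: s]) u u' ->
  exists z2 z3, [/\ Cs s z2, Cs s z3, IQ [:: n] z2, IQ [:: n] z3 &
    [/\ IQ Q ((1 + z2) * (1 + z3) - 1), IQ Q ((1 + z3) * (1 + z2) - 1) &
    Er X Y Bf (pf [:: s]) (f (1 + ee s * z2) * u')]].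
Proof.
move=> gu; have [z [z' [[zn zs] [zn' zs'] eu eu']]] := gl_lift gu.
have [N /(_ N (leqnn N)) [Pz zP]] := PP_supp HS n0 hs0 zs zn.
set a := cA n x y s N; set b := cB n x y s N.
have e1 : f (z * b) * f a = f z by rewrite -rmorphM -mulrA cBA // zP.
have Fa : Fs X Y tt_ (pf [:: s]) (f (z * b)) by apply: F_pf => //; apply: IQ_Mr.
have Fb : Fs X Y tt_ Bf (f a) by apply: F_Bf; apply: IQn_cA.
have gu2 : gl X Y (pf [:: s]) (1 + f (z * b) * f a) u' by rewrite e1 -(rmorph1 f) -rmorphD -eu.
have [g2 E2] := vaserstein HT (pf_idl HS f [:: s]) Fa Fb gu2.
have cut w : a * w * b = ee s * tau s (a * w * b).
  rewrite -corner //; have e3 := cA_ee HS hs0 N; have e4 := cB_ee HS n0 hs0 N; rewrite -/a -/b in e3 e4.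
  by set e := ee s in e3 e4 *; clearbody e; nc_ring (tt, e3, e4).
pose z2 := tau s (a * z * b); pose z3 := - tau s (a * ((1 + z') * z) * b).
have C2 : Cs s z2 by apply: tau_in_Cs.
have C3 : Cs s z3 by rewrite /z3 -sub0r; apply: CsB; [apply: Cs0|apply: tau_in_Cs].
have tn w : IQ [:: n] (tau s (a * w * b)).
  apply: tau_IQ => //; first by rewrite inE eq_sym.
    by move=> q; rewrite inE => /eqP ->.
  by apply: IQ_Mr; apply: IQ_Mr; apply: IQn_cA.
have f2 : 1 + f a * f (z * b) = f (1 + ee s * z2) by rewrite -rmorphM mulrA cut rmorphD rmorph1.
have f3 : 1 - f a * u' * f (z * b) = f (1 + ee s * z3).
  rewrite eu' -!rmorphM; have -> : a * (1 + z') * (z * b) = a * ((1 + z') * z) * b by nc_ring tt.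
  by rewrite cut /z3 mulrN rmorphB rmorph1.
rewrite f2 f3 in g2; rewrite f2 in E2.
have K0 w w' : Cs s w -> Cs s w' -> f (1 + ee s * w) * f (1 + ee s * w') = 1 -> IQ Q ((1 + w) * (1 + w') - 1).
  move=> Cw Cw'; rewrite -rmorphM -(rmorph1 f) => /(ker_eq _ _ mf) h.
  have -> : (1 + w) * (1 + w') - 1 = tau s (ee s * ((1 + w) * (1 + w') - 1)).
    by rewrite tau_ee //; apply: CsB; [apply: CsM; apply: CsD => //; apply: Cs1|apply: Cs1].
  apply: tau_IQ => //; first exact: okS_le.
  suff -> : ee s * ((1 + w) * (1 + w') - 1) = (1 + ee s * w) * (1 + ee s * w') - 1 by [].
  have c1 := ee_comm hs Cw; have i1 := ee_idem HS hs; have c2 := ee_comm hs Cw'.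
  by nc_ring (tt, c1, c2, i1).
exists z2, z3; split=> //; [exact: tn|by rewrite /z3; apply: IQ_N; apply: tn|].
split=> //; [by apply: K0 => //; apply: gl_r g2|by apply: K0 => //; apply: gl_l g2].
Qed.

Lemma UQ_eps b : UQ x y (s :: Q) b -> UQ x y Q (eps s b).
Proof.
elim=> [c c0|q|q|a c _ Ua _ Uc].
- by rewrite eps_scal; apply: UQ_scal.
- rewrite inE; have [-> _|qs /= qQ] := eqVneq q s.
    by rewrite eps_xs //; have := @UQ_scal K A x y Q 1 (oner_neq0 _); rewrite scale1r.
  by rewrite eps_x //; [apply: UQ_x|apply: (okS_le oQ)].
- rewrite inE; have [-> _|qs /= qQ] := eqVneq q s.
    by rewrite eps_ys //; have := @UQ_scal K A x y Q 1 (oner_neq0 _); rewrite scale1r.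
  by rewrite eps_y //; [apply: UQ_y|apply: (okS_le oQ)].
- by rewrite rmorphM; apply: UQ_mul.
Qed.

Lemma eps_ee : eps s (ee n) = ee n.
Proof. exact: Cs_ee. Qed.

(** Cutting by [ee s] is multiplicative, because [ee s] is an idempotent that commutes with every
    element free of [s]. *)
Lemma El_eps_cut G : El xn yn (Cs n) G -> El xn yn (pA HS [:: s]) (1 + ee s * (eps s G - 1)).
Proof.
elim=> [|a k l kl Ca|g h _ Eg _ Eh].
- by rewrite rmorph1 subrr mulr0 addr0; apply: El1.
- have -> : eps s (1 + a * En k l) - 1 = eps s a * En k l.
    by rewrite rmorphD rmorph1 rmorphM [eps s (En k l)](Cs_Ekl HS) // addrC addKr.
  rewrite mulrA; apply: ElE => //; split; last by apply: IQ_Mr; apply: IQ_ee; rewrite inE.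
  apply: CsM; first by apply: Cs_ee => //; rewrite eq_sym.
  exact: Cs_eps.
- have -> : 1 + ee s * (eps s (g * h) - 1) = (1 + ee s * (eps s g - 1)) * (1 + ee s * (eps s h - 1)).
    rewrite rmorphM; have c1 := ee_comm hs (epsK HS s g); have c2 := ee_comm hs (epsK HS s h); have i1 := ee_idem HS hs.
    by nc_ring (tt, c1, c2, i1).
  exact: ElM.
Qed.

Lemma eps_gam b : eps s (1 + (b - 1) * ee n) = 1 + (eps s b - 1) * ee n.
Proof. by rewrite rmorphD rmorphM rmorphB rmorph1 eps_ee. Qed.

Lemma gam_gl b : UQ x y Q b -> exists b', [/\ UQ x y Q b', gl X Y (pf [:: s]) (f (gam s b)) (f (gam s b')),
  f b * f b' = 1 & f b' * f b = 1].
Proof.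
move=> Ub; have [b' [Ub' h1 h2]] := UQ_inv HS oQ mf Ub; exists b'; split=> //.
have nQ := okS_n oQ.
have G c c' : UQ x y Q c -> UQ x y Q c' -> f c * f c' = 1 -> f (gam s c) * f (gam s c') = 1.
  move=> Uc Uc' h; rewrite -rmorphM gam_mul //; try exact: (UQ_Cs HS oQ _ Uc); try exact: (UQ_Cs HS oQ _ Uc').
  by rewrite /gam rmorphD rmorphM rmorphB (rmorphM f c) h rmorph1 subrr mul0r addr0.
have F c : Fs X Y tt_ (pf [:: s]) (f (gam s c) - 1).
  by rewrite -(rmorph1 f) -rmorphB; apply: F_pf => //; [apply: gam_IQn|apply: gam_IQs; rewrite inE].
by split; rewrite ?G.
Qed.

(** For a compressed unit [1 + ee s * z2], the element [1 + z2] remains a unit once [x s] is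
    inverted, where the monomial form is given. As [z2] is free of [s], the retraction [eps s]
    removes [s] from that form as well, and multiplication by [ee s] places it in the corner. *)
Lemma gl_corner : K1_monomial HS (s :: Q) -> forall u u', gl X Y (pf [:: s]) u u' ->
  exists e b, [/\ UQ x y Q b, Er X Y Bf (pf [:: s]) e & u = e * f (gam s b)].
Proof.
move=> TA u u' gu; have [z2 [z3 [C2 C3 n2 n3 [r l E]]]] := compress gu.
have [R2 [f2 m2]] := model_exists HS osQ.
have QsQ : {subset Q <= s :: Q} by move=> q qQ; rewrite inE qQ orbT.
have g2 : gl (f2 xn) (f2 yn) (Bof f2) (f2 (1 + z2)) (f2 (1 + z3)).
  split; rewrite -?rmorphM -(rmorph1 f2).
  - by apply/(ker_eq _ _ m2); apply: IQ_W r.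
  - by apply/(ker_eq _ _ m2); apply: IQ_W l.
  - by rewrite -rmorphB addrC addKr; apply: F_Bf.
  - by rewrite -rmorphB addrC addKr; apply: F_Bf.
have [b [g [Ub Eg e2]]] := TA _ _ m2 _ _ g2.
have [G EG eg] := El_lift Eg; rewrite eg in e2.
have [b' Ub'] : exists b', b' = eps s b by exists (eps s b).
have UB : UQ x y Q b' by rewrite Ub'; apply: UQ_eps.
(* [eps s] kills [ee s] and fixes [z2], so a congruence modulo [s :: Q] turns into one modulo
   [Q]. *)
have e3 : IQ Q (1 + z2 - (1 + (b' - 1) * ee n) * eps s G).
  have : IQ (s :: Q) (1 + z2 - (1 + (b - 1) * ee n) * G).
    apply/(ker_eq _ _ m2); rewrite e2 /beta rmorphM rmorphD rmorphM rmorphB rmorph1; congr ((1 + _ * _) * _).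
    by rewrite -f_Ekl /Ekl mul1r mulr1.
  move/(eps_IQ HS hs (okS_le osQ)); rewrite rmorphB rmorphM /= eps_gam -Ub' rmorphD rmorph1 [eps s z2]C2.
  by apply: IQ_W => q; rewrite eqxx /= mem_filter => /andP[].
have e4 : f (1 + ee s * z2) = f (gam s b') * f (1 + ee s * (eps s G - 1)).
  rewrite -rmorphM; apply/(ker_eq _ _ mf); rewrite /gam.
  have c1 := ee_comm hs (epsK HS s G); have i1 := ee_idem HS hs; have c2 := ee_comm hs C2.
  have c3 : ee s * b' = b' * ee s by rewrite Ub'; apply: (ee_comm hs (epsK HS s b)).
  have c4 : ee s * ee n = ee n * ee s by apply: (ee_comm (HS := HS)) => //; apply: Cs_ee.
  have -> : 1 + ee s * z2 - (1 + (b' - 1) * (ee s * ee n)) * (1 + ee s * (eps s G - 1)) =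
     ee s * (1 + z2 - (1 + (b' - 1) * ee n) * eps s G) by nc_ring (tt, c1, c2, c3, c4, i1).
  exact: IQ_Ml.
have Eg2 : Er X Y Bf (pf [:: s]) (f (1 + ee s * (eps s G - 1))).
  by apply: El_Er; apply: El_image (El_eps_cut EG) => a pa; exists a.
have [b'' [Ub'' gb _ _]] := gam_gl UB.
rewrite e4 in E; move: E Eg2; set w := f (gam s b') in gb *; set w' := f (gam s b'') in gb; set t := f (1 + _) => E Et.
have [E' [EE' EEr EEl]] := Er_inv HT (pf_idl HS f [:: s]) E.
have Et2 := Er_conj HT (pf_idl HS f [:: s]) (gl_B (pf_idl HS f [:: s]) gb) Et.
exists (E' * (w * t * w')), b'; split=> //; first exact: ErM.
rewrite -/w; have -> : E' * (w * t * w') * w = E' * (w * t) * (w' * w) by nc_ring tt.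
rewrite (gl_l gb) mulr1.
have -> : E' * (w * t) = E' * (w * t * u') * u by rewrite -mulrA -(mulrA _ u') (gl_l gu) mulr1.
by rewrite EEl mul1r.
Qed.

(* The Toeplitz unitary [[x_s, e_s], [0, y_s]] conjugates the block [b] into [1 + (b - 1) x_s y_s], the
   complement of the corner [gam s b] inside [b]. *)
Lemma gam_El b : UQ x y Q b -> El X Y Bf (f (gam s b)).
Proof.
move=> Ub; have [b' [Ub' h1 h2]] := UQ_inv HS oQ mf Ub.
have nQ := okS_n oQ.
have Bfx : Bf (f (x s)) by exists (x s) => //; apply: Cs_x => //; rewrite eq_sym.
have Bfy : Bf (f (y s)) by exists (y s) => //; apply: Cs_y => //; rewrite eq_sym.
have Bfe : Bf (f (ee s)) by exists (ee s) => //; apply: Cs_ee => //; rewrite eq_sym.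
have Bb := UQ_Bf HS f oQ Ub; have Bb' := UQ_Bf HS f oQ Ub'.
have gB := beta_gl n0 Bb Bb' h1 h2.
pose E k l := Ekl X Y k l.
pose W := 1 + (f (x s) - 1) * E 0 0 + f (ee s) * E 0 1 + (f (y s) - 1) * E 1 1.
pose W' := 1 + (f (y s) - 1) * E 0 0 + f (ee s) * E 1 0 + (f (x s) - 1) * E 1 1.
have EM k l r t : E k l * E r t = if l == r then E k t else 0 by apply: mulEkl (tc_YX HT) _ _ _ _.
have cx k l : E k l * f (x s) = f (x s) * E k l by rewrite (B_Ekl HT _ _ Bfx).
have cy k l : E k l * f (y s) = f (y s) * E k l by rewrite (B_Ekl HT _ _ Bfy).
have ce k l : E k l * f (ee s) = f (ee s) * E k l by rewrite (B_Ekl HT _ _ Bfe).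
have cb k l : E k l * f b' = f b' * E k l by rewrite (B_Ekl HT _ _ Bb').
have yx : f (y s) * f (x s) = 1 by rewrite -rmorphM (YX HS hs) rmorph1.
have ye : f (y s) * f (ee s) = 0 by rewrite -rmorphM (y_ee HS hs) rmorph0.
have ex : f (ee s) * f (x s) = 0 by rewrite -rmorphM (ee_x HS hs) rmorph0.
have ei : f (ee s) * f (ee s) = f (ee s) by rewrite -rmorphM (ee_idem HS hs).
have xy : f (x s) * f (y s) = 1 - f (ee s) by rewrite -rmorphM -(rmorph1 f) -rmorphB; congr (f _); rewrite /Defs.ee; nc_ring tt.
have Cb' := UQ_Cs HS oQ sQ Ub'; have [bx by_] := Cs_comm hs Cb'.
have xb : f (x s) * f b' = f b' * f (x s) by rewrite -!rmorphM bx.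
have yb : f (y s) * f b' = f b' * f (y s) by rewrite -!rmorphM by_.
have eb : f (ee s) * f b' = f b' * f (ee s) by rewrite -!rmorphM (ee_comm hs Cb').
move: (EM 0 0 0 0)%N (EM 0 0 0 1)%N (EM 0 0 1 0)%N (EM 0 0 1 1)%N (EM 0 1 0 0)%N (EM 0 1 0 1)%N (EM 0 1 1 0)%N (EM 0 1 1 1)%N
      (EM 1 0 0 0)%N (EM 1 0 0 1)%N (EM 1 0 1 0)%N (EM 1 0 1 1)%N (EM 1 1 0 0)%N (EM 1 1 0 1)%N (EM 1 1 1 0)%N (EM 1 1 1 1)%N => /=.
move: (cx 0 0)%N (cx 0 1)%N (cx 1 0)%N (cx 1 1)%N (cy 0 0)%N (cy 0 1)%N (cy 1 0)%N (cy 1 1)%N => x1 x2 x3 x4 y1 y2 y3 y4.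
move: (ce 0 0)%N (ce 0 1)%N (ce 1 0)%N (ce 1 1)%N (cb 0 0)%N (cb 0 1)%N (cb 1 0)%N (cb 1 1)%N => z1 z2 z3 z4 w1 w2 w3 w4.
move=> a1 a2 a3 a4 a5 a6 a7 a8 a9 b1 b2 b3 b4 b5 b6 b7.
have EF c k l : Bf c -> Fs X Y tt_ Bf (c * E k l) by move=> Bc; apply: FsE.
have B1 := tc_B1 HT; have BB := tc_BB HT.
have gW : gl X Y Bf W W'.
  split.
  - by rewrite /W /W'; nc_ring (tt, x1, x2, x3, x4, y1, y2, y3, y4, z1, z2, z3, z4, a1, a2, a3, a4, a5, a6, a7, a8, a9, b1, b2, b3, b4, b5, b6, b7, yx, ye, ex, ei, xy).
  - by rewrite /W /W'; nc_ring (tt, x1, x2, x3, x4, y1, y2, y3, y4, z1, z2, z3, z4, a1, a2, a3, a4, a5, a6, a7, a8, a9, b1, b2, b3, b4, b5, b6, b7, yx, ye, ex, ei, xy).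
  - have -> : W - 1 = (f (x s) - 1) * E 0 0 + (f (ee s) * E 0 1 + (f (y s) - 1) * E 1 1) by rewrite /W; nc_ring tt.
    by apply: FsD; [apply: EF; apply: BB|apply: FsD; [apply: EF|apply: EF; apply: BB]].
  - have -> : W' - 1 = (f (y s) - 1) * E 0 0 + (f (ee s) * E 1 0 + (f (x s) - 1) * E 1 1) by rewrite /W'; nc_ring tt.
    by apply: FsD; [apply: EF; apply: BB|apply: FsD; [apply: EF|apply: EF; apply: BB]].
have := Er_El (whitehead HT (idl_B HT) gW (gl_sym gB)).
suff -> : W * beta n x y f (f b') * W' * beta n x y f (f b) = f (gam s b) by [].
have -> : W * beta n x y f (f b') * W' = 1 + (f b' - 1) * f (x s) * f (y s) * E 0 0.
  rewrite /W /W' /beta -/(E 0 0)%N.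
  by nc_ring (tt, x1, x2, x3, x4, y1, y2, y3, y4, z1, z2, z3, z4, w1, w2, w3, w4, a1, a2, a3, a4, a5, a6, a7, a8, a9, b1, b2, b3, b4, b5, b6, b7, yx, ye, ex, ei, xy, xb, yb, eb).
have Cb := UQ_Cs HS oQ sQ Ub.
have eb2 : f (ee s) * f b = f b * f (ee s) by rewrite -!rmorphM (ee_comm hs Cb).
have w5 : E 0 0 * f b = f b * E 0 0 by rewrite (B_Ekl HT _ _ Bb).
rewrite /gam rmorphD rmorphM rmorphB rmorphM rmorph1.
have -> : f (ee n) = E 0%N 0%N by rewrite /E -f_Ekl /Ekl mul1r mulr1.
rewrite /beta -/(E 0 0)%N.
by nc_ring (tt, z1, w1, w5, a1, xy, eb, eb2, h2, ei).
Qed.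

Lemma UQ_split b (R2 : nzRingType) (f2 : {rmorphism A -> R2}) : model x y (s :: Q) f2 -> UQ x y (s :: Q) b ->
  exists b0 k l, UQ x y Q b0 /\ f2 b = f2 (b0 * x s ^+ k * y s ^+ l).
Proof.
move=> m2; have U1 : UQ x y Q 1 by have := @UQ_scal K A x y Q 1 (oner_neq0 _); rewrite scale1r.
elim=> [c c0|q|q|a c _ [a0 [k [l [Ua ea]]]] _ [c0 [k' [l' [Uc ec]]]]].
- by exists c%:A, 0%N, 0%N; rewrite !mulr1; split=> //; apply: UQ_scal.
- rewrite inE => /predU1P[->|qQ]; first by exists 1, 1%N, 0%N; rewrite mul1r mulr1.
  by exists (x q), 0%N, 0%N; rewrite !mulr1; split=> //; apply: UQ_x.
- rewrite inE => /predU1P[->|qQ]; first by exists 1, 0%N, 1%N; rewrite !mul1r.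
  by exists (y q), 0%N, 0%N; rewrite !mulr1; split=> //; apply: UQ_y.
exists (a0 * c0), (k + k')%N, (l + l')%N; split; first exact: UQ_mul.
have [h1 h2] := Cs_comm hs (UQ_Cs HS oQ sQ Uc).
have xy : f2 (x s) * f2 (y s) = 1 by apply: (model_xy m2); rewrite inE eqxx.
have yx : f2 (y s) * f2 (x s) = 1 by rewrite -rmorphM (YX HS hs) rmorph1.
have e1 : f2 (x s) ^+ k * f2 c0 = f2 c0 * f2 (x s) ^+ k.
  by rewrite comm_exp // -!rmorphM h1.
have e2 : f2 (y s) ^+ l * f2 c0 = f2 c0 * f2 (y s) ^+ l.
  by rewrite comm_exp // -!rmorphM h2.
have e3 : f2 (y s) ^+ l * f2 (x s) ^+ k' = f2 (x s) ^+ k' * f2 (y s) ^+ l.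
  by apply: commrX; apply: commr_sym; apply: commrX; rewrite /GRing.comm xy yx.
by rewrite rmorphM ea ec !rmorphM !rmorphXn !exprD; nc_ring (tt, e1, e2, e3).
Qed.

Lemma IQ_split t S : okS n (s :: S) -> IQ [:: n] t -> IQ (s :: S) t -> exists z w,
  [/\ IQ [:: s] z, IQ [:: n] z, IQ S w & t = z + w].
Proof.
move=> o tn ts; elim: (IQ_F HS n0 o tn ts) => [|a k l _ [_ Ia]|a b _ [z [w [h1 h2 h3 ->]]] _ [z' [w' [h4 h5 h6 ->]]]].
- by exists 0, 0; rewrite addr0; split=> //; apply: IQ_0.
- have [b [c [Ib Ic ->]]] := IQ_cons Ia; exists (b * En k l), (c * En k l); split; try exact: IQ_Mr; last by nc_ring tt.
  apply: (F_IQn (p := fun=> True)); exact: FsE.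
- by exists (z + z'), (w + w'); split; try exact: IQ_D; nc_ring tt.
Qed.

Lemma K1_monomial_step : K1_monomial HS (s :: Q) -> forall u u', gl X Y Bf u u' ->
  exists b g, [/\ UQ x y Q b, El X Y Bf g & u = beta n x y f (f b) * g].
Proof.
move=> TA u u' gu; have [z [z' [zn zn' eu eu']]] := gl_lift_B gu.
have [R2 [f2 m2]] := model_exists HS osQ.
have QsQ : {subset Q <= s :: Q} by move=> q qQ; rewrite inE qQ orbT.
have r : IQ Q ((1 + z) * (1 + z') - 1) by apply/(ker_eq _ _ mf); rewrite rmorphM -eu -eu' rmorph1 (gl_r gu).
have l : IQ Q ((1 + z') * (1 + z) - 1) by apply/(ker_eq _ _ mf); rewrite rmorphM -eu -eu' rmorph1 (gl_l gu).
have g2 : gl (f2 xn) (f2 yn) (Bof f2) (f2 (1 + z)) (f2 (1 + z')).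
  split; rewrite -?rmorphM -(rmorph1 f2).
  - by apply/(ker_eq _ _ m2); apply: IQ_W r.
  - by apply/(ker_eq _ _ m2); apply: IQ_W l.
  - by rewrite -rmorphB addrC addKr; apply: F_Bf.
  - by rewrite -rmorphB addrC addKr; apply: F_Bf.
have [b [g [Ub Eg e2]]] := TA _ _ m2 _ _ g2.
have [b0 [k [m [Ub0 eb]]]] := UQ_split m2 Ub.
have [G EG eg] := El_lift Eg; have [G' [EG' GG' G'G]] := El_inv (tctxA HS n0) (idl_B (tctxA HS n0)) EG.
have [b0' [Ub0' bb b'b]] := UQ_inv HS oQ mf Ub0.
have [d [v [vd ev]]] : exists d v, (v = x s ^+ d \/ v = y s ^+ d) /\ f2 (x s ^+ k * y s ^+ m) = f2 v.
  have xy : f2 (x s) * f2 (y s) = 1 by apply: (model_xy m2); rewrite inE eqxx.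
  have [km|mk] := leqP k m.
    by exists (m - k)%N, (y s ^+ (m - k)); split; [right|rewrite rmorphM !rmorphXn (mulYX_exp_le xy)].
  by exists (k - m)%N, (x s ^+ (k - m)); split; [left|rewrite rmorphM !rmorphXn (mulYX_exp_ge xy) // ltnW].
pose bt c : A := 1 + (c - 1) * ee n.
have btE (R0 : nzRingType) (f0 : {rmorphism A -> R0}) c : f0 (bt c) = beta n x y f0 (f0 c).
  rewrite /bt /beta rmorphD rmorphM rmorphB rmorph1 -f_Ekl; congr (1 + _ * f0 _).
  by rewrite /Ekl mul1r mulr1.
have btn c : IQ [:: n] (bt c - 1) by rewrite /bt addrC addKr; apply: IQ_Ml; apply: IQ_ee; rewrite inE.
have nQ := okS_n oQ.
have Bb0 := UQ_Bf HS f oQ Ub0; have Bb0' := UQ_Bf HS f oQ Ub0'.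
(* The unit with the monomial [b0] and the elementary matrix [G] divided out; modulo [s :: Q] only
   the block of [v] is left. *)
pose U1 := bt b0' * (1 + z) * G'; pose U1' := G * (1 + z') * bt b0.
have fr : f U1 * f U1' = 1.
  rewrite -rmorphM /U1 /U1'.
  have -> : bt b0' * (1 + z) * G' * (G * (1 + z') * bt b0) = bt b0' * ((1 + z) * (G' * G) * (1 + z')) * bt b0 by nc_ring tt.
  by rewrite G'G mulr1 !rmorphM -eu -eu' (gl_r gu) mulr1 !btE (beta_mul n0) // b'b beta1.
have fl : f U1' * f U1 = 1.
  rewrite -rmorphM /U1 /U1'.
  have -> : G * (1 + z') * bt b0 * (bt b0' * (1 + z) * G') = G * ((1 + z') * (bt b0 * bt b0') * (1 + z)) * G' by nc_ring tt.
  by rewrite !rmorphM !btE (beta_mul n0) // bb beta1 mulr1 -eu -eu' (gl_l gu) mulr1 -rmorphM GG' rmorph1.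
have U1n : IQ [:: n] (U1 - 1).
  by apply: IQ1_mul; [apply: IQ1_mul => //; rewrite addrC addKr|apply: El_IQn EG'].
have U1n' : IQ [:: n] (U1' - 1).
  by apply: IQ1_mul => //; apply: IQ1_mul; [apply: El_IQn EG|rewrite addrC addKr].
have U1s : IQ (s :: Q) (U1 - bt v).
  apply/(ker_eq _ _ m2); rewrite /U1 !rmorphM e2 eg !btE -mulrA -(mulrA _ (f2 G)) -rmorphM GG' rmorph1 mulr1.
  have UB c : UQ x y Q c -> Bof f2 (f2 c) by apply: UQ_Bf.
  rewrite (beta_mul n0 (UB _ Ub0') (UQ_Bf HS f2 osQ Ub)).
  by rewrite eb -mulrA rmorphM ev mulrA -rmorphM (_ : f2 (b0' * b0) = 1) ?mul1r // -(rmorph1 f2);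
      apply: (model_W QsQ mf m2); rewrite rmorphM b'b rmorph1.
have d0 : d = 0%N.
  (* [ep] sets all variables except [s] and [n] to 1. It annihilates the ideal of [Q], so the
     inverse relations, known only modulo [Q], become the equalities in [A] that the index lemma
     asks for. *)
  pose L := [seq j <- iota 1 n.-1 | j != s].
  have LE j : j \in L = (0 < j < n)%N && (j != s) by rewrite mem_filter mem_iota andbC; congr (_ && _); lia.
  pose ep (a : A) := foldr (fun j => eps j) a L.
  have epM a c : ep (a * c) = ep a * ep c by rewrite /ep; elim: (L) => //= j L' ->; rewrite rmorphM.
  have epB a c : ep (a - c) = ep a - ep c by rewrite /ep; elim: (L) => //= j L' ->; rewrite rmorphB.
  have ep1 : ep 1 = 1 by rewrite /ep; elim: (L) => //= j L' ->; rewrite rmorph1.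
  have epC a j : j \in L -> Cs j (ep a).
    rewrite /ep; elim: (L) => //= i L' IH; rewrite inE => /predU1P[->|/IH]; [exact: epsK|exact: Cs_eps].
  have epfix a : (forall j, j \in L -> Cs j a) -> ep a = a.
    rewrite /ep; elim: (L) => //= i L' IH H; rewrite IH; first by apply: H; rewrite inE eqxx.
    by move=> j jL; apply: H; rewrite inE jL orbT.
  have epI T a : okS n.+1 T -> IQ T a -> IQ [seq q <- T | q \notin L] (ep a).
    move=> oT Ia.
    have oL j : j \in L -> (0 < j <= n)%N by rewrite LE => /andP[/le_of].
    rewrite /ep; elim: (L) oL => /= [_|i L' IH oL]; first by apply: IQ_W Ia => q qT; rewrite mem_filter.
    have : IQ [seq q <- T | q \notin L'] (foldr (fun j => eps j) a L') by apply: IH => j jL; apply: oL; rewrite inE jL orbT.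
    move/(eps_IQ HS (oL i (mem_head _ _))) => H.
    have oT' q : q \in [seq q <- T | q \notin L'] -> (0 < q <= n)%N by rewrite mem_filter => /andP[_ /oT]; rewrite ltnS.
    by apply: IQ_W (H oT') => q; rewrite !mem_filter inE negb_or => /and3P[-> -> ->].
  have epQ a c : f a = f c -> ep a = ep c.
    move/(ker_eq _ _ mf) => /epI H; apply/eqP; rewrite -subr_eq0 -epB; apply/eqP/IQ_nil.
    apply: IQ_W (H _) => [q|q qQ]; last by have := oQ qQ; lia.
    rewrite mem_filter LE => /andP[h qQ]; rewrite oQ //= negbK in h.
    by case/negP: sQ; rewrite -(eqP h).
  have nL : n \notin L by rewrite LE ltnn andbF.
  have sL : s \notin L by rewrite LE eqxx andbF.
  have Lx j : j \in L -> (0 < j < n)%N /\ j != s by rewrite LE => /andP[].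
  have een : ep (ee n) = ee n by apply: epfix => j /Lx [h1 h2]; apply: Cs_ee => //; apply: ns_of.
  have epv : ep v = v.
    by apply: epfix => j /Lx [h1 h2]; case: vd => ->; apply: CsX; [apply: Cs_x|apply: Cs_y]; rewrite // eq_sym.
  have epbt : ep (bt v) = bt v.
    apply: epfix => j jL; apply: CsD; first exact: Cs1.
    apply: CsM; last by rewrite -een; apply: epC.
    by apply: CsB; [rewrite -epv; apply: epC|apply: Cs1].
  apply: (@index_lemma _ _ _ _ _ HS n0 s hs0 (ep U1) (ep U1') d _ _ _ v vd).
  - by move=> j h1 h2; split; apply: epC; rewrite LE h1.
  - by rewrite -epM -ep1; apply: epQ; rewrite rmorphM fr rmorph1.
  - by rewrite -epM -ep1; apply: epQ; rewrite rmorphM fl rmorph1.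
  - have -> : ep U1 - 1 - (v - 1) * ee n = ep (U1 - bt v) by rewrite epB epbt /bt; nc_ring tt.
    apply: IQ_W (epI _ _ _ U1s) => [q|q /osQ]; last by lia.
    rewrite mem_filter !inE => /andP[h /predU1P[//|qQ]]; first by move=> ->; rewrite eqxx.
    by move: h; rewrite LE oQ //= negbK.
  - apply: IQ_B; last by apply: IQ_Ml; apply: IQ_ee; rewrite inE.
    rewrite -ep1 -epB; apply: IQ_W (epI _ _ _ U1n) => [q|q]; first by rewrite mem_filter => /andP[].
    by rewrite inE => /eqP ->; rewrite n0 /=.
have v1 : bt v = 1 by rewrite /bt; case: vd => ->; rewrite d0 subrr mul0r addr0.
rewrite v1 in U1s.
have [z1 [w1 [z1s z1n w1Q ez]]] := IQ_split osQ U1n U1s.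
have fU1 : f U1 = f (1 + z1).
  by apply/(ker_eq _ _ mf); rewrite (_ : U1 - (1 + z1) = w1) // -[U1](subrK 1) ez; nc_ring tt.
have gU1 : gl X Y (pf [:: s]) (f U1) (f U1').
  apply: gl_of_B; first by split=> //; rewrite -(rmorph1 f) -rmorphB; apply: F_Bf.
  by rewrite fU1 -(rmorph1 f) -rmorphB addrC addKr; apply: F_pf.
have [e [b1 [Ub1 Ee eU]]] := gl_corner TA gU1.
have EU : El X Y Bf (f U1).
  rewrite eU; apply: ElM; last exact: gam_El.
  by apply: Er_El; apply: Er_W Ee => a [a' [Ca _] ->]; exists a'.
exists b0, (f U1 * f G); split=> //.
  by apply: ElM => //; apply: El_image EG => a Ca; exists a.
rewrite /U1 !rmorphM !btE.
have -> : beta n x y f (f b0) * (beta n x y f (f b0') * f (1 + z) * f G' * f G) =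
  beta n x y f (f b0) * beta n x y f (f b0') * f (1 + z) * (f G' * f G) by nc_ring tt.
by rewrite (beta_mul n0) // bb beta1 mul1r -rmorphM G'G rmorph1 mulr1.
Qed.
End Step.

Lemma model_eq Q Q' (R : nzRingType) (f : {rmorphism A -> R}) : Q =i Q' -> model x y Q f -> model x y Q' f.
Proof.
move=> e [m1 m2]; split=> // a; split=> [/m2|h]; first by apply: IQ_W => q; rewrite e.
by apply/m2; apply: IQ_W h => q; rewrite e.
Qed.
Lemma UQ_W Q Q' b : {subset Q <= Q'} -> UQ x y Q b -> UQ x y Q' b.
Proof.
move=> QQ; elim=> [c c0|q /QQ qQ|q /QQ qQ|a c _ Ua _ Uc];
  [exact: UQ_scal|exact: UQ_x|exact: UQ_y|exact: UQ_mul].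
Qed.

Theorem K1_monomial_all Q : okS n Q -> K1_monomial HS Q.
Proof.
have [k] := ubnP (size [seq j <- iota 1 n.-1 | j \notin Q]); elim: k Q => // k IH Q.
rewrite ltnS => hk oQ.
have [/hasP[s si sQ]|/hasPn all] := boolP (has (fun j => j \notin Q) (iota 1 n.-1)); last first.
  move=> R f mf u u' gu.
  have e : Q =i iota 1 n.-1.
    move=> q; apply/idP/idP => [/oQ|/all]; last by rewrite negbK.
    by rewrite mem_iota; lia.
  have [b [g [Ub Eg ->]]] := K1_monomial_base n0 (model_eq e mf) gu.
  by exists b, g; split=> //; apply: UQ_W Ub => q; rewrite e.
have hs : (0 < s < n)%N by move: si; rewrite mem_iota; lia.
move=> R f mf; apply: (K1_monomial_step oQ hs sQ mf); apply: IH.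
  set L := [seq j <- iota 1 n.-1 | j \notin Q] in hk.
  have sL : s \in L by rewrite mem_filter sQ.
  have -> : [seq j <- iota 1 n.-1 | j \notin s :: Q] = rem s L.
    rewrite rem_filter ?filter_uniq ?iota_uniq // -filter_predI; apply: eq_filter => j /=.
    by rewrite inE negb_or.
  by rewrite size_rem // prednK //; case: (L) sL.
by move=> q; rewrite inE => /predU1P[->//|]; apply: oQ.
Qed.

(** * Generators of the relative group *)

Definition thS i j : A := (1 + (y i - 1) * (ee j * ee n)) * (1 + (x j - 1) * (ee i * ee n)).

(** Hence pairs with [i < j] yield only inverses. The two inner factors multiply to [1 - ee j * p],
    because [x j * y j = 1 - ee j]; this defect is absorbed on the left, where [y i] kills [ee i],
    and the outer factors cancel by [y i * x i = 1]. *)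
Lemma thS_inv i j : (0 < i < n)%N -> (0 < j < n)%N -> i != j -> thS i j * thS j i = 1.
Proof.
move=> hi hj ij; have ji : j != i by rewrite eq_sym.
have ni := ns_of hi; have nj := ns_of hj; have i' := le_of hi; have j' := le_of hj.
have Ce a b : (0 < a <= n)%N -> (0 < b <= n)%N -> a != b -> ee b * ee a = ee a * ee b.
  by move=> ha hb ab; apply: (ee_comm (HS := HS)) => //; apply: Cs_ee.
have c1 := Ce _ _ i' j' ij; have c2 := Ce _ _ i' hn; rewrite eq_sym in c2; have {}c2 := c2 ni.
have c3 := Ce _ _ j' hn; rewrite eq_sym in c3; have {}c3 := c3 nj.
have Cn k : (0 < k < n)%N -> Cs k (ee n) by move=> hk; apply: Cs_ee => //; apply: ns_of.
have Cnx k : (0 < k < n)%N -> Cs n (x k) /\ Cs n (y k).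
  by move=> hk; have := ns_of hk; rewrite eq_sym => nk; split; [apply: Cs_x|apply: Cs_y]; rewrite ?le_of.
have [Cxi Cyi] := Cnx i hi; have [Cxj Cyj] := Cnx j hj.
have d1 : ee i * x j = x j * ee i by apply: (ee_comm (HS := HS)) => //; apply: Cs_x.
have d2 : ee i * y j = y j * ee i by apply: (ee_comm (HS := HS)) => //; apply: Cs_y.
have d3 : ee j * x i = x i * ee j by apply: (ee_comm (HS := HS)) => //; apply: Cs_x.
have d4 : ee j * y i = y i * ee j by apply: (ee_comm (HS := HS)) => //; apply: Cs_y.
have d5 := ee_comm hn Cxi; have d6 := ee_comm hn Cyi; have d7 := ee_comm hn Cxj; have d8 := ee_comm hn Cyj.
have l1 := ee_idem HS i'; have l2 := ee_idem HS j'; have l3 := ee_idem HS hn.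
have p1 : ee i * ee n * (ee i * ee n) = ee i * ee n by nc_ring (tt, c2, l1, l3).
have p2 : ee j * ee n * (ee j * ee n) = ee j * ee n by nc_ring (tt, c3, l2, l3).
have p3 : ee i * ee n * y j = y j * (ee i * ee n) by nc_ring (tt, d8, d2).
have p4 : ee j * ee n * x i = x i * (ee j * ee n) by nc_ring (tt, d5, d3).
have p5 : ee j * ee n * (ee j * (ee i * ee n)) = ee j * (ee i * ee n) by nc_ring (tt, c3, c2, c1, l1, l2, l3).
have p6 : y i * (ee j * (ee i * ee n)) = 0.
  by rewrite (mulrA (ee j)) c1 -(mulrA (ee i)) (mulrA (y i)) (y_ee HS i') mul0r.
have yx := YX HS i'.
have xy : x j * y j = 1 - ee j by rewrite /Defs.ee; nc_ring tt.
rewrite /thS; set p := ee i * ee n in p1 p3 p5 p6 *; set q := ee j * ee n in p2 p4 p5 *.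
have b1 : (1 + (x j - 1) * p) * (1 + (y j - 1) * p) = 1 - ee j * p by nc_ring (tt, p1, p3, xy).
have b2 : (1 + (y i - 1) * q) * (1 - ee j * p) = 1 + (y i - 1) * q by nc_ring (tt, p5, p6).
have b3 : (1 + (y i - 1) * q) * (1 + (x i - 1) * q) = 1 by nc_ring (tt, p2, p4, yx).
by rewrite mulrA -(mulrA (1 + (y i - 1) * q)) b1 b2.
Qed.

Lemma thS_IQn i j : IQ [:: n] (thS i j - 1).
Proof. by apply: IQ1_mul; rewrite addrC addKr; apply: IQ_Ml; apply: IQ_Ml; apply: IQ_ee; rewrite inE. Qed.
Lemma thS_IQ i j S : i \in S -> j \in S -> IQ S (thS i j - 1).
Proof. by move=> iS jS; apply: IQ1_mul; rewrite addrC addKr; apply: IQ_Ml; apply: IQ_Mr; apply: IQ_ee. Qed.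

(** Inverses have no constructor since [GR_gl] produces them from the same generators. The blocks
    carry monomials in [Q], as these are units in the quotient. *)
Inductive GR (R : nzRingType) (f : {rmorphism A -> R}) (Q S : seq nat) : R -> Prop :=
| GR_th i j : i \in S -> j \in S -> i != j -> GR f Q S (f (thS i j))
| GR_gam k b : k \in S -> UQ x y Q b -> GR f Q S (f (gam k b))
| GR_Er e : Er (f xn) (f yn) (Bf HS f) (pf HS f S) e -> GR f Q S e
| GR_mul a b : GR f Q S a -> GR f Q S b -> GR f Q S (a * b).


Lemma GR_gl (R : nzRingType) (f : {rmorphism A -> R}) Q S g : okS n Q -> okS n S -> (forall s, s \in S -> s \notin Q) ->
  model x y Q f -> GR f Q S g -> exists2 g', gl (f xn) (f yn) (pf HS f S) g g' & GR f Q S g'.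
Proof.
move=> oQ oS dis mf; elim=> [i j iS jS ij|k b kS Ub|e Ee|a b _ [a' ga Ga] _ [b' gb Gb]].
- have ji : j != i by rewrite eq_sym.
  exists (f (thS j i)); last exact: GR_th.
  have hi := oS i iS; have hj := oS j jS.
  by split; rewrite -?rmorphM ?thS_inv ?rmorph1 // -(rmorph1 f) -rmorphB; apply: F_pf => //;
     [apply: thS_IQn|apply: thS_IQ|apply: thS_IQn|apply: thS_IQ].
- have [b' [Ub' gg _ _]] := gam_gl oQ (oS k kS) (dis k kS) mf Ub.
  exists (f (gam k b')); last exact: GR_gam.
  by case: gg => h1 h2 h3 h4; split=> //; [move: h3|move: h4]; apply: FsW => // r; apply: pf_W => q; rewrite inE => /eqP ->.
- have [e' g1 g2] := Er_gl (tctx_model HS n0 f) (pf_idl HS f S) Ee.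
  by exists e' => //; apply: GR_Er.
- exists (b' * a'); last exact: GR_mul.
  by apply: (gl_mul (tctx_model HS n0 f)) => //; apply: pf_idl.
Qed.

(** Reduction modulo [ee s] moves [s] from [S] to [Q], which is why the induction is uniform in [Q].
    The generators found there are lifted; the unit divided by the lift is 1 modulo [s :: Q], hence
    lies over the ideal of [ee s], where [gl_corner] applies. *)
Theorem relGL_generated S : uniq S -> okS n S -> forall Q, okS n Q -> (forall s, s \in S -> s \notin Q) ->
  forall (R : nzRingType) (f : {rmorphism A -> R}), model x y Q f ->
  forall u u', gl (f xn) (f yn) (pf HS f S) u u' -> GR f Q S u.
Proof.
elim: S => [_ _ Q _ _ R f _ u u' gu|s S IH /= /andP[sS uS] oS Q oQ dis R f mf u u' gu].
  have [z [z' [[_ z0] _ -> _]]] := gl_lift gu.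
  by rewrite (IQ_nil z0) addr0 rmorph1; apply: GR_Er; apply: Er1.
have hs : (0 < s < n)%N by apply: oS; rewrite inE eqxx.
have sQ : s \notin Q by apply: dis; rewrite inE eqxx.
have oS' : okS n S by move=> q qS; apply: oS; rewrite inE qS orbT.
have osQ : okS n (s :: Q) by move=> q; rewrite inE => /predU1P[->//|]; apply: oQ.
have QsQ : {subset Q <= s :: Q} by move=> q qQ; rewrite inE qQ orbT.
have SsS : {subset S <= s :: S} by move=> q qS; rewrite inE qS orbT.
have s1S : {subset [:: s] <= s :: S} by move=> q; rewrite !inE => ->.
have dis' q : q \in S -> q \notin s :: Q.
  by move=> qS; rewrite inE negb_or dis ?inE ?qS ?orbT // andbT; apply: contraNneq sS => <-.
have [R2 [f2 m2]] := model_exists HS osQ.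
have [z [z' [[zn zS] [zn' zS'] eu eu']]] := gl_lift gu.
have F2 t : IQ [:: n] t -> IQ (s :: S) t -> Fs (f2 xn) (f2 yn) tt_ (pf HS f2 S) (f2 t).
  move=> tn tS; have [t1 [w [h1 h2 h3 et]]] := IQ_split oS tn tS.
  have -> : f2 t = f2 w.
    apply/(ker_eq _ _ m2); rewrite et addrK; apply: IQ_W h1 => q; rewrite !inE => ->//.
  apply: F_pf => //; have -> : w = t - t1 by rewrite et; nc_ring tt.
  exact: IQ_B.
have g2 : gl (f2 xn) (f2 yn) (pf HS f2 S) (f2 (1 + z)) (f2 (1 + z')).
  split; rewrite -?rmorphM -(rmorph1 f2).
  - by apply: (model_W QsQ mf m2); rewrite rmorphM -eu -eu' (gl_r gu) rmorph1.
  - by apply: (model_W QsQ mf m2); rewrite rmorphM -eu -eu' (gl_l gu) rmorph1.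
  - by rewrite -rmorphB addrC addKr; apply: F2.
  - by rewrite -rmorphB addrC addKr; apply: F2.
have L g : GR f2 (s :: Q) S g -> exists2 G, g = f2 G & GR f Q (s :: S) (f G).
  elim=> [i j iS jS ij|k b kS Ub|e Ee|a b _ [Ga -> h1] _ [Gb -> h2]].
  - by exists (thS i j) => //; apply: GR_th => //; apply: SsS.
  - have ks : k != s by apply: contraNneq sS => <-.
    have hk := oS' k kS.
    have e0 : f2 (ee s) = 0 by apply/(proj2 m2); apply: IQ_ee; rewrite inE eqxx.
    elim: Ub => [c c0|q|q|a c Ua [Ga e1 h1] Uc [Gc e2 h2]].
    + by exists (gam k c%:A) => //; apply: GR_gam; [apply: SsS|apply: UQ_scal].
    + rewrite inE => /predU1P[->|qQ]; last by exists (gam k (x q)) => //; apply: GR_gam; [apply: SsS|apply: UQ_x].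
      (* Modulo [ee s] the first factor of [thS k s] becomes 1 and the second is [gam k (x s)]. For
         [y s], below, it is the second factor of [thS s k] that disappears. *)
      exists (thS k s); last by apply: GR_th => //; [apply: SsS|rewrite inE eqxx].
      by rewrite /thS rmorphM [X in _ = X * _]rmorphD !rmorphM e0 mul0r mulr0 addr0 rmorph1 mul1r.
    + rewrite inE => /predU1P[->|qQ]; last by exists (gam k (y q)) => //; apply: GR_gam; [apply: SsS|apply: UQ_y].
      exists (thS s k); last by apply: GR_th => //; [rewrite inE eqxx|apply: SsS|rewrite eq_sym].
      by rewrite /thS rmorphM [X in _ = _ * X]rmorphD !rmorphM e0 mul0r mulr0 addr0 rmorph1 mulr1.
    + exists (Ga * Gc); last by rewrite rmorphM; apply: GR_mul.
      rewrite rmorphM -e1 -e2 -rmorphM gam_mul //; have kQ := dis' k kS; have nQ := okS_n osQ.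
      * exact: (UQ_Cs HS osQ _ Ua).
      * exact: (UQ_Cs HS osQ _ Ua).
      * exact: (UQ_Cs HS osQ _ Uc).
      * exact: (UQ_Cs HS osQ _ Uc).
  - suff [G eG EG] : exists2 G, e = f2 G & Er (f xn) (f yn) (Bf HS f) (pf HS f S) (f G).
      by exists G => //; apply: GR_Er; apply: Er_W EG => a; apply: pf_W.
    elim: Ee => [|h h' _ k l Eh Eh' hh' h'h kl [a pa ->]|a b _ [Ga -> h1] _ [Gb -> h2]].
    + by exists 1; rewrite ?rmorph1 //; apply: Er1.
    + have [H EH eH] := El_lift Eh; have [H' [EH' HH' H'H]] := El_inv (tctxA HS n0) (idl_B (tctxA HS n0)) EH.
      have eH' : h' = f2 H' by apply: (@inv_unique _ h) => //; rewrite eH -rmorphM HH' rmorph1.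
      exists (H * (1 + a * En k l) * H'); first by rewrite eH eH' !rmorphM rmorphD rmorphM f_Ekl rmorph1.
      rewrite !rmorphM rmorphD rmorphM f_Ekl rmorph1.
      apply: ErE => //; rewrite -?rmorphM ?HH' ?H'H ?rmorph1 //; last by exists a.
        by apply: El_image EH => c Cc; exists c.
      by apply: El_image EH' => c Cc; exists c.
    + by exists (Ga * Gb); rewrite rmorphM //; apply: ErM.
  - by exists (Ga * Gb); rewrite rmorphM //; apply: GR_mul.
have [G eG GG] := L _ (IH uS oS' _ osQ dis' _ _ m2 _ _ g2).
have [g' gG _] := GR_gl oQ oS dis mf GG.
have [w [w' [[wn wS] _ eG' ew]]] := gl_lift (gl_sym gG).
have fG2 : f2 G * f2 (1 + w) = 1.
  by rewrite -rmorphM -(rmorph1 f2); apply: (model_W QsQ mf m2); rewrite rmorphM -eG' (gl_r gG) rmorph1.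
have gu1 := gl_mul (tctx_model HS n0 f) (pf_idl HS f (s :: S)) gu (gl_sym gG).
have tn : IQ [:: n] ((1 + z) * (1 + w) - 1) by apply: IQ1_mul; rewrite addrC addKr.
have ts : IQ (s :: Q) ((1 + z) * (1 + w) - 1).
  by apply/(ker_eq _ _ m2); rewrite rmorphM eG fG2 rmorph1.
have [z1 [w1 [z1s z1n w1Q ez]]] := IQ_split osQ tn ts.
have fU : u * g' = f (1 + z1).
  rewrite eu eG' -rmorphM; apply/(ker_eq _ _ mf).
  by rewrite (_ : _ - _ = w1) // -[(1 + z) * _](subrK 1) ez; nc_ring tt.
have os : okS n [:: s] by move=> q; rewrite inE => /eqP ->.
have gU1 : gl (f xn) (f yn) (pf HS f [:: s]) (u * g') (f G * u').
  apply: gl_of_B; first by apply: gl_B gu1; apply: pf_idl.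
  by rewrite fU -(rmorph1 f) -rmorphB addrC addKr; apply: F_pf.
have [e [b1 [Ub1 Ee eU]]] := gl_corner oQ hs sQ mf (K1_monomial_all osQ) gU1.
have -> : u = u * g' * f G by rewrite -mulrA (gl_l gG) mulr1.
apply: GR_mul => //; rewrite eU; apply: GR_mul; last by apply: GR_gam => //; rewrite inE eqxx.
by apply: GR_Er; apply: Er_W Ee => a; apply: pf_W.
Qed.
End Descent.

(** * Determinants *)

Lemma frac_quotient (R : idomainType) (r : {fraction R}) :
  exists p q : R, q != 0 /\ r * FracField.tofrac q = FracField.tofrac p.
Proof.
elim/quotW: r => r; exists (r : R * R).1, (r : R * R).2; split; first exact: denom_ratioP.
rewrite !piE; apply/eqmodP; rewrite /= FracField.equivfE /FracField.mulf !numden_Ratio ?oner_neq0 ?mulr1 ?denom_ratioP //.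
by rewrite mulrC.
Qed.

Lemma subz_cross (a b c d : nat) : (0 < a)%N -> (0 < b)%N -> (0 < c)%N -> (0 < d)%N ->
  (a + d).-1 = (c + b).-1 -> a%:Z - b%:Z = c%:Z - d%:Z.
Proof. lia. Qed.
Lemma subz_degree (a b c d : nat) : (0 < a)%N -> (0 < b)%N -> (0 < c)%N -> (0 < d)%N ->
  (a + c).-1%:Z - (b + d).-1%:Z = (a%:Z - b%:Z) + (c%:Z - d%:Z).
Proof. lia. Qed.

(** The size of a numerator minus that of a denominator; cross multiplication makes it independent
    of the representation. *)
Lemma frac_degree_exists (K : fieldType) : exists deg : {fraction {poly K}} -> int,
  [/\ forall a b, a != 0 -> b != 0 -> deg (a * b) = deg a + deg b,
      deg (FracField.tofrac 'X) = 1 & forall c : K, c != 0 -> deg (FracField.tofrac c%:P) = 0].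
Proof.
have H (r : {fraction {poly K}}) : exists z : int, forall p q : {poly K}, p != 0 -> q != 0 ->
    r * FracField.tofrac q = FracField.tofrac p -> z = (size p)%:Z - (size q)%:Z.
  have [p [q [q0 e]]] := frac_quotient r; exists ((size p)%:Z - (size q)%:Z) => p' q' p0' q0' e'.
  have E : p * q' = p' * q.
    apply/eqP; rewrite -tofrac_eq !rmorphM /= -e -e'; apply/eqP.
    by rewrite mulrAC.
  have p0 : p != 0.
    apply: contraNneq (mulf_neq0 p0' q0) => p0; by rewrite -E p0 mul0r.
  have := congr1 (fun w : {poly K} => size w) E; rewrite /= !size_mul //.
  by apply: subz_cross; rewrite size_poly_gt0.
have [deg Hd] := choice H; exists deg; split=> [a b a0 b0||c c0].
- have [p [q [q0 e]]] := frac_quotient a; have [p' [q' [q0' e']]] := frac_quotient b.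
  have nz (r : {fraction {poly K}}) (u v : {poly K}) : r != 0 -> v != 0 -> r * FracField.tofrac v = FracField.tofrac u -> u != 0.
    move=> r0 v0 euv; have tv : FracField.tofrac v != 0 by rewrite tofrac_eq0.
    by have := mulf_neq0 r0 tv; rewrite euv tofrac_eq0.
  have p0 := nz _ _ _ a0 q0 e; have p0' := nz _ _ _ b0 q0' e'.
  have E : a * b * FracField.tofrac (q * q') = FracField.tofrac (p * p') by rewrite !rmorphM /= mulrACA e e'.
  rewrite (Hd _ _ _ (mulf_neq0 p0 p0') (mulf_neq0 q0 q0') E) (Hd _ _ _ p0 q0 e) (Hd _ _ _ p0' q0' e') !size_mul //.
  by apply: subz_degree; rewrite size_poly_gt0.
- by rewrite (Hd _ 'X 1) ?polyX_eq0 ?oner_neq0 ?size_polyX ?size_poly1 ?rmorph1 ?mulr1.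
- have cP : c%:P != 0 by rewrite polyC_eq0.
  have E : FracField.tofrac c%:P * FracField.tofrac 1 = FracField.tofrac c%:P by rewrite rmorph1 mulr1.
  by rewrite (Hd _ _ _ cP (oner_neq0 _) E) size_polyC c0 size_poly1 subrr.
Qed.

(** Sylvester's identity, the counterpart of Vaserstein's swap for determinants: it makes the
    determinants below independent of the chosen size. *)
Lemma det_1DMC (R : comNzRingType) m l (X : 'M[R]_(m, l)) (Y : 'M[R]_(l, m)) :
  \det (1%:M + X *m Y) = \det (1%:M + Y *m X).
Proof.
have e1 : block_mx 1%:M (- X) Y 1%:M = block_mx 1%:M 0 Y 1%:M *m block_mx 1%:M (- X) 0 (1%:M + Y *m X).
  rewrite mulmx_block !mulmx1 !mul1mx ?mul0mx ?mulmx0 ?addr0 mulmxN; congr block_mx.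
  by rewrite addrCA addNr addr0.
have e2 : block_mx 1%:M (- X) Y 1%:M = block_mx (1%:M + X *m Y) (- X) 0 1%:M *m block_mx 1%:M 0 Y 1%:M.
  rewrite mulmx_block !mulmx1 !mul1mx ?mul0mx ?mulmx0 ?addr0 ?add0r mulNmx; congr block_mx.
  by rewrite addrK.
have := congr1 determinant e1; rewrite e2 !det_mulmx det_ublock !det_lblock det_ublock !det1 !mul1r !mulr1.
by [].
Qed.

Section Inv.
Variables (K : fieldType) (A : unitAlgType K) (n : nat) (x y : nat -> A).
Hypothesis HS : is_Sn n x y.
Hypothesis n0 : (0 < n)%N.
Local Notation Cs := (Cs HS).
Local Notation IQ := (IQ x y).
Local Notation ee := (ee x y).
Local Notation xn := (x n).
Local Notation yn := (y n).
Let hn : (0 < n <= n)%N. Proof. by rewrite n0 leqnn. Qed.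
Variable k : nat.
Hypothesis hk : (0 < k < n)%N.
Let hk' : (0 < k <= n)%N. Proof. by case/andP: hk => -> /ltnW. Qed.
Let nk : n != k. Proof. by rewrite neq_ltn; case/andP: hk => _ ->; rewrite orbT. Qed.
Variables (L : comNzRingType) (rho : {rmorphism A -> L}).
Hypothesis rho_ee : forall j, (0 < j < n)%N -> j != k -> rho (ee j) = 0.

Let oth := [seq j <- iota 1 n.-1 | j != k].
Let othE j : (j \in oth) = (0 < j < n)%N && (j != k).
Proof. by rewrite mem_filter mem_iota andbC; congr (_ && _); lia. Qed.
Let ok_oth : okS n oth. Proof. by move=> j; rewrite othE => /andP[]. Qed.

Local Notation Dm := (Dm HS k rho).
Local Notation Th := (Th HS k rho).
Local Notation cA := (cA n x y k).
Local Notation cB := (cB n x y k).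
Local Notation PP := (PP n x y k).

Lemma Th_oth m l w : IQ oth w -> Th m l w = 0.
Proof.
move=> Iw; apply/matrixP => i j; rewrite !mxE.
have noth : n \notin oth := okS_n ok_oth.
have koth : k \notin oth by rewrite othE eqxx andbF.
have : IQ oth (T2 HS k (yn ^+ i * w * xn ^+ j)).
  by apply: tau_IQ => //; [exact: okS_le|apply: tau_IQ => //; [exact: okS_le|apply: IQ_Mr; apply: IQ_Ml]].
elim=> [|_ [q [u [v [qo ->]]]]|a b _ IHa _ IHb]; rewrite ?rmorph0 ?rmorphD ?rmorphM ?IHa ?IHb ?addr0 //.
by move: qo; rewrite othE => /andP[h1 h2]; rewrite rho_ee // mulr0 mul0r.
Qed.
Lemma Dm_oth N w : IQ oth w -> Dm N w = 0.
Proof. by move=> Iw; apply: Th_oth; apply: IQ_Mr; apply: IQ_Ml. Qed.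

Definition Jn h := IQ [:: n] h /\ IQ (iota 1 n.-1) h.
Lemma JnD a b : Jn a -> Jn b -> Jn (a + b). Proof. by move=> [? ?] [? ?]; split; apply: IQ_D. Qed.
Lemma JnM a b : Jn a -> Jn (a * b). Proof. by move=> [? ?]; split; apply: IQ_Mr. Qed.
Lemma Jn1M u v : Jn (u - 1) -> Jn (v - 1) -> Jn (u * v - 1).
Proof.
move=> ju jv; have -> : u * v - 1 = (u - 1) * v + (v - 1) by nc_ring tt.
by apply: JnD => //; apply: JnM.
Qed.

(** Only the part [z] over the ideal of [ee k] is visible at the coordinate [k]; the rest lies over
    the other [ee j], which [rho] kills. *)
Lemma Jn_supp h : Jn h -> exists z, [/\ Jn z, IQ oth (h - z) &
  exists N0, forall N, (N0 <= N)%N -> PP N * z = z /\ z * PP N = z].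
Proof.
move=> [h1 h2].
have ok : okS n (k :: oth) by move=> j; rewrite inE => /predU1P[->//|]; apply: ok_oth.
have h3 : IQ (k :: oth) h.
  by apply: IQ_W h2 => j; rewrite mem_iota inE othE; case: eqP => //= _ h'; rewrite andbT; lia.
have [z [w [z1 z2 w1 ->]]] := IQ_split HS n0 ok h1 h3.
exists z; split.
- split=> //; apply: IQ_W z1 => j; rewrite inE mem_iota => /eqP ->; lia.
- by rewrite addrC addKr.
- exact: (PP_supp HS n0 hk).
Qed.

Lemma Dm_eq N h z : IQ oth (h - z) -> Dm N h = Dm N z.
Proof. by move=> I; rewrite -[h](subrK z) DmD Dm_oth // add0r. Qed.

(** The two sizes are compared through the rectangular matrix of [cA N * z * cB N']. *)
Lemma det_stable z N N' : PP N * z = z -> z * PP N' = z ->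
  \det (1%:M + Dm N z) = \det (1%:M + Dm N' z).
Proof.
move=> Pz zP; have [e1 e2] := cA_cB_Pn HS n0 hk N; have [e1' e2'] := cA_cB_Pn HS n0 hk N'.
have -> : Dm N z = Th (N * N) (N' * N') (cA N * z * cB N') *m Th (N' * N') (N * N) (cA N' * cB N).
  rewrite -(Th_mul HS n0 hk); last by rewrite -(mulrA _ (cB N')) e2'.
  congr (Th _ _ _); rewrite -{1}zP -(cBA HS n0 hk); nc_ring tt.
rewrite det_1DMC -(Th_mul HS n0 hk); last by rewrite -(mulrA _ (cB N)) e2.
congr (\det (_ + Th _ _ _)); rewrite -{2}Pz -(cBA HS n0 hk); nc_ring tt.
Qed.

Lemma det_mul u v N zu : IQ oth (u - 1 - zu) -> zu * PP N = zu ->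
  \det (1%:M + Dm N (u * v - 1)) = \det (1%:M + Dm N (u - 1)) * \det (1%:M + Dm N (v - 1)).
Proof.
move=> I zP; rewrite -det_mulmx; congr (\det _).
have -> : u * v - 1 = (u - 1) + ((v - 1) + (u - 1) * (v - 1)) by nc_ring tt.
have E : Dm N ((u - 1) * (v - 1)) = Dm N (u - 1) *m Dm N (v - 1).
  rewrite (Dm_eq N I) -(Dm_mul HS n0 hk) //; apply: Dm_eq.
  by rewrite -mulrBl; apply: IQ_Mr.
move: (u - 1) (v - 1) E => a b E; rewrite !DmD E.
by rewrite mulmxDl !mulmxDr !mulmx1 mul1mx -!addrA; congr (_ + _); rewrite addrCA.
Qed.

(* The determinant, at the coordinate [k] and through [rho], of the finite matrix that [u] induces. *)
Lemma det_exists : exists D : A -> L,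
  (forall u, Jn (u - 1) -> exists N0, forall N, (N0 <= N)%N -> \det (1%:M + Dm N (u - 1)) = D u) /\
  (forall u v, Jn (u - 1) -> Jn (v - 1) -> D (u * v) = D u * D v).
Proof.
have H (u : A) : exists d, Jn (u - 1) -> exists N0, forall N, (N0 <= N)%N -> \det (1%:M + Dm N (u - 1)) = d.
  have [ju|nj] := pselect (Jn (u - 1)); last by exists 0.
  have [z [jz I [N0 Hz]]] := Jn_supp ju; exists (\det (1%:M + Dm N0 z)) => _; exists N0 => N hN.
  have [h1 h2] := Hz _ hN; have [h3 h4] := Hz _ (leqnn N0).
  by rewrite (Dm_eq N I); apply: det_stable.
have [D HD] := choice H; exists D; split=> // u v ju jv.
have [N1 H1] := HD _ ju; have [N2 H2] := HD _ jv; have [N3 H3] := HD _ (Jn1M ju jv).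
have [z [jz I [N0 Hz]]] := Jn_supp ju.
pose N := maxn (maxn N1 N2) (maxn N3 N0).
rewrite -(H1 N) -?(H2 N) -?(H3 N); try by rewrite /N !leq_max leqnn ?orbT.
apply: (det_mul _ I); have [] := Hz N; by rewrite ?/N ?leq_max ?leqnn ?orbT.
Qed.

Lemma Jn_gam j b : (0 < j < n)%N -> Jn (gam n x y j b - 1).
Proof. by move=> hj; split; [apply: gam_IQn|apply: gam_IQs; rewrite mem_iota add1n prednK]. Qed.

(** The block factors through the single cell of [ee k * ee n], so [det_1DMC] reduces the
    determinant to size 1. *)
Lemma det_gam D b : (forall u, Jn (u - 1) -> exists N0, forall N, (N0 <= N)%N -> \det (1%:M + Dm N (u - 1)) = D u) ->
  Cs n b -> Cs k b -> D (gam n x y k b) = rho b.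
Proof.
move=> HD Cn Ck; have [N0 /(_ N0.+1 (leqnSn _)) <-] := HD _ (Jn_gam b hk).
set N := N0.+1.
have l1 := ee_idem HS hk'; have l3 := ee_idem HS hn.
have c2 : ee n * ee k = ee k * ee n by apply: (ee_comm (HS := HS)) => //; apply: Cs_ee; rewrite // eq_sym.
have p1 : Pn xn yn 1 = ee n by rewrite /Pn !expr1.
have -> : Dm N (gam n x y k b - 1) = Th (N * N) 1 (cA N * (b - 1) * (ee k * ee n)) *m Th 1 (N * N) (ee k * ee n * cB N).
  rewrite -(Th_mul HS n0 hk) /gam ?p1; first by congr (Th _ _ _); nc_ring (tt, c2, l1, l3).
  by nc_ring (tt, c2, l1, l3).
have [e1 e2] := cA_cB_Pn HS n0 hk N.
rewrite det_1DMC -(Th_mul HS n0 hk); last by rewrite -(mulrA _ (cB N)) e2.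
have eP : ee k * ee n * PP N = ee k * ee n.
  have q i : (0 < i <= n)%N -> ee i * Pn (x i) (y i) N = ee i.
    move=> hi; rewrite /Pn /N exprS mulrBr mulr1 !mulrA (ee_x HS hi) !mul0r subr0 //.
  have q1 := q _ hk'; have q2 := q _ hn.
  have q3 : ee n * Pn (x k) (y k) N = Pn (x k) (y k) N * ee n.
    by apply: (ee_comm (HS := HS)) => //; apply: Cs_Pn; rewrite // eq_sym.
  have -> : PP N = Pn (x k) (y k) N * Pn xn yn N by [].
  by nc_ring (tt, q1, q2, q3).
have -> : ee k * ee n * cB N * (cA N * (b - 1) * (ee k * ee n)) = ee k * ee n * (b - 1).
  have -> : ee k * ee n * cB N * (cA N * (b - 1) * (ee k * ee n)) = ee k * ee n * (cB N * cA N) * (b - 1) * (ee k * ee n) by nc_ring tt.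
  rewrite (cBA HS n0 hk) eP.
  have d1 := esym (ee_comm hn Cn); have d2 := esym (ee_comm hk' Ck).
  by nc_ring (tt, c2, l1, l3, d1, d2).
rewrite [X in \det X]mx11_scalar det_scalar1 !mxE eqxx /= mul1r mulr1 T2_ee //; try by apply: CsB => //; apply: Cs1.
by rewrite -{1}(rmorph1 rho) -rmorphD addrC subrK.
Qed.

Lemma det_gam_oth D j b : (forall u, Jn (u - 1) -> exists N0, forall N, (N0 <= N)%N -> \det (1%:M + Dm N (u - 1)) = D u) ->
  (0 < j < n)%N -> j != k -> D (gam n x y j b) = 1.
Proof.
move=> HD hj jk; have [N0 /(_ N0 (leqnn _)) <-] := HD _ (Jn_gam b hj).
by rewrite Dm_oth ?addr0 ?det1 //; apply: gam_IQs; rewrite othE hj.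
Qed.
End Inv.

(** * The relative groups *)

Lemma unit_inv (R : unitRingType) (u v : R) : u * v = 1 -> v * u = 1 -> u \is a GRing.unit /\ u^-1 = v.
Proof.
move=> uv vu; have uu : u \is a GRing.unit by apply/unitrP; exists v.
by split=> //; rewrite -[LHS]mulr1 -uv mulrA mulVr // mul1r.
Qed.

Lemma prod_single (R : pzRingType) (I : eqType) (r : seq I) (F : I -> R) q : uniq r -> q \in r ->
  (forall p, p != q -> F p = 1) -> \prod_(p <- r) F p = F q.
Proof.
move=> ur qr H; elim: r ur qr => //= p r IH /andP[pr ur]; rewrite inE big_cons => /predU1P[e|qr].
  by rewrite e big1_seq ?mulr1 // => i /= ir; apply: H; apply: contraNneq pr => e'; rewrite -e -e'.
by rewrite (IH ur qr) H ?mul1r //; apply: contraNneq pr => ->.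
Qed.

Section Links.
Variables (K : fieldType) (A : unitAlgType K) (n : nat) (x y : nat -> A).
Hypothesis HS : is_Sn n x y.
Hypothesis n0 : (0 < n)%N.
Variable S : seq nat.
Hypothesis oS : okS n S.
Local Notation Cs := (Cs HS).
Local Notation IQ := (IQ x y).
Local Notation eps := (eps HS).
Local Notation ee := (ee x y).
Local Notation xn := (x n).
Local Notation yn := (y n).
Local Notation En k l := (Ekl xn yn k l).
Local Notation f0 := (idfun : {rmorphism A -> A}).
Local Notation GL := (GLrel n x y S).
Local Notation Er_ := (Erel n x y S).
Local Notation Ei_ := (Einf n x y).
Let hn : (0 < n <= n)%N. Proof. by rewrite n0 leqnn. Qed.
Let HT := tctx_model HS n0 f0.
Let HTA := tctxA HS n0.

Lemma in_Snm1P a : in_Snm1 n x y a <-> Cs n a.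
Proof.
split.
  elim=> [c|i /andP[i0 i_n]|i /andP[i0 i_n]|b c _ Cb _ Cc|b c _ Cb _ Cc].
  - exact: Cs_scal.
  - by apply: Cs_x; rewrite ?i0 ?(ltnW i_n) ?(ltn_eqF i_n).
  - by apply: Cs_y; rewrite ?i0 ?(ltnW i_n) ?(ltn_eqF i_n).
  - exact: CsD.
  - exact: CsM.
have S0 : in_Snm1 n x y 0 by rewrite -(scale0r (1 : A)); apply: Snm1_scal.
have S1 : in_Snm1 n x y 1 by rewrite -(scale1r (1 : A)); apply: Snm1_scal.
have SX b k : in_Snm1 n x y b -> in_Snm1 n x y (b ^+ k).
  by move=> Sb; elim: k => // k IH; rewrite exprS; apply: Snm1_mul.
move: a; apply: Cs_ind => // [b c|c m hm]; first exact: Snm1_add.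
rewrite -mulr_algl; apply: Snm1_mul; first exact: Snm1_scal.
apply: big_ind => // [b d|o _]; first exact: Snm1_mul.
have [on|on] := eqVneq o.+1 n; first by have [-> ->] := hm o on; rewrite mulr1.
have ho : (0 < o.+1 < n)%N by rewrite /= ltn_neqAle on ltn_ord.
by apply: Snm1_mul; apply: SX; [apply: Snm1_x|apply: Snm1_y].
Qed.

Lemma pidP a : pid n x y S a <-> pA HS S a.
Proof.
split.
  elim=> [|_ [u [v [i [/in_Snm1P Cu /in_Snm1P Cv iS ->]]]]|b c _ [h1 h2] _ [h3 h4]].
  - by split; [apply: Cs0|apply: IQ_0].
  - split; last by apply: IQ_Mr; apply: IQ_Ml; apply: IQ_ee.
    apply: CsM => //; apply: CsM => //; apply: Cs_ee; first exact: (okS_le oS).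
    by rewrite neq_ltn; case/andP: (oS iS) => _ ->.
  - by split; [apply: CsD|apply: IQ_D].
case=> Ca Ia; rewrite -Ca; elim: Ia {Ca} => [|_ [q [u [v [qS ->]]]]|b c _ Hb _ Hc]; rewrite ?rmorph0 ?rmorphD; [exact: sums0| |exact: sumsD].
rewrite !rmorphM; have -> : eps n (ee q) = ee q.
  apply: (Cs_ee HS); first exact: (okS_le oS); by rewrite neq_ltn; case/andP: (oS qS) => _ ->.
by apply: sumsG; exists (eps n u), (eps n v), q; split=> //; apply/in_Snm1P; apply: epsK.
Qed.

(** The product of the ideals is their intersection: by [IQ_F] an element of both is a sum of matrix
    units with coefficients in the ideal of [S], and every such term is a product. *)
Lemma ppnP a : ppn n x y S a <-> IQ [:: n] a /\ IQ S a.
Proof.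
split.
  elim=> [|_ [u [v [i [iS /IQ_pI pu /IQ_pI pv ->]]]]|b c _ [h1 h2] _ [h3 h4]].
  - by split; apply: IQ_0.
  - by split; [apply: IQ_Ml|apply: IQ_Mr; apply: IQ_W pu => q; rewrite inE => /eqP ->].
  - by split; apply: IQ_D.
case=> h1 h2; elim: (IQ_F HS n0 oS h1 h2) => [|b k l _ [_ Ib]|b c _ Hb _ Hc]; [exact: sums0| |exact: sumsD].
elim: Ib => [|_ [q [u [v [qS ->]]]]|c d _ Hc _ Hd]; first by rewrite mul0r; apply: sums0.
  apply: sumsG; exists (u * ee q * v), (En k l), q; split=> //; apply: sumsG; [by exists u, v|].
  by exists (xn ^+ k), (yn ^+ l).
by rewrite mulrDl; apply: sumsD.
Qed.

Lemma EstE k l : Est x y n k l = En k l.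
Proof. by rewrite /Est /Ekl exprSr exprS; nc_ring tt. Qed.

Lemma pf_id a : pf HS f0 S a <-> pA HS S a.
Proof. by split=> [[b pb ->]|pa] //; exists a. Qed.
Lemma Bf_id a : Bf HS f0 a <-> Cs n a.
Proof. by split=> [[b pb ->]|pa] //; exists a. Qed.

Lemma Einf_El g : Ei_ g <-> El xn yn (Bf HS f0) g.
Proof.
split.
  elim=> [|_ [a [k [l [/in_Snm1P Ca kl ->]]]]|a b _ Ea _ Eb|a _ Ea].
  - exact: El1.
  - by rewrite EstE; apply: ElE => //; apply/Bf_id.
  - exact: ElM.
  - have [g' [Eg' h1 h2]] := El_inv HT (idl_B HT) Ea.
    by have [_ ->] := unit_inv h1 h2.
elim=> [|a k l kl /Bf_id Ca|a b _ Ea _ Eb]; [exact: gg1| |exact: ggM].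
by apply: ggX; exists a, k, l; rewrite EstE; split=> //; apply/in_Snm1P.
Qed.

Lemma Erel_Er g : Er_ g <-> Er xn yn (Bf HS f0) (pf HS f0 S) g.
Proof.
split.
  elim=> [|_ [h [a [k [l [/Einf_El Eh /pidP pa kl ->]]]]]|a b _ Ea _ Eb|a _ Ea].
  - exact: Er1.
  - have [h' [Eh' h1 h2]] := El_inv HT (idl_B HT) Eh; have [_ ->] := unit_inv h1 h2.
    by rewrite EstE; apply: ErE => //; apply/pf_id.
  - exact: ErM.
  - have [g' [Eg' h1 h2]] := Er_inv HT (pf_idl HS f0 S) Ea.
    by have [_ ->] := unit_inv h1 h2.
elim=> [|h h' a k l Eh Eh' hh' h'h kl /pf_id pa|a b _ Ea _ Eb]; [exact: gg1| |exact: ggM].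
have [_ <-] := unit_inv hh' h'h.
by apply: ggX; exists h, a, k, l; rewrite EstE; split=> //; [apply/Einf_El|apply/pidP].
Qed.

Lemma GL_gl u : GL u <-> gl xn yn (pf HS f0 S) u u^-1.
Proof.
have F z : IQ [:: n] z -> IQ S z -> Fs xn yn (fun _ _ => true) (pf HS f0 S) z by apply: (@F_pf _ _ _ _ _ HS n0 _ f0).
split=> [[uu /ppnP [h1 h2]]|gu].
  have e : u^-1 - 1 = - (u^-1 * (u - 1)) by rewrite mulrBr mulVr // mulr1 opprB.
  split; rewrite ?mulrV ?mulVr //; first exact: F.
  by rewrite e; apply: F; apply: IQ_N; apply: IQ_Ml.
split; first by apply/unitrP; exists u^-1; split; [exact: gl_l gu|exact: gl_r gu].
apply/ppnP; split; first by apply: F_IQn (gl_F gu).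
by apply: F_IQ (gl_F gu) => a [b [_ Ib] ->].
Qed.

Lemma GL_unit u : GL u -> u \is a GRing.unit. Proof. by case. Qed.
Lemma GL_inv u v : gl xn yn (pf HS f0 S) u v -> GL u /\ u^-1 = v.
Proof. by move=> gu; have [_ e] := unit_inv (gl_r gu) (gl_l gu); split=> //; apply/GL_gl; rewrite e. Qed.
Lemma GL1 : GL 1.
Proof. by split; [exact: unitr1|apply/ppnP; rewrite subrr; split; apply: IQ_0]. Qed.
Lemma GLM u v : GL u -> GL v -> GL (u * v).
Proof. by move=> /GL_gl gu /GL_gl gv; case: (GL_inv (gl_mul HT (pf_idl HS f0 S) gu gv)). Qed.
Lemma GLV u : GL u -> GL u^-1.
Proof. by move=> /GL_gl /gl_sym /GL_inv []. Qed.
Lemma GLZ u z : GL u -> GL (u ^ z).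
Proof.
move=> gu; have H k : GL (u ^+ k) by elim: k => [|k IH]; [exact: GL1|rewrite exprS; apply: GLM].
case: z => k; first by rewrite -exprnP.
by rewrite NegzE -exprnN; apply: GLV.
Qed.
Lemma GL_prod (I : eqType) (r : seq I) (F : I -> A) : (forall i, i \in r -> GL (F i)) -> GL (\prod_(i <- r) F i).
Proof.
elim: r => [|i r IH] H; first by rewrite big_nil; apply: GL1.
rewrite big_cons; apply: GLM; first by apply: H; rewrite inE eqxx.
by apply: IH => j jr; apply: H; rewrite inE jr orbT.
Qed.
Lemma Erel_GL e : Er_ e -> GL e.
Proof. by move/Erel_Er => /(Er_gl HT (pf_idl HS f0 S)) [e' /GL_inv []]. Qed.
Lemma Einf_unit h : Ei_ h -> h \is a GRing.unit.
Proof. by move/Einf_El => /(El_inv HT (idl_B HT)) [h' [_ a b]]; have [] := unit_inv a b. Qed.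

Lemma GL_Jn u : GL u -> Jn n x y (u - 1).
Proof.
move=> [_ /ppnP [h1 h2]]; split=> //; apply: IQ_W h2 => q /oS; rewrite mem_iota; lia.
Qed.

Lemma Erel_conj w d : GL w -> Er_ d -> Er_ (w * d * w^-1).
Proof.
move=> /GL_gl gw /Erel_Er Ed; apply/Erel_Er; apply: (Er_conj HT) => //; first exact: pf_idl.
by apply: gl_B gw; apply: pf_idl.
Qed.
Lemma Erel_comm u v : GL u -> GL v -> Er_ (u * v * u^-1 * v^-1).
Proof.
move=> /GL_gl gu /GL_gl gv; apply/Erel_Er; apply: (whitehead HT) => //; first exact: pf_idl.
by apply: gl_B gu; apply: pf_idl.
Qed.

Lemma thetaSE i j : i != j -> thetaS n x y (i, j) = thS n x y i j.
Proof.
move=> ij; rewrite /thetaS /theta /thS /eI /= !eqxx (negPf ij) /= !big_cons !big_nil !mulr1 //.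
Qed.
Lemma muSE k lam : muS n x y k lam = gam n x y k lam%:A.
Proof.
rewrite /muS /mu /gam /eI !big_cons !big_nil !mulr1 -(mulr_algl lam (ee k * ee n)); nc_ring tt.
Qed.
Lemma GL_thS i j : i \in S -> j \in S -> i != j -> GL (thS n x y i j) /\ (thS n x y i j)^-1 = thS n x y j i.
Proof.
move=> iS jS ij; have ji : j != i by rewrite eq_sym.
have hi := oS iS; have hj := oS jS.
have [uu e] := unit_inv (thS_inv HS n0 hi hj ij) (thS_inv HS n0 hj hi ji).
by split=> //; split=> //; apply/ppnP; split; [apply: thS_IQn|apply: thS_IQ].
Qed.
Lemma Cs_gam_scal k c d : k \in S -> gam n x y k c%:A * gam n x y k d%:A = gam n x y k (c * d)%:A.
Proof.
move=> kS; rewrite (gam_mul n0 (oS kS) (Cs_scal HS _ _) (Cs_scal HS _ _) (Cs_scal HS _ _) (Cs_scal HS _ _)).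
by rewrite mulr_algl scalerA.
Qed.
Lemma GL_mu k c : k \in S -> c != 0 -> GL (gam n x y k c%:A).
Proof.
move=> kS c0; split; last by apply/ppnP; split; [apply: gam_IQn|apply: gam_IQs].
apply/unitrP; exists (gam n x y k (c^-1)%:A); rewrite !Cs_gam_scal // mulVf // divff // scale1r gam1 //.
Qed.

Lemma UQ_nil b : UQ x y [::] b -> exists2 c, c != 0 & b = c%:A.
Proof.
elim=> [c c0|//|//|a d _ [c c0 ->] _ [c' c0' ->]]; first by exists c.
by exists (c * c'); rewrite ?mulf_neq0 // mulr_algl scalerA.
Qed.

(** [relGL_generated] for the identity of [A] and empty [Q], where the blocks carry only scalars. *)
Lemma GL_ind (uS : uniq S) (P : A -> Prop) :
  (forall i j, i \in S -> j \in S -> i != j -> P (thS n x y i j)) ->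
  (forall k c, k \in S -> c != 0 -> P (gam n x y k c%:A)) -> (forall e, Er_ e -> P e) ->
  (forall a b, GL a -> GL b -> P a -> P b -> P (a * b)) -> forall u, GL u -> P u.
Proof.
move=> P1 P2 P3 P4 u /GL_gl gu.
have oN : okS n [::] by [].
have mN : model x y [::] f0 by split=> [r|a]; [exists r|split=> [h|/IQ_nil //]; rewrite (h : a = 0); apply: IQ_0].
have := relGL_generated (HS := HS) n0 uS oS oN (fun _ _ => isT) mN gu.
suff H g : GR HS f0 [::] S g -> GL g /\ P g by move/H => [].
elim=> [i j iS jS ij|k b kS /UQ_nil [c c0 ->]|e /Erel_Er Ee|a b _ [ga Pa] _ [gb Pb]].
- by split; [case: (GL_thS iS jS ij)|apply: P1].
- by split; [apply: GL_mu|apply: P2].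
- by split; [apply: Erel_GL|apply: P3].
- by split; [apply: GLM|apply: P4].
Qed.

(* A commutative character of [GL] kills [Erel]: as [p] is idempotent, every relative elementary matrix is a
   product of commutators of elements of [GL]. *)
Lemma Erel_char (L : comNzRingType) (D : A -> L) : D 1 = 1 ->
  (forall u v, Jn n x y (u - 1) -> Jn n x y (v - 1) -> D (u * v) = D u * D v) -> forall e, Er_ e -> D e = 1.
Proof.
move=> D1 DM e; have DG u v : GL u -> GL v -> D (u * v) = D u * D v by move=> /GL_Jn ju /GL_Jn jv; apply: DM.
have DV u : GL u -> D u * D u^-1 = 1 by move=> gu; rewrite -DG ?mulrV ?GL_unit //; apply: GLV.
have elem a k l h : Ei_ h -> pid n x y S a -> k != l -> GL (h * (1 + a * En k l) * h^-1).
  by move=> Eh pa kl; apply: Erel_GL; apply: ggX; exists h, a, k, l; rewrite EstE.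
elim=> [//|_ [h [a [k [l [Eh pa kl ->]]]]]|a b Ea Da Eb Db|a Ea Da].
- rewrite EstE; have hh := Einf_unit Eh; have hV := mulrV hh; have Vh := mulVr hh.
  set h' := h^-1 in hV Vh elem *.
  have CE c r s : Cs n c -> En r s * c = c * En r s by move=> Cc; rewrite (B_Ekl HTA _ _ Cc).
  have YXn := YX HS hn.
  elim: pa => [|_ [u [v [i [Su Sv iS ->]]]]|c d pc Dc pd Dd].
  + by rewrite mul0r addr0 mulr1 hV.
  (* A third index, different from [k] and [l], through which the commutator passes. *)
  + pose m := (k + l).+1.
    have km : k != m by rewrite neq_ltn /m ltnS leq_addr.
    have ml : m != l by rewrite neq_ltn /m ltnS leq_addl orbT.
    have Cei : in_Snm1 n x y (ee i).
      apply/in_Snm1P; apply: Cs_ee; first exact: (okS_le oS); by rewrite neq_ltn; case/andP: (oS iS) => _ ->.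
    have S1 : in_Snm1 n x y 1 by apply/in_Snm1P; apply: Cs1.
    have pb : pid n x y S (u * ee i) by apply: sumsG; exists u, 1, i; rewrite mulr1.
    have pc : pid n x y S (ee i * v) by apply: sumsG; exists 1, v, i; rewrite mul1r.
    have pN a0 : pid n x y S a0 -> pid n x y S (- a0).
      by move/pidP => [h1 h2]; apply/pidP; split; [rewrite -sub0r; apply: CsB => //; apply: Cs0|apply: IQ_N].
    (* Doubling the idempotent [ee i] splits the coefficient into two factors that both lie in the
       ideal. *)
    have -> : u * ee i * v = (u * ee i) * (ee i * v).
      by have ei := ee_idem HS (okS_le oS iS); nc_ring (tt, ei).
    move: (u * ee i) (ee i * v) pb pc => b c pb pc.
    have [Cb _] := proj1 (pidP b) pb; have [Cc _] := proj1 (pidP c) pc.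
    have e1 : h * (1 + b * c * En k l) * h' = (h * (1 + b * En k m) * h') * (h * (1 + c * En m l) * h') *
        ((h * (1 + - b * En k m) * h') * (h * (1 + - c * En m l) * h')).
      have a1 := CE _ k m Cb; have a2 := CE _ m l Cb; have a3 := CE _ k m Cc; have a4 := CE _ m l Cc; have a5 := CE _ k l Cb; have a6 := CE _ k l Cc.
      have b1 := mulEkl YXn k m m l; have b2 := mulEkl YXn k m k m; have b3 := mulEkl YXn m l m l; have b4 := mulEkl YXn m l k m.
      have b5 := mulEkl YXn k l k m; have b6 := mulEkl YXn k l m l; have b7 := mulEkl YXn m l k l; have b8 := mulEkl YXn k m k l; have b9 := mulEkl YXn k l k l.
      rewrite eqxx in b1; rewrite eq_sym (negPf km) in b2; rewrite eq_sym (negPf ml) in b3; rewrite eq_sym (negPf kl) in b4.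
      rewrite eq_sym (negPf kl) in b5; rewrite eq_sym (negPf ml) in b6; rewrite eq_sym (negPf kl) in b7; rewrite eq_sym (negPf km) in b8; rewrite eq_sym (negPf kl) in b9.
      by nc_ring (tt, Vh, a1, a2, a3, a4, a5, a6, b1, b2, b3, b4, b5, b6, b7, b8, b9).
    have inv a0 r s : pid n x y S a0 -> r != s -> D (h * (1 + a0 * En r s) * h') * D (h * (1 + - a0 * En r s) * h') = 1.
      move=> pa0 rs; rewrite -DG; [|exact: elem|by apply: elem => //; apply: pN].
      have [C0 _] := proj1 (pidP a0) pa0.
      have eV := elemV HTA C0 rs.
      have -> : h * (1 + a0 * En r s) * h' * (h * (1 + - a0 * En r s) * h') = h * ((1 + a0 * En r s) * (1 + - a0 * En r s)) * h'.
        by set w1 := 1 + a0 * _; set w2 := 1 + _; clearbody w1 w2; nc_ring (tt, Vh).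
      by rewrite eV mulr1 hV.
    have g1 := elem _ _ _ _ Eh pb km; have g2 := elem _ _ _ _ Eh pc ml.
    have g3 := elem _ _ _ _ Eh (pN _ pb) km; have g4 := elem _ _ _ _ Eh (pN _ pc) ml.
    rewrite e1 (DG _ _ (GLM g1 g2) (GLM g3 g4)) (DG _ _ g1 g2) (DG _ _ g3 g4).
    by rewrite mulrACA !inv // mulr1.
  + have [Cc _] := proj1 (pidP c) pc; have [Cd _] := proj1 (pidP d) pd.
    have -> : h * (1 + (c + d) * En k l) * h' = (h * (1 + c * En k l) * h') * (h * (1 + d * En k l) * h').
      have a1 := CE _ k l Cd; have b1 := mulEkl YXn k l k l; rewrite eq_sym (negPf kl) in b1.
      by nc_ring (tt, Vh, a1, b1).
    by rewrite (DG _ _ (elem _ _ _ _ Eh pc kl) (elem _ _ _ _ Eh pd kl)) Dc Dd mulr1.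
- by rewrite DG ?Da ?Db ?mulr1 //; apply: Erel_GL.
- by have := DV _ (Erel_GL Ea); rewrite Da mul1r.
Qed.

(** Congruence modulo [Erel]. It respects products because [Erel] is normalised by [GL], and the
    quotient is abelian because [Erel] contains the commutators. *)
Definition sim u v := exists2 e, Er_ e & u = v * e.
Lemma sim_refl u : sim u u. Proof. by exists 1; [apply: gg1|rewrite mulr1]. Qed.
Lemma sim_trans v u w : sim u v -> sim v w -> sim u w.
Proof. by move=> [e Ee ->] [e' Ee' ->]; exists (e' * e); [apply: ggM|rewrite mulrA]. Qed.
Lemma simM u u' v v' : GL v' -> sim u u' -> sim v v' -> sim (u * v) (u' * v').
Proof.
move=> gv [e Ee ->] [e' Ee' ->]; have uv := GL_unit gv; exists (v'^-1 * e * v' * e').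
  by apply: ggM => //; have := Erel_conj (GLV gv) Ee; rewrite invrK.
by rewrite !mulrA mulrK.
Qed.
Lemma simC u v : GL u -> GL v -> sim (u * v) (v * u).
Proof.
move=> gu gv; exists (u^-1 * v^-1 * u * v).
  by have := Erel_comm (GLV gu) (GLV gv); rewrite !invrK.
by rewrite !mulrA mulrK ?GL_unit // mulrV ?GL_unit // mul1r.
Qed.
Lemma sim_prod (I : eqType) (r : seq I) (a b : I -> A) : (forall i, i \in r -> GL (a i) /\ GL (b i)) ->
  sim ((\prod_(i <- r) a i) * (\prod_(i <- r) b i)) (\prod_(i <- r) (a i * b i)).
Proof.
elim: r => [|i r IH] H; first by rewrite !big_nil mulr1; apply: sim_refl.
have [ga gb] := H i (mem_head _ _).
have H' j : j \in r -> GL (a j) /\ GL (b j) by move=> jr; apply: H; rewrite inE jr orbT.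
have gA : GL (\prod_(i <- r) a i) by apply: GL_prod => j /H' [].
have gB : GL (\prod_(i <- r) b i) by apply: GL_prod => j /H' [].
have gAB : GL (\prod_(i <- r) (a i * b i)) by apply: GL_prod => j /H' [? ?]; apply: GLM.
rewrite !big_cons; set PA := \prod_(j <- r) a j in gA IH *; set PB := \prod_(j <- r) b j in gB IH *.
have -> : a i * PA * (b i * PB) = a i * (PA * b i) * PB by rewrite !mulrA.
apply: (sim_trans (v := a i * (b i * PA) * PB)).
  apply: simM => //; last exact: sim_refl.
  by apply: simM; [apply: GLM|apply: sim_refl|apply: simC].
rewrite !mulrA -mulrA; apply: simM => //; first exact: sim_refl.
exact: IH.
Qed.
End Links.

(** * Characters and the theorem *)

Section Characters.
Variables (K : fieldType) (A : unitAlgType K) (n : nat) (x y : nat -> A).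
Hypothesis HS : is_Sn n x y.
Hypothesis n0 : (0 < n)%N.
Local Notation ee := (ee x y).
Let le_of s : (0 < s < n)%N -> (0 < s <= n)%N. Proof. by case/andP => -> /ltnW. Qed.
Let ne_of s : (0 < s < n)%N -> s != n. Proof. by move=> h; rewrite neq_ltn; case/andP: h => _ ->. Qed.

(** The value on [thS a b] comes from its two blocks, [gam b (y a)] and [gam a (x b)]. *)
Definition det_char (L : comNzRingType) (rho : A -> L) k (D : A -> L) :=
  [/\ D 1 = 1, forall u v, Jn n x y (u - 1) -> Jn n x y (v - 1) -> D (u * v) = D u * D v,
      forall a b, (0 < a < n)%N -> (0 < b < n)%N -> a != b -> D (thS n x y a b) =
        (if a == k then rho (x b) else 1) * (if b == k then rho (y a) else 1) &
      forall k0 c, (0 < k0 < n)%N -> D (gam n x y k0 c%:A) = if k0 == k then rho c%:A else 1].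

Lemma det_char_exists k (L : comNzRingType) (rho : {rmorphism A -> L}) : (0 < k < n)%N ->
  (forall j, (0 < j < n)%N -> rho (x j) * rho (y j) = 1) -> exists D, det_char rho k D.
Proof.
move=> hk rxy.
have rho_ee j : (0 < j < n)%N -> j != k -> rho (ee j) = 0.
  by move=> hj _; rewrite /Defs.ee rmorphB rmorphM rxy // rmorph1 subrr.
have [D [HD DM]] := det_exists HS n0 hk rho_ee.
have Dk b : Cs HS n b -> Cs HS k b -> D (gam n x y k b) = rho b by apply: (det_gam n0 hk HD).
have Do j b : (0 < j < n)%N -> j != k -> D (gam n x y j b) = 1 by move=> hj jk; apply: (det_gam_oth n0 hk rho_ee b HD hj jk).
exists D; split=> // [|a b ha hb ab|k0 c hk0].
- by rewrite -(gam1 n x y k) Dk ?rmorph1 //; apply: Cs1.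
- rewrite (DM _ _ (Jn_gam x y n0 (y a) hb) (Jn_gam x y n0 (x b) ha)).
  rewrite mulrC; congr (_ * _).
    have [e|ak] := eqVneq a k; last exact: Do.
    by rewrite e Dk //; apply: Cs_x; rewrite ?le_of ?ne_of // eq_sym -e.
  have [e|bk] := eqVneq b k; last exact: Do.
  by rewrite e Dk //; apply: Cs_y; rewrite ?le_of ?ne_of // -e.
- have [e|bk] := eqVneq k0 k; last exact: Do.
  by rewrite e Dk //; apply: Cs_scal.
Qed.

(** Rational functions serve as target: they make [x j] invertible, and their nonzero elements have
    a degree. *)
Lemma eval_t_exists j : exists rho : {rmorphism A -> {fraction {poly K}}},
  (forall c, rho c%:A = FracField.tofrac c%:P) /\
  forall i, (0 < i <= n)%N -> rho (x i) = (if i == j then FracField.tofrac 'X else 1) /\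
                              rho (y i) = (if i == j then (FracField.tofrac 'X)^-1 else 1).
Proof.
pose L := {fraction {poly K}}; pose t : L := FracField.tofrac 'X.
have t0 : t != 0 by rewrite tofrac_eq0 polyX_eq0.
have HX : Srel n (fun i => if i == j then t else 1) (fun i => if i == j then t^-1 else 1).
  split=> [i _|i i' _ _ _]; last by split; rewrite mulrC.
  by case: ifP => _; rewrite ?mulVf ?mulr1.
have [f [_ h2 h3]] := @universal_gen _ _ _ _ _ HS L (@FracField.tofrac {poly K} \o polyC : {rmorphism K -> L}) _ _ HX (fun c z => mulrC _ _).
by exists f.
Qed.
End Characters.

Theorem theorem5p8 (K : fieldType) (A : unitAlgType K) (n : nat)
    (x y : nat -> A) (S : seq nat) :
  (2 <= n)%N -> is_Sn n x y ->
  uniq S -> S != [::] -> (forall i, i \in S -> (0 < i < n)%N) ->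
  [/\
   (* (1) generation *)
   (forall u, GLrel n x y S u <->
      grp_gen (fun g => [\/ exists2 p, p \in pairsS S & g = thetaS n x y p,
                            exists k lam, [/\ k \in S, lam != 0 & g = muS n x y k lam]
                          | Erel n x y S g]) u),
   (* (2) unique normal form, for any fixed order of the factors *)
   (forall (ps : seq (nat * nat)) (ks : seq nat),
      perm_eq ps (pairsS S) -> perm_eq ks S ->
      forall a, GLrel n x y S a ->
      exists nn lam e,
        [/\ (forall k, k \in S -> lam k != 0), Erel n x y S e,
            a = prodform n x y ps ks nn lam e &
            forall nn' lam' e', (forall k, k \in S -> lam' k != 0) ->
              Erel n x y S e' -> a = prodform n x y ps ks nn' lam' e' ->
              [/\ forall p, p \in ps -> nn' p = nn p,
                  forall k, k \in ks -> lam' k = lam k & e' = e]]) &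
   (* (3) K_1(S_{n-1}, p) = GL/E is isomorphic to
          prod_{pairs} <theta_ij> x prod_{k in S} U_{k,n}(K)
          = Z^{pairs} x (K^* )^S  (= Z^(m choose 2) x (K^* )^m) *)
   (exists (f1 : A -> nat * nat -> int) (f2 : A -> nat -> K),
      [/\ (* group homomorphism GL -> Z^{pairs} x (K^* )^S *)
          (forall u v, GLrel n x y S u -> GLrel n x y S v ->
             (forall p, p \in pairsS S -> f1 (u * v) p = f1 u p + f1 v p) /\
             (forall k, k \in S -> f2 (u * v) k = f2 u k * f2 v k)),
          (forall u, GLrel n x y S u -> forall k, k \in S -> f2 u k != 0),
          (* surjective *)
          (forall (nn : nat * nat -> int) (lam : nat -> K),
             (forall k, k \in S -> lam k != 0) ->
             exists2 u, GLrel n x y S u &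
               (forall p, p \in pairsS S -> f1 u p = nn p) /\
               (forall k, k \in S -> f2 u k = lam k)),
          (* kernel = E_oo(S_{n-1}, p) *)
          (forall u, GLrel n x y S u ->
             ((forall p, p \in pairsS S -> f1 u p = 0) /\
              (forall k, k \in S -> f2 u k = 1)) <-> Erel n x y S u) &
          (* theta_ij |-> generator of the ij-th Z, mu_{k,n}(lam) |-> lam in k-th K^* *)
          (forall q, q \in pairsS S ->
             (forall p, p \in pairsS S -> f1 (thetaS n x y q) p = (p == q)%:R) /\
             (forall k, k \in S -> f2 (thetaS n x y q) k = 1)) /\
          (forall k0 lam, k0 \in S -> lam != 0 ->
             (forall p, p \in pairsS S -> f1 (muS n x y k0 lam) p = 0) /\
             (forall k, k \in S -> f2 (muS n x y k0 lam) k = if k == k0 then lam else 1))])].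
Proof.
move=> n2 HS uS _ oS; have n0 : (0 < n)%N by apply: leq_trans n2.
pose GL := GLrel n x y S; pose Er_ := Erel n x y S.
have GM u v : GL u -> GL v -> GL (u * v) by apply: (GLM HS n0 oS).
have GV u : GL u -> GL u^-1 by apply: (GLV HS n0 oS).
have GU u : GL u -> u \is a GRing.unit by case.
have G1 : GL 1 by apply: (GL1 HS n0 oS).
have GE e : Er_ e -> GL e by apply: (Erel_GL HS n0 oS).
have GJ u : GL u -> Jn n x y (u - 1) by apply: (GL_Jn HS n0 oS).
have pS p : p \in pairsS S -> [/\ p.1 \in S, p.2 \in S & p.1 != p.2].
  rewrite mem_filter => /andP[lt /allpairsP[[i j] [/= iS jS e]]]; rewrite e /= in lt *.
  by split=> //; rewrite neq_ltn lt orbT.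
have pSE i j : i \in S -> j \in S -> (j < i)%N -> (i, j) \in pairsS S.
  by move=> iS jS ij; rewrite mem_filter ij; apply/allpairsP; exists (i, j).
have upS : uniq (pairsS S).
  by apply: filter_uniq; apply: allpairs_uniq => // -[a b] [c d] _ _ /= [-> ->].
have thE p : p \in pairsS S -> thetaS n x y p = thS n x y p.1 p.2.
  by move=> /pS [_ _ ne]; rewrite -thetaSE // -surjective_pairing.
have Gth p : p \in pairsS S -> GL (thetaS n x y p).
  by move=> pp; have [h1 h2 h3] := pS p pp; rewrite thE //; have [] := GL_thS HS n0 oS h1 h2 h3.
have Gmu k c : k \in S -> c != 0 -> GL (muS n x y k c) by move=> kS c0; rewrite muSE; apply: (GL_mu HS n0 oS).
have muM k c d : k \in S -> muS n x y k c * muS n x y k d = muS n x y k (c * d).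
  by move=> kS; rewrite !muSE (Cs_gam_scal HS n0 oS).
have mu1 k : muS n x y k 1 = 1 by rewrite muSE scale1r gam1.
have Tunit p : p \in pairsS S -> thetaS n x y p \is a GRing.unit by move=> /Gth /GU.
have GZ p z : p \in pairsS S -> GL (thetaS n x y p ^ z) by move=> pp; apply: (GLZ HS n0 oS); apply: Gth.
have GI := GL_ind HS n0 oS uS.
have thV i j : i \in S -> j \in S -> (i < j)%N -> thS n x y i j = (thetaS n x y (j, i))^-1.
  move=> iS jS ij; have ji : j != i by rewrite neq_ltn ij orbT.
  by rewrite thetaSE //; have [_ ->] := GL_thS HS n0 oS jS iS ji.
pose nf ps ks nn lam : A := (\prod_(p <- ps) thetaS n x y p ^ (nn p)) * (\prod_(k <- ks) muS n x y k (lam k)).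
have NF ps ks : perm_eq ps (pairsS S) -> perm_eq ks S -> forall u, GL u ->
    exists nn lam, (forall k, k \in S -> lam k != 0) /\ sim n x y S u (nf ps ks nn lam).
  move=> pps pks; have ups : uniq ps by rewrite (perm_uniq pps).
  have uks : uniq ks by rewrite (perm_uniq pks).
  have mps := perm_mem pps; have mks := perm_mem pks.
  have ones : \prod_(k <- ks) muS n x y k ((fun=> 1) k) = 1 by apply: big1 => k _; apply: mu1.
  have thz p z : p \in pairsS S -> exists nn lam, (forall k, k \in S -> lam k != 0) /\ sim n x y S (thetaS n x y p ^ z) (nf ps ks nn lam).
    move=> pp; exists (fun q => if q == p then z else 0), (fun=> 1); split=> [k _|]; first exact: oner_neq0.
    rewrite /nf ones mulr1 (prod_single (q := p)) ?mps //; first by rewrite eqxx; apply: sim_refl.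
    by move=> q /negPf ->; rewrite expr0z.
  apply: GI => [i j iS jS ij|k c kS c0|e Ee|a b ga gb [nn [lam [l0 sa]]] [nn' [lam' [l0' sb]]]].
  - have [lt|gt|e] := ltngtP i j; last by rewrite e eqxx in ij.
      by rewrite thV // -[_^-1]/(thetaS n x y (j, i) ^ (-1)); apply: thz; apply: pSE.
    by rewrite -thetaSE // -[thetaS n x y (i, j)]expr1z; apply: thz; apply: pSE.
  - exists (fun=> 0), (fun k' => if k' == k then c else 1); split=> [k' _|]; first by case: ifP => // _; apply: oner_neq0.
    rewrite /nf big1 ?mul1r => [|p _]; last by rewrite expr0z.
    rewrite (prod_single (q := k)) ?mks //; first by rewrite eqxx muSE; apply: sim_refl.
    by move=> q /negPf ->; apply: mu1.
  - exists (fun=> 0), (fun=> 1); split=> [k' _|]; first exact: oner_neq0.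
    rewrite /nf ones mulr1 big1 => [|p _]; last by rewrite expr0z.
    by exists e; rewrite ?mul1r.
  - exists (fun p => nn p + nn' p), (fun k => lam k * lam' k); split=> [k kS|]; first by rewrite mulf_neq0 ?l0 ?l0'.
    have GT m : GL (\prod_(p <- ps) thetaS n x y p ^ (m p)).
      by apply: (GL_prod HS n0 oS) => p; rewrite mps => pp; apply: GZ.
    have GMu (m : nat -> K) : (forall k, k \in S -> m k != 0) -> GL (\prod_(k <- ks) muS n x y k (m k)).
      by move=> m0; apply: (GL_prod HS n0 oS) => k; rewrite mks => kS; apply: Gmu => //; apply: m0.
    have gT := GT nn; have gT' := GT nn'; have gM := GMu _ l0; have gM' := GMu _ l0'.
    apply: (sim_trans (v := nf ps ks nn lam * nf ps ks nn' lam')).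
      by apply: (simM HS n0 oS) => //; apply: GM.
    rewrite /nf; move: gT gT' gM gM'; set T := \prod_(p <- ps) thetaS n x y p ^ nn p; set T' := \prod_(p <- ps) _ ^ nn' p.
    set M := \prod_(k <- ks) muS n x y k (lam k); set M' := \prod_(k <- ks) muS n x y k (lam' k) => gT gT' gM gM'.
    have -> : T * M * (T' * M') = T * (M * T') * M' by rewrite !mulrA.
    apply: (sim_trans (v := T * (T' * M) * M')).
      apply: (simM HS n0 oS) => //; last exact: sim_refl.
      by apply: (simM HS n0 oS); [apply: GM|apply: sim_refl|apply: (simC HS n0 oS)].
    have -> : T * (T' * M) * M' = (T * T') * (M * M') by rewrite !mulrA.
    have -> : \prod_(p <- ps) thetaS n x y p ^ (nn p + nn' p) = \prod_(p <- ps) (thetaS n x y p ^ nn p * thetaS n x y p ^ nn' p).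
      by apply: eq_big_seq => p; rewrite mps => pp; rewrite exprzDr ?Tunit.
    have -> : \prod_(k <- ks) muS n x y k (lam k * lam' k) = \prod_(k <- ks) (muS n x y k (lam k) * muS n x y k (lam' k)).
      by apply: eq_big_seq => k; rewrite mks => kS; rewrite muM.
    have gMM : GL (\prod_(k <- ks) (muS n x y k (lam k) * muS n x y k (lam' k))).
      by apply: (GL_prod HS n0 oS) => k; rewrite mks => kS; apply: GM; apply: Gmu; rewrite ?l0 ?l0'.
    apply: (simM HS n0 oS) => //.
      by apply: (sim_prod HS n0 oS) => p; rewrite mps => pp; split; apply: GZ.
    by apply: (sim_prod HS n0 oS) => k; rewrite mks => kS; split; apply: Gmu; rewrite ?l0 ?l0'.
have [aug [augc augx]] := aug_exists HS.
have [deg [degM degX degC]] := frac_degree_exists K.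
(* The zero function is a default outside the range of indices, needed to choose one family for all
   [k]. *)
have H2 k : exists D : A -> K, (0 < k < n)%N -> det_char n x y aug k D.
  have [hk|nk] := boolP (0 < k < n)%N; last by exists (fun=> 0).
  have [j hj|D HD] := det_char_exists HS n0 (rho := aug) hk; last by exists D.
  have hj' : (0 < j <= n)%N by case/andP: hj => -> /ltnW.
  by have [-> ->] := augx j hj'; rewrite mulr1.
have [D2 HD2] := choice H2.
have H1 (p : nat * nat) : exists D : A -> {fraction {poly K}}, exists rho : {rmorphism A -> {fraction {poly K}}},
   [/\ (0 < p.1 < n)%N -> det_char n x y rho p.1 D, forall c, rho c%:A = FracField.tofrac c%:P &
   forall i, (0 < i <= n)%N -> rho (x i) = (if i == p.2 then FracField.tofrac 'X else 1) /\
                              rho (y i) = (if i == p.2 then (FracField.tofrac 'X)^-1 else 1)].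
  have [rho [rc rx]] := eval_t_exists HS p.2.
  have [hk|nk] := boolP (0 < p.1 < n)%N; last by exists (fun=> 0), rho.
  have [j hj|D HD] := det_char_exists HS n0 (rho := rho) hk; last by exists D, rho.
  have hj' : (0 < j <= n)%N by case/andP: hj => -> /ltnW.
  have [-> ->] := rx j hj'.
  by case: ifP => _; rewrite ?mulr1 // divff // tofrac_eq0 polyX_eq0.
have [D1 HD1] := choice H1.
pose f1 u p := deg (D1 p u); pose f2 u k := D2 k u.
have EC (L : comNzRingType) (D : A -> L) : D 1 = 1 ->
  (forall u v, Jn n x y (u - 1) -> Jn n x y (v - 1) -> D (u * v) = D u * D v) -> forall e, Er_ e -> D e = 1.
  exact: (Erel_char HS n0 oS).
have NZ (L : fieldType) (D : A -> L) : D 1 = 1 ->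
  (forall u v, Jn n x y (u - 1) -> Jn n x y (v - 1) -> D (u * v) = D u * D v) -> forall u, GL u -> D u != 0.
  move=> D1' DM u gu; have e : D u * D u^-1 = 1 by rewrite -DM ?mulrV ?GU //; apply: GJ => //; apply: GV.
  by apply/eqP => z; move/eqP: e; rewrite z mul0r eq_sym oner_eq0.
have deg1 : deg 1 = 0 by have := degC 1 (oner_neq0 _); rewrite polyC1 rmorph1.
have f1M p u v : p \in pairsS S -> GL u -> GL v -> f1 (u * v) p = f1 u p + f1 v p.
  move=> pp gu gv; have [iS _ _] := pS p pp; have [rho [/(_ (oS _ iS)) [h1 h2 _ _] _ _]] := HD1 p.
  by rewrite /f1 h2 ?degM //; try exact: GJ; apply: (NZ _ _ h1 h2).
have f2M k u v : k \in S -> GL u -> GL v -> f2 (u * v) k = f2 u k * f2 v k.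
  by move=> kS gu gv; have [h1 h2 _ _] := HD2 k (oS _ kS); rewrite /f2 h2 //; apply: GJ.
have f2nz k u : k \in S -> GL u -> f2 u k != 0.
  by move=> kS gu; have [h1 h2 _ _] := HD2 k (oS _ kS); apply: (NZ _ _ h1 h2).
have f1E p e : p \in pairsS S -> Er_ e -> f1 e p = 0.
  move=> pp Ee; have [iS _ _] := pS p pp; have [rho [/(_ (oS _ iS)) [h1 h2 _ _] _ _]] := HD1 p.
  by rewrite /f1 (EC _ _ h1 h2).
have f2E k e : k \in S -> Er_ e -> f2 e k = 1.
  by move=> kS Ee; have [h1 h2 _ _] := HD2 k (oS _ kS); apply: (EC _ _ h1 h2).
have ok' i : i \in S -> (0 < i <= n)%N by move=> /oS /andP[-> /ltnW].
have f1th p q : p \in pairsS S -> q \in pairsS S -> f1 (thetaS n x y q) p = (p == q)%:R.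
  move=> pp qq; have [iS jS ij] := pS p pp; have [aS bS ab] := pS q qq.
  have [rho [/(_ (oS _ iS)) [h1 h2 h3 h4] rc rx]] := HD1 p.
  have := pp; have := qq; rewrite !mem_filter => /andP[ltq _] /andP[ltp _].
  rewrite /f1 thE // h3 ?oS //; have [-> _] := rx _ (ok' _ bS); have [_ ->] := rx _ (ok' _ aS).
  have -> : (p == q) = (q.1 == p.1) && (q.2 == p.2) by case: (p) (q) => [i j] [a b]; rewrite xpair_eqE /= ![_ == a]eq_sym ![_ == b]eq_sym.
  have [e1|n1] := eqVneq q.1 p.1.
    rewrite (_ : q.2 == p.1 = false) ?mulr1 /=; last by rewrite -e1 ltn_eqF.
    by case: (q.2 == p.2).
  (* A block of [q] at [q.2 = p.1] would contribute the degree of [y q.1], which is nonzero only for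
     [q.1 = p.2]; the orders [q.2 < q.1] and [p.2 < p.1] exclude this. *)
  rewrite mul1r /=; case: eqP => // e2; rewrite (_ : q.1 == p.2 = false) //.
  by rewrite gtn_eqF // (ltn_trans ltp) // -e2.
have f2th k q : k \in S -> q \in pairsS S -> f2 (thetaS n x y q) k = 1.
  move=> kS qq; have [aS bS ab] := pS q qq; have [h1 h2 h3 h4] := HD2 k (oS _ kS).
  rewrite /f2 thE // h3 ?oS //; have [-> _] := augx _ (ok' _ bS); have [_ ->] := augx _ (ok' _ aS).
  by case: ifP => _; case: ifP => _; rewrite mulr1.
have f1mu p k c : p \in pairsS S -> k \in S -> c != 0 -> f1 (muS n x y k c) p = 0.
  move=> pp kS c0; have [iS jS ij] := pS p pp; have [rho [/(_ (oS _ iS)) [h1 h2 h3 h4] rc rx]] := HD1 p.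
  rewrite /f1 muSE h4 ?oS // rc; case: ifP => _; [exact: degC|exact: deg1].
have f2mu k k0 c : k \in S -> k0 \in S -> f2 (muS n x y k0 c) k = if k == k0 then c else 1.
  move=> kS kS0; have [h1 h2 h3 h4] := HD2 k (oS _ kS).
  by rewrite /f2 muSE h4 ?oS // augc eq_sym.
have f1_1 p : p \in pairsS S -> f1 1 p = 0 by move=> pp; apply: f1E => //; apply: gg1.
have f2_1 k : k \in S -> f2 1 k = 1 by move=> kS; apply: f2E => //; apply: gg1.
have f1Z p u z : p \in pairsS S -> GL u -> f1 (u ^ z) p = z * f1 u p.
  move=> pp gu; have GX m : GL (u ^+ m) by elim: m => // m IH; rewrite exprS; apply: GM.
  have X m : f1 (u ^+ m) p = m%:Z * f1 u p.
    by elim: m => [|m IH]; rewrite ?mul0r ?f1_1 // exprS f1M // IH intS mulrDl mul1r.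
  case: z => m; first by rewrite -exprnP X.
  rewrite NegzE -exprnN; have : f1 (u ^+ m.+1 * u ^- m.+1) p = 0 by rewrite mulrV ?f1_1 //; apply: GU.
  rewrite f1M //; last exact: GV.
  by rewrite X mulNr => /eqP; rewrite addrC addr_eq0 => /eqP.
have f2Z k u z : k \in S -> GL u -> f2 u k = 1 -> f2 (u ^ z) k = 1.
  move=> kS gu u1; have GX m : GL (u ^+ m) by elim: m => // m IH; rewrite exprS; apply: GM.
  have X m : f2 (u ^+ m) k = 1 by elim: m => [|m IH]; rewrite ?f2_1 // exprS f2M // IH u1 mulr1.
  case: z => m; first by rewrite -exprnP X.
  rewrite NegzE -exprnN; have : f2 (u ^+ m.+1 * u ^- m.+1) k = 1 by rewrite mulrV ?f2_1 //; apply: GU.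
  by rewrite f2M ?X ?mul1r //; apply: GV.
have f1P p (I : eqType) (r : seq I) (F : I -> A) : p \in pairsS S -> (forall i, i \in r -> GL (F i)) ->
    f1 (\prod_(i <- r) F i) p = \sum_(i <- r) f1 (F i) p.
  move=> pp; elim: r => [|i r IH] H; first by rewrite !big_nil f1_1.
  have H' j : j \in r -> GL (F j) by move=> jr; apply: H; rewrite inE jr orbT.
  rewrite !big_cons f1M ?IH //; first by apply: H; rewrite inE eqxx.
  exact: (GL_prod HS n0 oS).
have f2P k (I : eqType) (r : seq I) (F : I -> A) : k \in S -> (forall i, i \in r -> GL (F i)) ->
    f2 (\prod_(i <- r) F i) k = \prod_(i <- r) f2 (F i) k.
  move=> pp; elim: r => [|i r IH] H; first by rewrite !big_nil f2_1.
  have H' j : j \in r -> GL (F j) by move=> jr; apply: H; rewrite inE jr orbT.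
  rewrite !big_cons f2M ?IH //; first by apply: H; rewrite inE eqxx.
  exact: (GL_prod HS n0 oS).
have fnf ps ks : perm_eq ps (pairsS S) -> perm_eq ks S -> forall nn lam, (forall k, k \in S -> lam k != 0) ->
    [/\ GL (nf ps ks nn lam), forall p, p \in pairsS S -> f1 (nf ps ks nn lam) p = nn p &
        forall k, k \in S -> f2 (nf ps ks nn lam) k = lam k].
  move=> pps pks nn lam l0; have ups : uniq ps by rewrite (perm_uniq pps).
  have uks : uniq ks by rewrite (perm_uniq pks).
  have mps := perm_mem pps; have mks := perm_mem pks.
  have gp p : p \in ps -> GL (thetaS n x y p ^ nn p) by rewrite mps => pp; apply: GZ.
  have gk k : k \in ks -> GL (muS n x y k (lam k)) by rewrite mks => kS; apply: Gmu => //; apply: l0.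
  have gT : GL (\prod_(p <- ps) thetaS n x y p ^ nn p) by apply: (GL_prod HS n0 oS).
  have gM : GL (\prod_(k <- ks) muS n x y k (lam k)) by apply: (GL_prod HS n0 oS).
  split=> [|p pp|k kS]; first exact: GM.
    rewrite f1M // !f1P // [X in _ + X]big1_seq ?addr0 => [|k /= kk]; last by rewrite mks in kk; rewrite f1mu ?l0.
    rewrite (bigD1_seq p) ?mps //= big1_seq ?addr0 => [|q /andP[qp qq]].
      by rewrite f1Z ?f1th ?eqxx ?mulr1 //; apply: Gth.
    by rewrite mps in qq; rewrite (f1Z _ _ _ pp (Gth _ qq)) f1th // eq_sym (negPf qp) mulr0.
  rewrite f2M // !f2P // [X in X * _]big1_seq ?mul1r => [|p /= pp]; last by rewrite mps in pp; apply: f2Z => //; [apply: Gth|apply: f2th].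
  rewrite (bigD1_seq k) ?mks //= big1_seq ?mulr1 => [|q /andP[qk qq]]; first by rewrite f2mu ?eqxx.
  by rewrite mks in qq; rewrite f2mu // eq_sym (negPf qk).
split.
- move=> u; split.
    apply: GI => {u} [i j iS jS ij|k c kS c0|e Ee|a b _ _]; last exact: ggM.
    + have [lt|gt|e] := ltngtP i j; last by rewrite e eqxx in ij.
        by rewrite thV //; apply: ggV; apply: ggX; apply: Or31; exists (j, i) => //; apply: pSE.
      by rewrite -thetaSE //; apply: ggX; apply: Or31; exists (i, j) => //; apply: pSE.
    + by apply: ggX; apply: Or32; exists k, c; rewrite muSE.
    + by apply: ggX; apply: Or33.
  elim=> [//|g [[p pp ->]|[k [c [kS c0 ->]]]|Ee]|a b _ ga _ gb|a _ ga].
  + exact: Gth.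
  + exact: Gmu.
  + exact: GE.
  + exact: GM.
  + exact: GV.
- move=> ps ks pps pks a ga; have [nn [lam [l0 [e Ee ea]]]] := NF ps ks pps pks a ga.
  have mps := perm_mem pps; have mks := perm_mem pks.
  exists nn, lam, e; split=> // nn' lam' e' l0' Ee' ea'.
  have [g1 h1 h2] := fnf ps ks pps pks nn lam l0; have [g2 h3 h4] := fnf ps ks pps pks nn' lam' l0'.
  have ea2 : a = nf ps ks nn' lam' * e' by rewrite ea' /prodform.
  have en p : p \in ps -> nn' p = nn p.
    rewrite mps => pp; rewrite -h1 // -h3 //.
    have E : f1 (nf ps ks nn' lam' * e') p = f1 (nf ps ks nn lam * e) p by rewrite -ea2 -ea.
    by move: E; rewrite (f1M _ _ _ pp g2 (GE _ Ee')) (f1M _ _ _ pp g1 (GE _ Ee)) (f1E _ _ pp Ee') (f1E _ _ pp Ee) !addr0.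
  have el k : k \in ks -> lam' k = lam k.
    rewrite mks => kS; rewrite -h2 // -h4 //.
    have E : f2 (nf ps ks nn' lam' * e') k = f2 (nf ps ks nn lam * e) k by rewrite -ea2 -ea.
    by move: E; rewrite (f2M _ _ _ kS g2 (GE _ Ee')) (f2M _ _ _ kS g1 (GE _ Ee)) (f2E _ _ kS Ee') (f2E _ _ kS Ee) !mulr1.
  split=> //; have enf : nf ps ks nn' lam' = nf ps ks nn lam.
    by congr (_ * _); apply: eq_big_seq => i hi; rewrite ?en ?el.
  apply: (can_inj (mulKr (GU _ g1))); by rewrite -ea -enf -ea2.
exists f1, f2; split.
- by move=> u v gu gv; split=> [p pp|k kS]; [apply: f1M|apply: f2M].
- by move=> u gu k kS; apply: f2nz.
- move=> nn lam l0; have [g h1 h2] := fnf _ _ (perm_refl _) (perm_refl _) nn lam l0.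
  by exists (nf (pairsS S) S nn lam).
- move=> u gu; split=> [[h1 h2]|Ee]; last by split=> [p pp|k kS]; [apply: f1E|apply: f2E].
  have [nn [lam [l0 [e Ee eu]]]] := NF _ _ (perm_refl (pairsS S)) (perm_refl S) u gu.
  have [g h3 h4] := fnf _ _ (perm_refl _) (perm_refl _) nn lam l0.
  (* The coordinates of the normal form are those of [u], hence all trivial. *)
  suff n1 : nf (pairsS S) S nn lam = 1 by rewrite eu n1 mul1r.
  rewrite /nf !big1_seq ?mulr1 // => [k|p] /= kk.
    by rewrite -h4 // -[f2 _ _]mulr1 -(f2E k e) // -f2M //; [rewrite -eu h2|apply: GE].
  by rewrite -h3 // -[f1 _ _]addr0 -(f1E p e) // -f1M //; [rewrite -eu h1|apply: GE].
- split=> [q qq|k0 c kS c0]; split=> [p pp|k kk]; by [apply: f1th|apply: f2th|apply: f1mu|apply: f2mu].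
Qed.
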